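(* Let $\mu\ge 1/2$ and let $L=D_t+c(t)P(x,D_x)$ be as in the context. Then: (a) if $b$ does not change sign on $\mathbb T$, then $L$ is $\mathcal S_\mu$-globally solvable if and only if $c_0$ satisfies condition $(\mathscr A)$; (b) if $b$ changes sign on $\mathbb T$, then $L$ is $\mathcal S_\mu$-globally solvable if and only if $\mathcal Z^C=\mathbb N\setminus\mathcal Z$ is finite and the sets $\Omega_r$ are connected for all $r\in\mathbb R$.
   Context: Let $\mathbb T=\mathbb R/2\pi\mathbb Z$, $n\ge1$. Let $P=P(x,D)=\sum_{|\alpha|+|\beta|\le m}c_{\alpha,\beta}x^\beta\partial_x^\alpha$, $c_{\alpha,\beta}\in\mathbb R$, be a differential operator on $\mathbb R^n$ of order $m\ge 2$ which is self-adjoint on $L^2(\mathbb R^n)$ and globally elliptic: $\sum_{|\alpha|+|\beta|=m}c_{\alpha,\beta}x^\beta(i\xi)^\alpha\neq0$ for $(x,\xi)\ne(0,0)$. Then $P$ has a discrete spectrum of real eigenvalues $\lambda_j$, $j\in\mathbb N$, with $|\lambda_j|\sim\rho j^{m/(2n)}$ as $j\to\infty$ for some $\rho>0$, and the corresponding eigenfunctions $\varphi_j$ form an orthonormal basis of $L^2(\mathbb R^n)$. For $\sigma>1$, $\mu\ge1/2$, $\mathcal S_{\sigma,\mu}=\mathcal S_{\sigma,\mu}(\mathbb T\times\mathbb R^n)$ is the space of smooth functions $u$ on $\mathbb T\times\mathbb R^n$ such that $\sup_{\alpha,\beta\in\mathbb N^n,\gamma\in\mathbb N}C^{-|\alpha+\beta|-\gamma}\gamma!^{-\sigma}(\alpha!\beta!)^{-\mu}\sup_{t,x}|x^\alpha\partial_x^\beta\partial_t^\gamma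 u(t,x)|<\infty$ for some $C>0$ (with inductive limit topology), and $\mathcal S'_{\sigma,\mu}$ is its dual. Put $\mathscr F_\mu=\bigcup_{\sigma>1}\mathcal S_{\sigma,\mu}$. Every $u\in\mathscr F_\mu$ (or in $\bigcup_{\sigma>1}\mathcal S'_{\sigma,\mu}$) is written $u=\sum_j u_j(t)\varphi_j(x)$ with $u_j(t)=\int_{\mathbb R^n}u(t,x)\varphi_j(x)\,dx$. Let $D_t=i^{-1}\partial_t$ and $L=D_t+c(t)P(x,D_x)$ where $c=a+ib$, with $a,b$ real-valued Gevrey functions on $\mathbb T$ of some order $>1$. Let $c_0=\frac1{2\pi}\int_0^{2\pi}c(t)dt=a_0+ib_0$, $\mathcal Z=\{j\in\mathbb N:\lambda_jc_0\in\mathbb Z\}$, $\mathcal Z^C=\mathbb N\setminus\mathcal Z$, and $\Omega_r=\{t\in\mathbb T:\int_0^tb(s)ds>r\}$, $r\in\mathbb R$. The space of admissible functions $\mathscr E_{L,\mu}$ is the set of $f\in\mathscr F_\mu$ such that $\int_0^{2\pi}\exp(i\lambda_j\int_0^tc(s)ds)f_j(t)dt=0$ for every $j\in\mathcal Z$. $L$ is called $\mathcal S_\mu$-globally solvable if for every $f\in\mathscr E_{L,\mu}$ there exists $u\in\mathscr F_\mu$ with $Lu=f$. Condition $(\mathscr A)$ for a complex number $\omega$: for every $\epsilon>0$ there is $C_\epsilon>0$ such that $|\tau-\omega\lambda_j|\ge C_\epsilon\exp(-\epsilon j^{1/(2n\mu)})$ for all $(\tau,j)\in\mathbb Z\times\mathbb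 N$ with $\tau-\omega\lambda_j\ne0$. *)

(* Defs.v *)
From Stdlib Require Import Reals ZArith List.
From Coquelicot Require Import Coquelicot.
Open Scope R_scope.

Definition in_Rn (n : nat) (x : nat -> R) : Prop := forall k, (n <= k)%nat -> x k = 0.
Definition upd (x : nat -> R) (k : nat) (s : R) : nat -> R :=
  fun j => if Nat.eqb j k then s else x j.

(* multi-indices alpha in N^n : nat -> nat (only coordinates < n are used) *)
Fixpoint sumN (n : nat) (a : nat -> nat) : nat :=
  match n with O => O | S m => (sumN m a + a m)%nat end.
Fixpoint prodR (n : nat) (F : nat -> R) : R :=
  match n with O => 1 | S m => prodR m F * F m end.
Definition xpow (n : nat) (a : nat -> nat) (x : nat -> R) : R := prodR n (fun k => x k ^ a k).
Definition mfact (n : nat) (a : nat -> nat) : R := prodR n (fun k => INR (fact (a k))).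

Definition DerC (g : R -> C) (s : R) : C :=
  (Derive (fun r => fst (g r)) s, Derive (fun r => snd (g r)) s).
Definition ex_derC (g : R -> C) (s : R) : Prop :=
  ex_derive (fun r => fst (g r)) s /\ ex_derive (fun r => snd (g r)) s.
Definition Cexp_ (z : C) : C := (exp (fst z) * cos (snd z), exp (fst z) * sin (snd z)).
Fixpoint Cpow_ (z : C) (k : nat) : C := match k with O => RtoC 1 | S j => Cmult (Cpow_ z j) z end.
Definition ofR {A : Type} (g : A -> R) : A -> C := fun x => RtoC (g x).

Definition pdx (k : nat) (g : (nat -> R) -> C) : (nat -> R) -> C :=
  fun x => DerC (fun s => g (upd x k s)) (x k).
Fixpoint dxa (n : nat) (a : nat -> nat) (g : (nat -> R) -> C) : (nat -> R) -> C :=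
  match n with O => g | S m => Nat.iter (a m) (pdx m) (dxa m a g) end.

Definition smooth_x (n : nat) (g : (nat -> R) -> C) : Prop :=
  forall (ds : list nat) (k : nat) (x : nat -> R),
    (forall d, In d ds -> (d < n)%nat) -> (k < n)%nat -> in_Rn n x ->
    ex_derC (fun s => fold_right pdx g ds (upd x k s)) (x k).

Definition Schwartz (n : nat) (g : (nat -> R) -> C) : Prop :=
  smooth_x n g /\
  forall a b : nat -> nat, exists K, forall x, in_Rn n x ->
    Rabs (xpow n a x) * Cmod (dxa n b g x) <= K.

Fixpoint intRn (n : nat) (g : (nat -> R) -> R) : R :=
  match n with
  | O => g (fun _ => 0)
  | S m => intRn m (fun x => RInt_gen (V := R_CompleteNormedModule)
                               (fun s => g (upd x m s))
                               (Rbar_locally m_infty) (Rbar_locally p_infty))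
  end.

Definition pdt (u : R -> (nat -> R) -> C) : R -> (nat -> R) -> C :=
  fun t x => DerC (fun s => u s x) t.
Definition pdir (d : option nat) (u : R -> (nat -> R) -> C) : R -> (nat -> R) -> C :=
  match d with None => pdt u | Some k => fun t => pdx k (u t) end.

Definition smooth_tx (n : nat) (u : R -> (nat -> R) -> C) : Prop :=
  forall (ds : list (option nat)) (d : option nat) (t : R) (x : nat -> R),
    (forall k, In (Some k) ds -> (k < n)%nat) -> in_Rn n x ->
    match d with
    | None => ex_derC (fun s => fold_right pdir u ds s x) t
    | Some k => (k < n)%nat -> ex_derC (fun s => fold_right pdir u ds t (upd x k s)) (x k)
    end.

Definition periodic_tx (n : nat) (u : R -> (nat -> R) -> C) : Prop :=
  forall t x, in_Rn n x -> u (t + 2 * PI) x = u t x.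

Definition GS (n : nat) (sigma mu : R) (u : R -> (nat -> R) -> C) : Prop :=
  periodic_tx n u /\ smooth_tx n u /\
  exists Cc K, 0 < Cc /\
    forall (a b : nat -> nat) (g : nat) (t : R) (x : nat -> R), in_Rn n x ->
      Rabs (xpow n a x) * Cmod (dxa n b (Nat.iter g pdt u t) x)
      <= K * Cc ^ (sumN n a + sumN n b + g)
           * Rpower (INR (fact g)) sigma * Rpower (mfact n a * mfact n b) mu.

Definition F_mu (n : nat) (mu : R) (u : R -> (nat -> R) -> C) : Prop :=
  exists sigma, 1 < sigma /\ GS n sigma mu u.

(* a monomial (c, alpha, beta) stands for c * x^beta * d_x^alpha *)
Definition monom : Type := (R * (nat -> nat) * (nat -> nat))%type.

Definition applyP (n : nat) (Pl : list monom) (g : (nat -> R) -> C) : (nat -> R) -> C :=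
  fun x => fold_right (fun (mo : monom) acc =>
              let '(c, a, b) := mo in
              Cplus (Cmult (RtoC (c * xpow n b x)) (dxa n a g x)) acc) (RtoC 0) Pl.

Definition principal (n m : nat) (Pl : list monom) (x xi : nat -> R) : C :=
  fold_right (fun (mo : monom) acc =>
     let '(c, a, b) := mo in
     if Nat.eqb (sumN n a + sumN n b) m
     then Cplus (Cmult (RtoC (c * xpow n b x * xpow n a xi)) (Cpow_ Ci (sumN n a))) acc
     else acc) (RtoC 0) Pl.

Definition good_operator (n m : nat) (Pl : list monom) : Prop :=
  (forall c a b, In (c, a, b) Pl -> (sumN n a + sumN n b <= m)%nat) /\
  (forall x xi, in_Rn n x -> in_Rn n xi ->
     (exists k, (k < n)%nat /\ (x k <> 0 \/ xi k <> 0)) ->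
     principal n m Pl x xi <> RtoC 0) /\
  (forall f g : (nat -> R) -> R, Schwartz n (ofR f) -> Schwartz n (ofR g) ->
     intRn n (fun x => fst (applyP n Pl (ofR f) x) * g x)
     = intRn n (fun x => f x * fst (applyP n Pl (ofR g) x))).

(* (lam k, phi k), k : nat, is the eigen-system of P indexed by j = k+1 in N = {1,2,...}:
   real eigenvalues, real Schwartz eigenfunctions forming an orthonormal basis of L^2(R^n),
   with |lam_j| ~ rho j^(m/(2n)). *)
Definition eigen_system (n m : nat) (Pl : list monom) (lam : nat -> R)
    (phi : nat -> (nat -> R) -> R) : Prop :=
  (forall k, Schwartz n (ofR (phi k))) /\
  (forall k x, in_Rn n x -> applyP n Pl (ofR (phi k)) x = RtoC (lam k * phi k x)) /\
  (forall j k, intRn n (fun x => phi j x * phi k x) = if Nat.eqb j k then 1 else 0) /\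
  (forall f : (nat -> R) -> R, Schwartz n (ofR f) ->
     is_series (fun k => (intRn n (fun x => f x * phi k x)) ^ 2)
               (intRn n (fun x => f x ^ 2))) /\
  (exists rho, 0 < rho /\
     is_lim_seq (fun k => Rabs (lam k) / (rho * Rpower (INR (S k)) (INR m / (2 * INR n)))) 1).

Definition Gevrey_T (f : R -> R) : Prop :=
  (forall t, f (t + 2 * PI) = f t) /\
  (forall k t, ex_derive (Derive_n f k) t) /\
  exists s, 1 < s /\ exists Cc K, forall k t,
    Rabs (Derive_n f k t) <= K * Cc ^ k * Rpower (INR (fact k)) s.

Definition c0 (a b : R -> R) : C :=
  (/ (2 * PI) * RInt a 0 (2 * PI), / (2 * PI) * RInt b 0 (2 * PI)).

Definition inZ (z : C) : Prop := exists k : Z, z = RtoC (IZR k).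

(* index k (i.e. j = k+1) belongs to the set Z *)
Definition Zset (a b : R -> R) (lam : nat -> R) (k : nat) : Prop :=
  inZ (Cmult (RtoC (lam k)) (c0 a b)).

Definition fcoef (n : nat) (phi : nat -> (nat -> R) -> R) (f : R -> (nat -> R) -> C)
    (k : nat) (t : R) : C :=
  (intRn n (fun x => fst (f t x) * phi k x), intRn n (fun x => snd (f t x) * phi k x)).

Definition admissible (n : nat) (mu : R) (a b : R -> R) (lam : nat -> R)
    (phi : nat -> (nat -> R) -> R) (f : R -> (nat -> R) -> C) : Prop :=
  F_mu n mu f /\
  forall k, Zset a b lam k ->
    RInt (V := C_R_CompleteNormedModule)
      (fun t => Cmult (Cexp_ (Cmult (0, lam k) (RInt a 0 t, RInt b 0 t))) (fcoef n phi f k t))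
      0 (2 * PI) = RtoC 0.

Definition Lop (n : nat) (Pl : list monom) (a b : R -> R) (u : R -> (nat -> R) -> C)
    (t : R) (x : nat -> R) : C :=
  Cplus (Cmult (0, -1) (pdt u t x)) (Cmult (a t, b t) (applyP n Pl (u t) x)).

Definition globally_solvable (n : nat) (Pl : list monom) (mu : R) (a b : R -> R)
    (lam : nat -> R) (phi : nat -> (nat -> R) -> R) : Prop :=
  forall f, admissible n mu a b lam phi f ->
    exists u, F_mu n mu u /\ forall t x, in_Rn n x -> Lop n Pl a b u t x = f t x.

(* condition (A) for omega; eigen-index j = k+1 *)
Definition condA (n : nat) (mu : R) (lam : nat -> R) (omega : C) : Prop :=
  forall eps, 0 < eps -> exists Ceps, 0 < Ceps /\
    forall (tau : Z) (k : nat),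
      Cminus (RtoC (IZR tau)) (Cmult omega (RtoC (lam k))) <> RtoC 0 ->
      Cmod (Cminus (RtoC (IZR tau)) (Cmult omega (RtoC (lam k))))
        >= Ceps * exp (- eps * Rpower (INR (S k)) (1 / (2 * INR n * mu))).

Definition changes_sign (b : R -> R) : Prop := exists t1 t2, b t1 < 0 /\ 0 < b t2.

(* Omega_r = { t in T : int_0^t b > r }, t taken in its representative in [0, 2pi);
   as a 2pi-periodic subset of R *)
Definition Omega (b : R -> R) (r : R) : R -> Prop :=
  fun t => exists k : Z, 0 <= t - 2 * PI * IZR k < 2 * PI /\ RInt b 0 (t - 2 * PI * IZR k) > r.

(* connectedness of a subset S of T = R/2piZ (S given as a 2pi-periodic subset of R),
   w.r.t. the quotient topology: open sets of T = 2pi-periodic open subsets of R *)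
Definition periodic_set (U : R -> Prop) : Prop := forall t, U (t + 2 * PI) <-> U t.
Definition connected_T (S : R -> Prop) : Prop :=
  ~ exists U V : R -> Prop,
      periodic_set U /\ periodic_set V /\ open U /\ open V /\
      (forall t, S t -> U t \/ V t) /\
      (exists t, S t /\ U t) /\ (exists t, S t /\ V t) /\
      (forall t, S t -> U t -> V t -> False).

Definition finite_set (A : nat -> Prop) : Prop := exists N, forall k, A k -> (k < N)%nat.

(* Main.v *)
Require Import Defs.
From Stdlib Require Import Reals ZArith List Lia Lra Permutation Classical ClassicalEpsilon FunctionalExtensionality ProofIrrelevance.
From Coquelicot Require Import Coquelicot.
Import ListNotations.
Open Scope R_scope.

(** In the eigenbasis of [P] the equation [L u = f] decouples into [D_t u_j + lam_j c(t) u_j = f_j] on the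
  circle, and [u] lies in [F_mu] if and only if the [u_j] satisfy Gevrey bounds of a common order with a factor
  [exp (- eps x_j)], where [x_j = (j + 1)^(1 / (2 n mu))].  One half of this rests on
  [|x^a d^b phi_j| <= C^(|a| + |b| + 1) (a! b!)^mu exp (eps x_j)]: by ellipticity
  [|z|^(2 N) (|P_m|^2 - c |z|^(2 m))] is a sum of squares for large [N], which quantizes, modulo lower order
  commutators, to an elliptic estimate for words in [x_i], [D_i], to be iterated on [P phi_j = lam_j phi_j].
  The other half pairs [P^N f] with [phi_j] and optimizes [N].

  The scalar equations are solved with the integrating factor [exp (i lam_j C)], [C' = c].  If [b] keeps its sign,
  integrating along the circle in the direction in which this factor decays only loses
  [1 / |exp (2 pi i lam_j c0) - 1|], which condition (A) controls.  If [b] changes sign and [j] is not resonant,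
  data of size [exp (- eps x_j)] adapted to the extrema of the primitive of [b] force [u_j] to grow exponentially
  in [|lam_j|].  For resonant [j] such growth occurs precisely when the primitive of [b] takes low, high, low, high
  values along the circle, that is, when some superlevel set is disconnected: the data then have opposite signs
  on two complementary arcs. *)

(* Pointwise positivity of a symbol says little about an operator, whereas a sum of squares becomes
   a sum of squared norms; this is why ellipticity is first turned into an exact polynomial
   identity. A positive form need not be a sum of squares, and the factor [|z|^(2 N)] that repairs
   this is harmless: it quantizes into the sum over all words of length [N] applied to [P u]. An
   identity between forms fails on operators only by words two letters shorter. The iteration keeps
   the eigenvalue as a scale [Th] with [lam ^ 2 <= Th ^ m], so [Th] is of size [x_j ^ (2 mu)], and
   the bound [(Th + T) ^ T] on squared norms for words of length [T] separates into a factorial and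
   an arbitrarily small exponential in [x_j]. This loss is affordable because the data decay like
   [exp (- eps x_j)] with some fixed [eps]. Time derivatives of [u_j] cost powers of [lam_j]; these
   go into a larger Gevrey order, which the union over [sigma] permits. Hence sup bounds in [t] on
   the scalar solutions decide everything. *)
Create HintDb rpos.
#[global] Hint Resolve Rabs_pos exp_pos pos_INR INR_fact_lt_0 sqrt_pos PI_RGT_0 Cmod_ge_0 cond_pos : rpos.
#[global] Hint Extern 1 (_ < Rpower _ _) => apply exp_pos : rpos.

Ltac pos := first [assumption | lra | solve [auto with rpos] | solve [left; auto with rpos] |
 lazymatch goal with
 | |- 0 <= _ ^ 2 => apply pow2_ge_0
 | |- 0 <= _ * _ => apply Rmult_le_pos; pos
 | |- 0 < _ * _ => apply Rmult_lt_0_compat; pos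
 | |- 0 <= _ + _ => apply Rplus_le_le_0_compat; pos
 | |- 0 <= _ / _ => apply Rmult_le_pos; pos
 | |- 0 < _ / _ => apply Rdiv_lt_0_compat; pos
 | |- 0 <= / _ => left; apply Rinv_0_lt_compat; pos
 | |- 0 < / _ => apply Rinv_0_lt_compat; pos
 | |- 0 <= _ ^ _ => apply pow_le; pos
 | |- 0 < _ ^ _ => apply pow_lt; pos
 | |- 0 < Rmin _ _ => apply Rmin_pos; pos
 end].

Ltac mono := first [assumption | lra |
 lazymatch goal with
 | |- ?a * _ <= ?a * _ => apply Rmult_le_compat_l; [pos|mono]
 | |- _ * ?a <= _ * ?a => apply Rmult_le_compat_r; [pos|mono]
 | |- _ * _ <= _ * _ => apply Rmult_le_compat; [pos|pos|mono|mono]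
 | |- _ + _ <= _ + _ => apply Rplus_le_compat; mono
 | |- _ ^ ?n <= _ ^ ?n => apply pow_incr; split; [pos|mono]
 | |- _ ^ _ <= _ ^ _ => apply Rle_pow; [lra|lia]
 end].

Tactic Notation "note" constr(t) := pose proof t.
Tactic Notation "note" constr(t) "as" simple_intropattern(p) := pose proof t as p.
Tactic Notation "fext" ident(x) := apply functional_extensionality; intros x.
Tactic Notation "via" constr(t) := apply Rle_trans with t.
Tactic Notation "bound" uconstr(t) := eapply Rle_trans; [apply t|].
Tactic Notation "bound_by" uconstr(t) := eapply Rle_trans; [|apply t].
Ltac scale_l := apply Rmult_le_compat_l; [pos|].
Ltac scale_r := apply Rmult_le_compat_r; [pos|].

(** * Elementary calculus, choice and finite sums *)

Lemma derive_continuous (f : R -> R) t : ex_derive f t -> continuous f t.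
Proof. apply (ex_derive_continuous (V := R_NormedModule)). Qed.

Lemma is_derive_continuous (f : R -> R) t l : is_derive f t l -> continuous f t.
Proof. intros D. apply derive_continuous. exists l. exact D. Qed.

Lemma continuous_Ropp (f : R -> R) t : continuous f t -> continuous (fun s => - f s) t.
Proof. apply (continuous_opp (V := R_NormedModule)). Qed.

Lemma ex_series_Rscal (c : R) (a : nat -> R) : ex_series a -> ex_series (fun k => c * a k).
Proof. apply (ex_series_scal (K := R_AbsRing) (V := R_NormedModule)). Qed.

Lemma is_derive_cst (c t : R) : is_derive (fun _ => c) t 0.
Proof. exact (@is_derive_const R_AbsRing R_NormedModule c t). Qed.

Lemma mean_value (f f' : R -> R) a b : (forall s, is_derive f s (f' s)) ->
 exists c, (a <= b -> a <= c <= b) /\ Rabs (c - a) <= Rabs (b - a) /\ f b - f a = f' c * (b - a).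
Proof.
 intros D. destruct (MVT_gen f a b f') as [c [Hc E]].
 - intros; apply D.
 - intros x _; apply continuity_pt_filterlim, (is_derive_continuous f x _ (D x)).
 - exists c. unfold Rmin, Rmax in Hc. destruct (Rle_dec a b); unfold Rabs; repeat destruct (Rcase_abs _); lra.
Qed.

Lemma derive_approx (f : R -> R) t l e : is_derive f t l -> 0 < e -> exists d, 0 < d /\ forall h, Rabs h < d -> Rabs (f (t + h) - f t - h * l) <= e * Rabs h.
Proof.
 intros D He. apply is_derive_Reals in D. destruct (D e He) as [d Hd]. exists d. split; [apply cond_pos|]. intros h Hh.
 destruct (Req_dec h 0) as [->|Hne]; [rewrite Rplus_0_r, Rabs_R0; replace (f t - f t - 0 * l) with 0 by ring; rewrite Rabs_R0; lra|].
 replace (f (t + h) - f t - h * l) with (((f (t + h) - f t) / h - l) * h) by (field; exact Hne). rewrite Rabs_mult.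
 apply Rmult_le_compat_r; [apply Rabs_pos|left; apply Hd; assumption].
Qed.

Lemma choice {A B : Type} (Q : A -> B -> Prop) : (forall x, exists y, Q x y) -> exists f, forall x, Q x (f x).
Proof. intros H. exists (fun x => proj1_sig (constructive_indefinite_description _ (H x))). intros x. apply (proj2_sig (constructive_indefinite_description _ (H x))). Qed.

Ltac triv := intros; repeat split; first [pos | lia | mono | nra | congruence | tauto | eauto with rpos].

Definition lsum {A : Type} (l : list A) (f : A -> R) : R :=
 fold_right (fun a s => f a + s) 0 l.

Lemma lsum_app {A} (l1 l2 : list A) f : lsum (l1 ++ l2) f = lsum l1 f + lsum l2 f.
Proof. induction l1; simpl; [ring|lra]. Qed.

Lemma lsum_map {A B} (h : A -> B) l f : lsum (map h l) f = lsum l (fun a => f (h a)).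
Proof. induction l; simpl; congruence. Qed.

Lemma lsum_flat_map {A B} (h : A -> list B) l f :
 lsum (flat_map h l) f = lsum l (fun a => lsum (h a) f).
Proof. induction l; simpl; [lra|rewrite lsum_app; congruence]. Qed.

Lemma lsum_ext {A} (l : list A) f g : (forall a, In a l -> f a = g a) -> lsum l f = lsum l g.
Proof.
 induction l; simpl; intros H; [lra|].
 rewrite (H a), IHl; auto.
Qed.

Lemma lsum_plus {A} (l : list A) f g : lsum l (fun a => f a + g a) = lsum l f + lsum l g.
Proof. induction l; simpl; [ring|lra]. Qed.

Lemma lsum_scal {A} (l : list A) c f : lsum l (fun a => c * f a) = c * lsum l f.
Proof. induction l; simpl; [ring|lra]. Qed.

Lemma lsum_le {A} (l : list A) f g : (forall a, In a l -> f a <= g a) -> lsum l f <= lsum l g.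
Proof.
 induction l; simpl; intros H; [lra|].
 apply Rplus_le_compat; [pos|pos]; auto.
Qed.

Lemma lsum_nonneg {A} (l : list A) f : (forall a, In a l -> 0 <= f a) -> 0 <= lsum l f.
Proof.
 induction l; simpl; intros H; [lra|].
 pos.
Qed.

Lemma lsum_mem {A} (l : list A) f a : (forall a, In a l -> 0 <= f a) -> In a l -> f a <= lsum l f.
Proof.
 induction l; simpl; intros H [].
 - subst; assert (0 <= lsum l f) by (apply lsum_nonneg; auto); lra.
 - assert (0 <= f a0) by auto; assert (f a <= lsum l f) by auto; lra.
Qed.

Lemma lsum_abs {A} (l : list A) f : Rabs (lsum l f) <= lsum l (fun a => Rabs (f a)).
Proof.
 induction l; simpl; [rewrite Rabs_R0; lra|].
 bound Rabs_triang; lra.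
Qed.

Lemma lsum_const {A} (l : list A) c : lsum l (fun _ => c) = INR (length l) * c.
Proof.
 induction l; simpl length; [simpl; ring|].
 rewrite S_INR; simpl; rewrite IHl; ring.
Qed.

Lemma lsum_swap {A B} (l : list A) (k : list B) f :
 lsum l (fun a => lsum k (fun b => f a b)) = lsum k (fun b => lsum l (fun a => f a b)).
Proof.
 induction l; simpl.
 - induction k; simpl; [lra|lra].
 - rewrite IHl, <- lsum_plus; reflexivity.
Qed.

Lemma lsum_0 {A} (l : list A) f : (forall a, In a l -> f a = 0) -> lsum l f = 0.
Proof.
 induction l; simpl; intros H; [lra|]. rewrite H, IHl; auto; ring.
Qed.

Lemma lsum_single (l : list nat) k v : NoDup l -> In k l ->
 lsum l (fun j => if Nat.eqb j k then v j else 0) = v k.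
Proof.
 induction l; simpl; intros Hnd [].
 - subst a; rewrite Nat.eqb_refl. inversion_clear Hnd.
  rewrite lsum_0; [ring|]. intros j Hj.
  destruct (Nat.eqb_spec j k); [subst; contradiction|lra].
 - inversion_clear Hnd. destruct (Nat.eqb_spec a k); [subst; contradiction|].
  rewrite IHl; auto; ring.
Qed.

(** * Commutative evaluation of words *)

Definition ev (z : nat -> R) (w : list nat) : R := fold_right (fun i a => z i * a) 1 w.

Lemma ev_app z a b : ev z (a ++ b) = ev z a * ev z b.
Proof. induction a; simpl; [ring|rewrite IHa; ring]. Qed.

Lemma ev_rev z a : ev z (rev a) = ev z a.
Proof. induction a; simpl; [lra|rewrite ev_app, IHa; simpl; ring]. Qed.

Fixpoint words (d M : nat) : list (list nat) :=
 match M with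
 | O => [[]]
 | S k => flat_map (fun w => map (fun i => i :: w) (seq 0 d)) (words d k)
 end.

Definition lt_letters (d : nat) (w : list nat) : Prop := List.Forall (fun i => (i < d)%nat) w.

Lemma words_spec d M w : In w (words d M) <-> length w = M /\ lt_letters d w.
Proof.
 revert w; induction M; intros w; simpl.
 - split.
  + intros [<-|[]]; split; [pos|pos].
  + intros [H _]; destruct w; [auto|discriminate].
 - rewrite in_flat_map; split.
  + intros (v & Hv & Hw). apply IHM in Hv. apply in_map_iff in Hw.
   destruct Hw as (i & <- & Hi). apply in_seq in Hi. simpl. destruct Hv as [Hl Hv].
   split; [lia|]. constructor; [lia|pos].
  + intros [Hl Hw]. destruct w as [|i v]; [discriminate|].
   inversion_clear Hw. exists v; split.
   * apply IHM; split; [pos|pos].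
   * apply in_map_iff; exists i; split; [pos|apply in_seq; lia].
Qed.

Lemma words_S d k f :
 lsum (words d (S k)) f = lsum (words d k) (fun w => lsum (seq 0 d) (fun i => f (i :: w))).
Proof.
 simpl words. rewrite lsum_flat_map. apply lsum_ext; intros; rewrite lsum_map; reflexivity.
Qed.

Definition nsq (d : nat) (z : nat -> R) : R := lsum (seq 0 d) (fun i => z i ^ 2).

Lemma words_sq d N z : lsum (words d N) (fun w => ev z w ^ 2) = nsq d z ^ N.
Proof.
 induction N.
 - simpl; ring.
 - rewrite words_S, <- tech_pow_Rmult, <- IHN, <- lsum_scal.
  apply lsum_ext; intros w _. unfold nsq. rewrite Rmult_comm, <- lsum_scal.
  apply lsum_ext; intros; simpl; ring.
Qed.

(** * A form vanishing identically quantizes to lower order *)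

(** At [t = 0] only the constant term survives; dividing the rest by [t] leaves a polynomial that
    vanishes off 0, hence at 0 by continuity, and the induction applies to it. *)
Lemma poly_zero (n : nat) : forall a : nat -> R,
 (forall t, lsum (seq 0 n) (fun k => t ^ k * a k) = 0) -> forall k, (k < n)%nat -> a k = 0.
Proof.
 induction n; intros a H k Hk; [lia|].
 assert (Hexp : forall t, lsum (seq 0 (S n)) (fun k => t ^ k * a k)
   = a O + t * lsum (seq 0 n) (fun k => t ^ k * a (S k))).
 { intros t. simpl. rewrite <- seq_shift, lsum_map, <- lsum_scal.
  f_equal; [ring|]. apply lsum_ext; intros; simpl; ring. }
 assert (H0 : a O = 0).
 { specialize (H 0). rewrite Hexp in H. lra. }
 destruct k as [|k]; [lra|].
 apply (IHn (fun k => a (S k))); [|lia].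
 set (p := fun t => lsum (seq 0 n) (fun k => t ^ k * a (S k))).
 assert (Hp : forall t, t <> 0 -> p t = 0).
 { intros t Ht. specialize (H t). rewrite Hexp, H0 in H.
  fold (p t) in H. apply Rmult_eq_reg_l with t; lra. }
 assert (Hc : forall t, continuous p t).
 { intros t. clear. induction (seq 0 n).
  - apply continuous_const.
  - apply (continuous_plus (V := R_NormedModule)); [|pos].
   apply derive_continuous. auto_derive. auto. }
 intros t. change (p t = 0). destruct (Req_dec t 0) as [->|Ht]; [|auto].
 destruct (Req_dec (0 - p 0) 0) as [e|Hne]; [lra|exfalso].
 assert (He : 0 < Rabs (p 0)) by (apply Rabs_pos_lt; lra).
 specialize (Hc 0). apply (proj1 (filterlim_locally _ _)) with (eps := mkposreal _ He) in Hc.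
 destruct Hc as [dl Hd].
 assert (Hb : ball 0 dl (dl / 2)).
 { change (Rabs (dl / 2 - 0) < dl). rewrite Rabs_pos_eq; destruct dl; simpl; lra. }
 apply Hd in Hb. change (Rabs (p (dl / 2) - p 0) < Rabs (p 0)) in Hb.
 rewrite Hp in Hb by (destruct dl; simpl; lra).
 rewrite Rminus_0_l, Rabs_Ropp in Hb. lra.
Qed.

(** Multiplicities of the letters below [d], highest letter first. For words in these letters the
    list determines the commutative monomial, and [canon] rebuilds a sorted word from it. *)
Fixpoint cnts (d : nat) (w : list nat) : list nat :=
 match d with O => [] | S k => count_occ Nat.eq_dec w k :: cnts k w end.

Lemma ev_remove z d w :
 ev z w = z d ^ count_occ Nat.eq_dec w d * ev z (remove Nat.eq_dec d w).
Proof.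
 induction w as [|i w IH]; simpl; [ring|].
 destruct (Nat.eq_dec d i) as [->|Hn].
 - destruct (Nat.eq_dec i i); [|lia]. simpl. rewrite IH; ring.
 - destruct (Nat.eq_dec i d); [lia|]. simpl. rewrite IH; ring.
Qed.

Lemma ev_ext z z' w : (forall i, In i w -> z i = z' i) -> ev z w = ev z' w.
Proof.
 induction w; simpl; intros H; [lra|]. rewrite (H a), IHw; auto.
Qed.

Lemma count_remove_other d i w : i <> d ->
 count_occ Nat.eq_dec (remove Nat.eq_dec d w) i = count_occ Nat.eq_dec w i.
Proof.
 intros H. induction w as [|j w IH]; simpl; [pos|].
 destruct (Nat.eq_dec d j) as [->|].
 - destruct (Nat.eq_dec j i); [lia|pos].
 - simpl. destruct (Nat.eq_dec j i); congruence.
Qed.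

Lemma cnts_remove d k w : (k <= d)%nat -> cnts k (remove Nat.eq_dec d w) = cnts k w.
Proof.
 induction k; simpl; intros H; [pos|].
 rewrite count_remove_other, IHk by lia. pos.
Qed.

(** A polynomial vanishing everywhere has vanishing coefficients, so any weight depending on the
    exponents alone sums to zero against it. The induction is on the number of variables, with [z d]
    singled out as the variable of a univariate polynomial. *)
Lemma forms_identity d : forall F : list (R * list nat),
 (forall cw, In cw F -> lt_letters d (snd cw)) ->
 (forall z, lsum F (fun cw => fst cw * ev z (snd cw)) = 0) ->
 forall G : list nat -> R, lsum F (fun cw => fst cw * G (cnts d (snd cw))) = 0.
Proof.
 induction d; intros F HF Hz G.
 - rewrite <- (Rmult_0_r (G [])), <- (Hz (fun _ => 0)), <- lsum_scal.
  apply lsum_ext; intros [c w] Hin. specialize (HF _ Hin).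
  destruct w; [simpl; ring|]. inversion HF; lia.
 - set (cn := fun cw : R * list nat => count_occ Nat.eq_dec (snd cw) d).
  assert (HK : exists K, forall cw, In cw F -> (cn cw < K)%nat).
  { clear. induction F as [|a F [K HK]]; [exists O; intros ? []|].
   exists (S (cn a) + K)%nat. intros cw [<-|H]; [lia|apply HK in H; lia]. }
  destruct HK as [K HK].
  (* [Fk k] is the coefficient of [z d ^ k]; keeping all entries of [F] with zeroed coefficients,
     instead of filtering, makes the sums over [k] easy to exchange. *)
  set (Fk := fun k => map (fun cw => (if Nat.eqb (cn cw) k then fst cw else 0,
         remove Nat.eq_dec d (snd cw))) F).
  assert (Hk : forall k, (k < K)%nat -> lsum (Fk k) (fun cw => fst cw * G (k :: cnts d (snd cw))) = 0).
  { intros k Hk. apply (IHd (Fk k)) with (G := fun l => G (k :: l)).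
   - intros cw Hin. apply in_map_iff in Hin. destruct Hin as ([c w] & <- & Hin).
    specialize (HF _ Hin). unfold lt_letters in *. rewrite Forall_forall in *.
    intros i Hi. apply in_remove in Hi. destruct Hi as [Hi Hne]. apply HF in Hi. lia.
   - intros z.
    apply (poly_zero K (fun k => lsum (Fk k) (fun cw => fst cw * ev z (snd cw)))); [|pos].
    intros t. rewrite <- (Hz (fun j => if Nat.eqb j d then t else z j)).
    rewrite (lsum_ext (seq 0 K) _ (fun k => lsum F (fun cw =>
     if Nat.eqb k (cn cw) then fst cw * (t ^ k * ev z (remove Nat.eq_dec d (snd cw))) else 0))).
    + rewrite lsum_swap. apply lsum_ext; intros cw Hin.
     rewrite (lsum_single _ (cn cw) (fun k0 => fst cw * (t ^ k0 * ev z (remove Nat.eq_dec d (snd cw)))));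
      [|apply seq_NoDup|apply in_seq; split; [lia|pos]].
     rewrite (ev_remove _ d (snd cw)). rewrite Nat.eqb_refl.
     do 2 f_equal. apply ev_ext. intros i Hi. apply in_remove in Hi.
     destruct (Nat.eqb_spec i d); [tauto|lra].
    + intros j _. unfold Fk. rewrite lsum_map, <- lsum_scal. apply lsum_ext; intros cw _.
     simpl. rewrite Nat.eqb_sym. destruct (Nat.eqb j (cn cw)); ring. }
  rewrite (lsum_ext F _ (fun cw => lsum (seq 0 K) (fun k =>
    if Nat.eqb k (cn cw) then fst cw * G (k :: cnts d (snd cw)) else 0))).
  + rewrite lsum_swap. apply lsum_0. intros k Hin. apply in_seq in Hin.
   etransitivity; [|apply (Hk k); lia]. unfold Fk. rewrite lsum_map. apply lsum_ext; intros cw _.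
   simpl. rewrite cnts_remove by lia. rewrite (Nat.eqb_sym k). destruct (Nat.eqb (cn cw) k); ring.
  + intros cw Hin. rewrite (lsum_single _ (cn cw) (fun k => fst cw * G (k :: cnts d (snd cw))));
    [reflexivity|apply seq_NoDup|apply in_seq; split; [lia|pos]].
Qed.

Fixpoint canon (l : list nat) : list nat :=
 match l with [] => [] | k :: ks => repeat (length ks) k ++ canon ks end.

Lemma cnts_length d w : length (cnts d w) = d.
Proof. induction d; simpl; congruence. Qed.

Lemma count_canon d w i : count_occ Nat.eq_dec (canon (cnts d w)) i
 = if Nat.ltb i d then count_occ Nat.eq_dec w i else O.
Proof.
 induction d; [pos|].
 simpl cnts; simpl canon. rewrite cnts_length, count_occ_app, IHd.
 destruct (Nat.eq_dec i d) as [->|Hne].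
 - rewrite count_occ_repeat_eq by reflexivity.
  destruct (Nat.ltb_spec d d), (Nat.ltb_spec d (S d)); lia.
 - rewrite count_occ_repeat_neq by congruence.
  destruct (Nat.ltb_spec i d), (Nat.ltb_spec i (S d)); lia.
Qed.

Lemma canon_perm d w : lt_letters d w -> Permutation w (canon (cnts d w)).
Proof.
 intros H. apply (Permutation_count_occ Nat.eq_dec). intros i. rewrite count_canon.
 destruct (Nat.ltb_spec i d); [pos|].
 apply count_occ_not_In. intros Hi. unfold lt_letters in H. rewrite Forall_forall in H.
 apply H in Hi. lia.
Qed.

(** The model is the real or imaginary part of [ip (W w u) u]: exchanging neighbouring letters
    leaves a scalar commutator times a word shorter by two, which [B] bounds. *)
Definition swap_bounded (d E : nat) (l : list nat -> R) (B : R) : Prop :=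
 forall a i j b, (length a + length b + 2 = E)%nat -> lt_letters d (a ++ i :: j :: b) ->
  Rabs (l (a ++ i :: j :: b) - l (a ++ j :: i :: b)) <= B.

Lemma perm_swap_bound w w' : Permutation w w' -> exists M, 0 <= M /\ forall d pre l B,
 lt_letters d (pre ++ w) -> 0 <= B -> swap_bounded d (length pre + length w) l B ->
 Rabs (l (pre ++ w) - l (pre ++ w')) <= M * B.
Proof.
 induction 1 as [|x w w' HP [M [HM IH]]|x y w|w1 w2 w3 HP1 [M1 [HM1 IH1]] HP2 [M2 [HM2 IH2]]].
 - exists 0; split; [lra|]. intros. rewrite Rminus_diag_eq, Rabs_R0; [nra|lra].
 - exists M; split; [lra|]. intros d pre l B Hl HB Hs.
  specialize (IH d (pre ++ [x]) l B). rewrite <- !app_assoc in IH.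
  apply IH; auto. rewrite length_app. simpl.
  replace (length pre + 1 + length w)%nat with (length pre + S (length w))%nat by lia. exact Hs.
 - exists 1; split; [lra|]. intros d pre l B Hl HB Hs. rewrite Rmult_1_l. apply Hs.
  + simpl; lia.
  + exact Hl.
 - exists (M1 + M2); split; [lra|]. intros d pre l B Hl HB Hs.
  replace (l (pre ++ w1) - l (pre ++ w3))
   with ((l (pre ++ w1) - l (pre ++ w2)) + (l (pre ++ w2) - l (pre ++ w3))) by ring.
  bound Rabs_triang. rewrite Rmult_plus_distr_r.
  apply Rplus_le_compat; [apply (IH1 d); auto|apply (IH2 d)]; auto.
  + unfold lt_letters in *. rewrite Forall_app in *. destruct Hl as [? Hl]; split; [pos|].
   rewrite Forall_forall in *. intros i Hi. apply Hl. eapply Permutation_in; [symmetry; exact HP1|pos].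
  + rewrite <- (Permutation_length HP1). exact Hs.
Qed.

(** Sorting every word changes the sum by a multiple of [B]; on sorted words the functional depends
    on the exponents alone, so [forms_identity] annihilates it. *)
Lemma vanishing_form_bound d E (F : list (R * list nat)) :
 (forall cw, In cw F -> lt_letters d (snd cw) /\ length (snd cw) = E) ->
 (forall z, lsum F (fun cw => fst cw * ev z (snd cw)) = 0) ->
 exists M, 0 <= M /\ forall l B, 0 <= B -> swap_bounded d E l B ->
  Rabs (lsum F (fun cw => fst cw * l (snd cw))) <= M * B.
Proof.
 intros HF Hz.
 assert (HM : exists M, 0 <= M /\ forall l B, 0 <= B -> swap_bounded d E l B ->
   Rabs (lsum F (fun cw => fst cw * (l (snd cw) - l (canon (cnts d (snd cw)))))) <= M * B).
 { clear Hz. induction F as [|[c w] F IH].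
  - exists 0; split; [lra|]. intros; simpl. rewrite Rabs_R0; lra.
  - destruct IH as [M [HM IH]]; [intros; apply HF; simpl; auto|].
   destruct (HF (c, w)) as [Hl HE]; [pos|]. simpl in Hl, HE.
   destruct (perm_swap_bound w (canon (cnts d w))) as [M1 [HM1 H1]]; [apply canon_perm; exact Hl|].
   exists (Rabs c * M1 + M). split; [pos|].
   intros l B HB Hs. simpl lsum. bound Rabs_triang.
   rewrite Rmult_plus_distr_r. apply Rplus_le_compat; [|pos].
   rewrite Rabs_mult, Rmult_assoc. scale_l.
   apply (H1 d [] l B); auto. rewrite HE. exact Hs. }
 destruct HM as [M [HM H]]. exists M; split; [lra|]. intros l B HB Hs.
 specialize (H l B HB Hs).
 replace (lsum F (fun cw => fst cw * l (snd cw))) with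
  (lsum F (fun cw => fst cw * (l (snd cw) - l (canon (cnts d (snd cw)))))
   + lsum F (fun cw => fst cw * l (canon (cnts d (snd cw))))).
 - rewrite (forms_identity d F) with (G := fun x => l (canon x)); auto.
  + rewrite Rplus_0_r. exact H.
  + intros; apply HF; assumption.
 - rewrite <- lsum_plus. apply lsum_ext; intros; ring.
Qed.

(** * Noncommutative forms with complex coefficients *)

Definition fs := list (C * list nat).
Definition csum {A : Type} (l : list A) (f : A -> C) : C :=
 fold_right (fun a s => Cplus (f a) s) (RtoC 0) l.

Lemma fst_csum {A} (l : list A) f : fst (csum l f) = lsum l (fun a => fst (f a)).
Proof. induction l; simpl; congruence. Qed.

Lemma snd_csum {A} (l : list A) f : snd (csum l f) = lsum l (fun a => snd (f a)).
Proof. induction l; simpl; congruence. Qed.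

Lemma csum_ext {A} (l : list A) f g : (forall a, In a l -> f a = g a) -> csum l f = csum l g.
Proof.
 induction l; simpl; intros H; [pos|]. rewrite (H a), IHl; auto.
Qed.

Lemma csum_app {A} (l1 l2 : list A) f : csum (l1 ++ l2) f = Cplus (csum l1 f) (csum l2 f).
Proof. induction l1; simpl; [ring|rewrite IHl1; ring]. Qed.

Lemma csum_map {A B} (h : A -> B) l f : csum (map h l) f = csum l (fun a => f (h a)).
Proof. induction l; simpl; congruence. Qed.

Lemma csum_flat_map {A B} (h : A -> list B) l f :
 csum (flat_map h l) f = csum l (fun a => csum (h a) f).
Proof. induction l; simpl; [pos|rewrite csum_app; congruence]. Qed.

Lemma csum_scal {A} (l : list A) c f : csum l (fun a => Cmult c (f a)) = Cmult c (csum l f).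
Proof. induction l; simpl; [ring|rewrite IHl; ring]. Qed.

Lemma csum_conj {A} (l : list A) f : Cconj (csum l f) = csum l (fun a => Cconj (f a)).
Proof.
 induction l; simpl; [unfold Cconj; simpl; rewrite Ropp_0; reflexivity|].
 rewrite <- IHl, Cplus_conj. pos.
Qed.

(** One evaluation serves twice: with [l w = ev z w] it gives the symbol, with [l w = ip (W w u) u]
    the quadratic form of the quantized operator. *)
Definition LF (l : list nat -> C) (F : fs) : C := csum F (fun cw => Cmult (fst cw) (l (snd cw))).
Definition evF (z : nat -> R) (F : fs) : C := LF (fun w => RtoC (ev z w)) F.
Definition starF (F : fs) : fs := map (fun cw => (Cconj (fst cw), rev (snd cw))) F.
Definition mulF (F G : fs) : fs :=
 flat_map (fun a => map (fun b => (Cmult (fst a) (fst b), snd a ++ snd b)) G) F.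

Definition homog (d E : nat) (F : fs) : Prop :=
 forall cw, In cw F -> lt_letters d (snd cw) /\ length (snd cw) = E.

Lemma LF_app l F G : LF l (F ++ G) = Cplus (LF l F) (LF l G).
Proof. apply csum_app. Qed.

Lemma LF_mul l F G : LF l (mulF F G)
 = csum F (fun a => csum G (fun b => Cmult (Cmult (fst a) (fst b)) (l (snd a ++ snd b)))).
Proof.
 unfold LF, mulF. rewrite csum_flat_map. apply csum_ext; intros a _.
 rewrite csum_map. pos.
Qed.

Lemma evF_mul z F G : evF z (mulF F G) = Cmult (evF z F) (evF z G).
Proof.
 unfold evF. rewrite LF_mul. unfold LF.
 rewrite Cmult_comm, <- csum_scal. apply csum_ext; intros a _.
 rewrite Cmult_comm, <- csum_scal. apply csum_ext; intros b _.
 rewrite ev_app, RtoC_mult. ring.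
Qed.

Lemma evF_star z F : evF z (starF F) = Cconj (evF z F).
Proof.
 unfold evF, LF, starF. rewrite csum_map, csum_conj. apply csum_ext; intros a _. simpl.
 rewrite ev_rev, Cmult_conj. f_equal. unfold Cconj, RtoC; simpl. f_equal; ring.
Qed.

Lemma evF_star_mul z F : evF z (mulF (starF F) F) = RtoC (Cmod (evF z F) ^ 2).
Proof. rewrite evF_mul, evF_star, Cmod2_conj. ring. Qed.

Lemma lt_letters_app d a b : lt_letters d (a ++ b) <-> lt_letters d a /\ lt_letters d b.
Proof. apply Forall_app. Qed.

Lemma lt_letters_rev d a : lt_letters d a -> lt_letters d (rev a).
Proof. apply Forall_rev. Qed.

Lemma homog_app d E F G : homog d E F -> homog d E G -> homog d E (F ++ G).
Proof. intros HF HG cw H. apply in_app_or in H. destruct H; auto. Qed.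

Lemma homog_star d E F : homog d E F -> homog d E (starF F).
Proof.
 intros H cw Hin. apply in_map_iff in Hin. destruct Hin as (a & <- & Hin).
 apply H in Hin. simpl. rewrite length_rev. split; [apply lt_letters_rev|]; tauto.
Qed.

Lemma homog_mul d E1 E2 F G : homog d E1 F -> homog d E2 G -> homog d (E1 + E2) (mulF F G).
Proof.
 intros HF HG cw Hin. apply in_flat_map in Hin. destruct Hin as (a & Ha & Hin).
 apply in_map_iff in Hin. destruct Hin as (b & <- & Hb).
 apply HF in Ha; apply HG in Hb. simpl. rewrite length_app, lt_letters_app. intuition.
Qed.

Lemma homog_flat_map {A} d E (h : A -> fs) l :
 (forall a, In a l -> homog d E (h a)) -> homog d E (flat_map h l).
Proof.
 intros H cw Hin. apply in_flat_map in Hin. destruct Hin as (a & Ha & Hin). exact (H a Ha cw Hin).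
Qed.

(** * Symmetric operators with scalar commutators *)

(** No zero vector is postulated: [vsc 0 u], the same for all [u] by [vsc_0], plays its part. The
    inner product is linear in the first argument and only semidefinite, and completeness is not
    asked for, so Schwartz functions form an instance. *)
Record opspace := OpSpace {
 V :> Type;
 vadd : V -> V -> V;
 vsc : C -> V -> V;
 ip : V -> V -> C;
 X : nat -> V -> V;
 cc : nat -> nat -> C;
 vadd_comm : forall u v, vadd u v = vadd v u;
 vadd_assoc : forall u v w, vadd u (vadd v w) = vadd (vadd u v) w;
 vsc_1 : forall u, vsc (RtoC 1) u = u;
 vsc_0 : forall u v, vsc (RtoC 0) u = vsc (RtoC 0) v;
 vsc_sc : forall a b u, vsc a (vsc b u) = vsc (Cmult a b) u;
 vsc_plus : forall a b u, vadd (vsc a u) (vsc b u) = vsc (Cplus a b) u;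
 vsc_add : forall a u v, vsc a (vadd u v) = vadd (vsc a u) (vsc a v);
 ip_add : forall u v w, ip (vadd u v) w = Cplus (ip u w) (ip v w);
 ip_sc : forall c u w, ip (vsc c u) w = Cmult c (ip u w);
 ip_conj : forall u v, ip v u = Cconj (ip u v);
 ip_pos : forall u, 0 <= fst (ip u u);
 X_add : forall i u v, X i (vadd u v) = vadd (X i u) (X i v);
 X_sc : forall i c u, X i (vsc c u) = vsc c (X i u);
 X_sym : forall i u v, ip (X i u) v = ip u (X i v);
 cc_le : forall i j, Cmod (cc i j) <= 1;
 X_comm : forall i j u, X i (X j u) = vadd (X j (X i u)) (vsc (cc i j) u)
}.

Arguments vadd {o}. Arguments vsc {o}. Arguments ip {o}. Arguments X {o}. Arguments cc {o}.

Section OperatorSpace.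
Variable Sp : opspace.
Implicit Types u v : Sp.

Definition nrm2 u : R := fst (ip u u).
Definition nrm u : R := sqrt (nrm2 u).
Definition W (w : list nat) u : Sp := fold_right X u w.

Lemma nrm2_pos u : 0 <= nrm2 u. Proof. apply ip_pos. Qed.
Lemma nrm_pos u : 0 <= nrm u. Proof. triv. Qed.
Lemma nrm_sq u : nrm u ^ 2 = nrm2 u. Proof. apply pow2_sqrt, nrm2_pos. Qed.

Lemma ip_self u : ip u u = RtoC (nrm2 u).
Proof.
 note (ip_conj _ u u) as H. unfold nrm2. destruct (ip u u) as [x y].
 injection H as H. unfold RtoC. f_equal. lra.
Qed.

Lemma ip_add_r u v w : ip u (vadd v w) = Cplus (ip u v) (ip u w).
Proof.
 rewrite ip_conj, ip_add, Cplus_conj, <- !ip_conj. pos.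
Qed.

Lemma ip_sc_r c u v : ip u (vsc c v) = Cmult (Cconj c) (ip u v).
Proof. rewrite ip_conj, ip_sc, Cmult_conj, <- ip_conj. pos. Qed.

Lemma cauchy_schwarz u v : Cmod (ip u v) <= nrm u * nrm v.
Proof.
 set (q := Cmod (ip u v)).
 assert (Hq : 0 <= q) by apply Cmod_ge_0.
 (* This is the squared norm of [u - t (ip u v) v]; with the phase of [ip u v] built in, a real
    quadratic in [t] suffices. *)
 assert (H : forall t : R, 0 <= nrm2 u - 2 * t * q ^ 2 + t ^ 2 * q ^ 2 * nrm2 v).
 { intros t. note (nrm2_pos (vadd u (vsc (Cmult (RtoC (- t)) (ip u v)) v))) as H.
  unfold nrm2 in H at 1. rewrite ip_add, !ip_add_r, !ip_sc, !ip_sc_r, !ip_self in H.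
  rewrite (ip_conj _ u v) in H.
  assert (Hq2 : q ^ 2 = fst (ip u v) ^ 2 + snd (ip u v) ^ 2).
  { unfold q, Cmod. rewrite pow2_sqrt; [lra|nra]. }
  rewrite Hq2. simpl in H |- *. lra. }
 assert (Hsq : q ^ 2 <= nrm2 u * nrm2 v).
 { note (nrm2_pos u); note (nrm2_pos v).
  (* The form is only semidefinite: if [nrm2 v = 0] with [q] nonzero, the quadratic becomes linear
     and a suitable [t] makes it equal to -1. *)
  destruct (Req_dec (nrm2 v) 0) as [Hv|Hv].
  - destruct (Req_dec q 0) as [->|Hq0]; [nra|].
   specialize (H ((nrm2 u + 1) / (2 * q ^ 2))). rewrite Hv in H.
   replace (nrm2 u - 2 * ((nrm2 u + 1) / (2 * q ^ 2)) * q ^ 2 +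
    ((nrm2 u + 1) / (2 * q ^ 2)) ^ 2 * q ^ 2 * 0) with (-1) in H; [lra|].
   field. exact Hq0.
  - specialize (H (/ nrm2 v)).
   apply (Rmult_le_compat_r (nrm2 v)) in H; [|lra].
   replace ((nrm2 u - 2 * / nrm2 v * q ^ 2 + (/ nrm2 v) ^ 2 * q ^ 2 * nrm2 v) * nrm2 v)
    with (nrm2 u * nrm2 v - q ^ 2) in H by (field; exact Hv). lra. }
 unfold nrm. rewrite <- sqrt_mult by apply nrm2_pos.
 rewrite <- (sqrt_pow2 q Hq). apply sqrt_le_1_alt; exact Hsq.
Qed.

Lemma nrm2_sc c u : nrm2 (vsc c u) = Cmod c ^ 2 * nrm2 u.
Proof.
 unfold nrm2 at 1. rewrite ip_sc, ip_sc_r, ip_self, Cmult_assoc, <- Cmod2_conj.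
 rewrite <- RtoC_mult. pos.
Qed.

Lemma nrm_sc c u : nrm (vsc c u) = Cmod c * nrm u.
Proof.
 unfold nrm. rewrite nrm2_sc, sqrt_mult; [|pos|apply nrm2_pos].
 rewrite sqrt_pow2; [lra|pos].
Qed.

Lemma nrm_add u v : nrm (vadd u v) <= nrm u + nrm v.
Proof.
 apply Rsqr_incr_0_var; [|note (nrm_pos u); note (nrm_pos v); lra].
 unfold Rsqr. replace (nrm (vadd u v) * nrm (vadd u v)) with (nrm2 (vadd u v)) by (rewrite <- nrm_sq; ring).
 assert (E : nrm2 (vadd u v) = nrm2 u + nrm2 v + 2 * fst (ip u v)).
 { unfold nrm2. rewrite ip_add, !ip_add_r, (ip_conj _ u v). simpl. ring. }
 rewrite E. note (cauchy_schwarz u v). note (re_le_Cmod (ip u v)) as Hr.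
 unfold Re in Hr. note (Rle_abs (fst (ip u v))).
 rewrite <- !nrm_sq. nra.
Qed.

Lemma nrm2_add u v : nrm2 (vadd u v) <= 2 * nrm2 u + 2 * nrm2 v.
Proof.
 note (nrm_add u v).
 note (nrm_pos (vadd u v)). rewrite <- !nrm_sq.
 assert (nrm (vadd u v) ^ 2 <= (nrm u + nrm v) ^ 2) by mono.
 note (pow2_ge_0 (nrm u - nrm v)). lra.
Qed.

Lemma W_app a b u : W (a ++ b) u = W a (W b u).
Proof. apply fold_right_app. Qed.

Lemma W_add w u v : W w (vadd u v) = vadd (W w u) (W w v).
Proof. induction w; simpl; [pos|rewrite IHw, X_add; reflexivity]. Qed.

Lemma W_sc w c u : W w (vsc c u) = vsc c (W w u).
Proof. induction w; simpl; [pos|rewrite IHw, X_sc; reflexivity]. Qed.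

Lemma W_adj w u v : ip (W w u) v = ip u (W (rev w) v).
Proof.
 revert v; induction w; intros v; simpl; [pos|].
 rewrite X_sym, IHw, W_app. pos.
Qed.

Definition Op (F : fs) u : Sp := fold_right (fun cw acc => vadd (vsc (fst cw) (W (snd cw) u)) acc) (vsc (RtoC 0) u) F.

Lemma ip_Op F u v : ip (Op F u) v = csum F (fun cw => Cmult (fst cw) (ip (W (snd cw) u) v)).
Proof.
 induction F as [|cw F IH]; simpl.
 - rewrite ip_sc. ring.
 - rewrite ip_add, ip_sc, IH. pos.
Qed.

Lemma ip_Op_r F u v : ip v (Op F u) = csum F (fun cw => Cmult (Cconj (fst cw)) (ip v (W (snd cw) u))).
Proof.
 rewrite ip_conj, ip_Op, csum_conj. apply csum_ext; intros cw _.
 rewrite Cmult_conj, <- ip_conj. pos.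
Qed.

Lemma ip_Op_Op F u : RtoC (nrm2 (Op F u)) = LF (fun w => ip (W w u) u) (mulF (starF F) F).
Proof.
 rewrite <- ip_self, LF_mul. unfold starF. rewrite csum_map.
 rewrite ip_Op_r. apply csum_ext; intros a _. simpl. rewrite ip_Op, <- csum_scal.
 apply csum_ext; intros b _. rewrite W_app, (W_adj (rev (snd a))), rev_involutive. ring.
Qed.

Lemma Op_W_bound F u B : (forall cw, In cw F -> nrm (W (snd cw) u) <= B) ->
 nrm (Op F u) <= lsum F (fun cw => Cmod (fst cw)) * B.
Proof.
 induction F as [|cw F IH]; intros H; simpl.
 - rewrite nrm_sc, Cmod_0. lra.
 - bound nrm_add. rewrite nrm_sc, Rmult_plus_distr_r.
  apply Rplus_le_compat.
  + scale_l. apply H; simpl; auto.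
  + apply IH. intros; apply H; simpl; auto.
Qed.

Variable d : nat.

Definition N2 (M : nat) u : R := lsum (words d M) (fun w => nrm2 (W w u)).

Lemma N2_pos M u : 0 <= N2 M u.
Proof. apply lsum_nonneg; intros; apply nrm2_pos. Qed.

Lemma nrm2_le_N2 w u : lt_letters d w -> nrm2 (W w u) <= N2 (length w) u.
Proof.
 intros H. apply (lsum_mem _ (fun w => nrm2 (W w u))); [intros; apply nrm2_pos|].
 apply words_spec; auto.
Qed.

Lemma N2_0 u : N2 0 u = nrm2 u.
Proof. unfold N2; simpl. ring. Qed.

(** Symmetry moves the first half of the word, reversed, to the other side of the inner product;
    Cauchy-Schwarz then sees two words of length [q]. *)
Lemma word_functional_bound w u q : lt_letters d w -> length w = (2 * q)%nat ->
 Cmod (ip (W w u) u) <= N2 q u.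
Proof.
 intros Hl Hq. rewrite <- (firstn_skipn q w) in Hl |- *.
 rewrite W_app, W_adj. apply lt_letters_app in Hl. destruct Hl as [H1 H2].
 bound cauchy_schwarz.
 assert (L1 : length (rev (firstn q w)) = q) by (rewrite length_rev, length_firstn; lia).
 assert (L2 : length (skipn q w) = q) by (rewrite length_skipn; lia).
 note (nrm2_le_N2 (rev (firstn q w)) u (lt_letters_rev _ _ H1)) as E1. rewrite L1 in E1.
 note (nrm2_le_N2 (skipn q w) u H2) as E2. rewrite L2 in E2.
 rewrite <- nrm_sq in E1, E2.
 nra.
Qed.

Lemma word_functional_swap u q : (1 <= q)%nat ->
 forall l, l = (fun w => fst (ip (W w u) u)) \/ l = (fun w => snd (ip (W w u) u)) ->
 swap_bounded d (2 * q) l (N2 (q - 1) u).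
Proof.
 intros Hq l Hl a i j b Hlen Hlt.
 assert (E : ip (W (a ++ i :: j :: b) u) u
   = Cplus (ip (W (a ++ j :: i :: b) u) u) (Cmult (@cc Sp i j) (ip (W (a ++ b) u) u))).
 { rewrite !W_app. simpl. rewrite X_comm, W_add, W_sc, ip_add, ip_sc. pos. }
 assert (Hb : Cmod (Cmult (@cc Sp i j) (ip (W (a ++ b) u) u)) <= N2 (q - 1) u).
 { rewrite Cmod_mult, <- (Rmult_1_l (N2 _ _)). apply Rmult_le_compat; try apply Cmod_ge_0.
  - apply cc_le.
  - apply word_functional_bound.
   + unfold lt_letters in *. rewrite Forall_app in *. destruct Hlt as [? Hlt]. split; [pos|].
    inversion_clear Hlt. inversion_clear H1. assumption.
   + rewrite length_app. lia. }
 destruct Hl as [-> | ->]; rewrite E; simpl;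
  (eapply Rle_trans; [|exact Hb]); set (z := Cmult (@cc Sp i j) _).
 - replace (fst _ + fst z - fst _) with (Re z) by (unfold Re; ring). apply re_le_Cmod.
 - replace (snd _ + snd z - snd _) with (Im z) by (unfold Im; ring).
  bound Rmax_r; apply (Rmax_Cmod z).
Qed.

(** Real and imaginary parts of the coefficients give two real forms that vanish separately, since
    [ev] is real. Degree [2 q] is that of a squared norm, and the error has two letters less, hence
    [q - 1]. *)
Lemma vanishing_form_functional q (F : fs) : (1 <= q)%nat -> homog d (2 * q) F ->
 (forall z, evF z F = RtoC 0) ->
 exists M, 0 <= M /\ forall u, Rabs (fst (LF (fun w => ip (W w u) u) F)) <= M * N2 (q - 1) u.
Proof.
 intros Hq HF Hz.
 destruct (vanishing_form_bound d (2 * q) (map (fun cw => (fst (fst cw), snd cw)) F)) as [M1 [HM1 H1]].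
 { intros cw Hin. apply in_map_iff in Hin. destruct Hin as (a & <- & Hin). exact (HF a Hin). }
 { intros z. rewrite lsum_map. note (f_equal fst (Hz z)) as E. unfold evF, LF in E.
  rewrite fst_csum in E. etransitivity; [|exact E]. apply lsum_ext; intros; simpl; rewrite Rmult_0_r, Rminus_0_r; reflexivity. }
 destruct (vanishing_form_bound d (2 * q) (map (fun cw => (snd (fst cw), snd cw)) F)) as [M2 [HM2 H2]].
 { intros cw Hin. apply in_map_iff in Hin. destruct Hin as (a & <- & Hin). exact (HF a Hin). }
 { intros z. rewrite lsum_map. note (f_equal snd (Hz z)) as E. unfold evF, LF in E.
  rewrite snd_csum in E. etransitivity; [|exact E]. apply lsum_ext; intros; simpl; rewrite Rmult_0_r, Rplus_0_l; apply Rmult_comm || reflexivity. }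
 exists (M1 + M2). split; [lra|]. intros u.
 specialize (H1 _ _ (N2_pos (q - 1) u) (word_functional_swap u q Hq _ (or_introl eq_refl))).
 specialize (H2 _ _ (N2_pos (q - 1) u) (word_functional_swap u q Hq _ (or_intror eq_refl))).
 rewrite lsum_map in H1, H2.
 unfold LF. rewrite fst_csum.
 rewrite (lsum_ext F _ (fun a => fst (fst a) * fst (ip (W (snd a) u) u)
   + (-1) * (snd (fst a) * snd (ip (W (snd a) u) u)))) by (intros; simpl; ring).
 rewrite lsum_plus, lsum_scal. bound Rabs_triang.
 rewrite Rabs_mult. replace (Rabs (-1)) with 1 by (rewrite Rabs_left; lra).
 rewrite Rmult_plus_distr_r, Rmult_1_l. mono.
Qed.

End OperatorSpace.

(** * Interpolation between orders and the elliptic estimate *)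

Lemma interpolation_step_iter (kap : R) (j : nat) : 0 <= kap -> forall del, 0 < del -> exists Cd, 0 <= Cd /\
 forall a : nat -> R, (forall j, 0 <= a j) ->
 (forall e j, 0 < e -> a (S j) <= e * a (S (S j)) + kap / e * a j) ->
 a j <= del * a (S j) + Cd * a O.
Proof.
 intros Hk. induction j; intros del Hd.
 - exists 1; split; [lra|]. intros a Ha _. note (Ha 1%nat). nra.
 (* With [e = del / 2] in the hypothesis, this smallness returns [a (S j)] with coefficient at most
    1/2, which is absorbed on the left. *)
 - destruct (IHj (del / (4 * kap + 4))) as [C [HC H]].
  { pos. }
  exists (4 * kap / del * C). split.
  { pos. }
  intros a Ha Hs. specialize (H a Ha Hs). note (Hs (del / 2) j ltac:(lra)) as H1.
  assert (E : kap / (del / 2) * a j <= / 2 * a (S j) + 2 * kap / del * C * a O).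
  { via (kap / (del / 2) * (del / (4 * kap + 4) * a (S j) + C * a O)).
   - apply Rmult_le_compat_l; [|lra].
    apply Rmult_le_pos; [lra|]. left; apply Rinv_0_lt_compat; lra.
   - via ((2 * kap / (4 * kap + 4)) * a (S j) + 2 * kap / del * C * a O).
    + right. field. split; lra.
    + apply Rplus_le_compat_r. scale_r.
     apply Rmult_le_reg_r with (4 * kap + 4); [lra|]. field_simplify; lra. }
  lra.
Qed.

Lemma interpolation_sequence (kap : R) (D : nat) : 0 <= kap -> forall del, 0 < del -> exists Cd, 0 <= Cd /\
 forall a : nat -> R, (forall j, 0 <= a j) ->
 (forall e j, 0 < e -> a (S j) <= e * a (S (S j)) + kap / e * a j) ->
 forall j, (j < D)%nat -> a j <= del * a D + Cd * a O.
Proof.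
 intros Hk. induction D; intros del Hd.
 - exists 0; split; [lra|]. intros; lia.
 - destruct (IHD 1 ltac:(lra)) as [C1 [HC1 H1]].
  destruct (interpolation_step_iter kap D Hk del Hd) as [C2 [HC2 H2]].
  exists (C1 + C2); split; [lra|]. intros a Ha Hs j Hj.
  specialize (H2 a Ha Hs). note (Ha O).
  destruct (Nat.eq_dec j D) as [->|Hn]; [nra|].
  specialize (H1 a Ha Hs j ltac:(lia)). nra.
Qed.

Section Elliptic.
Variable Sp : opspace.
Variable d : nat.
Implicit Types u v : Sp.

Definition preF (w : list nat) (F : fs) : fs := map (fun cw => (fst cw, w ++ snd cw)) F.

Lemma W_Op w F u : W Sp w (Op Sp F u) = Op Sp (preF w F) u.
Proof.
 induction F as [|cw F IH]; simpl.
 - rewrite W_sc. apply vsc_0.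
 - rewrite W_add, IH, W_sc, W_app. pos.
Qed.

Lemma evF_pre z w F : evF z (preF w F) = Cmult (RtoC (ev z w)) (evF z F).
Proof.
 unfold evF, LF, preF. rewrite csum_map, <- csum_scal. apply csum_ext; intros a _. simpl.
 rewrite ev_app, RtoC_mult. ring.
Qed.

Lemma homog_pre w E F : lt_letters d w -> homog d E F -> homog d (length w + E) (preF w F).
Proof.
 intros Hw H cw Hin. apply in_map_iff in Hin. destruct Hin as (a & <- & Hin). apply H in Hin.
 simpl. rewrite length_app, lt_letters_app. intuition.
Qed.

Lemma LF_flat_map {A} l (h : A -> fs) k : LF l (flat_map h k) = csum k (fun a => LF l (h a)).
Proof. apply csum_flat_map. Qed.

Definition scF (c : R) (F : fs) : fs := map (fun cw => (Cmult (RtoC c) (fst cw), snd cw)) F.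

Lemma LF_sc l c F : LF l (scF c F) = Cmult (RtoC c) (LF l F).
Proof.
 unfold LF, scF. rewrite csum_map, <- csum_scal. apply csum_ext; intros; simpl. ring.
Qed.

Lemma homog_sc E c F : homog d E F -> homog d E (scF c F).
Proof.
 intros H cw Hin. apply in_map_iff in Hin. destruct Hin as (a & <- & Hin). exact (H a Hin).
Qed.

Lemma csum_RtoC {A} (l : list A) (f : A -> R) : csum l (fun a => RtoC (f a)) = RtoC (lsum l f).
Proof. induction l; simpl; [pos|rewrite IHl, RtoC_plus; reflexivity]. Qed.

(** The squared norms on both sides are quadratic forms of degree [2 (N + m)] whose symbols agree by
    the certificate, so their difference is of lower order. The sum of squares contributes a
    nonnegative term and is dropped. *)
Lemma elliptic_principal (Pm : fs) (m N : nat) (c : R) (L : list fs) :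
 homog d m Pm -> (forall s, In s L -> homog d (N + m) s) -> (1 <= N + m)%nat ->
 (forall z, nsq d z ^ N * (Cmod (evF z Pm) ^ 2 - c * nsq d z ^ m)
       = lsum L (fun s => Cmod (evF z s) ^ 2)) ->
 exists M, 0 <= M /\ forall u,
  c * N2 Sp d (N + m) u <= lsum (words d N) (fun w => nrm2 Sp (W Sp w (Op Sp Pm u)))
               + M * N2 Sp d (N + m - 1) u.
Proof.
 intros HPm HL HNm Hid.
 set (sq := fun F => mulF (starF F) F).
 (* The three groups quantize to the squared norms of [W w (Op Pm u)], to [N2 (N + m)], and to the
    discarded squares; their combination has symbol zero by [Hid]. *)
 set (T1 := flat_map (fun w => sq (preF w Pm)) (words d N)).
 set (T2 := flat_map (fun w => sq [(RtoC 1, w)]) (words d (N + m))).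
 set (T3 := flat_map sq L).
 destruct (vanishing_form_functional Sp d (N + m) (T1 ++ scF (- c) T2 ++ scF (-1) T3) HNm) as [M [HM H]].
 - assert (Hsq : forall F, homog d (N + m) F -> homog d (2 * (N + m)) (sq F)).
  { intros F HF. replace (2 * (N + m))%nat with ((N + m) + (N + m))%nat by lia.
   apply homog_mul; [apply homog_star|]; exact HF. }
  apply homog_app; [|apply homog_app; apply homog_sc].
  + apply homog_flat_map. intros w Hw. apply words_spec in Hw. destruct Hw as [Hw1 Hw2].
   apply Hsq. rewrite <- Hw1. apply homog_pre; assumption.
  + apply homog_flat_map. intros w Hw. apply words_spec in Hw. destruct Hw as [Hw1 Hw2].
   apply Hsq. intros cw [<-|[]]. split; assumption.
  + apply homog_flat_map. intros s Hs. apply Hsq, HL, Hs.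
 - intros z. unfold evF. rewrite !LF_app, !LF_sc. unfold T1, T2, T3. rewrite !LF_flat_map.
  change (LF (fun w => RtoC (ev z w))) with (evF z).
  rewrite (csum_ext (words d N) _ (fun w => RtoC (Cmod (evF z Pm) ^ 2 * ev z w ^ 2))).
  2:{ intros w _. unfold sq. rewrite evF_star_mul, evF_pre. f_equal.
    rewrite Cmod_mult, Cmod_R, Rpow_mult_distr, pow2_abs. ring. }
  rewrite (csum_ext (words d (N + m)) _ (fun w => RtoC (ev z w ^ 2))).
  2:{ intros w _. unfold sq. rewrite evF_star_mul. f_equal.
    replace (evF z [(RtoC 1, w)]) with (RtoC (ev z w)) by (unfold evF, LF; simpl; ring).
    rewrite Cmod_R, pow2_abs. lra. }
  rewrite (csum_ext L _ (fun s => RtoC (Cmod (evF z s) ^ 2))) by (intros; apply evF_star_mul).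
  rewrite !csum_RtoC, <- (Hid z), words_sq, lsum_scal, words_sq, pow_add.
  rewrite <- !RtoC_mult, <- !RtoC_plus. f_equal. ring.
 - exists M; split; [lra|]. intros u. specialize (H u).
  rewrite !LF_app, !LF_sc in H. unfold T1, T2, T3 in H. rewrite !LF_flat_map in H.
  rewrite (csum_ext (words d N) _ (fun w => RtoC (nrm2 Sp (W Sp w (Op Sp Pm u))))) in H.
  2:{ intros w _. unfold sq. rewrite <- ip_Op_Op, W_Op. pos. }
  rewrite (csum_ext (words d (N + m)) _ (fun w => RtoC (nrm2 Sp (W Sp w u)))) in H.
  2:{ intros w _. unfold sq. rewrite <- ip_Op_Op. f_equal. simpl.
    rewrite (vsc_0 _ u (W Sp w u)), vsc_plus, Cplus_0_r, vsc_1. lra. }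
  rewrite (csum_ext L _ (fun s => RtoC (nrm2 Sp (Op Sp s u)))) in H.
  2:{ intros s _. unfold sq. rewrite <- ip_Op_Op. pos. }
  rewrite !csum_RtoC, <- !RtoC_mult, <- !RtoC_plus in H. simpl fst in H.
  assert (0 <= lsum L (fun s => nrm2 Sp (Op Sp s u))) by (apply lsum_nonneg; intros; apply nrm2_pos).
  apply Rabs_le_between in H. unfold N2 at 1. lra.
Qed.

Definition low_order (m : nat) (F : fs) : Prop :=
 forall cw, In cw F -> lt_letters d (snd cw) /\ (length (snd cw) < m)%nat.

Definition coefsum (F : fs) : R := lsum F (fun cw => Cmod (fst cw)).

Lemma coefsum_pos F : 0 <= coefsum F.
Proof. apply lsum_nonneg; intros; apply Cmod_ge_0. Qed.

Lemma coefsum_pre w F : coefsum (preF w F) = coefsum F.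
Proof. unfold coefsum, preF. rewrite lsum_map. pos. Qed.

Lemma vadd_cancel u v : vadd (vadd u v) (vsc (RtoC (-1)) v) = u.
Proof.
 rewrite <- vadd_assoc. rewrite <- (vsc_1 _ v) at 1. rewrite vsc_plus.
 rewrite <- RtoC_plus, Rplus_opp_r, (vsc_0 _ v u). rewrite <- (vsc_1 _ u) at 1.
 rewrite vsc_plus, Cplus_0_r. apply vsc_1.
Qed.

Section Estimate.
Variables (Pm Pl : fs) (m N : nat) (c : R) (L : list fs) (P : Sp -> Sp).
Hypothesis (HPm : homog d m Pm) (HPl : low_order m Pl) (Hm : (2 <= m)%nat) (Hc : 0 < c).
Hypothesis (HL : forall s, In s L -> homog d (N + m) s).
Hypothesis Hid : forall z, nsq d z ^ N * (Cmod (evF z Pm) ^ 2 - c * nsq d z ^ m)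
       = lsum L (fun s => Cmod (evF z s) ^ 2).
Hypothesis HP : forall u, P u = vadd (Op Sp Pm u) (Op Sp Pl u).

Lemma elliptic_lower : exists M, 0 <= M /\ forall u,
 c * N2 Sp d (N + m) u <= 2 * lsum (words d N) (fun w => nrm2 Sp (W Sp w (P u)))
   + M * lsum (seq 0 (N + m)) (fun j => N2 Sp d j u).
Proof.
 destruct (elliptic_principal Pm m N c L HPm HL ltac:(lia) Hid) as [M [HM H]].
 set (k := INR (length (words d N))).
 exists (2 * k * coefsum Pl ^ 2 + M). split.
 { assert (0 <= k) by apply pos_INR. pos. }
 intros u. specialize (H u).
 set (S := lsum (seq 0 (N + m)) (fun j => N2 Sp d j u)).
 assert (HS : forall j, (j < N + m)%nat -> N2 Sp d j u <= S).
 { intros j Hj. apply (lsum_mem _ (fun j => N2 Sp d j u)); [intros; apply N2_pos|].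
  apply in_seq. lia. }
 assert (HS0 : 0 <= S) by (apply lsum_nonneg; intros; apply N2_pos).
 assert (E : lsum (words d N) (fun w => nrm2 Sp (W Sp w (Op Sp Pm u)))
   <= lsum (words d N) (fun w => 2 * nrm2 Sp (W Sp w (P u)) + 2 * (coefsum Pl ^ 2 * S))).
 { apply lsum_le. intros w Hw. apply words_spec in Hw.
  rewrite <- (vadd_cancel (Op Sp Pm u) (Op Sp Pl u)) at 1. rewrite <- HP, W_add, W_sc.
  bound nrm2_add. apply Rplus_le_compat_l.
  rewrite nrm2_sc, Cmod_R, pow2_abs.
  replace ((-1) ^ 2) with 1 by ring. rewrite Rmult_1_l. scale_l.
  rewrite W_Op, <- nrm_sq. rewrite <- (pow2_sqrt S HS0), <- Rpow_mult_distr.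
  apply pow_incr. split; [triv|].
  rewrite <- (coefsum_pre w). apply Op_W_bound. intros cw Hin.
  apply in_map_iff in Hin. destruct Hin as (a & <- & Hin). apply HPl in Hin. simpl.
  apply sqrt_le_1_alt. bound (nrm2_le_N2 Sp d).
  - apply lt_letters_app; tauto.
  - apply HS. rewrite length_app. lia. }
 rewrite lsum_plus, lsum_scal, lsum_const in E. fold k in E.
 assert (M * N2 Sp d (N + m - 1) u <= M * S) by (apply Rmult_le_compat_l; [lra|apply HS; lia]).
 lra.
Qed.

(** From [ip (X i v) (X i v) = ip (X i (X i v)) v] and the arithmetic-geometric mean. The words
    [i :: i :: w] are among those of length [S (S j)], and [INR d] counts the letters [i]. *)
Lemma interpolation_N2 e j u : 0 < e ->
 N2 Sp d (S j) u <= e * N2 Sp d (S (S j)) u + INR d / e * N2 Sp d j u.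
Proof.
 intros He. unfold N2. rewrite !words_S, <- !lsum_scal, <- lsum_plus.
 apply lsum_le. intros w _.
 replace (INR d / e * nrm2 Sp (W Sp w u)) with (lsum (seq 0 d) (fun _ => / e * nrm2 Sp (W Sp w u))).
 2:{ rewrite lsum_const, length_seq. lra. }
 via (lsum (seq 0 d) (fun i => e * nrm2 Sp (W Sp (i :: i :: w) u) + / e * nrm2 Sp (W Sp w u))).
 - apply lsum_le. intros i _. unfold nrm2 at 1. simpl W at 1 2. rewrite X_sym.
  bound Rle_abs. bound (re_le_Cmod (ip _ _)).
  bound cauchy_schwarz.
  rewrite <- !nrm_sq. set (p := nrm Sp (W Sp w u)). set (r := nrm Sp (W Sp (i :: i :: w) u)).
  note (pow2_ge_0 (e * r - p)) as Hs.
  apply Rmult_le_reg_l with e; [lra|].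
  replace (e * (e * r ^ 2 + / e * p ^ 2)) with (e ^ 2 * r ^ 2 + p ^ 2) by (field; lra).
  assert (0 <= e * (p * r)) by (repeat apply Rmult_le_pos; try apply nrm_pos; lra). change (nrm Sp (X i (X i (W Sp w u)))) with r. lra.
 - rewrite lsum_plus. apply Rplus_le_compat_r. rewrite lsum_scal.
  scale_l. apply lsum_le. intros i Hi.
  apply (lsum_mem (seq 0 d) (fun k => nrm2 Sp (W Sp (k :: i :: w) u))); [intros; apply nrm2_pos|pos].
Qed.

Lemma lsum_interpolate (a : nat -> R) D x y : (forall j, (j < D)%nat -> a j <= x + y) ->
 lsum (seq 0 D) a <= INR D * (x + y).
Proof.
 intros H. rewrite <- (length_seq D 0) at 2. rewrite <- lsum_const. apply lsum_le.
 intros j Hj. apply in_seq in Hj. apply H. lia.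
Qed.

Lemma elliptic_estimate : exists M, 0 <= M /\ forall u,
 N2 Sp d (N + m) u <= M * (lsum (words d N) (fun w => nrm2 Sp (W Sp w (P u))) + nrm2 Sp u).
Proof.
 destruct elliptic_lower as [M [HM H]].
 set (D := (N + m)%nat) in *.
 (* Small enough that the lower orders return at most half of [c] times the top order, as [E3]
    records. *)
 set (del := c / (2 * M * INR D + 1)).
 assert (HD : 0 <= INR D) by apply pos_INR.
 assert (Hden : 0 < 2 * M * INR D + 1) by nra.
 assert (Hdel : 0 < del) by (apply Rdiv_lt_0_compat; assumption).
 destruct (interpolation_sequence (INR d) D (pos_INR d) del Hdel) as [C [HC HI]].
 exists (2 / c * (2 + M * INR D * C)). split.
 { pos. }
 intros u. specialize (H u).
 specialize (HI (fun j => N2 Sp d j u) (fun j => N2_pos Sp d j u) (fun e j He => interpolation_N2 e j u He)).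
 simpl in HI.
 note (lsum_interpolate (fun j => N2 Sp d j u) D _ _ HI) as E. rewrite N2_0 in E.
 set (Q := lsum (words d N) (fun w => nrm2 Sp (W Sp w (P u)))) in *.
 assert (HQ : 0 <= Q) by (apply lsum_nonneg; intros; apply nrm2_pos).
 note (nrm2_pos Sp u) as Hu. note (N2_pos Sp d D u) as Ha.
 set (b := nrm2 Sp u) in *.
 assert (E3 : M * INR D * del <= c / 2).
 { unfold del. apply Rmult_le_reg_r with (2 * M * INR D + 1); [lra|].
  field_simplify; [|lra]. nra. }

 apply Rmult_le_reg_l with (c / 2); [lra|].
 replace (c / 2 * (2 / c * (2 + M * INR D * C) * (Q + b))) with ((2 + M * INR D * C) * (Q + b)) by (field; lra).
 assert (0 <= M * INR D * C) by pos. nra.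
Qed.

(** Dividing [N2 j u] by [Th ^ j] makes the interpolation inequality scale invariant (take [e / Th]
    for [e]), and [lam ^ 2 <= Th ^ m] puts the eigenvalue term at the same scale. The constant is
    therefore uniform in the eigenvalue. *)
Lemma eigen_low_orders : exists M, 0 <= M /\ forall u (lam Th : R),
 P u = vsc (RtoC lam) u -> 1 <= Th -> lam ^ 2 <= Th ^ m ->
 forall j, (j <= N + m)%nat -> N2 Sp d j u <= M * Th ^ j * nrm2 Sp u.
Proof.
 destruct elliptic_lower as [M [HM H]].
 set (D := (N + m)%nat) in *.
 set (del := c / (2 * (2 + M) * INR D + 1)).
 assert (HD : 0 <= INR D) by apply pos_INR.
 assert (Hden : 0 < 2 * (2 + M) * INR D + 1) by nra.
 assert (Hdel : 0 < del) by (apply Rdiv_lt_0_compat; assumption).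
 destruct (interpolation_sequence (INR d) D (pos_INR d) del Hdel) as [C [HC HI]].
 set (KD := 2 / c * ((2 + M) * INR D * C)).
 assert (HKD : 0 <= KD).
 { apply Rmult_le_pos; [pos|]. pos. }
 exists (KD + del * KD + C). split; [nra|].
 intros u lam Th Hu HT Hlam.
 assert (HTp : forall j, 0 < Th ^ j) by triv.
 assert (HI1 : forall j, (j < D)%nat -> N2 Sp d j u / Th ^ j <= del * (N2 Sp d D u / Th ^ D) + C * nrm2 Sp u).
 { rewrite <- N2_0 with (d := d), <- (Rdiv_1_r (N2 Sp d 0 u)). apply HI.
  - intros j. apply Rmult_le_pos; [apply N2_pos|pos].
  - intros e j He. note (interpolation_N2 (e / Th) j u ltac:(apply Rdiv_lt_0_compat; lra)) as E.
   apply (Rmult_le_compat_r (/ Th ^ S j)) in E; [|pos].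
   eapply Rle_trans; [exact E|]. right. simpl. note (HTp j). field. lra. }
 set (a := N2 Sp d D u / Th ^ D) in *. set (b := nrm2 Sp u) in *.
 assert (Hb : 0 <= b) by apply nrm2_pos.
 assert (Ha : 0 <= a) by (apply Rmult_le_pos; [apply N2_pos|pos]).
 assert (HaD : a <= KD * b).
 { specialize (H u). rewrite Hu in H.
  rewrite (lsum_ext _ _ (fun w => lam ^ 2 * nrm2 Sp (W Sp w u))) in H.
  2:{ intros w _. rewrite W_sc, nrm2_sc, Cmod_R, pow2_abs. lra. }
  rewrite lsum_scal in H. fold (N2 Sp d N u) in H.
  assert (E1 : lam ^ 2 * N2 Sp d N u <= Th ^ D * (N2 Sp d N u / Th ^ N)).
  { unfold D. rewrite pow_add. replace (Th ^ N * Th ^ m * (N2 Sp d N u / Th ^ N)) with (Th ^ m * N2 Sp d N u).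
   - apply Rmult_le_compat_r; [apply N2_pos|lra].
   - note (HTp N). field. lra. }
  assert (E2 : forall j, (j < D)%nat -> N2 Sp d j u <= Th ^ D * (del * a + C * b)).
  { intros j Hj. via (Th ^ D * (N2 Sp d j u / Th ^ j)).
   - via (Th ^ j * (N2 Sp d j u / Th ^ j)).
    + right. note (HTp j). field. lra.
    + apply Rmult_le_compat_r; [|mono].
     apply Rmult_le_pos; [apply N2_pos|pos].
   - scale_l; pos. }
  note (lsum_interpolate (fun j => N2 Sp d j u) D (Th ^ D * (del * a)) (Th ^ D * (C * b))) as E3.
  assert (E4 : lsum (seq 0 D) (fun j => N2 Sp d j u) <= INR D * (Th ^ D * (del * a) + Th ^ D * (C * b))).
  { apply E3. intros j Hj. specialize (E2 j Hj). lra. }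
  assert (HDN : (N < D)%nat) by lia.
  note (HI1 N HDN) as E5.
  assert (HDge : 1 <= INR D) by (change 1 with (INR 1); apply le_INR; unfold D; lia).
  assert (E6 : c * (Th ^ D * a) <= 2 * (Th ^ D * (N2 Sp d N u / Th ^ N)) + M * (INR D * (Th ^ D * (del * a) + Th ^ D * (C * b)))).
  { replace (Th ^ D * a) with (N2 Sp d D u) by (unfold a; note (HTp D); field; lra).
   nra. }
  assert (E7 : c * a <= (2 + M) * INR D * (del * a + C * b)).
  { apply Rmult_le_reg_l with (Th ^ D); [pos|].
   assert (E8 : Th ^ D * (N2 Sp d N u / Th ^ N) <= Th ^ D * (del * a + C * b))
    by mono.
   assert (E9 : Th ^ D * (del * a + C * b) <= INR D * (Th ^ D * (del * a + C * b))).
   { rewrite <- (Rmult_1_l (Th ^ D * _)) at 1. mono. }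
   lra. }
  assert (E8 : (2 + M) * INR D * del <= c / 2).
  { unfold del. apply Rmult_le_reg_r with (2 * (2 + M) * INR D + 1); [lra|].
   field_simplify; [|lra]. nra. }
  assert (E9 : (2 + M) * INR D * del * a <= c / 2 * a) by mono.
  unfold KD. apply Rmult_le_reg_l with (c / 2); [lra|].
  replace (c / 2 * (2 / c * ((2 + M) * INR D * C) * b)) with ((2 + M) * INR D * C * b) by (field; lra).
  lra. }
 intros j Hj.
 assert (Ej : N2 Sp d j u / Th ^ j <= (KD + del * KD + C) * b).
 { destruct (Nat.eq_dec j D) as [->|Hn].
  - fold a. assert (0 <= del * KD * b) by pos. assert (0 <= C * b) by pos. lra.
  - eapply Rle_trans; [apply HI1; lia|].
   nra. }
 apply (Rmult_le_compat_l (Th ^ j)) in Ej; [|pos].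
 replace (Th ^ j * (N2 Sp d j u / Th ^ j)) with (N2 Sp d j u) in Ej by (note (HTp j); field; lra).
 lra.
Qed.

End Estimate.
End Elliptic.

(** * Words of arbitrary length applied to eigenvectors *)

Section EigenBound.
Variable Sp : opspace.
Variable d : nat.
Implicit Types u v : Sp.

Lemma vadd_0_r u v : vadd u (vsc (RtoC 0) v) = u.
Proof.
 rewrite (vsc_0 _ v u). rewrite <- (vsc_1 _ u) at 1. rewrite vsc_plus, Cplus_0_r. apply vsc_1.
Qed.

Lemma nrm_0 u : nrm Sp (vsc (RtoC 0) u) = 0.
Proof. rewrite nrm_sc, Cmod_0. ring. Qed.

(** Each of the [length y] exchanges leaves a commutator on a word with both letters deleted; its
    length is the total minus two, which is what [B] is required to bound. *)
Lemma move_letter i a y e u B :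
 (forall x, lt_letters d x -> length x = (length a + length y + length e - 1)%nat -> nrm Sp (W Sp x u) <= B) ->
 lt_letters d (a ++ i :: y ++ e) ->
 exists r, W Sp (a ++ i :: y ++ e) u = vadd (W Sp (a ++ y ++ i :: e) u) r /\ nrm Sp r <= INR (length y) * B.
Proof.
 revert a; induction y as [|j y IH]; intros a HB Hlt.
 - exists (vsc (RtoC 0) u). rewrite nrm_0. split; [simpl; symmetry; apply vadd_0_r|simpl; lra].
 - assert (Hlt' : lt_letters d (a ++ [j]) /\ lt_letters d (i :: y ++ e) /\ lt_letters d (a ++ y ++ e)).
  { unfold lt_letters in *. rewrite !Forall_app in *. destruct Hlt as [Ha H]. inversion_clear H.
   inversion_clear H1. rewrite Forall_app in H2. repeat split; try tauto.
   - constructor; [pos|pos].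
   - constructor; [pos|]. apply Forall_app; tauto. }
  destruct Hlt' as [H1 [H2 H3]].
  destruct (IH (a ++ [j])) as [r [Hr Hn]].
  + intros x Hx Hl. apply HB; [pos|]. rewrite Hl, length_app. simpl. lia.
  + apply lt_letters_app; split; assumption.
  + rewrite <- !app_assoc in Hr. simpl in Hr.
   exists (vadd r (vsc (@cc Sp i j) (W Sp (a ++ y ++ e) u))). split.
   * rewrite vadd_assoc. simpl. rewrite <- Hr. rewrite !(W_app _ a). simpl.
    rewrite X_comm, W_add, W_sc. reflexivity.
   * bound nrm_add. rewrite nrm_sc. simpl length. rewrite S_INR.
    assert (E : nrm Sp (W Sp (a ++ y ++ e) u) <= B).
    { apply HB; [pos|]. rewrite !length_app. simpl. lia. }
    note (cc_le Sp i j). note (nrm_pos Sp (W Sp (a ++ y ++ e) u)).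
    nra.
Qed.

Lemma move_word p a y e u B :
 (forall x, lt_letters d x -> length x = (length a + length p + length y + length e - 2)%nat -> nrm Sp (W Sp x u) <= B) ->
 lt_letters d (a ++ p ++ y ++ e) ->
 exists r, W Sp (a ++ p ++ y ++ e) u = vadd (W Sp (a ++ y ++ p ++ e) u) r
  /\ nrm Sp r <= INR (length p) * INR (length y) * B.
Proof.
 revert a; induction p as [|i p IH]; intros a HB Hlt.
 - exists (vsc (RtoC 0) u). rewrite nrm_0. split; [simpl; symmetry; apply vadd_0_r|simpl; lra].
 - destruct (IH (a ++ [i])) as [r1 [Hr1 Hn1]].
  { intros x Hx Hl. apply HB; [pos|]. rewrite Hl, length_app. simpl. lia. }
  { rewrite <- app_assoc. pos. }
  rewrite <- !app_assoc in Hr1. simpl in Hr1.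
  destruct (move_letter i a y (p ++ e) u B) as [r2 [Hr2 Hn2]].
  { intros x Hx Hl. apply HB; [pos|]. rewrite Hl, !length_app. simpl. lia. }
  { unfold lt_letters in *. simpl app in Hlt.
   rewrite Forall_app, Forall_cons_iff, !Forall_app in *. tauto. }
  exists (vadd r2 r1). split.
  + simpl. rewrite Hr1, Hr2, vadd_assoc. reflexivity.
  + bound nrm_add. simpl length. rewrite S_INR. lra.
Qed.

(** Commuting an operator of order [m] past [y] takes at most [m * length y] exchanges per term.
    This growth, linear in [length y], is what the weight [(Th + T) ^ T] compensates later. *)
Lemma move_Op m F a y u B : 0 <= B ->
 (forall cw, In cw F -> lt_letters d (snd cw) /\ (length (snd cw) <= m)%nat) ->
 lt_letters d a -> lt_letters d y ->
 (forall x, lt_letters d x -> (length x + 2 <= length a + m + length y)%nat -> nrm Sp (W Sp x u) <= B) ->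
 exists r, Op Sp (preF a F) (W Sp y u) = vadd (W Sp (a ++ y) (Op Sp F u)) r
  /\ nrm Sp r <= coefsum F * (INR m * INR (length y) * B).
Proof.
 intros HB0 HF Ha Hy HB. induction F as [|[c p] F IH].
 - exists (vsc (RtoC 0) u). rewrite nrm_0. split.
  + simpl. rewrite vadd_0_r, W_sc. apply vsc_0.
  + unfold coefsum; simpl; lra.
 - destruct IH as [r1 [Hr1 Hn1]]; [intros; apply HF; simpl; auto|].
  destruct (HF (c, p)) as [Hp1 Hp2]; [pos|].
  assert (HE : exists r2, W Sp (a ++ p ++ y) u = vadd (W Sp (a ++ y ++ p) u) r2
    /\ nrm Sp r2 <= INR (length p) * INR (length y) * B).
  { destruct p as [|i p]; [exists (vsc (RtoC 0) u); rewrite nrm_0; split;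
    [simpl; rewrite app_nil_r; symmetry; apply vadd_0_r|simpl; lra]|].
   destruct y as [|j y]; [exists (vsc (RtoC 0) u); rewrite nrm_0; split;
    [rewrite app_nil_r; simpl; symmetry; apply vadd_0_r|simpl; lra]|].
   destruct (move_word (i :: p) a (j :: y) [] u B) as [r [Hr Hn]].
   - intros x Hx Hl. apply HB; [pos|]. simpl in *. lia.
   - rewrite app_nil_r. apply lt_letters_app; split; [|apply lt_letters_app]; auto.
   - exists r. rewrite !app_nil_r in Hr. pos. }
  destruct HE as [r2 [Hr2 Hn2]].
  exists (vadd (vsc c r2) r1). split.
  + change (vadd (vsc c (W Sp (a ++ p) (W Sp y u))) (Op Sp (preF a F) (W Sp y u)) =
    vadd (W Sp (a ++ y) (vadd (vsc c (W Sp p u)) (Op Sp F u))) (vadd (vsc c r2) r1)).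
   rewrite Hr1. rewrite <- W_app, <- app_assoc, Hr2.
   rewrite vsc_add, W_add, W_sc.
   replace (W Sp (a ++ y) (W Sp p u)) with (W Sp (a ++ y ++ p) u) by (rewrite !W_app; reflexivity).
   rewrite <- !vadd_assoc. f_equal. rewrite !vadd_assoc. f_equal. apply vadd_comm.
  + bound nrm_add. rewrite nrm_sc. simpl.
   rewrite Rmult_plus_distr_r. apply Rplus_le_compat; [|lra].
   scale_l. eapply Rle_trans; [exact Hn2|].
   scale_r. scale_r.
   apply le_INR, Hp2.
Qed.

(** A word shorter by [j >= 1] letters leaves room for [j] factors [Th + INR T] and saves one factor
    [A], which closes the induction. *)
Lemma eigen_weight_step (K A Th : R) (T j : nat) (k : nat) : 0 <= K -> 1 <= A -> 1 <= Th ->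
 (1 <= j)%nat -> (j + k <= T)%nat ->
 (Th + INR T) ^ j * (K * A ^ k * (Th + INR k) ^ k) <= K * A ^ (T - 1) * (Th + INR T) ^ T.
Proof.
 intros HK HA HT Hj Hjk.
 note (pos_INR T). note (pos_INR k).
 via (K * A ^ (T - 1) * ((Th + INR T) ^ j * (Th + INR T) ^ k)).
 - replace ((Th + INR T) ^ j * (K * A ^ k * (Th + INR k) ^ k))
   with (K * (A ^ k * ((Th + INR T) ^ j * (Th + INR k) ^ k))) by ring.
  rewrite Rmult_assoc. scale_l.
  apply Rmult_le_compat.
  + apply pow_le; lra.
  + apply Rmult_le_pos; apply pow_le; lra.
  + apply Rle_pow; [lra|lia].
  + scale_l. apply pow_incr. split; [lra|].
   apply Rplus_le_compat_l, le_INR. lia.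
 - apply Rmult_le_compat_l.
  + apply Rmult_le_pos; [lra|pos].
  + rewrite <- pow_add. mono.
Qed.

Variables (Pm Pl : fs) (m N : nat) (c : R) (L : list fs) (P : Sp -> Sp).
Hypothesis (HPm : homog d m Pm) (HPl : low_order d m Pl) (Hm : (2 <= m)%nat) (Hc : 0 < c).
Hypothesis (HL : forall s, In s L -> homog d (N + m) s).
Hypothesis Hid : forall z, nsq d z ^ N * (Cmod (evF z Pm) ^ 2 - c * nsq d z ^ m)
       = lsum L (fun s => Cmod (evF z s) ^ 2).
Hypothesis HP : forall u, P u = vadd (Op Sp Pm u) (Op Sp Pl u).

(** Strong induction on the length. The first [N + m] letters are removed by the elliptic estimate
    applied to [W y u], where [P (W y u)] is [lam] times [W y u] plus a commutator of about
    [m * length y] words two letters shorter; the two missing letters supply the factor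
    [(Th + T)^(-2)] that beats [(length y)^2]. *)
Theorem eigen_word_bound : exists K A, 0 <= K /\ 1 <= A /\ forall u (lam Th : R),
 P u = vsc (RtoC lam) u -> nrm2 Sp u = 1 -> 1 <= Th -> lam ^ 2 <= Th ^ m ->
 forall y, lt_letters d y ->
  nrm2 Sp (W Sp y u) <= K * A ^ length y * (Th + INR (length y)) ^ length y.
Proof.
 destruct (elliptic_estimate Sp d Pm Pl m N c L P HPm HPl Hm Hc HL Hid HP) as [M1 [HM1 H1]].
 destruct (eigen_low_orders Sp d Pm Pl m N c L P HPm HPl Hm Hc HL Hid HP) as [K [HK H2]].
 set (kw := INR (length (words d N))).
 set (cf := coefsum Pm + coefsum Pl).
 (* Chosen so that [A0 * bT] bounds the right side of the elliptic estimate: the eigenvalue part,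
    the commutators of [Pm] and [Pl], and [nrm2 (W y u)]. *)
 set (A0 := M1 * (kw * (2 + 2 * (cf * INR m) ^ 2) + 1)).
 assert (Hkw : 0 <= kw) by apply pos_INR.
 assert (HA0 : 0 <= A0).
 { apply Rmult_le_pos; [lra|]. pos. }
 set (A := 1 + A0).
 assert (HA : 1 <= A) by (unfold A; lra).
 exists K, A. split; [lra|]. split; [lra|].
 intros u lam Th Hu Hu1 HT Hlam y.
 remember (length y) as T eqn:HTe. revert y HTe.
 induction T as [T IH] using lt_wf_ind. intros z Hz Hlt.
 assert (HTT : 0 <= INR T) by apply pos_INR.
 destruct (lt_dec T (N + m)) as [Hsmall|Hbig].
 - bound (nrm2_le_N2 Sp d z u Hlt). rewrite <- Hz.
  eapply Rle_trans; [apply (H2 u lam Th Hu HT Hlam T); lia|]. rewrite Hu1, Rmult_1_r, Rmult_assoc.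
  scale_l. rewrite <- (Rmult_1_l (Th ^ T)).
  apply Rmult_le_compat; [lra|pos|apply pow_R1_Rle; lra|mono].
 - set (D := (N + m)%nat) in *. set (y := skipn D z). set (w0 := firstn D z).
  assert (Hzy : z = w0 ++ y) by (symmetry; apply firstn_skipn).
  assert (Lw : length w0 = D) by (unfold w0; rewrite length_firstn; lia).
  assert (Ly : length y = (T - D)%nat) by (unfold y; rewrite length_skipn; lia).
  assert (Hlt2 : lt_letters d w0 /\ lt_letters d y) by (apply lt_letters_app; rewrite <- Hzy; exact Hlt).
  destruct Hlt2 as [Hw0 Hy].
  (* The claimed bound with one factor [A] missing. *)
  set (bT := K * A ^ (T - 1) * (Th + INR T) ^ T).
  assert (HbT : 0 <= bT).
  { repeat apply Rmult_le_pos; [lra|pos|pos]. }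
  assert (Hstep : forall j x, lt_letters d x -> (1 <= j)%nat -> (j + length x <= T)%nat ->
    (Th + INR T) ^ j * nrm2 Sp (W Sp x u) <= bT).
  { intros j x Hx Hj Hl. eapply Rle_trans; [|apply (eigen_weight_step K A Th T j (length x)); auto].
   scale_l. apply (IH (length x)); [lia|pos|pos]. }
  set (B := sqrt (bT / (Th + INR T) ^ 2)).
  assert (HpT : 0 < (Th + INR T) ^ 2) by pos.
  assert (HB2 : 0 <= bT / (Th + INR T) ^ 2)
   by pos.
  assert (HBx : forall x, lt_letters d x -> (length x + 2 <= N + m + length y)%nat -> nrm Sp (W Sp x u) <= B).
  { intros x Hx Hl. apply sqrt_le_1_alt. apply Rmult_le_reg_l with ((Th + INR T) ^ 2); [lra|].
   replace ((Th + INR T) ^ 2 * (bT / (Th + INR T) ^ 2)) with bT by (field; lra).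
   apply Hstep; [pos|lia|]. lia. }
  assert (HBp : 0 <= B) by apply sqrt_pos.
  assert (Hterm : forall w, In w (words d N) -> nrm2 Sp (W Sp w (P (W Sp y u))) <= (2 + 2 * (cf * INR m) ^ 2) * bT).
  { intros w Hw. apply words_spec in Hw. destruct Hw as [Lww Hw].
   rewrite HP, W_add, !W_Op.
   destruct (move_Op m Pm w y u B HBp) as [r1 [E1 R1]]; auto.
   { intros cw Hin. apply HPm in Hin. triv. }
   { rewrite Lww. pos. }
   destruct (move_Op m Pl w y u B HBp) as [r2 [E2 R2]]; auto.
   { intros cw Hin. apply HPl in Hin. triv. }
   { rewrite Lww. pos. }
   rewrite E1, E2.
   replace (vadd (vadd (W Sp (w ++ y) (Op Sp Pm u)) r1) (vadd (W Sp (w ++ y) (Op Sp Pl u)) r2))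
    with (vadd (W Sp (w ++ y) (P u)) (vadd r1 r2)).
   2:{ rewrite HP, W_add. rewrite <- !vadd_assoc. f_equal. rewrite !vadd_assoc. f_equal. apply vadd_comm. }
   bound nrm2_add.
   rewrite Hu, W_sc, nrm2_sc, Cmod_R, pow2_abs.
   assert (F1 : lam ^ 2 * nrm2 Sp (W Sp (w ++ y) u) <= bT).
   { bound_by (Hstep m (w ++ y)).
    - apply Rmult_le_compat_r; [apply nrm2_pos|]. eapply Rle_trans; [exact Hlam|].
     apply pow_incr; lra.
    - apply lt_letters_app; auto.
    - lia.
    - rewrite length_app, Lww, Ly. lia. }
   assert (F2 : nrm2 Sp (vadd r1 r2) <= (cf * INR m) ^ 2 * bT).
   { rewrite <- nrm_sq. via ((cf * INR m * INR T * B) ^ 2).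
    - apply pow_incr. split; [triv|]. bound nrm_add.
     assert (G : INR m * INR (length y) * B <= INR m * INR T * B).
     { scale_r. scale_l.
      apply le_INR. lia. }
     unfold cf. note (coefsum_pos Pm). note (coefsum_pos Pl). nra.
    - replace ((cf * INR m * INR T * B) ^ 2) with ((cf * INR m) ^ 2 * (INR T ^ 2 * B ^ 2)) by ring.
     scale_l.
     unfold B. rewrite pow2_sqrt by exact HB2.
     apply Rmult_le_reg_r with ((Th + INR T) ^ 2); [lra|].
     replace (INR T ^ 2 * (bT / (Th + INR T) ^ 2) * (Th + INR T) ^ 2) with (INR T ^ 2 * bT) by (field; lra).
     rewrite (Rmult_comm bT). mono. }
   lra. }
  assert (Hy1 : nrm2 Sp (W Sp y u) <= bT).
  { bound_by (Hstep 1%nat y Hy); [|lia|lia].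
   rewrite <- (Rmult_1_l (nrm2 Sp _)) at 1.
   apply Rmult_le_compat_r; [apply nrm2_pos|lra]. }
  rewrite Hzy, W_app. bound (nrm2_le_N2 Sp d w0 _ Hw0).
  rewrite Lw. bound H1.
  via (M1 * (kw * ((2 + 2 * (cf * INR m) ^ 2) * bT) + bT)).
  + scale_l. apply Rplus_le_compat; [|lra].
   unfold kw. rewrite <- lsum_const. apply lsum_le. exact Hterm.
  + replace (M1 * (kw * ((2 + 2 * (cf * INR m) ^ 2) * bT) + bT)) with (A0 * bT) by (unfold A0; ring).
   via (A * bT); [apply Rmult_le_compat_r; [lra|unfold A; lra]|].
   right. unfold bT. replace T with (S (T - 1)) at 4 by lia. simpl pow. ring.
Qed.

End EigenBound.

(** * Positive polynomials on a cube *)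

Definition in_cube (z : nat -> R) : Prop := forall i, -1 <= z i <= 1.
Definition depends_below (d : nat) (f : (nat -> R) -> R) : Prop :=
 forall z z', (forall i, (i < d)%nat -> z i = z' i) -> f z = f z'.
Definition sep_lipschitz (d : nat) (K : R) (f : (nat -> R) -> R) : Prop :=
 forall i s z, (i < d)%nat -> in_cube z -> -1 <= s <= 1 -> Rabs (f (upd z i s) - f z) <= K * Rabs (s - z i).

Lemma upd_same x k s : upd x k s k = s.
Proof. unfold upd. rewrite Nat.eqb_refl. lra. Qed.

Lemma upd_other x k s j : j <> k -> upd x k s j = x j.
Proof. intros H. unfold upd. apply Nat.eqb_neq in H. rewrite H. lra. Qed.

Lemma in_cube_upd z i s : in_cube z -> -1 <= s <= 1 -> in_cube (upd z i s).
Proof.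
 intros Hz Hs j. unfold upd. destruct (Nat.eqb j i); auto.
Qed.

(** Extending [h] by its end values makes it continuous at -1 and 1 too, as the extreme value
    theorem requires. *)
Lemma clamp_lipschitz_continuous K (h : R -> R) :
 (forall s s', -1 <= s <= 1 -> -1 <= s' <= 1 -> Rabs (h s' - h s) <= K * Rabs (s' - s)) ->
 forall x, continuity_pt (fun s => h (Rmax (-1) (Rmin 1 s))) x.
Proof.
 intros H x. set (cl := fun s => Rmax (-1) (Rmin 1 s)).
 assert (Hcl : forall s, -1 <= cl s <= 1).
 { intros s. unfold cl, Rmax, Rmin. destruct (Rle_dec 1 s), (Rle_dec _ _); lra. }
 assert (Hl : forall s s', Rabs (cl s' - cl s) <= Rabs (s' - s)).
 { intros s s'. unfold cl, Rmax, Rmin, Rabs.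
  destruct (Rle_dec 1 s), (Rle_dec 1 s'); repeat destruct (Rle_dec _ _);
   repeat destruct (Rcase_abs _); lra. }
 intros eps He. exists (eps / (Rabs K + 1)).
 note (Rabs_pos K). split; [apply Rdiv_lt_0_compat; lra|].
 intros y [_ Hy]. simpl in *. unfold Rdist in *.
 eapply Rle_lt_trans; [apply H; apply Hcl|].
 apply Rle_lt_trans with (Rabs K * Rabs (y - x)).
 - apply Rmult_le_compat; try apply Rabs_pos || apply Rle_abs || apply Hl.

  specialize (H 0 1 ltac:(lra) ltac:(lra)). replace (1 - 0) with 1 in H by ring.
  rewrite Rabs_R1 in H. note (Rabs_pos (h 1 - h 0)). lra.
 - apply Rlt_le_trans with ((Rabs K + 1) * (eps / (Rabs K + 1))).
  + note (Rabs_pos (y - x)). nra.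
  + right. field. lra.
Qed.

(** Compactness by induction on the dimension: the minimum over the last variable is attained, hence
    positive, and inherits the Lipschitz constant [K], so it is a function of the same kind in one
    variable less. *)
Lemma cube_positive_bound d : forall (f : (nat -> R) -> R) K,
 depends_below d f -> sep_lipschitz d K f -> (forall z, in_cube z -> 0 < f z) ->
 exists c, 0 < c /\ forall z, in_cube z -> c <= f z.
Proof.
 induction d; intros f K Hdep Hlip Hpos.
 - exists (f (fun _ => 0)). assert (H0 : in_cube (fun _ => 0)) by triv.
  split; [pos|]. right. apply Hdep. intros; lia.
 - assert (Hmin : forall z, exists v, in_cube z ->
    (forall s, -1 <= s <= 1 -> v <= f (upd z d s)) /\ exists s, -1 <= s <= 1 /\ v = f (upd z d s)).
  { intros z. destruct (classic (in_cube z)) as [Hz|Hz]; [|exists 0; tauto].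
   assert (Hc : forall s s', -1 <= s <= 1 -> -1 <= s' <= 1 ->
     Rabs (f (upd z d s') - f (upd z d s)) <= K * Rabs (s' - s)).
   { intros s s' Hs Hs'. note (Hlip d s' (upd z d s) ltac:(lia) (in_cube_upd _ _ _ Hz Hs) Hs') as E.
    rewrite upd_same in E. replace (upd (upd z d s) d s') with (upd z d s') in E; [lra|].
    fext j.
    unfold upd. destruct (Nat.eqb j d); reflexivity. }
   destruct (continuity_ab_min (fun s => f (upd z d (Rmax (-1) (Rmin 1 s)))) (-1) 1) as [s0 [H1 H2]]; [lra| |].
   { intros c _. apply (clamp_lipschitz_continuous K (fun s => f (upd z d s)) Hc). }
   assert (Hcl : forall s, -1 <= s <= 1 -> Rmax (-1) (Rmin 1 s) = s).
   { intros s Hs. rewrite Rmin_right, Rmax_right; lra. }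
   exists (f (upd z d s0)). split; [|triv].
   intros s Hs. specialize (H1 s Hs). rewrite !Hcl in H1; auto. }
  destruct (choice _ Hmin) as [g Hg].
  (* [g] is specified on the cube only; composing it with the coordinatewise projection onto the
     cube gives a total function for the induction hypothesis. *)
  assert (Hcl : exists cl : (nat -> R) -> nat -> R, (forall z, in_cube (cl z)) /\ (forall z, in_cube z -> cl z = z)
    /\ (forall z z', (forall i, (i < d)%nat -> z i = z' i) -> forall i, (i < d)%nat -> cl z i = cl z' i)).
  { exists (fun z i => Rmax (-1) (Rmin 1 (z i))). repeat split.
   - apply Rmax_l.
   - apply Rmax_lub; [lra|apply Rmin_l].
   - intros z Hz. fext i.
    specialize (Hz i). rewrite Rmin_right, Rmax_right; lra.
   - intros z z' H i Hi. rewrite (H i Hi). lra. }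
  destruct Hcl as [cl [Hcl1 [Hcl2 Hcl3]]].
  assert (Hgle : forall z z', in_cube z -> in_cube z' -> forall B,
    (forall s, -1 <= s <= 1 -> f (upd z d s) <= f (upd z' d s) + B) -> g z <= g z' + B).
  { intros z z' Hz Hz' B H. destruct (Hg z' Hz') as [_ [s [Hs ->]]].
   destruct (Hg z Hz) as [H1 _]. specialize (H1 s Hs). specialize (H s Hs). lra. }
  destruct (IHd (fun z => g (cl z)) K) as [c [Hc H]].
  + intros z z' H.
   assert (E : forall s, f (upd (cl z) d s) = f (upd (cl z') d s)).
   { intros s. apply Hdep. intros i Hi. unfold upd. destruct (Nat.eqb_spec i d); [lra|].
    apply Hcl3; [pos|lia]. }
   assert (G1 : g (cl z) <= g (cl z') + 0) by (apply Hgle; auto; intros; rewrite E; lra).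
   assert (G2 : g (cl z') <= g (cl z) + 0) by (apply Hgle; auto; intros; rewrite E; lra).
   lra.
  + intros i s z Hi Hz Hs. assert (Hz' := in_cube_upd z i s Hz Hs).
   rewrite !Hcl2 by assumption.
   assert (E : forall r, -1 <= r <= 1 -> Rabs (f (upd (upd z i s) d r) - f (upd z d r)) <= K * Rabs (s - z i)).
   { intros r Hr. replace (upd (upd z i s) d r) with (upd (upd z d r) i s).
    - note (Hlip i s (upd z d r) ltac:(lia) (in_cube_upd _ _ _ Hz Hr) Hs) as E.
     rewrite (upd_other z d r i) in E by lia. exact E.
    - fext j. unfold upd.
     destruct (Nat.eqb_spec j i), (Nat.eqb_spec j d); subst; try reflexivity; lia. }
   apply Rabs_le_between. split.
   * enough (g z <= g (upd z i s) + K * Rabs (s - z i)) by lra.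
    apply Hgle; auto. intros r Hr. specialize (E r Hr). apply Rabs_le_between in E. lra.
   * enough (g (upd z i s) <= g z + K * Rabs (s - z i)) by lra.
    apply Hgle; auto. intros r Hr. specialize (E r Hr). apply Rabs_le_between in E. lra.
  + intros z _. destruct (Hg (cl z) (Hcl1 z)) as [_ [s [Hs ->]]]. apply Hpos, in_cube_upd; auto.
  + exists c. split; [lra|]. intros z Hz. specialize (H z Hz). rewrite Hcl2 in H by exact Hz.
   destruct (Hg z Hz) as [H1 _]. specialize (H1 (z d) (Hz d)).
   replace (upd z d (z d)) with z in H1; [lra|].
   fext j. unfold upd.
   destruct (Nat.eqb_spec j d); subst; reflexivity.
Qed.

Definition evR (Q : list (R * list nat)) (z : nat -> R) : R := lsum Q (fun cw => fst cw * ev z (snd cw)).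

Lemma ev_cube_le z w : in_cube z -> Rabs (ev z w) <= 1.
Proof.
 intros Hz. induction w; simpl; [rewrite Rabs_R1; lra|]. rewrite Rabs_mult.
 note (Hz a). assert (Rabs (z a) <= 1) by (apply Rabs_le; lra).
 note (Rabs_pos (z a)). nra.
Qed.

Lemma ev_lipschitz i s z w : in_cube z -> -1 <= s <= 1 ->
 Rabs (ev (upd z i s) w - ev z w) <= INR (length w) * Rabs (s - z i).
Proof.
 intros Hz Hs. induction w as [|j w IH]; [simpl; rewrite Rminus_diag, Rabs_R0; lra|].
 simpl ev. simpl length. rewrite S_INR.
 replace (upd z i s j * ev (upd z i s) w - z j * ev z w) with
  (upd z i s j * (ev (upd z i s) w - ev z w) + (upd z i s j - z j) * ev z w) by ring.
 bound Rabs_triang. rewrite !Rabs_mult.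
 note (ev_cube_le z w Hz) as H1. note (in_cube_upd z i s Hz Hs j) as H2.
 assert (H3 : Rabs (upd z i s j) <= 1) by (apply Rabs_le; lra).
 assert (H4 : Rabs (upd z i s j - z j) <= Rabs (s - z i)).
 { unfold upd. destruct (Nat.eqb_spec j i); subst; [lra|]. rewrite Rminus_diag, Rabs_R0. pos. }
 note (Rabs_pos (upd z i s j - z j)). note (Rabs_pos (ev (upd z i s) w - ev z w)). nra.
Qed.

Lemma evR_lipschitz d Q : exists K, sep_lipschitz d K (evR Q).
Proof.
 exists (lsum Q (fun cw => Rabs (fst cw) * INR (length (snd cw)))).
 intros i s z Hi Hz Hs. unfold evR.
 replace (lsum Q (fun cw => fst cw * ev (upd z i s) (snd cw)) - lsum Q (fun cw => fst cw * ev z (snd cw)))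
  with (lsum Q (fun cw => fst cw * (ev (upd z i s) (snd cw) - ev z (snd cw)))).
 - bound lsum_abs. rewrite Rmult_comm, <- lsum_scal. apply lsum_le. intros cw _.
  rewrite Rabs_mult. note (ev_lipschitz i s z (snd cw) Hz Hs). note (Rabs_pos (fst cw)). nra.
 - rewrite (lsum_ext Q _ (fun cw => fst cw * ev (upd z i s) (snd cw) + (-1) * (fst cw * ev z (snd cw))))
   by triv.
  rewrite lsum_plus, lsum_scal. ring.
Qed.

Lemma evR_depends d Q : (forall cw, In cw Q -> lt_letters d (snd cw)) -> depends_below d (evR Q).
Proof.
 intros H z z' Hz. apply lsum_ext. intros cw Hin. f_equal. apply ev_ext.
 specialize (H cw Hin). unfold lt_letters in H. rewrite Forall_forall in H. auto.
Qed.

(** * Bernstein coefficients *)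

(** The coefficient of [binom L j * u^j * v^(L - j)] in [(u - v)^a (u + v)^(L - a)]; multiplication
    by [u - v] gives the recursion. For [u + v = 1] these are the Bernstein coefficients of [x^a]
    with [x = u - v]. *)
Fixpoint bern (a L j : nat) : R :=
 match a with
 | O => 1
 | S a' => INR j / INR L * bern a' (L - 1) (j - 1) - (INR L - INR j) / INR L * bern a' (L - 1) j
 end.

(** The recursion takes, up to sign, a convex combination with weights [j / L] and [(L - j) / L]. *)
Lemma bern_le a : forall L j, (a <= L)%nat -> (j <= L)%nat -> Rabs (bern a L j) <= 1.
Proof.
 induction a; intros L j Ha Hj; [simpl; rewrite Rabs_R1; lra|].
 simpl. assert (HL : 0 < INR L) by (apply lt_0_INR; lia).
 assert (HjL : INR j <= INR L) by (apply le_INR; exact Hj). note (pos_INR j).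
 assert (H1 : INR j / INR L * Rabs (bern a (L - 1) (j - 1)) <= INR j / INR L).
 { rewrite <- (Rmult_1_r (INR j / INR L)) at 2. apply Rmult_le_compat_l.
  - apply Rmult_le_pos; [lra|pos].
  - apply IHa; lia. }
 assert (H2 : (INR L - INR j) / INR L * Rabs (bern a (L - 1) j) <= (INR L - INR j) / INR L).
 { destruct (Nat.eq_dec j L) as [->|].
  - lra.
  - rewrite <- (Rmult_1_r ((INR L - INR j) / INR L)) at 2. apply Rmult_le_compat_l.
   + apply Rmult_le_pos; [lra|pos].
   + apply IHa; lia. }
 bound Rabs_triang. rewrite Rabs_Ropp, !Rabs_mult.
 rewrite (Rabs_pos_eq (INR j / INR L)) by pos.
 rewrite (Rabs_pos_eq ((INR L - INR j) / INR L)) by pos.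
 replace 1 with (INR j / INR L + (INR L - INR j) / INR L) by (field; lra). lra.
Qed.

Lemma pow_lipschitz a : forall x y, Rabs x <= 1 -> Rabs y <= 1 -> Rabs (x ^ a - y ^ a) <= INR a * Rabs (x - y).
Proof.
 induction a; intros x y Hx Hy; [simpl; rewrite Rminus_diag, Rabs_R0; lra|].
 rewrite S_INR. simpl. replace (x * x ^ a - y * y ^ a) with (x * (x ^ a - y ^ a) + (x - y) * y ^ a) by ring.
 bound Rabs_triang. rewrite !Rabs_mult. specialize (IHa x y Hx Hy).
 assert (Rabs (y ^ a) <= 1).
 { rewrite <- RPow_abs. rewrite <- (pow1 a). mono. }
 note (Rabs_pos (x ^ a - y ^ a)). note (Rabs_pos (x - y)).
 nra.
Qed.

(** The recursion amounts to multiplication by the node value [2 j / L - 1], except that the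
    previous coefficients live on the grid of degree [L - 1], whose nodes differ by at most
    [2 / (L - 1)]. Accumulating these shifts gives [O(1 / L)]. *)
Lemma bern_approx a : forall L j, (a < L)%nat -> (j <= L)%nat ->
 Rabs (bern a L j - (2 * INR j / INR L - 1) ^ a) <= 2 * INR a ^ 2 / (INR L - INR a).
Proof.
 induction a; intros L j Ha Hj; [simpl; rewrite Rminus_diag, Rabs_R0; unfold Rdiv; rewrite !Rmult_0_l, Rmult_0_r, Rmult_0_l; lra|].
 assert (HaL : INR (S a) < INR L) by (apply lt_INR; lia).
 rewrite S_INR in HaL |- *. note (pos_INR a) as Ha0. note (pos_INR j) as Hj0.
 assert (HjL : INR j <= INR L) by (apply le_INR; exact Hj).
 set (y := 2 * INR j / INR L - 1).
 assert (EL : INR (L - 1) = INR L - 1) by (rewrite minus_INR by lia; reflexivity).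
 assert (Hy : Rabs y <= 1).
 { apply Rabs_le. unfold y. split.
  - assert (0 <= 2 * INR j / INR L) by pos. lra.
  - apply Rmult_le_reg_r with (INR L); [lra|]. field_simplify; lra. }
 set (E := 2 * INR a ^ 2 / (INR L - 1 - INR a) + INR a * (2 / (INR L - 1))).
 assert (Hsub : forall i yi, (i <= L - 1)%nat -> yi = 2 * INR i / INR (L - 1) - 1 -> Rabs (yi - y) <= 2 / (INR L - 1) ->
   Rabs (bern a (L - 1) i - y ^ a) <= E).
 { intros i yi Hi Hyi Hd. specialize (IHa (L - 1)%nat i ltac:(lia) Hi). rewrite <- Hyi in IHa. rewrite EL in IHa.
  replace (bern a (L - 1) i - y ^ a) with ((bern a (L - 1) i - yi ^ a) + (yi ^ a - y ^ a)) by ring.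
  bound Rabs_triang. apply Rplus_le_compat; [lra|].
  eapply Rle_trans; [apply pow_lipschitz; [|lra]|mono].
  apply Rabs_le. rewrite Hyi, EL.
  assert (INR i <= INR L - 1) by (rewrite <- EL; apply le_INR; exact Hi). split.
  - assert (0 <= 2 * INR i / (INR L - 1)) by pos. lra.
  - apply Rmult_le_reg_r with (INR L - 1); [lra|]. field_simplify; lra. }
 assert (H1 : INR j / INR L * Rabs (bern a (L - 1) (j - 1) - y ^ a) <= INR j / INR L * E).
 { destruct j as [|j'].
  - simpl (INR 0). lra.
  - scale_l.
   apply (Hsub (S j' - 1)%nat _ ltac:(lia) eq_refl). unfold y. rewrite EL.
   replace (S j' - 1)%nat with j' by lia. rewrite S_INR in *.
   replace (2 * INR j' / (INR L - 1) - 1 - (2 * (INR j' + 1) / INR L - 1))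
    with (- (2 / (INR L - 1) * ((INR L - (INR j' + 1)) / INR L))) by (field; lra).
   rewrite Rabs_Ropp, Rabs_mult. rewrite (Rabs_pos_eq (2 / (INR L - 1))) by pos.
   rewrite <- (Rmult_1_r (2 / (INR L - 1))) at 2. scale_l.
   rewrite Rabs_pos_eq by pos.
   apply Rmult_le_reg_r with (INR L); [lra|]. field_simplify; lra. }
 assert (H2 : (INR L - INR j) / INR L * Rabs (bern a (L - 1) j - y ^ a) <= (INR L - INR j) / INR L * E).
 { destruct (Nat.eq_dec j L) as [->|Hne].
  - lra.
  - scale_l.
   apply (Hsub j _ ltac:(lia) eq_refl). unfold y. rewrite EL.
   replace (2 * INR j / (INR L - 1) - 1 - (2 * INR j / INR L - 1))
    with (2 / (INR L - 1) * (INR j / INR L)) by (field; lra).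
   rewrite Rabs_mult. rewrite (Rabs_pos_eq (2 / (INR L - 1))) by pos.
   rewrite <- (Rmult_1_r (2 / (INR L - 1))) at 2. scale_l.
   rewrite Rabs_pos_eq by pos.
   apply Rmult_le_reg_r with (INR L); [lra|]. field_simplify; lra. }
 via E.
 - simpl bern. replace (INR j / INR L * bern a (L - 1) (j - 1) - (INR L - INR j) / INR L * bern a (L - 1) j - y ^ S a)
   with (INR j / INR L * (bern a (L - 1) (j - 1) - y ^ a) + - ((INR L - INR j) / INR L * (bern a (L - 1) j - y ^ a))).
  + bound Rabs_triang. rewrite Rabs_Ropp, !Rabs_mult.
   rewrite (Rabs_pos_eq (INR j / INR L)) by pos.
   rewrite (Rabs_pos_eq ((INR L - INR j) / INR L)) by pos.
   replace E with (INR j / INR L * E + (INR L - INR j) / INR L * E) by (field; lra). lra.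
  + simpl. unfold y. field. lra.
 - unfold E.
  assert (G : INR a * (2 / (INR L - 1)) <= (2 * INR a) / (INR L - (INR a + 1))).
  { replace (INR a * (2 / (INR L - 1))) with ((2 * INR a) * / (INR L - 1)) by lra.
   scale_l. apply Rinv_le_contravar; lra. }
  replace (INR L - 1 - INR a) with (INR L - (INR a + 1)) by ring.
  via ((2 * INR a ^ 2 + 2 * INR a) / (INR L - (INR a + 1))).
  + lra.
  + scale_r. nra.
Qed.

Definition binom (n k : nat) : R := Binomial.C n k.

Lemma lsum_seq_S (f : nat -> R) n : lsum (seq 0 (S n)) f = lsum (seq 0 n) f + f n.
Proof. rewrite seq_S, lsum_app. simpl. ring. Qed.

Lemma lsum_seq_shift (f : nat -> R) n : lsum (seq 0 (S n)) f = f O + lsum (seq 0 n) (fun j => f (S j)).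
Proof. simpl. rewrite <- seq_shift, lsum_map. lra. Qed.

Lemma lsum_sum_f_R0 (f : nat -> R) n : lsum (seq 0 (S n)) f = sum_f_R0 f n.
Proof. induction n; [simpl; ring|]. rewrite lsum_seq_S, IHn. pos. Qed.

Lemma binom_pos n k : 0 <= binom n k.
Proof.
 unfold binom, Binomial.C. pos.
Qed.

Lemma binom_up n j : (j <= n)%nat -> INR (S j) / INR (S n) * binom (S n) (S j) = binom n j.
Proof.
 intros H. unfold binom, Binomial.C. replace (S n - S j)%nat with (n - j)%nat by lia.
 rewrite !fact_simpl, !mult_INR. field.
 repeat split; try apply INR_fact_neq_0; apply not_0_INR; lia.
Qed.

Lemma binom_same n j : (j <= n)%nat -> (INR (S n) - INR j) / INR (S n) * binom (S n) j = binom n j.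
Proof.
 intros H. unfold binom, Binomial.C. replace (S n - j)%nat with (S (n - j)) by lia.
 rewrite !fact_simpl, !mult_INR. rewrite (S_INR (n - j)), minus_INR, (S_INR n) by lia. field.
 repeat split; try apply INR_fact_neq_0; rewrite <- ?S_INR; try (apply not_0_INR; lia).
 assert (INR j <= INR n) by (apply le_INR; lia). lra.
Qed.

(** Multiplying the expansion for [a] at degree [L - 1] by [u - v] and regrouping binomial
    coefficients reproduces the recursion of [bern]. *)
Lemma bern_expansion a : forall L u v, (a <= L)%nat ->
 lsum (seq 0 (S L)) (fun j => binom L j * bern a L j * (u ^ j * v ^ (L - j))) = (u - v) ^ a * (u + v) ^ (L - a).
Proof.
 induction a; intros L u v HaL.
 - rewrite Rmult_1_l, Nat.sub_0_r, (binomial u v L), lsum_sum_f_R0.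
  apply sum_eq; intros; simpl. unfold binom. ring.
 - destruct L as [|n]; [lia|].
  rewrite (lsum_ext _ _ (fun j => INR j / INR (S n) * binom (S n) j * bern a n (j - 1) * (u ^ j * v ^ (S n - j))
   + (-1) * ((INR (S n) - INR j) / INR (S n) * binom (S n) j * bern a n j * (u ^ j * v ^ (S n - j))))).
  2:{ intros j _. cbn [bern]. replace (S n - 1)%nat with n by lia. ring. }
  rewrite lsum_plus, lsum_scal.
  rewrite (lsum_seq_shift (fun j => INR j / INR (S n) * _ * _ * _)).
  rewrite (lsum_seq_S (fun j => (INR (S n) - INR j) / INR (S n) * _ * _ * _)).
  rewrite (lsum_ext _ (fun j => INR (S j) / INR (S n) * binom (S n) (S j) * bern a n (S j - 1) * (u ^ S j * v ^ (S n - S j)))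
    (fun j => u * (binom n j * bern a n j * (u ^ j * v ^ (n - j))))).
  2:{ intros j Hj. apply in_seq in Hj. rewrite binom_up by lia.
    replace (S j - 1)%nat with j by lia. simpl. ring. }
  rewrite (lsum_ext _ (fun j => (INR (S n) - INR j) / INR (S n) * binom (S n) j * bern a n j * (u ^ j * v ^ (S n - j)))
    (fun j => v * (binom n j * bern a n j * (u ^ j * v ^ (n - j))))).
  2:{ intros j Hj. apply in_seq in Hj. rewrite binom_same by lia.
    replace (S n - j)%nat with (S (n - j)) by lia. simpl. ring. }
  rewrite !lsum_scal, IHa by lia. unfold Rdiv.
  simpl. ring.
Qed.

(** Entries are numbered from the end of the word. *)
Fixpoint prodw (F : nat -> nat -> R) (w : list nat) : R :=
 match w with [] => 1 | j :: t => prodw F t * F (length t) j end.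

Lemma prodR_ext n F G : (forall i, (i < n)%nat -> F i = G i) -> prodR n F = prodR n G.
Proof. induction n; simpl; intros H; [lra|]. rewrite IHn, H; auto. Qed.

Lemma prodR_one n F : (forall i, (i < n)%nat -> F i = 1) -> prodR n F = 1.
Proof. induction n; simpl; intros H; [lra|]. rewrite IHn, H; auto; ring. Qed.

(** Distributivity: a word of length [d] over [n] letters selects one term from each of the [d]
    factors. *)
Lemma words_prodw n d F : lsum (words n d) (prodw F) = prodR d (fun i => lsum (seq 0 n) (F i)).
Proof.
 induction d; [simpl; ring|]. rewrite words_S. simpl prodR. rewrite <- IHd.
 rewrite Rmult_comm, <- lsum_scal. apply lsum_ext. intros w Hw.
 apply words_spec in Hw. destruct Hw as [Hw _]. simpl. rewrite Hw.
 rewrite lsum_scal. ring.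
Qed.

Lemma prodw_mult F G w : prodw (fun i j => F i j * G i j) w = prodw F w * prodw G w.
Proof. induction w; simpl; [ring|nra]. Qed.

Lemma prodw_nonneg F w : (forall i j, In j w -> 0 <= F i j) -> 0 <= prodw F w.
Proof.
 induction w; simpl; intros H; [lra|]. pos.
Qed.

Lemma prodw_abs_le F w : (forall i j, (i < length w)%nat -> In j w -> Rabs (F i j) <= 1) -> Rabs (prodw F w) <= 1.
Proof.
 induction w as [|j w IH]; simpl; intros H; [rewrite Rabs_R1; lra|]. rewrite Rabs_mult.
 assert (H1 : Rabs (prodw F w) <= 1) by pos.
 assert (H2 : Rabs (F (length w) j) <= 1) by pos.
 note (Rabs_pos (prodw F w)). nra.
Qed.

Lemma prodw_approx F G e w :
 (forall i j, (i < length w)%nat -> In j w -> Rabs (F i j) <= 1 /\ Rabs (G i j) <= 1 /\ Rabs (F i j - G i j) <= e) ->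
 Rabs (prodw F w - prodw G w) <= INR (length w) * e.
Proof.
 induction w as [|j w IH]; intros H; [simpl; rewrite Rminus_diag, Rabs_R0; lra|].
 cbn [prodw length]. rewrite S_INR.
 replace (prodw F w * F (length w) j - prodw G w * G (length w) j)
  with ((prodw F w - prodw G w) * F (length w) j + prodw G w * (F (length w) j - G (length w) j)) by ring.
 bound Rabs_triang. rewrite !Rabs_mult.
 assert (H1 : Rabs (prodw F w - prodw G w) <= INR (length w) * e)
  by (apply IH; intros; apply H; simpl; auto).
 assert (H2 : Rabs (prodw G w) <= 1) by (apply prodw_abs_le; intros; apply H; simpl; auto).
 destruct (H (length w) j) as [H3 [H4 H5]]; simpl; auto.
 note (Rabs_pos (prodw F w - prodw G w)).
 note (Rabs_pos (F (length w) j - G (length w) j)). nra.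
Qed.

Lemma ev_counts d : forall z w, lt_letters d w -> ev z w = prodR d (fun i => z i ^ count_occ Nat.eq_dec w i).
Proof.
 induction d; intros z w Hw.
 - destruct w; [pos|inversion Hw; lia].
 - rewrite (ev_remove z d w), (IHd z (remove Nat.eq_dec d w)).
  + simpl. rewrite Rmult_comm. f_equal. apply prodR_ext. intros i Hi.
   rewrite count_remove_other by lia. reflexivity.
  + unfold lt_letters in *. rewrite Forall_forall in *. intros i Hi. apply in_remove in Hi.
   destruct Hi as [Hi Hn]. apply Hw in Hi. lia.
Qed.

Fixpoint grid_point (L : nat) (w : list nat) : nat -> R :=
 match w with [] => fun _ => 0 | j :: t => upd (grid_point L t) (length t) (2 * INR j / INR L - 1) end.

Lemma grid_node_le L j : (1 <= L)%nat -> (j <= L)%nat -> -1 <= 2 * INR j / INR L - 1 <= 1.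
Proof.
 intros HL Hj. assert (0 < INR L) by (apply lt_0_INR; lia).
 assert (INR j <= INR L) by (apply le_INR; exact Hj). split.
 - assert (0 <= 2 * INR j / INR L) by pos. lra.
 - apply Rmult_le_reg_r with (INR L); [lra|]. field_simplify; lra.
Qed.

Lemma grid_point_cube L w : (1 <= L)%nat -> lt_letters (S L) w -> in_cube (grid_point L w).
Proof.
 intros HL. induction 1; simpl; [triv|]. apply in_cube_upd; [pos|].
 apply grid_node_le; lia.
Qed.

Lemma prodw_grid L (a : nat -> nat) w :
 prodw (fun i j => (2 * INR j / INR L - 1) ^ a i) w = prodR (length w) (fun i => grid_point L w i ^ a i).
Proof.
 induction w as [|j w IH]; [pos|].
 cbn [prodw length prodR grid_point]. rewrite IH, upd_same. f_equal. apply prodR_ext. intros i Hi.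
 rewrite upd_other by lia. lra.
Qed.

Lemma count_le_length (w : list nat) i : (count_occ Nat.eq_dec w i <= length w)%nat.
Proof. apply count_occ_bound. Qed.

(** In large degree every Bernstein coefficient is close to the value of the polynomial at a grid
    node, and the margin [c] keeps it nonnegative. [L1] lets the degree be raised further on
    demand. *)
Lemma bernstein_positive d (Q : list (R * list nat)) c :
 (forall cw, In cw Q -> lt_letters d (snd cw)) -> 0 < c ->
 (forall z, in_cube z -> c <= evR Q z) ->
 forall L1, exists L, (L1 <= L)%nat /\ exists co : list nat -> R, (forall w, In w (words (S L) d) -> 0 <= co w) /\
 forall u v, (forall i, u i + v i = 1) ->
  evR Q (fun i => u i - v i) = lsum (words (S L) d) (fun w => co w * prodw (fun i j => u i ^ j * v i ^ (L - j)) w).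
Proof.
 intros HQ Hc Hpos L1.
 assert (HM : exists M, forall cw, In cw Q -> (length (snd cw) <= M)%nat).
 { clear. induction Q as [|a Q [M HM]]; [exists O; intros ? []|].
  exists (Nat.max (length (snd a)) M). intros cw [<-|H]; [lia|apply HM in H; lia]. }
 destruct HM as [M HM].
 set (cs := lsum Q (fun cw => Rabs (fst cw))).
 assert (Hcs : 0 <= cs) by (apply lsum_nonneg; intros; apply Rabs_pos).
 (* The error over all monomials and all [d] factors is at most [cs * (INR d * e)], which must not
    exceed [c]. *)
 set (e := c / (cs * INR d + 1)).
 assert (Hden : 0 < cs * INR d + 1) by (note (pos_INR d); assert (0 <= cs * INR d) by pos; lra).
 assert (He : 0 < e) by (apply Rdiv_lt_0_compat; assumption).
 destruct (nfloor_ex (2 * INR M ^ 2 / e)) as [n0 [_ Hn0]].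
 { pos. }
 (* [n0 + 1] exceeds [2 M^2 / e] and [L - M] is at least [n0 + 1], so [bern_approx] is accurate to
    [e]. *)
 set (L := (M + n0 + 1 + L1)%nat). exists L. split; [lia|].
 set (bb := fun (w : list nat) (i j : nat) => bern (count_occ Nat.eq_dec w i) L j).
 exists (fun b => prodw (fun _ j => binom L j) b * lsum Q (fun cw => fst cw * prodw (bb (snd cw)) b)).
 split.
 - intros b Hb. apply words_spec in Hb. destruct Hb as [Lb Hb].
  assert (Hj : forall j, In j b -> (j <= L)%nat).
  { intros j Hj. unfold lt_letters in Hb. rewrite Forall_forall in Hb. apply Hb in Hj. lia. }
  apply Rmult_le_pos; [apply prodw_nonneg; intros; apply binom_pos|].
  note (Hpos (grid_point L b) (grid_point_cube L b ltac:(unfold L; lia) Hb)) as H0.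
  assert (E : Rabs (lsum Q (fun cw => fst cw * prodw (bb (snd cw)) b) - evR Q (grid_point L b)) <= cs * (INR d * e)).
  { unfold evR. replace (lsum Q (fun cw => fst cw * prodw (bb (snd cw)) b) - lsum Q (fun cw => fst cw * ev (grid_point L b) (snd cw)))
    with (lsum Q (fun cw => fst cw * (prodw (bb (snd cw)) b - ev (grid_point L b) (snd cw)))).
   2:{ rewrite (lsum_ext Q _ (fun cw => fst cw * prodw (bb (snd cw)) b + (-1) * (fst cw * ev (grid_point L b) (snd cw)))) by triv.
     rewrite lsum_plus, lsum_scal. ring. }
   bound lsum_abs. unfold cs. rewrite Rmult_comm, <- lsum_scal. apply lsum_le. intros cw Hin.
   rewrite Rabs_mult, Rmult_comm. scale_r.
   rewrite (ev_counts d) by pos. rewrite <- Lb, <- prodw_grid. apply prodw_approx.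
   intros i j Hi Hin2. apply Hj in Hin2.
   note (count_le_length (snd cw) i) as Hci. note (HM cw Hin) as HMc.
   set (a := count_occ Nat.eq_dec (snd cw) i) in *.
   split; [apply bern_le; unfold L in *; lia|]. split.
   - rewrite <- RPow_abs. via (1 ^ a); [|rewrite pow1; lra].
    apply pow_incr. split; [pos|].
    apply Rabs_le. apply grid_node_le; unfold L in *; lia.
   - eapply Rle_trans; [apply bern_approx; unfold L in *; lia|].
    assert (Ha : INR a <= INR M) by (apply le_INR; lia). note (pos_INR a).
    assert (HLM : INR n0 + 1 <= INR L - INR M).
    { unfold L. rewrite !plus_INR. note (pos_INR L1). simpl (INR 1). lra. }
    note (pos_INR n0).
    via (2 * INR M ^ 2 / (INR n0 + 1)).
    + apply Rmult_le_compat.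
     * note (pow2_ge_0 (INR a)); lra.
     * left; apply Rinv_0_lt_compat; lra.
     * scale_l. apply pow_incr; lra.
     * apply Rinv_le_contravar; lra.
    + apply Rmult_le_reg_r with (INR n0 + 1); [lra|].
     replace (2 * INR M ^ 2 / (INR n0 + 1) * (INR n0 + 1)) with (2 * INR M ^ 2) by (field; lra).
     apply Rmult_le_reg_r with (/ e); [pos|].
     replace (e * (INR n0 + 1) * / e) with (INR n0 + 1) by (field; lra). lra. }
  assert (cs * (INR d * e) <= c).
  { unfold e. apply Rmult_le_reg_r with (cs * INR d + 1); [lra|]. field_simplify; [|lra]. lra. }
  apply Rabs_le_between in E. lra.
 - intros u v Huv.
  assert (E : forall cw, In cw Q -> ev (fun i => u i - v i) (snd cw) =
    lsum (words (S L) d) (fun w => prodw (fun _ j => binom L j) w * prodw (bb (snd cw)) w * prodw (fun i j => u i ^ j * v i ^ (L - j)) w)).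
  { intros cw Hin. rewrite (ev_counts d) by pos.
   rewrite (lsum_ext _ _ (prodw (fun i j => binom L j * bb (snd cw) i j * (u i ^ j * v i ^ (L - j))))).
   2:{ intros w _. rewrite (prodw_mult (fun i j => binom L j * bb (snd cw) i j)).
     rewrite (prodw_mult (fun _ j => binom L j)). lra. }
   rewrite words_prodw. apply prodR_ext. intros i Hi. unfold bb. rewrite bern_expansion.
   - rewrite Huv, pow1, Rmult_1_r. reflexivity.
   - note (count_le_length (snd cw) i). note (HM cw Hin). lia. }
  unfold evR.
  rewrite (lsum_ext Q _ (fun cw => lsum (words (S L) d) (fun w => fst cw *
    (prodw (fun _ j => binom L j) w * prodw (bb (snd cw)) w * prodw (fun i j => u i ^ j * v i ^ (L - j)) w)))).
  2:{ intros cw Hin. rewrite E by exact Hin. rewrite lsum_scal. lra. }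
  rewrite lsum_swap. apply lsum_ext. intros w _.
  rewrite Rmult_assoc, (Rmult_comm (lsum Q _)), <- Rmult_assoc, <- lsum_scal.
  apply lsum_ext. triv.
Qed.

(** * Sums of squares of [f + rho g], [rho] the Euclidean norm *)

Definition rho (d : nat) (z : nat -> R) : R := sqrt (nsq d z).

Lemma nsq_pos d z : 0 <= nsq d z.
Proof. apply lsum_nonneg. triv. Qed.

Lemma rho_sq d z : rho d z ^ 2 = nsq d z.
Proof. apply pow2_sqrt, nsq_pos. Qed.

Definition rval (d : nat) (z : nat -> R) (fg : fs * fs) : C :=
 Cplus (evF z (fst fg)) (Cmult (RtoC (rho d z)) (evF z (snd fg))).

(** Sums of squared moduli in the polynomials extended by [rho]. Since [rho ^ 2] is a polynomial,
    products stay inside; [rho] is what homogenizes the constant term of [1 + x_i]. *)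
Definition cone (d D : nat) (F : (nat -> R) -> R) : Prop :=
 exists l : list (fs * fs), (forall fg, In fg l -> homog d D (fst fg) /\ homog d (D - 1) (snd fg)) /\
  forall z, F z = lsum l (fun fg => Cmod (rval d z fg) ^ 2).

Lemma cone_ext d D F G : (forall z, F z = G z) -> cone d D F -> cone d D G.
Proof. intros H (l & Hl & Hz). exists l. split; [pos|]. intros z. rewrite <- H. apply Hz. Qed.

Lemma cone_add d D F G : cone d D F -> cone d D G -> cone d D (fun z => F z + G z).
Proof.
 intros (l & Hl & Hz) (l' & Hl' & Hz'). exists (l ++ l'). split.
 - intros fg H. apply in_app_or in H. destruct H; auto.
 - intros z. rewrite lsum_app, <- Hz, <- Hz'. lra.
Qed.

Lemma cone_zero d D : cone d D (fun _ => 0).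
Proof. exists []. triv. Qed.

Lemma evF_sc z c F : evF z (scF c F) = Cmult (RtoC c) (evF z F).
Proof. apply LF_sc. Qed.

Lemma cone_scal d D c F : 0 <= c -> cone d D F -> cone d D (fun z => c * F z).
Proof.
 intros Hc (l & Hl & Hz). exists (map (fun fg => (scF (sqrt c) (fst fg), scF (sqrt c) (snd fg))) l). split.
 - intros fg H. apply in_map_iff in H. destruct H as (a & <- & H). apply Hl in H.
  split; apply homog_sc; tauto.
 - intros z. rewrite lsum_map, Hz, <- lsum_scal. apply lsum_ext. intros fg _.
  unfold rval. simpl fst; simpl snd. rewrite !evF_sc.
  replace (Cplus (Cmult (RtoC (sqrt c)) (evF z (fst fg))) (Cmult (RtoC (rho d z)) (Cmult (RtoC (sqrt c)) (evF z (snd fg)))))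
   with (Cmult (RtoC (sqrt c)) (Cplus (evF z (fst fg)) (Cmult (RtoC (rho d z)) (evF z (snd fg))))) by ring.
  rewrite Cmod_mult, Cmod_R, Rpow_mult_distr, pow2_abs, pow2_sqrt by exact Hc. lra.
Qed.

Lemma cone_lsum {A} d D (l : list A) (F : A -> (nat -> R) -> R) :
 (forall a, In a l -> cone d D (F a)) -> cone d D (fun z => lsum l (fun a => F a z)).
Proof.
 induction l; intros H; [apply cone_zero|]. apply cone_add; [|apply IHl]; intros; apply H; simpl; auto.
Qed.

Definition sqF (d : nat) : fs := map (fun i => (RtoC 1, [i; i])) (seq 0 d).

Lemma evF_sqF d z : evF z (sqF d) = RtoC (nsq d z).
Proof.
 unfold evF, LF, sqF, nsq. rewrite csum_map, <- csum_RtoC. apply csum_ext. intros i _. simpl.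
 ring.
Qed.

Lemma homog_sqF d : homog d 2 (sqF d).
Proof.
 intros cw H. apply in_map_iff in H. destruct H as (i & <- & H). apply in_seq in H.
 repeat constructor; simpl; lia.
Qed.

Lemma evF_app z F G : evF z (F ++ G) = Cplus (evF z F) (evF z G).
Proof. apply LF_app. Qed.

Lemma cone_mult d D E F G : (1 <= D)%nat -> (1 <= E)%nat -> cone d D F -> cone d E G ->
 cone d (D + E) (fun z => F z * G z).
Proof.
 intros HD HE (l & Hl & Hz) (l' & Hl' & Hz').
 exists (flat_map (fun a => map (fun b =>
   (mulF (fst a) (fst b) ++ mulF (sqF d) (mulF (snd a) (snd b)),
   mulF (fst a) (snd b) ++ mulF (snd a) (fst b))) l') l).
 split.
 - intros fg H. apply in_flat_map in H. destruct H as (a & Ha & H).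
  apply in_map_iff in H. destruct H as (b & <- & Hb).
  apply Hl in Ha. apply Hl' in Hb. destruct Ha as [Ha1 Ha2], Hb as [Hb1 Hb2]. split.
  + apply homog_app; [apply homog_mul; assumption|].
   replace (D + E)%nat with (2 + ((D - 1) + (E - 1)))%nat by lia.
   apply homog_mul; [apply homog_sqF|]. apply homog_mul; assumption.
  + apply homog_app; [replace (D + E - 1)%nat with (D + (E - 1))%nat by lia
            |replace (D + E - 1)%nat with ((D - 1) + E)%nat by lia]; apply homog_mul; assumption.
 - intros z. rewrite lsum_flat_map, Hz, Hz', Rmult_comm, <- lsum_scal. apply lsum_ext. intros a _.
  rewrite lsum_map, Rmult_comm, <- lsum_scal. apply lsum_ext. intros b _.
  rewrite <- Rpow_mult_distr, <- Cmod_mult. do 2 f_equal. unfold rval. simpl fst; simpl snd.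
  rewrite !evF_app, !evF_mul, evF_sqF, <- rho_sq. simpl. rewrite Rmult_1_r, !RtoC_mult. ring.
Qed.

(** This is [nsq d z * (1 + s x_i) / 2] at the point [x = z / rho] of the unit sphere, written so
    that it makes sense at [z = 0]. *)
Definition hfac (d : nat) (s : R) (i : nat) (z : nat -> R) : R := rho d z * (rho d z + s * z i) / 2.

(** Because [2 rho (rho + s z_i) = (rho + s z_i)^2 + (rho^2 - z_i^2)], where the last bracket is the
    sum of the other squares. *)
Lemma cone_hfac d s i : s ^ 2 = 1 -> (i < d)%nat -> cone d 1 (hfac d s i).
Proof.
 intros Hs Hi.
 apply cone_ext with (fun z => / 4 * ((rho d z + s * z i) ^ 2 + lsum (seq 0 d) (fun j => if Nat.eqb j i then 0 else z j ^ 2))).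
 - intros z. unfold hfac.
  assert (E : lsum (seq 0 d) (fun j => if Nat.eqb j i then 0 else z j ^ 2) = nsq d z - z i ^ 2).
  { replace (z i ^ 2) with (lsum (seq 0 d) (fun j => if Nat.eqb j i then z j ^ 2 else 0)).
   - unfold nsq.
    replace (lsum (seq 0 d) (fun i0 => z i0 ^ 2)) with (lsum (seq 0 d) (fun j => (if Nat.eqb j i then 0 else z j ^ 2)
      + (if Nat.eqb j i then z j ^ 2 else 0))).
    + rewrite lsum_plus. ring.
    + apply lsum_ext. intros j _. destruct (Nat.eqb j i); ring.
   - apply (lsum_single (seq 0 d) i (fun j => z j ^ 2)); [apply seq_NoDup|apply in_seq; lia]. }
  rewrite E, <- rho_sq. replace ((rho d z + s * z i) ^ 2) with (rho d z ^ 2 + 2 * s * rho d z * z i + s ^ 2 * z i ^ 2) by ring.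
  rewrite Hs. field.
 - apply cone_scal; [lra|]. apply cone_add.
  + exists [([(RtoC s, [i])], [(RtoC 1, [])])]. split.
   * intros fg [<-|[]]. split; intros cw [<-|[]]; simpl; split; try reflexivity; repeat constructor; exact Hi.
   * intros z. unfold lsum; cbn [fold_right]. rewrite Rplus_0_r.
    replace (rval d z ([(RtoC s, [i])], [(RtoC 1, [])])) with (RtoC (rho d z + s * z i)).
    -- rewrite Cmod_R, pow2_abs. reflexivity.
    -- unfold rval, evF, LF. simpl. rewrite Rmult_1_r, RtoC_plus, RtoC_mult. ring.
  + apply (cone_lsum d 1 (seq 0 d) (fun j z => if Nat.eqb j i then 0 else z j ^ 2)).
   intros j Hj. apply in_seq in Hj. destruct (Nat.eqb j i); [apply cone_zero|].
   exists [([(RtoC 1, [j])], [])]. split.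
   * intros fg [<-|[]]. split; [|triv]. intros cw [<-|[]]; simpl; split; [|pos].
    repeat constructor; lia.
   * intros z. unfold lsum; cbn [fold_right]. rewrite Rplus_0_r.
    replace (rval d z ([(RtoC 1, [j])], [])) with (RtoC (z j)).
    -- rewrite Cmod_R, pow2_abs. reflexivity.
    -- unfold rval, evF, LF. simpl. rewrite Rmult_1_r. ring.
Qed.

Lemma cone_pow d D F k : (1 <= D)%nat -> cone d D F -> (1 <= k)%nat -> cone d (k * D) (fun z => F z ^ k).
Proof.
 intros HD HF. induction k as [|k IH]; intros Hk; [lia|]. destruct k as [|k].
 - rewrite Nat.mul_1_l. apply cone_ext with F; [triv|pos].
 -
  apply cone_mult; [pos|nia|pos|apply IH; lia].
Qed.

Lemma cone_node d L i j : (1 <= L)%nat -> (j <= L)%nat -> (i < d)%nat ->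
 cone d L (fun z => hfac d 1 i z ^ j * hfac d (-1) i z ^ (L - j)).
Proof.
 intros HL Hj Hi.
 assert (H1 : cone d 1 (hfac d 1 i)) by (apply cone_hfac; [ring|pos]).
 assert (H2 : cone d 1 (hfac d (-1) i)) by (apply cone_hfac; [ring|pos]).
 destruct (Nat.eq_dec j 0) as [->|Hj0].
 - apply cone_ext with (fun z => hfac d (-1) i z ^ L); [intros; rewrite Nat.sub_0_r; ring|].
  rewrite <- (Nat.mul_1_r L) at 1. apply cone_pow; auto.
 - destruct (Nat.eq_dec j L) as [->|HjL].
  + apply cone_ext with (fun z => hfac d 1 i z ^ L); [intros; rewrite Nat.sub_diag; ring|].
   rewrite <- (Nat.mul_1_r L) at 1. apply cone_pow; auto.
  + replace L with (j * 1 + (L - j) * 1)%nat at 1 by lia.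
   apply cone_mult; try lia; apply cone_pow; auto; lia.
Qed.

Lemma cone_prodw d L w : (1 <= L)%nat -> lt_letters (S L) w -> (1 <= length w)%nat -> (length w <= d)%nat ->
 cone d (length w * L) (fun z => prodw (fun i j => hfac d 1 i z ^ j * hfac d (-1) i z ^ (L - j)) w).
Proof.
 intros HL. induction w as [|j w IH]; intros Hw H1 Hd; [easy|].
 inversion_clear Hw. simpl in Hd.
 assert (Hn : cone d L (fun z => hfac d 1 (length w) z ^ j * hfac d (-1) (length w) z ^ (L - j)))
  by (apply cone_node; lia).
 destruct w as [|k w].
 - rewrite Nat.mul_1_l. eapply cone_ext; [|exact Hn]. intros z. simpl. ring.
 - change (length (j :: k :: w) * L)%nat with (L + length (k :: w) * L)%nat. rewrite Nat.add_comm.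
  apply (cone_mult d (length (k :: w) * L) L
    (fun z => prodw (fun i j => hfac d 1 i z ^ j * hfac d (-1) i z ^ (L - j)) (k :: w))); [simpl; nia|pos| |pos].
  apply IH; [pos|simpl; lia|lia].
Qed.

Lemma ev_neg z w : ev (fun i => - z i) w = (-1) ^ length w * ev z w.
Proof. induction w; simpl; [ring|nra]. Qed.

Lemma evF_neg d E z F : homog d E F -> evF (fun i => - z i) F = Cmult (RtoC ((-1) ^ E)) (evF z F).
Proof.
 intros H. unfold evF, LF. rewrite <- csum_scal. apply csum_ext. intros cw Hin.
 destruct (H cw Hin) as [_ Hl]. rewrite ev_neg, Hl, RtoC_mult. ring.
Qed.

Lemma nsq_neg d z : nsq d (fun i => - z i) = nsq d z.
Proof. apply lsum_ext. triv. Qed.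

Lemma Cmod_sq z : Cmod z ^ 2 = fst z ^ 2 + snd z ^ 2.
Proof. apply pow2_sqrt. pos. Qed.

(** The degrees of [f] and [g] have opposite parities, so averaging over [z] and [-z] turns
    [|f + rho g|^2] into [|f|^2 + rho^2 |g|^2], and [rho^2 |g|^2] is the sum of the [|z_i g|^2]. *)
Lemma cone_even d D F : (1 <= D)%nat -> cone d D F -> (forall z, F (fun i => - z i) = F z) ->
 exists L : list fs, (forall s, In s L -> homog d D s) /\ forall z, F z = lsum L (fun s => Cmod (evF z s) ^ 2).
Proof.
 intros HD (l & Hl & Hz) Hev.
 exists (flat_map (fun fg => fst fg :: map (fun i => preF [i] (snd fg)) (seq 0 d)) l). split.
 - intros s H. apply in_flat_map in H. destruct H as (fg & Hin & H). apply Hl in Hin.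
  destruct Hin as [H1 H2]. destruct H as [<-|H]; [pos|].
  apply in_map_iff in H. destruct H as (i & <- & Hi). apply in_seq in Hi.
  replace D with (length [i] + (D - 1))%nat by (simpl; lia). apply homog_pre; [|pos].
  repeat constructor; lia.
 - intros z. rewrite lsum_flat_map.
  assert (E : F z = / 2 * (lsum l (fun fg => Cmod (rval d z fg) ^ 2) + lsum l (fun fg => Cmod (rval d (fun i => - z i) fg) ^ 2))).
  { rewrite <- !Hz, Hev. field. }
  rewrite E, <- lsum_plus, <- lsum_scal. apply lsum_ext. intros fg Hin. apply Hl in Hin. destruct Hin as [H1 H2].
  simpl. rewrite lsum_map.
  rewrite (lsum_ext _ (fun a => Cmod (evF z (preF [a] (snd fg))) * (Cmod (evF z (preF [a] (snd fg))) * 1))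
    (fun i => Cmod (evF z (snd fg)) ^ 2 * z i ^ 2)).
  2:{ intros i _. rewrite evF_pre, Cmod_mult, Cmod_R. simpl ev. rewrite Rmult_1_r.
    rewrite <- (pow2_abs (z i)). ring. }
  rewrite lsum_scal. fold (nsq d z). unfold rval.
  rewrite (evF_neg d D), (evF_neg d (D - 1)) by assumption.
  replace (rho d (fun i => - z i)) with (rho d z) by (unfold rho; rewrite nsq_neg; reflexivity).
  rewrite <- rho_sq.
  replace ((-1) ^ (D - 1)) with (- (-1) ^ D) by (replace D with (S (D - 1)) at 1 by lia; simpl; ring).
  set (p := evF z (fst fg)). set (q := evF z (snd fg)). set (r := rho d z).
  assert (Hs : (-1) ^ D = 1 \/ (-1) ^ D = -1).
  { clear. induction D; [lra|]. simpl. lra. }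
  change (Cmod p * (Cmod p * 1)) with (Cmod p ^ 2).
  change (Cmod (p + RtoC r * q) * (Cmod (p + RtoC r * q) * 1)) with (Cmod (p + RtoC r * q) ^ 2).
  match goal with |- _ * (_ + Cmod ?x * (Cmod ?x * 1)) = _ => change (Cmod x * (Cmod x * 1)) with (Cmod x ^ 2) end.
  rewrite !Cmod_sq.
  destruct Hs as [-> | ->]; simpl; field.
Qed.

(** The certificate for [|Pm|^2 - c |z|^(2m)] comes from the Bernstein expansion on the cube of
  [|Pm|^2 + (|z|^2 - 1)^2 - c], which agrees with it on the unit sphere and is positive off it;
  each Bernstein factor [(1 +- z_i)/2] becomes, after homogenization by [rho], a sum of squares. *)
Theorem sos_certificate d m (Pm : fs) : (1 <= d)%nat -> (1 <= m)%nat -> homog d m Pm ->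
 (forall z, (exists i, (i < d)%nat /\ z i <> 0) -> evF z Pm <> RtoC 0) ->
 exists (c : R) (N : nat) (L : list fs), 0 < c /\ (forall s, In s L -> homog d (N + m) s) /\
  forall z, nsq d z ^ N * (Cmod (evF z Pm) ^ 2 - c * nsq d z ^ m) = lsum L (fun s => Cmod (evF z s) ^ 2).
Proof.
 intros Hd Hm HPm Hell.
 (* [T] stands for [nsq - 1]; its square makes the sum positive at the origin, where [Pm] vanishes,
    without disturbing the unit sphere. *)
 set (T := sqF d ++ [(RtoC (-1), [])]).
 set (Q0 := mulF (starF Pm) Pm ++ mulF T T).
 set (re := map (fun cw : C * list nat => (fst (fst cw), snd cw))).
 assert (HevT : forall z, evF z T = RtoC (nsq d z - 1)).
 { intros z. unfold T. rewrite evF_app, evF_sqF. unfold evF, LF; simpl.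
  unfold Rminus. rewrite RtoC_plus, Cplus_0_r, <- RtoC_mult, Rmult_1_r. pos. }
 assert (Hre : forall z, evR (re Q0) z = Cmod (evF z Pm) ^ 2 + (nsq d z - 1) ^ 2).
 { intros z. replace (Cmod (evF z Pm) ^ 2 + (nsq d z - 1) ^ 2) with (fst (evF z Q0)).
  - unfold evR, re, evF, LF. rewrite lsum_map, fst_csum. apply lsum_ext. intros; simpl.
   rewrite Rmult_0_r, Rminus_0_r. reflexivity.
  - unfold Q0. rewrite evF_app, evF_star_mul, evF_mul, HevT. simpl. ring. }
 assert (Hlet : forall cw, In cw (re Q0) -> lt_letters d (snd cw)).
 { assert (HT : forall cw, In cw T -> lt_letters d (snd cw)).
  { intros cw H. apply in_app_or in H. destruct H as [H|[<-|[]]]; [|pos].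
   apply (homog_sqF d cw H). }
  intros cw H. apply in_map_iff in H. destruct H as (a & <- & H). simpl.
  apply in_app_or in H. destruct H as [H|H].
  - apply (homog_mul d m m _ _ (homog_star _ _ _ HPm) HPm a H).
  - apply in_flat_map in H. destruct H as (b & Hb & H). apply in_map_iff in H. destruct H as (b' & <- & Hb').
   simpl. apply lt_letters_app; auto. }
 destruct (evR_lipschitz d (re Q0)) as [K HK].
 destruct (cube_positive_bound d (evR (re Q0)) K (evR_depends d _ Hlet) HK) as [c [Hc Hcb]].
 { intros z _. rewrite Hre.
  destruct (Req_dec (nsq d z) 0) as [H0|H0].
  - rewrite H0. note (pow2_ge_0 (Cmod (evF z Pm))). lra.
  - assert (Hne : exists i, (i < d)%nat /\ z i <> 0).
   { apply Classical_Prop.NNPP. intros Hn. apply H0. apply lsum_0. intros i Hi. apply in_seq in Hi.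
    destruct (Req_dec (z i) 0) as [->|Hzi]; [ring|]. exfalso. apply Hn. exists i. triv. }
   note (Hell z Hne) as Hnz. apply Cmod_gt_0 in Hnz.
   note (pow_lt _ 2 Hnz). note (pow2_ge_0 (nsq d z - 1)). lra. }
 (* Only half of the lower bound [c] is subtracted, which leaves the margin [c / 2] demanded by
    [bernstein_positive]; the subtracted half becomes the ellipticity constant. *)
 set (Q := re Q0 ++ [(- (c / 2), [])]).
 assert (HQ : forall z, evR Q z = Cmod (evF z Pm) ^ 2 + (nsq d z - 1) ^ 2 - c / 2).
 { intros z. unfold Q, evR. rewrite lsum_app. fold (evR (re Q0) z). rewrite Hre. simpl. ring. }
 destruct (bernstein_positive d Q (c / 2)) with (L1 := (m + 1)%nat) as (L & HL & co & Hco & Hexp).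
 { intros cw H. apply in_app_or in H. destruct H as [H|[<-|[]]]; [auto|pos]. }
 { lra. }
 { intros z Hz. rewrite HQ, <- Hre. specialize (Hcb z Hz). lra. }
 set (F := fun z => lsum (words (S L) d) (fun w => co w * prodw (fun i j => hfac d 1 i z ^ j * hfac d (-1) i z ^ (L - j)) w)).
 assert (HdL : (m < d * L)%nat) by nia.
 assert (HF : cone d (d * L) F).
 { apply (cone_lsum d (d * L) (words (S L) d) (fun w z => co w * prodw (fun i j => hfac d 1 i z ^ j * hfac d (-1) i z ^ (L - j)) w)).
  intros w Hw. note (Hco w Hw). apply words_spec in Hw. destruct Hw as [Lw Hw].
  apply cone_scal; [lra|]. note (cone_prodw d L w ltac:(lia) Hw ltac:(lia) ltac:(lia)) as G.
  triv. }
 assert (HFz : forall z, F z = nsq d z ^ (d * L - m) * (Cmod (evF z Pm) ^ 2 - c / 2 * nsq d z ^ m)).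
 (* At the origin both sides vanish because [m < d * L]; elsewhere [z] is scaled to the unit sphere,
    where the correction [(nsq - 1)^2] drops out. *)
 { intros z. destruct (Req_dec (nsq d z) 0) as [H0|H0].
  - rewrite H0, pow_i by lia. rewrite Rmult_0_l. apply lsum_0. intros w Hw.
   apply words_spec in Hw. destruct Hw as [Lw Hw].
   destruct w as [|j w]; [simpl in Lw; lia|]. simpl. unfold hfac, rho. rewrite H0, sqrt_0.
   unfold Rdiv. rewrite !Rmult_0_l, <- pow_add. rewrite pow_i; [ring|]. lia.
  - note (nsq_pos d z) as Hpos. assert (Hr : 0 < rho d z) by (apply sqrt_lt_R0; lra).
   set (x := fun i => z i / rho d z).
   assert (Hx : nsq d x = 1).
   { unfold nsq, x. rewrite (lsum_ext _ _ (fun i => / nsq d z * z i ^ 2)).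
    - rewrite lsum_scal. fold (nsq d z). field. exact H0.
    - intros i _. rewrite <- rho_sq. field. lra. }
   assert (Hevx : forall w, ev z w = rho d z ^ length w * ev x w).
   { induction w; simpl; [ring|]. rewrite IHw. unfold x at 2. field. lra. }
   assert (HPx : Cmod (evF z Pm) ^ 2 = nsq d z ^ m * Cmod (evF x Pm) ^ 2).
   { replace (evF z Pm) with (Cmult (RtoC (rho d z ^ m)) (evF x Pm)).
    - rewrite Cmod_mult, Cmod_R, Rpow_mult_distr, pow2_abs, <- rho_sq, <- !pow_mult. do 2 f_equal. lia.
    - unfold evF, LF. rewrite <- csum_scal. apply csum_ext. intros cw Hin.
     destruct (HPm cw Hin) as [_ El]. rewrite Hevx, El, RtoC_mult. ring. }
   note (Hexp (fun i => (1 + x i) / 2) (fun i => (1 - x i) / 2)) as E. cbv beta in E.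
   replace (evR Q (fun i => (1 + x i) / 2 - (1 - x i) / 2)) with (evR Q x) in E.
   2:{ f_equal. fext i. field. }
   rewrite HQ, Hx in E.
   assert (Hfac : F z = nsq d z ^ (d * L) * (Cmod (evF x Pm) ^ 2 + (1 - 1) ^ 2 - c / 2)).
   { rewrite E by triv. rewrite <- lsum_scal. apply lsum_ext. intros w Hw.
    apply words_spec in Hw. destruct Hw as [Lw Hw].
    rewrite <- Rmult_assoc, (Rmult_comm (nsq d z ^ _)), Rmult_assoc. f_equal.
    replace (d * L)%nat with (length w * L)%nat by pos.
    clear Lw. induction w as [|j w IHw]; [simpl; ring|].
    inversion_clear Hw. cbn [prodw length]. rewrite IHw by assumption.
    replace (S (length w) * L)%nat with (L + length w * L)%nat by lia. rewrite pow_add.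
    replace (hfac d 1 (length w) z) with (nsq d z * ((1 + x (length w)) / 2)).
    2:{ unfold hfac, x. rewrite <- rho_sq. field. lra. }
    replace (hfac d (-1) (length w) z) with (nsq d z * ((1 - x (length w)) / 2)).
    2:{ unfold hfac, x. rewrite <- rho_sq. field. lra. }
    rewrite !Rpow_mult_distr. replace (nsq d z ^ L) with (nsq d z ^ j * nsq d z ^ (L - j)).
    - ring.
    - rewrite <- pow_add. f_equal. lia. }
   rewrite Hfac, HPx. replace (d * L)%nat with ((d * L - m) + m)%nat at 1 by lia. rewrite pow_add. ring. }
 destruct (cone_even d (d * L) F ltac:(lia) HF) as (Lf & HLf & HLz).
 { intros z. rewrite !HFz, nsq_neg, (evF_neg d m) by exact HPm.
  rewrite Cmod_mult, Cmod_R, <- RPow_abs. replace (Rabs (-1)) with 1 by (rewrite Rabs_left; lra).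
  rewrite pow1, Rmult_1_l. lra. }
 exists (c / 2), (d * L - m)%nat, Lf. split; [lra|]. split.
 - replace (d * L - m + m)%nat with (d * L)%nat by lia. exact HLf.
 - intros z. rewrite <- HFz. pos.
Qed.

(** * Iterated improper integrals of dominated functions *)

(** An integrable weight with primitive [atan], so that tails and the total mass [PI] are explicit.
    Its largest value 1 is taken at 0, whence setting a coordinate to 0 removes its factor. *)
Definition w1 (s : R) : R := / (1 + s ^ 2).
Definition iw (n : nat) (x : nat -> R) : R := prodR n (fun i => w1 (x i)).
Definition Rint (f : R -> R) : R :=
 RInt_gen (V := R_CompleteNormedModule) f (Rbar_locally m_infty) (Rbar_locally p_infty).

Lemma w1_pos s : 0 < w1 s.
Proof. apply Rinv_0_lt_compat. nra. Qed.

Lemma w1_le_1 s : w1 s <= 1.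
Proof. unfold w1. rewrite <- Rinv_1 at 2. apply Rinv_le_contravar; [lra|]. nra. Qed.

Lemma w1_0 : w1 0 = 1.
Proof. unfold w1. lra. Qed.

Lemma prodR_pos n F : (forall i, (i < n)%nat -> 0 < F i) -> 0 < prodR n F.
Proof. induction n; simpl; intros H; [lra|]. pos. Qed.

Lemma iw_pos n x : 0 < iw n x.
Proof. apply prodR_pos. intros; apply w1_pos. Qed.

Lemma iw_upd_le n x k s : iw n (upd x k s) <= iw n (upd x k 0).
Proof.
 unfold iw. induction n; simpl; [lra|].
 assert (H : w1 (upd x k s n) <= w1 (upd x k 0 n)).
 { unfold upd. destruct (Nat.eqb n k); [rewrite w1_0; apply w1_le_1|lra]. }
 note (iw_pos n (upd x k s)). note (w1_pos (upd x k s n)).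
 mono.
Qed.

Lemma iw_le_1 n x : iw n x <= 1.
Proof.
 unfold iw. induction n; simpl; [lra|]. note (w1_le_1 (x n)). note (w1_pos (x n)).
 nra.
Qed.

Lemma iw_S_upd n x s : iw (S n) (upd x n s) = iw n x * w1 s.
Proof.
 unfold iw. simpl. rewrite upd_same. f_equal. apply prodR_ext. intros i Hi. rewrite upd_other by lia. lra.
Qed.

Lemma upd_comm x k j r s : k <> j -> upd (upd x k r) j s = upd (upd x j s) k r.
Proof.
 intros H. fext i. unfold upd.
 destruct (Nat.eqb_spec i j), (Nat.eqb_spec i k); subst; congruence.
Qed.

Lemma upd_upd x k r s : upd (upd x k r) k s = upd x k s.
Proof. fext i. unfold upd. destruct (Nat.eqb i k); reflexivity. Qed.

Lemma upd_id x k : upd x k (x k) = x.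
Proof. fext i. unfold upd. destruct (Nat.eqb_spec i k); subst; reflexivity. Qed.

Definition dom1 (K : R) (f : R -> R) : Prop := (forall s, continuous f s) /\ forall s, Rabs (f s) <= K * w1 s.

Lemma dom1_ex K f a b : dom1 K f -> ex_RInt f a b.
Proof. intros [H _]. apply (ex_RInt_continuous (V := R_CompleteNormedModule)). pos. Qed.

Lemma is_derive_atan x : is_derive atan x (w1 x).
Proof. apply is_derive_Reals. unfold w1. replace (x ^ 2) with (Rsqr x) by (unfold Rsqr; simpl; ring). rewrite Rsqr_pow2. apply derivable_pt_lim_atan. Qed.

Lemma continuous_w1 x : continuous w1 x.
Proof. apply derive_continuous. unfold w1. auto_derive. nra. Qed.

Lemma dom1_RInt_le K f a b : dom1 K f -> a <= b -> Rabs (RInt f a b) <= K * (atan b - atan a).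
Proof.
 intros Hf Hab. note (dom1_ex K f a b Hf) as Hex.
 assert (Hw : is_RInt w1 a b (atan b - atan a)).
 { apply (is_RInt_derive atan w1); intros; [apply is_derive_atan|apply continuous_w1]. }
 assert (Hw' : is_RInt (fun s => K * w1 s) a b (K * (atan b - atan a))).
 { apply (is_RInt_scal w1 a b K). exact Hw. }
 eapply Rle_trans; [apply abs_RInt_le; assumption|].
 rewrite <- (is_RInt_unique _ _ _ _ Hw'). apply RInt_le; auto.
 - apply (ex_RInt_norm f); exact Hex.
 - eexists; exact Hw'.
 - intros s _. apply (proj2 Hf).
Qed.

Lemma dom1_K_pos K f : dom1 K f -> 0 <= K.
Proof.
 intros [_ H]. specialize (H 0). rewrite w1_0 in H. note (Rabs_pos (f 0)). lra.
Qed.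

Lemma atan_tail eps : 0 < eps -> exists M, forall s, M < s -> PI / 2 - eps < atan s /\ atan (- s) < - (PI / 2) + eps.
Proof.
 intros He. set (e := Rmin eps (PI / 4)).
 assert (Hpi : 0 < PI) by apply PI_RGT_0.
 assert (He1 : 0 < e) by (apply Rmin_pos; lra).
 assert (He2 : e <= eps) by apply Rmin_l.
 assert (He3 : e <= PI / 4) by apply Rmin_r.
 exists (tan (PI / 2 - e)). intros s Hs. apply atan_increasing in Hs.
 rewrite atan_tan in Hs by lra. rewrite atan_opp. lra.
Qed.

Lemma dom1_tail K f eps : dom1 K f -> 0 < eps -> exists M, forall a b a' b', a < - M -> a' < - M -> M < b -> M < b' ->
 Rabs (RInt f a b - RInt f a' b') < eps.
Proof.
 intros Hf He. note (dom1_K_pos K f Hf) as HK.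
 destruct (atan_tail (eps / (2 * K + 1))) as [M HM]; [pos|].
 assert (Hb : forall x y, Rabs (RInt f x y) <= K * Rabs (atan y - atan x)).
 { intros x y. destruct (Rle_dec x y) as [H|H].
  - rewrite (Rabs_pos_eq (atan y - atan x)); [apply dom1_RInt_le; assumption|].
   destruct (Rle_lt_or_eq_dec x y H) as [Hl| ->]; [apply atan_increasing in Hl; lra|lra].
  - rewrite <- (opp_RInt_swap f) by (apply (dom1_ex K); exact Hf).
   rewrite Rabs_Ropp, (Rabs_minus_sym (atan y)).
   assert (Hl : y < x) by lra. note (atan_increasing _ _ Hl).
   rewrite (Rabs_pos_eq (atan x - atan y)) by lra. apply dom1_RInt_le; [pos|lra]. }
 exists M. intros a b a' b' Ha Ha' Hbb Hbb'.
 assert (E : RInt f a b - RInt f a' b' = RInt f a a' + RInt f b' b).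
 { rewrite <- (RInt_Chasles f a a' b) by (apply (dom1_ex K); exact Hf).
  rewrite <- (RInt_Chasles f a' b' b) by (apply (dom1_ex K); exact Hf).
  unfold plus; simpl. ring. }
 rewrite E. eapply Rle_lt_trans; [apply Rabs_triang|].
 assert (Hat : forall x y, x < - M -> y < - M -> Rabs (atan y - atan x) <= eps / (2 * K + 1)).
 { intros x y Hx Hy. destruct (HM (- x)) as [_ H1]; [lra|]. destruct (HM (- y)) as [_ H2]; [lra|].
  rewrite Ropp_involutive in H1, H2. note (atan_bound x). note (atan_bound y).
  apply Rabs_le. lra. }
 assert (Hat' : forall x y, M < x -> M < y -> Rabs (atan y - atan x) <= eps / (2 * K + 1)).
 { intros x y Hx Hy. destruct (HM x) as [H1 _]; [lra|]. destruct (HM y) as [H2 _]; [lra|].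
  note (atan_bound x). note (atan_bound y). apply Rabs_le. lra. }
 note (Hb a a'). note (Hb b' b).
 note (Rmult_le_compat_l K _ _ HK (Hat a a' Ha Ha')).
 note (Rmult_le_compat_l K _ _ HK (Hat' b' b Hbb' Hbb)).
 apply Rle_lt_trans with (2 * K * (eps / (2 * K + 1))); [lra|].
 apply Rmult_lt_reg_r with (2 * K + 1); [lra|]. field_simplify; lra.
Qed.

(** The Cauchy criterion on the filter of growing intervals yields the limit; the tails are
    controlled by those of [atan]. *)
Lemma Rint_correct K f : dom1 K f ->
 is_RInt_gen (V := R_CompleteNormedModule) f (Rbar_locally m_infty) (Rbar_locally p_infty) (Rint f).
Proof.
 intros Hf. apply (RInt_gen_correct (V := R_CompleteNormedModule) f).
 set (FF := filter_prod (Rbar_locally m_infty) (Rbar_locally p_infty)).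
 assert (Hex : exists y : R, filterlim (fun ab : R * R => RInt f (fst ab) (snd ab)) FF (locally y)).
 { apply (filterlim_locally_cauchy (U := R_CompleteSpace)). intros eps.
  destruct (dom1_tail K f eps Hf (cond_pos eps)) as [M HM].
  exists (fun ab => fst ab < - M /\ M < snd ab). split.
  - apply (Filter_prod _ _ _ (fun a => a < - M) (fun b => M < b)).
   + exists (- M). intros x Hx; exact Hx.
   + exists M. intros x Hx; exact Hx.
   + intros x y Hx Hy; split; assumption.
  - intros u v [Hu1 Hu2] [Hv1 Hv2]. change (Rabs (RInt f (fst v) (snd v) - RInt f (fst u) (snd u)) < eps).
   pos. }
 destruct Hex as [y Hy]. exists y. intros P HP. specialize (Hy P HP).
 unfold filtermapi. eapply filter_imp; [|exact Hy].
 intros ab Hab. exists (RInt f (fst ab) (snd ab)). split; [|pos].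
 apply RInt_correct. apply (dom1_ex K); exact Hf.
Qed.

Lemma Rint_approx K f eps : dom1 K f -> 0 < eps ->
 exists M, forall a b, a < - M -> M < b -> Rabs (RInt f a b - Rint f) < eps.
Proof.
 intros Hf He. note (Rint_correct K f Hf) as H.
 assert (HP : locally (Rint f) (fun y => Rabs (y - Rint f) < eps)).
 { exists (mkposreal eps He). pos. }
 specialize (H _ HP). destruct H as [Q1 Q2 [M1 H1] [M2 H2] H].
 exists (Rmax (- M1) M2). intros a b Ha Hb.
 note (Rmax_l (- M1) M2). note (Rmax_r (- M1) M2).
 destruct (H a b) as [y [Hy1 Hy2]]; [apply H1; lra|apply H2; lra|].
 simpl in Hy1. rewrite (is_RInt_unique _ _ _ _ Hy1). lra.
Qed.

Lemma Rint_plus K K' f g : dom1 K f -> dom1 K' g -> Rint (fun s => f s + g s) = Rint f + Rint g.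
Proof.
 intros Hf Hg. apply (is_RInt_gen_unique (V := R_CompleteNormedModule) (Fa := Rbar_locally m_infty) (Fb := Rbar_locally p_infty) (fun s => f s + g s)).
 apply (is_RInt_gen_plus f g); [apply (Rint_correct K); exact Hf|apply (Rint_correct K'); exact Hg].
Qed.

Lemma Rint_scal K c f : dom1 K f -> Rint (fun s => c * f s) = c * Rint f.
Proof.
 intros Hf. apply (is_RInt_gen_unique (V := R_CompleteNormedModule) (Fa := Rbar_locally m_infty) (Fb := Rbar_locally p_infty) (fun s => c * f s)). apply (is_RInt_gen_scal f c), (Rint_correct K), Hf.
Qed.

Lemma Rint_abs_le K f : dom1 K f -> Rabs (Rint f) <= PI * K.
Proof.
 intros Hf. note (dom1_K_pos K f Hf). apply le_epsilon. intros eps He.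
 destruct (Rint_approx K f eps Hf He) as [M HM].
 set (b := Rabs M + 1). assert (Hb : M < b) by (unfold b; note (Rle_abs M); lra).
 assert (Hb0 : 0 < b) by (unfold b; note (Rabs_pos M); lra).
 specialize (HM (- b) b ltac:(lra) Hb).
 note (dom1_RInt_le K f (- b) b Hf ltac:(lra)) as H1.
 note (atan_bound b). note (atan_bound (- b)).
 assert (K * (atan b - atan (- b)) <= K * PI) by mono.
 replace (Rint f) with (RInt f (- b) b - (RInt f (- b) b - Rint f)) by ring.
 bound Rabs_triang. rewrite Rabs_Ropp. lra.
Qed.

Lemma Rint_nonneg K f : dom1 K f -> (forall s, 0 <= f s) -> 0 <= Rint f.
Proof.
 intros Hf Hp. apply le_epsilon. intros eps He.
 destruct (Rint_approx K f eps Hf He) as [M HM].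
 set (b := Rabs M + 1). assert (Hb : M < b) by (unfold b; note (Rle_abs M); lra).
 assert (Hb0 : 0 < b) by (unfold b; note (Rabs_pos M); lra).
 specialize (HM (- b) b ltac:(lra) Hb). apply Rabs_def2 in HM.
 assert (0 <= RInt f (- b) b) by (apply RInt_ge_0; [lra|apply (dom1_ex K), Hf|pos]). lra.
Qed.

Lemma RInt_le_Rint K f a b : dom1 K f -> (forall s, 0 <= f s) -> a <= b -> RInt f a b <= Rint f.
Proof.
 intros Hf Hp Hab. apply le_epsilon. intros eps He.
 destruct (Rint_approx K f eps Hf He) as [M HM].
 set (B := Rabs M + Rabs a + Rabs b + 1).
 note (Rle_abs M). note (Rabs_pos M). note (Rle_abs b). note (Rabs_pos a).
 note (Rabs_pos b). note (Rle_abs (- a)) as Ha. rewrite Rabs_Ropp in Ha.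
 specialize (HM (- B) B ltac:(unfold B; lra) ltac:(unfold B; lra)). apply Rabs_def2 in HM.
 rewrite <- (RInt_Chasles f (- B) a B) in HM by (apply (dom1_ex K); exact Hf).
 rewrite <- (RInt_Chasles f a b B) in HM by (apply (dom1_ex K); exact Hf).
 unfold plus in HM; simpl in HM.
 assert (0 <= RInt f (- B) a) by (apply RInt_ge_0; [unfold B; lra|apply (dom1_ex K), Hf|pos]).
 assert (0 <= RInt f b B) by (apply RInt_ge_0; [unfold B; lra|apply (dom1_ex K), Hf|pos]).
 lra.
Qed.

Lemma Rint_zero K f : dom1 K f -> (forall s, 0 <= f s) -> Rint f = 0 -> forall s, f s = 0.
Proof.
 intros Hf Hp H0 s. destruct (Req_dec (f s) 0) as [E|Hn]; [lra|exfalso].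
 assert (Hfs : 0 < f s) by (specialize (Hp s); lra).
 note (proj1 Hf s) as Hc. apply (proj1 (filterlim_locally _ _)) with (eps := pos_div_2 (mkposreal _ Hfs)) in Hc.
 destruct Hc as [dl Hd]. note (cond_pos dl) as Hdl.
 assert (E : 0 < RInt f s (s + dl / 2)).
 { apply Rlt_le_trans with (RInt (fun _ => f s / 2) s (s + dl / 2)).
  - rewrite RInt_const.
   apply Rmult_lt_0_compat; lra.
  - apply RInt_le; [lra|apply ex_RInt_const|apply (dom1_ex K), Hf|].
   intros r Hr. assert (Hb : ball s dl r).
   { change (Rabs (r - s) < dl). rewrite Rabs_pos_eq; lra. }
   apply Hd in Hb. change (Rabs (f r - f s) < f s / 2) in Hb. apply Rabs_def2 in Hb. lra. }
 note (RInt_le_Rint K f s (s + dl / 2) Hf Hp ltac:(lra)). lra.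
Qed.

Lemma w1_small eps : 0 < eps -> exists M, 0 < M /\ forall s, M < Rabs s -> w1 s < eps.
Proof.
 exists (1 + / eps). assert (0 < / eps) by pos.
 split; [lra|]. intros s Hs. rewrite <- (Rinv_inv eps). apply Rinv_lt_contravar.
 - apply Rmult_lt_0_compat; [lra|]. note (pow2_ge_0 s); lra.
 - rewrite <- pow2_abs. nra.
Qed.

Lemma Rint_derive_zero K K' f f' : dom1 K f -> dom1 K' f' -> (forall s, is_derive f s (f' s)) -> Rint f' = 0.
Proof.
 intros Hf Hf' Hd. note (dom1_K_pos K f Hf) as HK.
 apply cond_eq. intros eps He. rewrite Rminus_0_r.
 destruct (Rint_approx K' f' (eps / 2) Hf' ltac:(lra)) as [M HM].
 destruct (w1_small (eps / (4 * K + 1))) as [M2 [HM2 Hw]]; [pos|].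
 set (b := Rabs M + M2 + 1). note (Rle_abs M). note (Rabs_pos M).
 specialize (HM (- b) b ltac:(unfold b; lra) ltac:(unfold b; lra)).
 assert (E : RInt f' (- b) b = f b - f (- b)).
 { apply is_RInt_unique. apply (is_RInt_derive f f'); intros; [pos|apply (proj1 Hf')]. }
 assert (Hb0 : 0 < b) by (unfold b; lra).
 assert (Hs : forall s, Rabs s = b -> Rabs (f s) <= eps / 4).
 { intros s Hs. bound (proj2 Hf).
  assert (Hws : w1 s < eps / (4 * K + 1)) by (apply Hw; rewrite Hs; unfold b; lra).
  via (K * (eps / (4 * K + 1))); [mono|].
  apply Rmult_le_reg_r with (4 * K + 1); [lra|]. field_simplify; lra. }
 note (Hs b ltac:(apply Rabs_pos_eq; lra)).
 note (Hs (- b) ltac:(rewrite Rabs_Ropp; apply Rabs_pos_eq; lra)).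
 rewrite E in HM. replace (Rint f') with (f b + - f (- b) + - (f b - f (- b) - Rint f')) by ring.
 eapply Rle_lt_trans; [apply Rabs_triang|]. rewrite Rabs_Ropp.
 note (Rabs_triang (f b) (- f (- b))) as Ht. rewrite Rabs_Ropp in Ht. lra.
Qed.

(** Differentiation under integral and series signs goes through this criterion: a quadratic
    remainder bound is an inequality, hence survives integration and summation. *)
Lemma is_derive_quadratic f t l C : (forall s, Rabs (f s - f t - (s - t) * l) <= C * (s - t) ^ 2) -> is_derive f t l.
Proof.
 intros H. apply is_derive_Reals. intros eps He.
 assert (HC : 0 <= C).
 { specialize (H (t + 1)). replace (t + 1 - t) with 1 in H by ring.
  note (Rabs_pos (f (t + 1) - f t - 1 * l)). lra. }
 assert (Hd : 0 < eps / (C + 1)) by pos.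
 exists (mkposreal _ Hd). intros h Hh Hlt. simpl in Hlt.
 specialize (H (t + h)). replace (t + h - t) with h in H by ring.
 replace ((f (t + h) - f t) / h - l) with ((f (t + h) - f t - h * l) / h) by (field; exact Hh).
 unfold Rdiv. rewrite Rabs_mult, Rabs_inv.
 assert (Hp : 0 < Rabs h) by (apply Rabs_pos_lt, Hh).
 apply Rmult_lt_reg_r with (Rabs h); [lra|]. rewrite Rmult_assoc, Rinv_l, Rmult_1_r by lra.
 eapply Rle_lt_trans; [exact H|]. rewrite <- pow2_abs.
 assert (C * Rabs h < eps).
 { apply Rle_lt_trans with ((C + 1) * Rabs h); [nra|].
  apply Rmult_lt_reg_l with (/ (C + 1)); [pos|].
  rewrite <- Rmult_assoc, Rinv_l, Rmult_1_l by lra. lra. }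
 nra.
Qed.

Lemma quadratic_remainder (f f' : R -> R) t C : 0 <= C -> (forall s, is_derive f s (f' s)) ->
 (forall s, Rabs (f' s - f' t) <= C * Rabs (s - t)) ->
 forall s, Rabs (f s - f t - (s - t) * f' t) <= C * (s - t) ^ 2.
Proof.
 intros HC Hd Hl s.
 destruct (mean_value (fun r => f r - r * f' t) (fun r => f' r - f' t) t s) as (c & _ & Hc & E).
 - intros x. refine (is_derive_minus f (fun r => r * f' t) x (f' x) (f' t) (Hd x) _).
  auto_derive; [lra|ring].
 - replace (f s - f t - (s - t) * f' t) with (f s - s * f' t - (f t - t * f' t)) by ring.
  rewrite E, Rabs_mult.
  note (Hl c). rewrite <- pow2_abs. note (Rabs_pos (s - t)).
  assert (C * Rabs (c - t) <= C * Rabs (s - t)) by mono. nra.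
Qed.

(** A class of integrands stable under integration of the last variable ([En_Iop]). In the Lipschitz
    condition [upd x k 0] gives the weight without its [k]-th factor, since no decay in that
    variable is asked of the increment. *)
Definition En (n : nat) (K : R) (h : (nat -> R) -> R) : Prop :=
 (forall x, Rabs (h x) <= K * iw n x) /\
 (forall k x s s', (k < n)%nat -> Rabs (h (upd x k s) - h (upd x k s')) <= K * Rabs (s - s') * iw n (upd x k 0)).

Definition Iop (n : nat) (h : (nat -> R) -> R) : (nat -> R) -> R := fun x => Rint (fun s => h (upd x n s)).

Lemma lipschitz_continuous C f : (forall s s', Rabs (f s - f s') <= C * Rabs (s - s')) -> forall s, continuous f s.
Proof.
 intros H s. apply filterlim_locally. intros eps.
 assert (HC : 0 <= C).
 { specialize (H 1 0). rewrite Rminus_0_r, Rabs_R1 in H. note (Rabs_pos (f 1 - f 0)). lra. }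
 assert (Hd : 0 < eps / (C + 1)) by pos.
 exists (mkposreal _ Hd). intros y Hy. change (Rabs (y - s) < eps / (C + 1)) in Hy.
 eapply Rle_lt_trans; [apply H|].
 apply Rle_lt_trans with ((C + 1) * Rabs (y - s)); [mono|].
 apply Rmult_lt_reg_l with (/ (C + 1)); [pos|].
 rewrite <- Rmult_assoc, Rinv_l, Rmult_1_l by lra. lra.
Qed.

Lemma En_dom1 n K h x : En (S n) K h -> dom1 (K * iw n x) (fun s => h (upd x n s)).
Proof.
 intros [H1 H2]. split.
 - apply (lipschitz_continuous (K * iw (S n) (upd x n 0))). intros s s'.
  specialize (H2 n x s s' ltac:(lia)). lra.
 - intros s. specialize (H1 (upd x n s)). rewrite iw_S_upd in H1. lra.
Qed.

Lemma En_plus n K K' h g : En n K h -> En n K' g -> En n (K + K') (fun x => h x + g x).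
Proof.
 intros [H1 H2] [G1 G2]. split.
 - intros x. bound Rabs_triang. specialize (H1 x). specialize (G1 x). lra.
 - intros k x s s' Hk. specialize (H2 k x s s' Hk). specialize (G2 k x s s' Hk).
  replace (h (upd x k s) + g (upd x k s) - (h (upd x k s') + g (upd x k s')))
   with ((h (upd x k s) - h (upd x k s')) + (g (upd x k s) - g (upd x k s'))) by ring.
  bound Rabs_triang. lra.
Qed.

Lemma En_scal n K c h : En n K h -> En n (Rabs c * K) (fun x => c * h x).
Proof.
 intros [H1 H2]. note (Rabs_pos c). split.
 - intros x. rewrite Rabs_mult, Rmult_assoc. apply Rmult_le_compat_l; auto.
 - intros k x s s' Hk. rewrite <- Rmult_minus_distr_l, Rabs_mult, !Rmult_assoc.
  scale_l. rewrite <- Rmult_assoc. auto.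
Qed.

Lemma En_Iop n K h : En (S n) K h -> En n (PI * K) (Iop n h).
Proof.
 intros Hh. split.
 - intros x. rewrite Rmult_assoc. apply Rint_abs_le, En_dom1, Hh.
 - intros k x s s' Hk. unfold Iop.
  note (En_dom1 n K h (upd x k s) Hh) as D1. note (En_dom1 n K h (upd x k s') Hh) as D2.
  assert (E : Rint (fun s0 => h (upd (upd x k s) n s0)) - Rint (fun s0 => h (upd (upd x k s') n s0))
   = Rint (fun s0 => h (upd (upd x k s) n s0) + (-1) * h (upd (upd x k s') n s0))).
  { assert (D3 : dom1 (Rabs (-1) * (K * iw n (upd x k s'))) (fun s0 => (-1) * h (upd (upd x k s') n s0))).
   { split.
    - intros r. apply (continuous_scal_r (-1) (fun r => h (upd (upd x k s') n r))). apply (proj1 D2).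
    - intros r. rewrite Rabs_mult, Rmult_assoc. scale_l; apply (proj2 D2). }
   rewrite (Rint_plus _ _ _ _ D1 D3), (Rint_scal _ _ _ D2). ring. }
  rewrite E.
  replace (PI * K * Rabs (s - s') * iw n (upd x k 0)) with (PI * (K * Rabs (s - s') * iw n (upd x k 0))) by ring.
  apply Rint_abs_le. split.
  + intros r. apply (continuous_plus (fun r => h (upd (upd x k s) n r))); [apply (proj1 D1)|].
   apply (continuous_scal_r (-1) (fun r => h (upd (upd x k s') n r))), (proj1 D2).
  + intros r. rewrite !(upd_comm x k n) by lia.
   replace (h (upd (upd x n r) k s) + -1 * h (upd (upd x n r) k s')) with (h (upd (upd x n r) k s) - h (upd (upd x n r) k s')) by ring.
   note (proj2 Hh k (upd x n r) s s' ltac:(lia)) as H.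
   rewrite <- (upd_comm x k n 0 r), iw_S_upd in H by lia. lra.
Qed.

Lemma Iop_plus n K K' h g x : En (S n) K h -> En (S n) K' g -> Iop n (fun x => h x + g x) x = Iop n h x + Iop n g x.
Proof. intros Hh Hg. apply (Rint_plus (K * iw n x) (K' * iw n x)); apply En_dom1; assumption. Qed.

Lemma Iop_scal n K c h x : En (S n) K h -> Iop n (fun x => c * h x) x = c * Iop n h x.
Proof. intros Hh. apply (Rint_scal (K * iw n x)). apply En_dom1, Hh. Qed.

Lemma in_Rn_upd n x k s : in_Rn n x -> (k < n)%nat -> in_Rn n (upd x k s).
Proof. intros H Hk j Hj. unfold upd. destruct (Nat.eqb_spec j k); [lia|auto]. Qed.

Lemma intRn_ext n : forall h g, (forall x, in_Rn n x -> h x = g x) -> intRn n h = intRn n g.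
Proof.
 induction n; intros h g H; simpl; [apply H; intros k _; reflexivity|].
 apply IHn. intros x Hx. f_equal. fext s. apply H.
 intros j Hj. rewrite upd_other by lia. apply Hx. lia.
Qed.

Lemma intRn_S n h : intRn (S n) h = intRn n (Iop n h).
Proof. pos. Qed.

Lemma intRn_plus n : forall K K' h g, En n K h -> En n K' g -> intRn n (fun x => h x + g x) = intRn n h + intRn n g.
Proof.
 induction n; intros K K' h g Hh Hg; [pos|].
 rewrite !intRn_S, <- (IHn _ _ _ _ (En_Iop _ _ _ Hh) (En_Iop _ _ _ Hg)).
 apply intRn_ext. intros x _. apply (Iop_plus n K K'); assumption.
Qed.

Lemma intRn_scal n : forall K c h, En n K h -> intRn n (fun x => c * h x) = c * intRn n h.
Proof.
 induction n; intros K c h Hh; [pos|].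
 rewrite !intRn_S, <- (IHn _ _ _ (En_Iop _ _ _ Hh)).
 apply intRn_ext. intros x _. apply (Iop_scal n K); assumption.
Qed.

Lemma intRn_abs_le n : forall K B h, En n K h -> (forall x, Rabs (h x) <= B * iw n x) -> Rabs (intRn n h) <= PI ^ n * B.
Proof.
 induction n; intros K B h Hh HB.
 - simpl. specialize (HB (fun _ => 0)). unfold iw in HB; simpl in HB. lra.
 - replace (PI ^ S n * B) with (PI ^ n * (PI * B)) by (simpl; ring).
  apply (IHn (PI * K)); [apply En_Iop, Hh|]. intros x. rewrite Rmult_assoc. apply Rint_abs_le.
  split; [apply (En_dom1 n K), Hh|]. intros s. specialize (HB (upd x n s)). rewrite iw_S_upd in HB. lra.
Qed.

Lemma intRn_nonneg n : forall K h, En n K h -> (forall x, 0 <= h x) -> 0 <= intRn n h.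
Proof.
 induction n; intros K h Hh Hp; [triv|].
 apply (IHn (PI * K)); [apply En_Iop, Hh|]. intros x.
 apply (Rint_nonneg (K * iw n x)); [apply En_dom1, Hh|auto].
Qed.

Lemma intRn_zero n : forall K h, En n K h -> (forall x, 0 <= h x) -> intRn n h = 0 -> forall x, in_Rn n x -> h x = 0.
Proof.
 induction n; intros K h Hh Hp H0 x Hx.
 - rewrite <- H0. simpl. f_equal. fext k. apply Hx. lia.
 -
  assert (E : Iop n h (upd x n 0) = 0).
  { apply (IHn (PI * K)); auto; [apply En_Iop, Hh| |].
   - intros y. apply (Rint_nonneg (K * iw n y)); [apply En_dom1, Hh|auto].
   - intros j Hj. unfold upd. destruct (Nat.eqb_spec j n); [lra|]. apply Hx. lia. }
  note (Rint_zero (K * iw n (upd x n 0)) _ (En_dom1 n K h _ Hh) (fun s => Hp _) E (x n)) as H.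
  simpl in H. rewrite upd_upd, upd_id in H. exact H.
Qed.

Definition isD (k : nat) (h h' : (nat -> R) -> R) : Prop :=
 forall x, is_derive (fun s => h (upd x k s)) (x k) (h' x).

Lemma isD_upd k h h' x s : isD k h h' -> is_derive (fun r => h (upd x k r)) s (h' (upd x k s)).
Proof.
 intros H. specialize (H (upd x k s)). rewrite upd_same in H.
 eapply is_derive_ext; [|exact H]. intros r. simpl. rewrite upd_upd. lra.
Qed.

(** The Lipschitz bound that [En] contains for the derivative gives a quadratic remainder integrable
    in the last variable. *)
Lemma Iop_isD n K K' h h' k : En (S n) K h -> En (S n) K' h' -> (k < n)%nat -> isD k h h' -> isD k (Iop n h) (Iop n h').
Proof.
 intros Hh Hh' Hk HD x.
 assert (HK' : 0 <= K').
 { note (proj1 Hh' (fun _ => 0)) as H. note (Rabs_pos (h' (fun _ => 0))).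
  note (iw_pos (S n) (fun _ => 0)). nra. }
 apply (is_derive_quadratic _ _ _ (PI * (K' * iw n (upd x k 0)))). intros s.
 rewrite upd_id. unfold Iop.
 assert (Es : forall c K h x, En (S n) K h -> dom1 (Rabs c * K * iw n x) (fun r => c * h (upd x n r))).
 { intros c K0 h0 x0 H0. apply (En_dom1 n (Rabs c * K0) (fun y => c * h0 y)). apply En_scal, H0. }
 assert (E : Rint (fun r => h (upd (upd x k s) n r)) - Rint (fun r => h (upd x n r)) - (s - x k) * Rint (fun r => h' (upd x n r))
  = Rint (fun r => (h (upd (upd x k s) n r) + (-1) * h (upd x n r)) + (- (s - x k)) * h' (upd x n r))).
 { assert (D12 : dom1 (K * iw n (upd x k s) + Rabs (-1) * K * iw n x) (fun r => h (upd (upd x k s) n r) + (-1) * h (upd x n r))).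
  { note (En_dom1 n K h (upd x k s) Hh) as D1. note (Es (-1) K h x Hh) as D2. split.
   - intros r. apply (continuous_plus (fun r => h (upd (upd x k s) n r))); [apply (proj1 D1)|apply (proj1 D2)].
   - intros r. bound Rabs_triang. note (proj2 D1 r). note (proj2 D2 r).
    lra. }
  rewrite (Rint_plus _ _ _ _ D12 (Es _ _ _ _ Hh')).
  rewrite (Rint_plus _ _ _ _ (En_dom1 n K h (upd x k s) Hh) (Es _ _ _ _ Hh)).
  rewrite (Rint_scal _ _ _ (En_dom1 n K h x Hh)), (Rint_scal _ _ _ (En_dom1 n K' h' x Hh')). ring. }
 rewrite E. rewrite Rmult_assoc. apply Rint_abs_le. split.
 - intros r. apply (continuous_plus (fun r => h (upd (upd x k s) n r) + (-1) * h (upd x n r))).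
  + apply (continuous_plus (fun r => h (upd (upd x k s) n r))); [apply (proj1 (En_dom1 n K h (upd x k s) Hh))|apply (proj1 (Es (-1) K h x Hh))].
  + apply (proj1 (Es _ _ _ _ Hh')).
 - intros r. rewrite (upd_comm x k n) by lia.
  set (y := upd x n r).
  assert (Hyk : y k = x k) by (unfold y; apply upd_other; lia).
  note (quadratic_remainder (fun q => h (upd y k q)) (fun q => h' (upd y k q)) (y k) (K' * iw (S n) (upd y k 0))) as Q.
  cbv beta in Q. rewrite upd_id in Q. rewrite <- Hyk.
  replace (h (upd y k s) + -1 * h y + - (s - y k) * h' y) with (h (upd y k s) - h y - (s - y k) * h' y) by ring.
  replace (K' * iw n (upd x k 0) * (s - y k) ^ 2 * w1 r) with (K' * iw (S n) (upd y k 0) * (s - y k) ^ 2).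
  + apply Q.
   * apply Rmult_le_pos; [lra|left; apply iw_pos].
   * intros q. apply isD_upd, HD.
   * intros q. rewrite <- (upd_id y k) at 2. note (proj2 Hh' k y q (y k) ltac:(lia)). lra.
  + unfold y. rewrite <- (upd_comm x k n) by lia. rewrite iw_S_upd. ring.
Qed.

(** For the last variable the boundary terms vanish by decay; any other derivative is first carried
    outside the inner integral. *)
Lemma intRn_derive_zero n : forall K K' h h' k, En n K h -> En n K' h' -> (k < n)%nat -> isD k h h' -> intRn n h' = 0.
Proof.
 induction n; intros K K' h h' k Hh Hh' Hk HD; [lia|]. rewrite intRn_S.
 destruct (Nat.eq_dec k n) as [->|Hkn].
 - rewrite (intRn_ext n _ (fun _ => 0)).
  + clear. induction n; [pos|]. rewrite intRn_S, <- IHn at 1. apply intRn_ext. intros x _.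
   apply (Rint_derive_zero 0 0 (fun _ => 0)).
   * split; [intros; apply continuous_const|intros; rewrite Rabs_R0; lra].
   * split; [intros; apply continuous_const|intros; rewrite Rabs_R0; lra].
   * apply (is_derive_cst 0).
  + intros x _. apply (Rint_derive_zero (K * iw n x) (K' * iw n x) (fun s => h (upd x n s))).
   * apply En_dom1, Hh.
   * apply En_dom1, Hh'.
   * intros s. apply isD_upd, HD.
 - apply (IHn (PI * K) (PI * K') (Iop n h) (Iop n h') k); [apply En_Iop, Hh|apply En_Iop, Hh'|lia|].
  apply (Iop_isD n K K'); auto. lia.
Qed.

(** * Schwartz functions *)

(** Points of [R^n] are sequences vanishing from index [n] on, and the hypotheses speak of these
    alone. Precomposing with this projection yields functions controlled on all sequences, which
    frees later statements from side conditions. *)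
Definition nproj (n : nat) (x : nat -> R) : nat -> R := fun j => if Nat.ltb j n then x j else 0.
Definition proj_inv (n : nat) (f : (nat -> R) -> R) : Prop := forall x, f x = f (nproj n x).
Definition pdr (k : nat) (f : (nat -> R) -> R) : (nat -> R) -> R :=
 fun x => Derive (fun s => f (upd x k s)) (x k).
Definition Dl (ds : list nat) (f : (nat -> R) -> R) : (nat -> R) -> R := fold_right pdr f ds.

Definition smoothR (n : nat) (f : (nat -> R) -> R) : Prop :=
 proj_inv n f /\
 forall ds k x, lt_letters n ds -> (k < n)%nat -> ex_derive (fun s => Dl ds f (upd x k s)) (x k).
Definition SR (n : nat) (f : (nat -> R) -> R) : Prop :=
 smoothR n f /\
 forall ds p, lt_letters n ds -> exists K, forall x, Rabs (Dl ds f x) <= K * iw n x ^ p.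

Lemma nproj_in_Rn n x : in_Rn n (nproj n x).
Proof. intros k Hk. unfold nproj. destruct (Nat.ltb_spec k n); [lia|lra]. Qed.

Lemma nproj_id n x : in_Rn n x -> nproj n x = x.
Proof.
 intros H. fext k. unfold nproj.
 destruct (Nat.ltb_spec k n); [lra|symmetry; auto].
Qed.

Lemma nproj_upd n x k s : (k < n)%nat -> nproj n (upd x k s) = upd (nproj n x) k s.
Proof.
 intros H. fext j. unfold nproj, upd.
 destruct (Nat.eqb_spec j k); [subst; destruct (Nat.ltb_spec k n); [lra|lia]|lra].
Qed.

Lemma nproj_at n x k : (k < n)%nat -> nproj n x k = x k.
Proof. unfold nproj. destruct (Nat.ltb_spec k n); [lra|lia]. Qed.

Lemma iw_nproj n x : iw n (nproj n x) = iw n x.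
Proof. apply prodR_ext. intros i Hi. rewrite nproj_at by exact Hi. lra. Qed.

Lemma lt_letters_cons n k ds : lt_letters n (k :: ds) <-> (k < n)%nat /\ lt_letters n ds.
Proof. split; [intros H; inversion H; auto|intros [H1 H2]; constructor; auto]. Qed.

Lemma Dl_proj_inv n f ds : proj_inv n f -> lt_letters n ds -> proj_inv n (Dl ds f).
Proof.
 intros Hf. induction ds as [|k ds IH]; intros H x; [pos|].
 apply lt_letters_cons in H. destruct H as [Hk H]. simpl. unfold pdr.
 rewrite nproj_at by exact Hk. apply Derive_ext. intros s. rewrite IH by exact H.
 rewrite nproj_upd by exact Hk. lra.
Qed.

Lemma Dl_app a b f : Dl (a ++ b) f = Dl a (Dl b f).
Proof. apply fold_right_app. Qed.

Lemma smoothR_isD n f ds k : smoothR n f -> lt_letters n ds -> (k < n)%nat -> isD k (Dl ds f) (Dl (k :: ds) f).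
Proof. intros [_ H] Hds Hk x. apply Derive_correct. pos. Qed.

Lemma isD_pdr k f f' : isD k f f' -> pdr k f = f'.
Proof.
 intros H. fext x. apply is_derive_unique, H.
Qed.

Lemma isD_plus k f g f' g' : isD k f f' -> isD k g g' -> isD k (fun x => f x + g x) (fun x => f' x + g' x).
Proof. intros Hf Hg x. apply (is_derive_plus (fun s => f (upd x k s)) (fun s => g (upd x k s))); auto. Qed.

Lemma isD_scal k c f f' : isD k f f' -> isD k (fun x => c * f x) (fun x => c * f' x).
Proof. intros Hf x. apply (is_derive_scal (fun s => f (upd x k s))). apply Hf. Qed.

Lemma isD_mult k f g f' g' : isD k f f' -> isD k g g' -> isD k (fun x => f x * g x) (fun x => f' x * g x + f x * g' x).
Proof.
 intros Hf Hg x. note (is_derive_mult _ _ _ _ _ (Hf x) (Hg x) Rmult_comm) as H.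
 cbv beta in H. rewrite upd_id in H. exact H.
Qed.

Lemma isD_lsum {A} k (l : list A) (f f' : A -> (nat -> R) -> R) : (forall a, In a l -> isD k (f a) (f' a)) ->
 isD k (fun x => lsum l (fun a => f a x)) (fun x => lsum l (fun a => f' a x)).
Proof.
 induction l; intros H; simpl.
 - intros x. apply is_derive_cst.
 - apply isD_plus; [apply H; simpl; auto|apply IHl; intros; apply H; simpl; auto].
Qed.

Lemma isD_coord k i : isD k (fun x => x i) (fun _ => if Nat.eqb i k then 1 else 0).
Proof.
 intros x. unfold upd. destruct (Nat.eqb i k); auto_derive; auto.
Qed.

Lemma isD_ext k f f' g' : (forall x, f' x = g' x) -> isD k f f' -> isD k f g'.
Proof. intros H Hf x. rewrite <- H. apply Hf. Qed.

Lemma Dl_plus n f g ds : smoothR n f -> smoothR n g -> lt_letters n ds ->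
 Dl ds (fun x => f x + g x) = fun x => Dl ds f x + Dl ds g x.
Proof.
 intros Hf Hg. induction ds as [|k ds IH]; intros H; [pos|].
 apply lt_letters_cons in H. destruct H as [Hk H]. simpl. rewrite IH by exact H.
 apply isD_pdr. apply isD_plus; apply (smoothR_isD n); assumption.
Qed.

Lemma Dl_scal n c f ds : smoothR n f -> lt_letters n ds -> Dl ds (fun x => c * f x) = fun x => c * Dl ds f x.
Proof.
 intros Hf. induction ds as [|k ds IH]; intros H; [pos|].
 apply lt_letters_cons in H. destruct H as [Hk H]. simpl. rewrite IH by exact H.
 apply isD_pdr. apply isD_scal; apply (smoothR_isD n); assumption.
Qed.

Lemma smoothR_plus n f g : smoothR n f -> smoothR n g -> smoothR n (fun x => f x + g x).
Proof.
 intros Hf Hg. split.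
 - intros x. rewrite <- (proj1 Hf x), <- (proj1 Hg x). reflexivity.
 - intros ds k x Hds Hk. rewrite (Dl_plus n) by assumption. eexists.
  apply isD_plus; apply (smoothR_isD n); assumption.
Qed.

Lemma smoothR_scal n c f : smoothR n f -> smoothR n (fun x => c * f x).
Proof.
 intros Hf. split.
 - intros x. rewrite <- (proj1 Hf x). reflexivity.
 - intros ds k x Hds Hk. rewrite (Dl_scal n) by assumption. eexists.
  apply isD_scal; apply (smoothR_isD n); assumption.
Qed.

Lemma SR_plus n f g : SR n f -> SR n g -> SR n (fun x => f x + g x).
Proof.
 intros [Hf Bf] [Hg Bg]. split; [apply smoothR_plus; assumption|].
 intros ds p Hds. destruct (Bf ds p Hds) as [K1 H1]. destruct (Bg ds p Hds) as [K2 H2].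
 exists (K1 + K2). intros x. rewrite (Dl_plus n) by assumption.
 bound Rabs_triang. specialize (H1 x). specialize (H2 x). lra.
Qed.

Lemma SR_scal n c f : SR n f -> SR n (fun x => c * f x).
Proof.
 intros [Hf Bf]. split; [apply smoothR_scal; assumption|].
 intros ds p Hds. destruct (Bf ds p Hds) as [K1 H1].
 exists (Rabs c * K1). intros x. rewrite (Dl_scal n), Rabs_mult, Rmult_assoc by assumption.
 scale_l; pos.
Qed.

Lemma smoothR_pdr n k f : (k < n)%nat -> smoothR n f -> smoothR n (pdr k f).
Proof.
 intros Hk Hf. split.
 - apply (Dl_proj_inv n f [k]); [apply Hf|repeat constructor; exact Hk].
 - intros ds j x Hds Hj.
  note (proj2 Hf (ds ++ [k]) j x) as H. rewrite Dl_app in H. apply H; [|pos].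
  apply Forall_app; split; [pos|pos].
Qed.

Lemma SR_pdr n k f : (k < n)%nat -> SR n f -> SR n (pdr k f).
Proof.
 intros Hk [Hf Bf]. split; [apply smoothR_pdr; assumption|].
 intros ds p Hds. destruct (Bf (ds ++ [k]) p) as [K H].
 - apply Forall_app; split; [pos|pos].
 - exists K. intros x. specialize (H x). rewrite Dl_app in H. exact H.
Qed.

Definition mulx (k : nat) (f : (nat -> R) -> R) : (nat -> R) -> R := fun x => x k * f x.

Lemma Dl_mulx n k f ds : smoothR n f -> lt_letters n ds -> exists L, (forall l, In l L -> lt_letters n l) /\
 Dl ds (mulx k f) = fun x => x k * Dl ds f x + lsum L (fun l => Dl l f x).
Proof.
 intros Hf. induction ds as [|i ds IH]; intros H.
 - exists []. split; [triv|]. fext x. unfold mulx; simpl. ring.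
 - apply lt_letters_cons in H. destruct H as [Hi H]. destruct (IH H) as [L [HL E]].
  exists ((if Nat.eqb k i then [ds] else []) ++ map (cons i) L). split.
  + intros l Hin. apply in_app_or in Hin. destruct Hin as [Hin|Hin].
   * destruct (Nat.eqb k i); [destruct Hin as [<-|[]]; exact H|triv].
   * apply in_map_iff in Hin. destruct Hin as (l' & <- & Hin). apply lt_letters_cons. auto.
  + simpl. rewrite E. apply isD_pdr.
   eapply isD_ext; [|apply isD_plus; [apply isD_mult; [apply isD_coord|apply (smoothR_isD n); assumption]|]].
   2:{ apply isD_lsum. intros l Hl. apply (smoothR_isD n); auto. }
   intros x. rewrite lsum_app, lsum_map. destruct (Nat.eqb k i); simpl; ring.
Qed.

Lemma coord_iw_le n k x : (k < n)%nat -> Rabs (x k) * iw n x <= 1.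
Proof.
 induction n; intros H; [lia|]. unfold iw. simpl. fold (iw n x).
 note (iw_pos n x). note (iw_le_1 n x). note (w1_pos (x n)). note (w1_le_1 (x n)).
 note (Rabs_pos (x k)).
 destruct (Nat.eq_dec k n) as [->|Hn].
 - assert (Rabs (x n) * w1 (x n) <= 1).
  { unfold w1. rewrite <- pow2_abs. note (pow2_ge_0 (Rabs (x n) - 1)).
   apply Rmult_le_reg_r with (1 + Rabs (x n) ^ 2); [nra|].
   rewrite Rmult_assoc, Rinv_l by nra. lra. }
  nra.
 - assert (Rabs (x k) * iw n x <= 1) by (apply IHn; lia).
  nra.
Qed.

Lemma smoothR_mulx n k f : (k < n)%nat -> smoothR n f -> smoothR n (mulx k f).
Proof.
 intros Hk Hf. split.
 - intros x. unfold mulx. rewrite nproj_at, <- (proj1 Hf x) by exact Hk. reflexivity.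
 - intros ds i x Hds Hi. destruct (Dl_mulx n k f ds Hf Hds) as [L [HL E]]. rewrite E.
  assert (HD : isD i (fun x => x k * Dl ds f x + lsum L (fun l => Dl l f x))
   (fun x => ((if Nat.eqb k i then 1 else 0) * Dl ds f x + x k * Dl (i :: ds) f x) + lsum L (fun l => Dl (i :: l) f x))).
  { apply isD_plus.
   - apply isD_mult; [apply isD_coord|apply (smoothR_isD n); assumption].
   - apply (isD_lsum i L (fun l => Dl l f) (fun l => Dl (i :: l) f)). intros l Hl. apply (smoothR_isD n); auto. }
  eexists. apply (HD x).
Qed.

Lemma SR_lsum_bound n f (L : list (list nat)) p : SR n f -> (forall l, In l L -> lt_letters n l) ->
 exists K, forall x, Rabs (lsum L (fun l => Dl l f x)) <= K * iw n x ^ p.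
Proof.
 intros [_ Bf]. induction L as [|l L IH]; intros HL.
 - exists 0. intros x. simpl. rewrite Rabs_R0. lra.
 - destruct IH as [K1 H1]; [intros; apply HL; simpl; auto|].
  destruct (Bf l p) as [K2 H2]; [apply HL; simpl; auto|]. exists (K2 + K1). intros x. simpl.
  bound Rabs_triang. specialize (H1 x). specialize (H2 x). lra.
Qed.

Lemma SR_mulx n k f : (k < n)%nat -> SR n f -> SR n (mulx k f).
Proof.
 intros Hk Hf. split; [apply smoothR_mulx; [pos|apply Hf]|].
 intros ds p Hds. destruct (Dl_mulx n k f ds (proj1 Hf) Hds) as [L [HL E]].
 destruct (SR_lsum_bound n f L p Hf HL) as [K1 H1]. destruct (proj2 Hf ds (S p) Hds) as [K2 H2].
 exists (K2 + K1). intros x. rewrite E. bound Rabs_triang.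
 rewrite Rmult_plus_distr_r. apply Rplus_le_compat; [|pos].
 rewrite Rabs_mult. specialize (H2 x). note (coord_iw_le n k x Hk) as H3. note (iw_pos n x) as H4.
 simpl in H2. note (Rabs_pos (x k)).
 assert (HK : 0 <= K2).
 { note (Rabs_pos (Dl ds f x)). assert (0 < iw n x * iw n x ^ p) by pos. nra. }
 via (Rabs (x k) * (K2 * (iw n x * iw n x ^ p))).
 - apply Rmult_le_compat_l; assumption.
 - replace (Rabs (x k) * (K2 * (iw n x * iw n x ^ p))) with ((Rabs (x k) * iw n x) * (K2 * iw n x ^ p)) by ring.
  rewrite <- (Rmult_1_l (K2 * iw n x ^ p)) at 2. mono.
Qed.

Lemma En_of_derivatives n K h (h' : nat -> (nat -> R) -> R) : 0 <= K -> (forall x, Rabs (h x) <= K * iw n x) ->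
 (forall k, (k < n)%nat -> isD k h (h' k) /\ forall x, Rabs (h' k x) <= K * iw n x) -> En n K h.
Proof.
 intros HK Hb HD. split; [pos|]. intros k x s s' Hk. destruct (HD k Hk) as [H1 H2].
 destruct (mean_value (fun r => h (upd x k r)) (fun r => h' k (upd x k r)) s' s) as (c & _ & _ & E).
 - intros r. apply isD_upd, H1.
 - rewrite E, Rabs_mult.
  assert (Rabs (h' k (upd x k c)) <= K * iw n (upd x k 0)).
  { bound H2. scale_l. apply iw_upd_le. }
  note (Rabs_pos (s - s')). nra.
Qed.

Lemma SR_bound_pair n f g a b : SR n f -> SR n g -> lt_letters n a -> lt_letters n b ->
 exists K, 0 <= K /\ forall x, Rabs (Dl a f x * Dl b g x) <= K * iw n x.
Proof.
 intros Hf Hg Ha Hb. destruct (proj2 Hf a 1%nat Ha) as [K1 H1]. destruct (proj2 Hg b O Hb) as [K2 H2].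
 exists (Rabs K1 * Rabs K2). split; [pos|]. intros x.
 specialize (H1 x). specialize (H2 x). rewrite Rabs_mult.
 note (Rle_abs K1). note (Rle_abs K2). note (iw_pos n x).
 replace (Rabs K1 * Rabs K2 * iw n x) with ((Rabs K1 * iw n x) * Rabs K2) by ring.
 apply Rmult_le_compat; try apply Rabs_pos; nra.
Qed.

Lemma finite_bound (n : nat) (Pr : nat -> R -> Prop) : (forall k K K', Pr k K -> K <= K' -> Pr k K') ->
 (forall k, (k < n)%nat -> exists K, Pr k K) -> exists K, 0 <= K /\ forall k, (k < n)%nat -> Pr k K.
Proof.
 intros Hm. induction n; intros H; [exists 0; split; [lra|lia]|].
 destruct IHn as [K1 [H1 H2]]; [pos|]. destruct (H n ltac:(lia)) as [K2 H3].
 exists (Rmax K1 K2). split; [eapply Rle_trans; [exact H1|apply Rmax_l]|]. intros k Hk.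
 destruct (Nat.eq_dec k n) as [->|]; [apply (Hm n K2); [pos|apply Rmax_r]|].
 apply (Hm k K1); [apply H2; lia|apply Rmax_l].
Qed.

Lemma En_product n f g a b : SR n f -> SR n g -> lt_letters n a -> lt_letters n b ->
 exists K, En n K (fun x => Dl a f x * Dl b g x).
Proof.
 intros Hf Hg Ha Hb.
 destruct (finite_bound n (fun k K => forall x, Rabs (Dl (k :: a) f x * Dl b g x + Dl a f x * Dl (k :: b) g x) <= K * iw n x))
  as [K [HK H]].
 - intros k K K' H Hle x. bound H. apply Rmult_le_compat_r; [left; apply iw_pos|lra].
 - intros k Hk. destruct (SR_bound_pair n f g (k :: a) b Hf Hg) as [K1 [_ H1]]; [apply lt_letters_cons; auto|auto|].
  destruct (SR_bound_pair n f g a (k :: b) Hf Hg) as [K2 [_ H2]]; [auto|apply lt_letters_cons; auto|].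
  exists (K1 + K2). intros x. bound Rabs_triang. specialize (H1 x). specialize (H2 x). lra.
 - destruct (SR_bound_pair n f g a b Hf Hg Ha Hb) as [K0 [HK0 H0]].
  exists (K + K0). apply (En_of_derivatives n (K + K0) _ (fun k x => Dl (k :: a) f x * Dl b g x + Dl a f x * Dl (k :: b) g x)).
  + lra.
  + intros x. specialize (H0 x). note (iw_pos n x). nra.
  + intros k Hk. split.
   * apply isD_mult; apply (smoothR_isD n); auto; [apply Hf|apply Hg].
   * intros x. specialize (H k Hk x). note (iw_pos n x). nra.
Qed.

Lemma En_mult n f g : SR n f -> SR n g -> exists K, En n K (fun x => f x * g x).
Proof. intros Hf Hg. apply (En_product n f g [] []); auto; constructor. Qed.

Lemma intRn_by_parts n f g k : SR n f -> SR n g -> (k < n)%nat ->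
 intRn n (fun x => pdr k f x * g x) = - intRn n (fun x => f x * pdr k g x).
Proof.
 intros Hf Hg Hk.
 destruct (En_mult n f g Hf Hg) as [K HE].
 destruct (En_mult n _ _ (SR_pdr n k f Hk Hf) Hg) as [K1 HE1].
 destruct (En_mult n _ _ Hf (SR_pdr n k g Hk Hg)) as [K2 HE2].
 note (En_plus n _ _ _ _ HE1 HE2) as HE3.
 assert (E : isD k (fun x => f x * g x) (fun x => pdr k f x * g x + f x * pdr k g x)).
 { apply isD_mult; [exact (smoothR_isD n f [] k (proj1 Hf) (Forall_nil _) Hk)
           |exact (smoothR_isD n g [] k (proj1 Hg) (Forall_nil _) Hk)]. }
 note (intRn_derive_zero n _ _ _ _ k HE HE3 Hk E) as H.
 note (intRn_plus n _ _ _ _ HE1 HE2) as H2. lra.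
Qed.

(** * Reordering of derivatives *)

Fixpoint dlist (n : nat) (a : nat -> nat) : list nat :=
 match n with O => [] | S m => repeat m (a m) ++ dlist m a end.

Lemma iter_repeat {A} (F : nat -> A -> A) m r h : Nat.iter r (F m) h = fold_right F h (repeat m r).
Proof. induction r; simpl; [pos|triv]. Qed.

Lemma dxa_fold n a g : dxa n a g = fold_right pdx g (dlist n a).
Proof.
 induction n; simpl; [pos|]. rewrite fold_right_app, <- IHn. apply iter_repeat.
Qed.

Lemma dlist_lt n a : lt_letters n (dlist n a).
Proof.
 induction n; simpl; [pos|]. apply Forall_app. split.
 - apply Forall_forall. intros i Hi. apply repeat_spec in Hi. lia.
 - eapply Forall_impl; [|exact IHn]. pos.
Qed.

Lemma lt_letters_le n m ds : (n <= m)%nat -> lt_letters n ds -> lt_letters m ds.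
Proof. intros H. apply Forall_impl. lia. Qed.

(** Boundedness is available only for derivatives taken in a fixed order, so [d_i f], [d_j d_i f] and
  [d_j d_j d_i f] must suffice. *)
Lemma clairaut_bounded n f i j K : smoothR n f -> (i < n)%nat -> (j < n)%nat -> i <> j ->
 (forall x, Rabs (Dl [j; j; i] f x) <= K) -> forall x, Dl [i; j] f x = Dl [j; i] f x.
Proof.
 intros Hf Hi Hj Hij HK x. assert (Hji : j <> i) by auto.
 assert (D : forall k ds, (k < n)%nat -> lt_letters n ds -> isD k (Dl ds f) (Dl (k :: ds) f)) by (intros; apply (smoothR_isD n); assumption).
 assert (L0 : lt_letters n []) by constructor. assert (Li : lt_letters n [i]) by (repeat constructor; exact Hi). assert (Lj : lt_letters n [j]) by (repeat constructor; exact Hj).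
 assert (Lji : lt_letters n [j; i]) by (repeat constructor; assumption).
 set (hji := Dl [j; i] f).
 assert (HK0 : 0 <= K) by (bound Rabs_pos; apply (HK x)).
 apply cond_eq. intros e0 He0. set (e := e0 / 6). assert (He : 0 < e) by (unfold e; lra).
 assert (DD : isD i hji (Dl [i; j; i] f)) by (apply (D i [j; i]); assumption).
 assert (Hcont : exists d, 0 < d /\ forall s, Rabs s < d -> Rabs (hji (upd x i (x i + s)) - hji x) <= e).
 { destruct (derive_approx _ _ _ 1 (DD x) Rlt_0_1) as [d [Hd H]]. rewrite upd_id in H. set (M := Rabs (Dl [i; j; i] f x) + 1).
  assert (HM : 0 < M) by (unfold M; note (Rabs_pos (Dl [i; j; i] f x)); lra).
  exists (Rmin d (e / M)). split; [triv|]. intros s Hs.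
  note (Rmin_l d (e / M)). note (Rmin_r d (e / M)). specialize (H s ltac:(lra)).
  replace (hji (upd x i (x i + s)) - hji x) with ((hji (upd x i (x i + s)) - hji x - s * Dl [i; j; i] f x) + s * Dl [i; j; i] f x) by ring.
  bound Rabs_triang. rewrite (Rabs_mult s). via (M * Rabs s); [unfold M; lra|].
  via (M * (e / M)); [nra|right; field; lra]. }
 destruct Hcont as [d1 [Hd1 H1]].
 destruct (derive_approx _ _ _ e (D i [j] Hi Lj x) He) as [d2 [Hd2 H2]].
 set (s := Rmin d1 d2 / 2). note (Rmin_l d1 d2). note (Rmin_r d1 d2). assert (Hs : 0 < s) by (unfold s; note (Rmin_pos d1 d2 Hd1 Hd2); lra).
 assert (Es : Rabs s = s) by (apply Rabs_pos_eq; lra). specialize (H2 s ltac:(unfold s in *; lra)). rewrite Es in H2. set (y := upd x i (x i + s)) in *.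
 assert (D0 : isD j f (Dl [j] f)) by (apply (D j []); assumption).
 assert (He2 : 0 < e * s) by nra.
 (* The step [s] in direction [i] is already fixed, so the accuracy in direction [j] may depend on
    it; division by [s] brings [e * s] back to [e]. *)
 destruct (derive_approx _ _ _ (e * s) (D0 x) He2) as [d3 [Hd3 H3]]. destruct (derive_approx _ _ _ (e * s) (D0 y) He2) as [d4 [Hd4 H4]].
 set (t := Rmin (Rmin d3 d4) (e / (K + 1)) / 2). note (Rmin_l (Rmin d3 d4) (e / (K + 1))). note (Rmin_r (Rmin d3 d4) (e / (K + 1))). note (Rmin_l d3 d4). note (Rmin_r d3 d4).
 assert (HeK : 0 < e / (K + 1)) by triv.
 assert (Ht : 0 < t) by (unfold t; note (Rmin_pos (Rmin d3 d4) (e / (K + 1)) (Rmin_pos d3 d4 Hd3 Hd4) HeK); lra).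
 assert (Et : Rabs t = t) by (apply Rabs_pos_eq; lra). specialize (H3 t ltac:(unfold t in *; lra)). specialize (H4 t ltac:(unfold t in *; lra)). rewrite upd_id, Et in *.
 assert (Di : isD i f (Dl [i] f)) by (apply (D i []); assumption).
 (* Two mean value theorems write the second difference as [s * t] times the derivative [Dl [j; i]
    f] at an intermediate point. *)
 destruct (mean_value (fun r => f (upd (upd x i r) j (x j + t)) - f (upd x i r)) (fun r => Dl [i] f (upd (upd x i r) j (x j + t)) - Dl [i] f (upd x i r)) (x i) (x i + s)) as (c & _ & Hc & E).
 { intros r. apply (is_derive_minus (fun r => f (upd (upd x i r) j (x j + t))) (fun r => f (upd x i r))); [|apply isD_upd, Di].
  rewrite upd_comm by exact Hij. eapply is_derive_ext; [|apply (isD_upd i f _ (upd x j (x j + t)) r Di)]. intros q. rewrite (upd_comm x i j) by exact Hij. nra. }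
 fold y in E. replace (x i + s - x i) with s in * by ring.
 set (z := upd x i c) in *. assert (Ezj : z j = x j) by (apply upd_other; exact Hji). assert (Eyj : y j = x j) by (apply upd_other; exact Hji).
 destruct (mean_value (fun r => Dl [i] f (upd z j r)) (fun r => hji (upd z j r)) (z j) (z j + t)) as (c2 & _ & Hc2 & E2).
 { intros r. apply isD_upd. apply (D j [i]); assumption. }
 destruct (mean_value (fun r => hji (upd z j r)) (fun r => Dl [j; j; i] f (upd z j r)) (z j) c2) as (c3 & _ & Hc3 & E3).
 { intros r. apply isD_upd. apply (D j [j; i]); assumption. }
 rewrite upd_id, Ezj in *. rewrite Eyj in H4. replace (x j + t - x j) with t in * by ring.
 specialize (H1 (c - x i) ltac:(unfold s in *; lra)). replace (x i + (c - x i)) with c in H1 by ring. fold z in H1.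
 set (g := hji (upd z j c2)) in *. set (p1 := Dl [j] f y) in *. set (p0 := Dl [j] f x) in *. set (l := Dl [i; j] f x) in *.
 assert (Hg : Rabs (g - hji x) <= 2 * e).
 { replace (g - hji x) with ((g - hji z) + (hji z - hji x)) by ring. bound Rabs_triang. rewrite E3, Rabs_mult.
  assert (HKt : Rabs (Dl [j; j; i] f (upd z j c3)) * Rabs (c2 - x j) <= K * t) by (apply Rmult_le_compat; [triv|triv|triv|nra]).
  assert (K * t <= e). { via ((K + 1) * (e / (K + 1))); [apply Rmult_le_compat; try lra; unfold t; lra|right; field; lra]. } lra. }
 assert (F : t * (p1 - p0) - t * s * g = - (f (upd y j (x j + t)) - f y - t * p1) + (f (upd x j (x j + t)) - f x - t * p0)) by nra.
 assert (F1 : Rabs (p1 - p0 - s * g) <= 2 * (e * s)).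
 { apply Rmult_le_reg_l with t; [nra|]. rewrite <- Et at 1. rewrite <- Rabs_mult. replace (t * (p1 - p0 - s * g)) with (t * (p1 - p0) - t * s * g) by ring. rewrite F.
  bound Rabs_triang. rewrite Rabs_Ropp. lra. }
 assert (F2 : Rabs (l - g) <= 3 * e).
 { apply Rmult_le_reg_l with s; [nra|]. rewrite <- Es at 1. rewrite <- Rabs_mult. replace (s * (l - g)) with (- (p1 - p0 - s * l) + (p1 - p0 - s * g)) by ring.
  bound Rabs_triang. rewrite Rabs_Ropp. lra. }
 replace (l - hji x) with ((l - g) + (g - hji x)) by ring. eapply Rle_lt_trans; [apply Rabs_triang|]. unfold e in *. lra.
Qed.

Definition incr (b : nat -> nat) (d : nat) : nat -> nat := fun j => if Nat.eqb j d then S (b j) else b j.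

Lemma dlist_ext n a b : (forall i, (i < n)%nat -> a i = b i) -> dlist n a = dlist n b.
Proof. induction n; intros H; simpl; [pos|]. rewrite IHn, H; auto. Qed.

Lemma dlist_trunc n m b : (m <= n)%nat -> dlist n (fun j => if Nat.ltb j m then b j else O) = dlist m b.
Proof.
 intros H. induction n.
 - replace m with O by lia. reflexivity.
 - simpl. destruct (Nat.ltb_spec n m).
  + replace m with (S n) by lia. simpl. f_equal. apply dlist_ext. intros i Hi.
   destruct (Nat.ltb_spec i (S n)); [pos|lia].
  + pos.
Qed.

Lemma smoothR_Dl n f ds : smoothR n f -> lt_letters n ds -> smoothR n (Dl ds f).
Proof.
 intros Hf. induction ds as [|k ds IH]; intros H; [pos|].
 apply lt_letters_cons in H. destruct H. apply smoothR_pdr; auto.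
Qed.

Lemma SR_Dl n f ds : SR n f -> lt_letters n ds -> SR n (Dl ds f).
Proof.
 intros Hf. induction ds as [|k ds IH]; intros H; [pos|].
 apply lt_letters_cons in H. destruct H. apply SR_pdr; auto.
Qed.

(** [pdr d] is moved inward through the block of [pdr j], one factor at a time. Clairaut's lemma
    asks for a bound on the derivative [[j; j; d]], which by the inner induction is again an ordered
    derivative and so bounded by assumption. *)
Lemma Dl_insert n f : smoothR n f -> (forall b, exists K, forall x, Rabs (Dl (dlist n b) f x) <= K) ->
 forall m d b, (m <= n)%nat -> (d < m)%nat -> pdr d (Dl (dlist m b) f) = Dl (dlist m (incr b d)) f.
Proof.
 intros Hf HB. induction m as [|j IH]; intros d b Hm Hd; [lia|].
 simpl. destruct (Nat.eq_dec d j) as [->|Hdj].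
 - unfold incr at 1. rewrite Nat.eqb_refl. simpl. do 2 f_equal.
  f_equal. apply dlist_ext. intros i Hi. unfold incr. destruct (Nat.eqb_spec i j); [lia|pos].
 - unfold incr at 1. destruct (Nat.eqb_spec j d); [lia|].
  generalize (b j) as r. induction r as [|r IHr]; [apply IH; lia|].
  set (h := Dl (repeat j r ++ dlist j b) f).
  assert (Hlt : lt_letters n (repeat j r ++ dlist j b)).
  { apply Forall_app. split.
   - apply Forall_forall. intros i Hi. apply repeat_spec in Hi. lia.
   - apply (lt_letters_le j); [lia|apply dlist_lt]. }
  assert (Hh : smoothR n h) by (apply smoothR_Dl; assumption).
  destruct (HB (fun i => if Nat.ltb i (S j) then (if Nat.eqb i j then S (S r) else incr b d i) else O)) as [K HK].
  rewrite dlist_trunc in HK by lia. simpl in HK. rewrite Nat.eqb_refl in HK.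
  rewrite (dlist_ext j _ (incr b d)) in HK.
  2:{ intros i Hi. destruct (Nat.eqb_spec i j); [lia|pos]. }
  assert (E : Dl [j; j; d] h = pdr j (pdr j (Dl (repeat j r ++ dlist j (incr b d)) f))).
  { simpl. unfold h. triv. }
  fext x.
  change (Dl [d; j] h x = pdr j (Dl (repeat j r ++ dlist j (incr b d)) f) x).
  rewrite (clairaut_bounded n h d j K Hh); try lia.
  + simpl. unfold h. rewrite IHr. reflexivity.
  + rewrite E. exact HK.
Qed.

Lemma Dl_sort n f : smoothR n f -> (forall b, exists K, forall x, Rabs (Dl (dlist n b) f x) <= K) ->
 forall ds, lt_letters n ds -> exists b, Dl ds f = Dl (dlist n b) f.
Proof.
 intros Hf HB. induction ds as [|k ds IH]; intros H.
 - exists (fun _ => O).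
  clear. induction n; simpl; auto.
 - apply lt_letters_cons in H. destruct H as [Hk H]. destruct (IH H) as [b E].
  exists (incr b k). simpl. rewrite E. apply (Dl_insert n f Hf HB); auto.
Qed.

(** The estimates in the definitions of the theorem concern derivatives in one fixed order, while
    commutators and integration by parts produce all orders. *)
Lemma SR_of_ordered n f : smoothR n f ->
 (forall b p, exists K, forall x, Rabs (Dl (dlist n b) f x) <= K * iw n x ^ p) -> SR n f.
Proof.
 intros Hf HB. split; [pos|]. intros ds p Hds.
 destruct (Dl_sort n f Hf) with (ds := ds) as [b E]; [|pos|rewrite E; apply HB].
 intros b. destruct (HB b O) as [K HK]. exists K. intros x. specialize (HK x). lra.
Qed.

Lemma Dl_components n g ds : lt_letters n ds -> forall x, in_Rn n x ->
 fold_right pdx g ds x = (Dl ds (fun y => fst (g (nproj n y))) x, Dl ds (fun y => snd (g (nproj n y))) x).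
Proof.
 induction ds as [|k ds IH]; intros H x Hx.
 - simpl. rewrite nproj_id by exact Hx. destruct (g x); reflexivity.
 - apply lt_letters_cons in H. destruct H as [Hk H]. simpl. unfold pdx at 1, DerC, pdr.
  f_equal; apply Derive_ext; intros s; rewrite (IH H) by (apply in_Rn_upd; assumption); reflexivity.
Qed.

Lemma smoothR_components n g : smooth_x n g ->
 smoothR n (fun x => fst (g (nproj n x))) /\ smoothR n (fun x => snd (g (nproj n x))).
Proof.
 intros Hg.
 assert (Hidem : forall x, nproj n (nproj n x) = nproj n x) by (intros; apply nproj_id, nproj_in_Rn).
 assert (P1 : proj_inv n (fun x => fst (g (nproj n x)))) by triv.
 assert (P2 : proj_inv n (fun x => snd (g (nproj n x)))) by triv.
 split; (split; [pos|]); intros ds k x Hds Hk;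
  destruct (Hg ds k (nproj n x)) as [H1 H2]; try (apply nproj_in_Rn); auto;
  try (intros d Hd; unfold lt_letters in Hds; rewrite Forall_forall in Hds; auto);
  rewrite nproj_at in H1, H2 by exact Hk.
 - eapply ex_derive_ext; [|exact H1]. intros s. simpl.
  rewrite (Dl_components n g ds Hds) by (apply in_Rn_upd; [apply nproj_in_Rn|pos]).
  rewrite <- nproj_upd by exact Hk. symmetry. apply (Dl_proj_inv n _ ds P1 Hds).
 - eapply ex_derive_ext; [|exact H2]. intros s. simpl.
  rewrite (Dl_components n g ds Hds) by (apply in_Rn_upd; [apply nproj_in_Rn|pos]).
  rewrite <- nproj_upd by exact Hk. symmetry. apply (Dl_proj_inv n _ ds P2 Hds).
Qed.

(** One coordinate at a time, using [(1 + x^2)^p <= 2^p (1 + x^(2 p))]: each step combines the bound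
    for a monomial with that for the monomial raised by [2 p] in the new coordinate. *)
Lemma weight_of_monomials n (G : (nat -> R) -> R) : (forall x, 0 <= G x) ->
 (forall a : nat -> nat, exists K, forall x, in_Rn n x -> Rabs (xpow n a x) * G x <= K) ->
 forall p, exists K, 0 <= K /\ forall x, in_Rn n x -> G x <= K * iw n x ^ p.
Proof.
 intros HG H p.
 assert (Hm : forall m, (m <= n)%nat -> forall a, exists K, forall x, in_Rn n x ->
   prodR m (fun i => (1 + x i ^ 2) ^ p) * (Rabs (xpow n a x) * G x) <= K).
 { induction m as [|m IH]; intros Hm a.
  - destruct (H a) as [K HK]. exists K. intros x Hx. rewrite Rmult_1_l. auto.
  - destruct (IH ltac:(lia) a) as [K1 H1].
   destruct (IH ltac:(lia) (fun i => if Nat.eqb i m then (a i + 2 * p)%nat else a i)) as [K2 H2].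
   exists (2 ^ p * (K1 + K2)). intros x Hx. specialize (H1 x Hx). specialize (H2 x Hx).
   assert (E : xpow n (fun i => if Nat.eqb i m then (a i + 2 * p)%nat else a i) x = xpow n a x * x m ^ (2 * p)).
   { unfold xpow. clear - Hm. generalize (2 * p)%nat as q. intros q. induction n; [lia|].
    cbn [prodR]. destruct (Nat.eqb_spec n m) as [->|Hne].
    - rewrite pow_add. rewrite (prodR_ext m _ (fun k => x k ^ a k)); [ring|].
     intros i Hi. destruct (Nat.eqb_spec i m); [lia|lra].
    - rewrite IHn by lia. ring. }
   rewrite E, Rabs_mult in H2. cbn [prodR].
   assert (Hp : (1 + x m ^ 2) ^ p <= 2 ^ p * (1 + x m ^ (2 * p))).
   { note (pow2_ge_0 (x m)). rewrite pow_mult. destruct (Rle_dec (x m ^ 2) 1).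
    - via (2 ^ p * 1); [rewrite Rmult_1_r; apply pow_incr; lra|].
     scale_l. note (pow_le _ p H0). lra.
    - via (2 ^ p * (x m ^ 2) ^ p).
     + rewrite <- Rpow_mult_distr. apply pow_incr; lra.
     + mono. }
   rewrite (Rabs_pos_eq (x m ^ (2 * p))) in H2 by (rewrite pow_mult; apply pow_le, pow2_ge_0).
   set (A := prodR m (fun i => (1 + x i ^ 2) ^ p)) in *.
   assert (HA : 0 < A).
   { apply prodR_pos. intros i _. apply pow_lt. nra. }
   set (B := Rabs (xpow n a x) * G x) in *.
   assert (HB : 0 <= B) by (apply Rmult_le_pos; [pos|pos]).
   assert (HAB : 0 <= A * B) by pos.
   via (A * B * (2 ^ p * (1 + x m ^ (2 * p)))).
   + replace (A * (1 + x m ^ 2) ^ p * B) with (A * B * (1 + x m ^ 2) ^ p) by ring.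
    apply Rmult_le_compat_l; assumption.
   + replace (A * B * (2 ^ p * (1 + x m ^ (2 * p)))) with
     (2 ^ p * (A * B + A * (Rabs (xpow n a x) * x m ^ (2 * p) * G x))) by (unfold B; ring).
    mono. }
 destruct (Hm n (le_n n) (fun _ => O)) as [K HK]. exists (Rabs K). split; [pos|].
 intros x Hx. specialize (HK x Hx).
 assert (E1 : xpow n (fun _ => O) x = 1) by (apply prodR_one; intros; reflexivity).
 rewrite E1, Rabs_R1, Rmult_1_l in HK.
 assert (E2 : prodR n (fun i => (1 + x i ^ 2) ^ p) * iw n x ^ p = 1).
 { clear. unfold iw. induction n; cbn [prodR]; [rewrite pow1; ring|].
  rewrite Rpow_mult_distr. set (u := prodR n (fun i => (1 + x i ^ 2) ^ p)) in *.
  replace (u * (1 + x n ^ 2) ^ p * (prodR n (fun i => w1 (x i)) ^ p * w1 (x n) ^ p))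
   with ((u * prodR n (fun i => w1 (x i)) ^ p) * ((1 + x n ^ 2) ^ p * w1 (x n) ^ p)) by ring.
  rewrite IHn. rewrite <- Rpow_mult_distr. rewrite Rinv_r, pow1 by nra. ring. }
 note (pow_lt _ p (iw_pos n x)) as Hw.
 apply (Rmult_le_compat_r (iw n x ^ p)) in HK; [|lra].
 replace (prodR n (fun i => (1 + x i ^ 2) ^ p) * G x * iw n x ^ p)
  with (G x * (prodR n (fun i => (1 + x i ^ 2) ^ p) * iw n x ^ p)) in HK by ring.
 rewrite E2, Rmult_1_r in HK. eapply Rle_trans; [exact HK|].
 scale_r; apply Rle_abs.
Qed.

Lemma fst_le_Cmod z : Rabs (fst z) <= Cmod z.
Proof. bound Rmax_l; apply Rmax_Cmod. Qed.

Lemma snd_le_Cmod z : Rabs (snd z) <= Cmod z.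
Proof. bound Rmax_r; apply Rmax_Cmod. Qed.

Lemma Schwartz_SR n g : Schwartz n g -> SR n (fun x => fst (g (nproj n x))) /\ SR n (fun x => snd (g (nproj n x))).
Proof.
 intros [Hs Hb]. destruct (smoothR_components n g Hs) as [S1 S2].
 assert (HW : forall b p, exists K, forall x, in_Rn n x -> Cmod (dxa n b g x) <= K * iw n x ^ p).
 { intros b p. destruct (weight_of_monomials n (fun x => Cmod (dxa n b g x)) (fun x => Cmod_ge_0 _)) with (p := p) as [K [_ HK]].
  - intros a. apply (Hb a b).
  - triv. }
 split; (apply SR_of_ordered; [pos|]); intros b p; destruct (HW b p) as [K HK]; exists K; intros x.
 - rewrite (Dl_proj_inv n _ _ (proj1 S1) (dlist_lt n b) x), <- (iw_nproj n x).
  specialize (HK (nproj n x) (nproj_in_Rn n x)). rewrite dxa_fold, (Dl_components n g _ (dlist_lt n b)) in HK by apply nproj_in_Rn.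
  eapply Rle_trans; [|exact HK]. apply (fst_le_Cmod (_, _)).
 - rewrite (Dl_proj_inv n _ _ (proj1 S2) (dlist_lt n b) x), <- (iw_nproj n x).
  specialize (HK (nproj n x) (nproj_in_Rn n x)). rewrite dxa_fold, (Dl_components n g _ (dlist_lt n b)) in HK by apply nproj_in_Rn.
  eapply Rle_trans; [|exact HK]. apply (snd_le_Cmod (_, _)).
Qed.

Lemma fold_pdx_ofR f ds : fold_right pdx (ofR f) ds = ofR (Dl ds f).
Proof.
 induction ds as [|k ds IH]; [pos|]. simpl. rewrite IH. fext x.
 unfold pdx, DerC, ofR, pdr, RtoC. simpl. f_equal. apply Derive_const.
Qed.

Lemma xpow_iw_le n a x : Rabs (xpow n a x) * iw n x ^ sumN n a <= 1.
Proof.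
 assert (H : forall m S, (sumN m a <= S)%nat -> Rabs (xpow m a x) * iw m x ^ S <= 1).
 { induction m as [|m IH]; intros S HS; unfold xpow, iw in *; simpl.
  - rewrite Rabs_R1, pow1. lra.
  - rewrite Rabs_mult, Rpow_mult_distr. simpl in HS.
   specialize (IH S ltac:(lia)).

   assert (HC : Rabs (x m ^ a m) * w1 (x m) ^ S <= 1).
   { replace S with (a m + (S - a m))%nat by lia. rewrite pow_add, <- RPow_abs, <- Rmult_assoc, <- Rpow_mult_distr.
    note (w1_pos (x m)). note (w1_le_1 (x m)).
    assert (Hx : 0 <= Rabs (x m) * w1 (x m) <= 1).
    { split; [pos|].
     unfold w1. rewrite <- pow2_abs. note (pow2_ge_0 (Rabs (x m) - 1)). note (pow2_ge_0 (Rabs (x m))).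
     apply Rmult_le_reg_r with (1 + Rabs (x m) ^ 2); [lra|].
     rewrite Rmult_assoc, Rinv_l by lra. lra. }
    assert (H1 : (Rabs (x m) * w1 (x m)) ^ a m <= 1) by (rewrite <- (pow1 (a m)); apply pow_incr; lra).
    assert (H2 : w1 (x m) ^ (S - a m) <= 1) by (rewrite <- (pow1 (S - a m)); apply pow_incr; lra).
    assert (H3 : 0 <= (Rabs (x m) * w1 (x m)) ^ a m) by pos.
    nra. }
   assert (HD : 0 <= Rabs (x m ^ a m) * w1 (x m) ^ S).
   { apply Rmult_le_pos; [pos|apply pow_le; left; apply w1_pos]. }
   nra. }
 pos.
Qed.

Lemma SR_Schwartz n f : SR n f -> Schwartz n (ofR f).
Proof.
 intros [Hs Hb]. split.
 - intros ds k x Hds Hk Hx. rewrite fold_pdx_ofR. split; simpl.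
  + apply (proj2 Hs); [|pos]. apply Forall_forall. exact Hds.
  + apply ex_derive_const.
 - intros a b. destruct (Hb (dlist n b) (sumN n a) (dlist_lt n b)) as [K HK]. exists K.
  intros x Hx. rewrite dxa_fold, fold_pdx_ofR. unfold ofR. rewrite Cmod_R. specialize (HK x).
  note (xpow_iw_le n a x) as H. note (Rabs_pos (xpow n a x)).
  assert (HK0 : 0 <= K).
  { note (pow_lt _ (sumN n a) (iw_pos n x)). note (Rabs_pos (Dl (dlist n b) f x)). nra. }
  nra.
Qed.

(** * Sup bounds from square integrals *)

Lemma le_Rint_of_derivative K K1 (F F' G : R -> R) : dom1 K F -> dom1 K1 G -> (forall s, is_derive F s (F' s)) ->
 (forall s, continuous F' s) -> (forall s, F' s <= G s) -> (forall s, 0 <= G s) -> forall t, F t <= Rint G.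
Proof.
 intros HF HG HD HC HFG HG0 t. apply le_epsilon. intros eps He. note (dom1_K_pos K F HF) as HK.
 destruct (w1_small (eps / (K + 1))) as [M [HM Hw]]; [pos|].
 set (s := - (M + Rabs t + 1)). note (Rabs_pos t). note (Rle_abs (- t)) as Ht. rewrite Rabs_Ropp in Ht.
 assert (Hs : Rabs (F s) <= eps).
 { bound (proj2 HF). via (K * (eps / (K + 1))).
  - scale_l. left. apply Hw. unfold s. rewrite Rabs_Ropp, Rabs_pos_eq; lra.
  - apply Rmult_le_reg_r with (K + 1); [lra|]. field_simplify; lra. }
 assert (Hst : s <= t) by (unfold s; lra).
 assert (E : RInt F' s t = F t - F s) by (apply is_RInt_unique; apply (is_RInt_derive F F'); intros; auto).
 assert (RInt F' s t <= RInt G s t).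
 { apply RInt_le; auto; [apply (ex_RInt_continuous (V := R_CompleteNormedModule)); auto|apply (dom1_ex K1), HG]. }
 note (RInt_le_Rint K1 G s t HG HG0 Hst). apply Rabs_le_between in Hs. lra.
Qed.

(** Interpolates between a point value ([j = 0]) and the full integral ([j = n]), the last variables
    being integrated first. *)
Fixpoint Tint (n j : nat) (h : (nat -> R) -> R) : (nat -> R) -> R :=
 match j with O => h | S i => Iop (n - S i) (Tint n i h) end.

Lemma intRn_Tint n j h : (j <= n)%nat -> intRn n h = intRn (n - j) (Tint n j h).
Proof.
 induction j; intros H; [rewrite Nat.sub_0_r; reflexivity|].
 rewrite IHj by lia. replace (n - j)%nat with (S (n - S j)) by lia. pos.
Qed.

Section Sobolev.
Variables (n : nat) (f : (nat -> R) -> R).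
Hypothesis Hf : SR n f.

Definition hprod (a b : list nat) : (nat -> R) -> R := fun x => Dl a f x * Dl b f x.

Lemma Tint_En j a b : (j <= n)%nat -> lt_letters n a -> lt_letters n b -> exists K, En (n - j) K (Tint n j (hprod a b)).
Proof.
 intros Hj Ha Hb. induction j.
 - rewrite Nat.sub_0_r. apply (En_product n f f a b); auto.
 - destruct IHj as [K HK]; [lia|]. exists (PI * K). apply En_Iop.
  replace (S (n - S j)) with (n - j)%nat by lia. exact HK.
Qed.

Lemma Tint_isD j a b k : (j <= n)%nat -> lt_letters n a -> lt_letters n b -> (k < n - j)%nat ->
 isD k (Tint n j (hprod a b)) (fun x => Tint n j (hprod (k :: a) b) x + Tint n j (hprod a (k :: b)) x).
Proof.
 intros Hj Ha Hb Hk. induction j.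
 - apply isD_mult; apply (smoothR_isD n); try assumption; try apply Hf; lia.
 - assert (Hka : lt_letters n (k :: a)) by (apply lt_letters_cons; split; [lia|pos]).
  assert (Hkb : lt_letters n (k :: b)) by (apply lt_letters_cons; split; [lia|pos]).
  destruct (Tint_En j a b) as [K HK]; auto; [lia|].
  destruct (Tint_En j (k :: a) b) as [K1 HK1]; auto; [lia|].
  destruct (Tint_En j a (k :: b)) as [K2 HK2]; auto; [lia|].
  replace (n - j)%nat with (S (n - S j)) in HK, HK1, HK2 by lia.
  eapply isD_ext; [|apply (Iop_isD (n - S j) K (K1 + K2) _ (fun x => Tint n j (hprod (k :: a) b) x + Tint n j (hprod a (k :: b)) x)); auto].
  + intros x. apply (Iop_plus (n - S j) K1 K2); assumption.
  + apply En_plus; assumption.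
  + apply IHj; lia.
Qed.

Lemma Rint_le K K' u v : dom1 K u -> dom1 K' v -> (forall s, u s <= v s) -> Rint u <= Rint v.
Proof.
 intros Hu Hv H.
 assert (Hs : dom1 (Rabs (-1) * K) (fun s => (-1) * u s)).
 { split.
  - intros s. apply (continuous_scal_r (-1) u), (proj1 Hu).
  - intros s. rewrite Rabs_mult, Rmult_assoc. scale_l; apply (proj2 Hu). }
 assert (Hd : dom1 (K' + Rabs (-1) * K) (fun s => v s + (-1) * u s)).
 { split.
  - intros s. apply (continuous_plus v (fun s => (-1) * u s)); [apply (proj1 Hv)|apply (proj1 Hs)].
  - intros s. bound Rabs_triang. note (proj2 Hv s). note (proj2 Hs s).
   lra. }
 assert (E : 0 <= Rint (fun s => v s + (-1) * u s)) by (apply (Rint_nonneg _ _ Hd); intros s; specialize (H s); lra).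
 rewrite (Rint_plus _ _ _ _ Hv Hs), (Rint_scal _ _ _ Hu) in E. lra.
Qed.

Lemma Tint_nonneg j a : (j <= n)%nat -> lt_letters n a -> forall x, 0 <= Tint n j (hprod a a) x.
Proof.
 intros Hj Ha. induction j; intros x; [apply Rle_0_sqr|].
 destruct (Tint_En j a a) as [K HK]; auto; [lia|]. replace (n - j)%nat with (S (n - S j)) in HK by lia.
 apply (Rint_nonneg (K * iw (n - S j) x)); [apply En_dom1, HK|]. intros s. apply IHj. lia.
Qed.

Lemma Tint_cross j a b : (j <= n)%nat -> lt_letters n a -> lt_letters n b ->
 forall x, 2 * Tint n j (hprod a b) x <= Tint n j (hprod a a) x + Tint n j (hprod b b) x.
Proof.
 intros Hj Ha Hb. induction j; intros x.
 - simpl. unfold hprod. note (pow2_ge_0 (Dl a f x - Dl b f x)). lra.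
 - destruct (Tint_En j a b) as [K HK]; auto; [lia|].
  destruct (Tint_En j a a) as [K1 HK1]; auto; [lia|].
  destruct (Tint_En j b b) as [K2 HK2]; auto; [lia|].
  replace (n - j)%nat with (S (n - S j)) in HK, HK1, HK2 by lia. simpl.
  rewrite <- (Iop_scal (n - S j) K) by exact HK. rewrite <- (Iop_plus (n - S j) K1 K2) by assumption.
  apply (Rint_le (Rabs 2 * K * iw (n - S j) x) ((K1 + K2) * iw (n - S j) x)).
  + apply (En_dom1 (n - S j) (Rabs 2 * K) (fun y => 2 * Tint n j (hprod a b) y)), En_scal, HK.
  + apply (En_dom1 (n - S j) (K1 + K2) (fun y => Tint n j (hprod a a) y + Tint n j (hprod b b) y)), En_plus; assumption.
  + intros s. apply IHj. lia.
Qed.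

(** As a function of the coordinate [k], the partial integral of [h^2] decays and has as derivative
    the integral of [2 h d_k h], at most that of [h^2 + (d_k h)^2]; integrating from minus infinity
    removes the point evaluation in that variable. *)
Lemma Tint_step j a : (S j <= n)%nat -> lt_letters n a ->
 forall x, Tint n j (hprod a a) x <= Tint n (S j) (hprod a a) x + Tint n (S j) (hprod ((n - S j)%nat :: a) ((n - S j)%nat :: a)) x.
Proof.
 intros Hj Ha x. set (k := (n - S j)%nat).
 assert (Hka : lt_letters n (k :: a)) by (apply lt_letters_cons; split; [lia|pos]).
 destruct (Tint_En j a a) as [K HK]; auto; [lia|].
 destruct (Tint_En j (k :: a) (k :: a)) as [K1 HK1]; auto; [lia|].
 destruct (Tint_En j (k :: a) a) as [K2 HK2]; auto; [lia|].
 destruct (Tint_En j a (k :: a)) as [K3 HK3]; auto; [lia|].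
 replace (n - j)%nat with (S k) in HK, HK1, HK2, HK3 by lia.
 simpl. rewrite <- (Iop_plus k K K1) by assumption.
 rewrite <- (upd_id x k) at 1.
 apply (le_Rint_of_derivative (K * iw k x) ((K + K1) * iw k x) (fun s => Tint n j (hprod a a) (upd x k s))
  (fun s => Tint n j (hprod (k :: a) a) (upd x k s) + Tint n j (hprod a (k :: a)) (upd x k s))).
 - apply En_dom1, HK.
 - apply (En_dom1 k (K + K1) (fun y => Tint n j (hprod a a) y + Tint n j (hprod (k :: a) (k :: a)) y)), En_plus; assumption.
 - intros s. apply (isD_upd k (Tint n j (hprod a a)) (fun x => Tint n j (hprod (k :: a) a) x + Tint n j (hprod a (k :: a)) x)).
  apply Tint_isD; auto; unfold k; lia.
 - intros s. apply (continuous_plus (fun s => Tint n j (hprod (k :: a) a) (upd x k s))).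
  + apply (proj1 (En_dom1 k K2 _ x HK2)).
  + apply (proj1 (En_dom1 k K3 _ x HK3)).
 - intros s. note (Tint_cross j (k :: a) a ltac:(lia) Hka Ha (upd x k s)).
  note (Tint_cross j a (k :: a) ltac:(lia) Ha Hka (upd x k s)). lra.
 - intros s. note (Tint_nonneg j a ltac:(lia) Ha (upd x k s)).
  note (Tint_nonneg j (k :: a) ltac:(lia) Hka (upd x k s)). lra.
Qed.

Fixpoint subs (j : nat) : list (list nat) :=
 match j with O => [[]] | S i => flat_map (fun a => [a; (n - S i)%nat :: a]) (subs i) end.

Lemma subs_spec j a : (j <= n)%nat -> In a (subs j) -> lt_letters n a /\ (length a <= j)%nat.
Proof.
 revert a; induction j; intros a Hj Hin; simpl in Hin.
 - destruct Hin as [<-|[]]. split; [pos|pos].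
 - apply in_flat_map in Hin. destruct Hin as (b & Hb & Hin). apply IHj in Hb; [|lia]. destruct Hb as [H1 H2].
  destruct Hin as [<-|[<-|[]]]; [pos|].
  split; [apply lt_letters_cons; split; [lia|pos]|simpl; lia].
Qed.

Lemma Tint_proj_inv j a b x : (j <= n)%nat -> lt_letters n a -> lt_letters n b ->
 Tint n j (hprod a b) x = Tint n j (hprod a b) (nproj (n - j) x).
Proof.
 intros Hj Ha Hb. revert x; induction j; intros x.
 - rewrite Nat.sub_0_r. simpl. unfold hprod.
  rewrite <- (Dl_proj_inv n f a (proj1 (proj1 Hf)) Ha x), <- (Dl_proj_inv n f b (proj1 (proj1 Hf)) Hb x). reflexivity.
 - simpl. unfold Iop. f_equal. fext s.
  rewrite (IHj ltac:(lia) (upd x _ s)), (IHj ltac:(lia) (upd (nproj _ x) _ s)). f_equal.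
  fext i. unfold nproj, upd.
  destruct (Nat.ltb_spec i (n - j)); [|lra]. destruct (Nat.eqb_spec i (n - S j)); [lra|].
  destruct (Nat.ltb_spec i (n - S j)); [lra|lia].
Qed.

Theorem sobolev_sup x : f x ^ 2 <= lsum (subs n) (fun l => intRn n (fun y => Dl l f y ^ 2)).
Proof.
 assert (H : forall j, (j <= n)%nat -> f x ^ 2 <= lsum (subs j) (fun a => Tint n j (hprod a a) x)).
 { induction j; intros Hj.
  - unfold hprod. simpl. lra.
  - eapply Rle_trans; [apply IHj; lia|]. cbn [subs]. rewrite lsum_flat_map. apply lsum_le. intros a Ha.
   apply subs_spec in Ha; [|lia]. unfold lsum; cbn [fold_right]. rewrite Rplus_0_r.
   apply Tint_step; [pos|tauto]. }
 bound (H n (le_n n)). apply lsum_le. intros a Ha. apply subs_spec in Ha; [|lia].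
 right. rewrite (Tint_proj_inv n a a x) by triv.
 transitivity (intRn n (hprod a a)).
 - rewrite (intRn_Tint n n) by lia. rewrite Nat.sub_diag. simpl. f_equal.
 - apply intRn_ext. intros y _. unfold hprod. ring.
Qed.

End Sobolev.

(** * The operators [x_i] and [D_i] on complex Schwartz functions *)

Definition RS (n : nat) : Type := {f : (nat -> R) -> R | SR n f}.

Lemma RS_eq n (f g : RS n) : (forall x, proj1_sig f x = proj1_sig g x) -> f = g.
Proof.
 destruct f as [f Hf], g as [g Hg]. intros H.
 assert (E : f = g) by (apply functional_extensionality; exact H). subst. f_equal. apply proof_irrelevance.
Qed.

(** Letters below [n] are positions, the following [n] are derivatives, any other letter gives 0.
    The operators are kept real; [yphase] supplies the factor that makes derivatives symmetric. *)
Definition Yop (n i : nat) (f : (nat -> R) -> R) : (nat -> R) -> R :=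
 if Nat.ltb i n then mulx i f else if Nat.ltb i (2 * n) then pdr (i - n) f else fun _ => 0.

Definition Yw (n : nat) (w : list nat) (f : (nat -> R) -> R) : (nat -> R) -> R := fold_right (Yop n) f w.

Lemma SR_zero n : SR n (fun _ => 0).
Proof.
 assert (H : forall ds, Dl ds (fun _ => 0) = fun _ => 0).
 { induction ds as [|k ds IH]; [pos|]. simpl. rewrite IH. fext x.
  exact (Derive_const 0 (x k)). }
 split; [split|].
 - intros x. reflexivity.
 - intros ds k x _ _. rewrite H. apply ex_derive_const.
 - exists 0. intros x. rewrite H, Rabs_R0. lra.
Qed.

Lemma SR_Yop n i f : SR n f -> SR n (Yop n i f).
Proof.
 intros H. unfold Yop. destruct (Nat.ltb_spec i n); [apply SR_mulx; assumption|].
 destruct (Nat.ltb_spec i (2 * n)); [apply SR_pdr; [lia|pos]|apply SR_zero].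
Qed.

Lemma SR_Yw n w f : SR n f -> SR n (Yw n w f).
Proof. intros H. induction w; simpl; [pos|apply SR_Yop; exact IHw]. Qed.

Lemma Yw_app n a b f : Yw n (a ++ b) f = Yw n a (Yw n b f).
Proof. apply fold_right_app. Qed.

Lemma pdr_plus n k f g : SR n f -> SR n g -> (k < n)%nat -> forall x, pdr k (fun x => f x + g x) x = pdr k f x + pdr k g x.
Proof.
 intros Hf Hg Hk x. assert (Hl : lt_letters n [k]) by (repeat constructor; exact Hk).
 exact (f_equal (fun h => h x) (Dl_plus n f g [k] (proj1 Hf) (proj1 Hg) Hl)).
Qed.

Lemma pdr_scal n k c f : SR n f -> (k < n)%nat -> forall x, pdr k (fun x => c * f x) x = c * pdr k f x.
Proof.
 intros Hf Hk x. assert (Hl : lt_letters n [k]) by (repeat constructor; exact Hk).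
 exact (f_equal (fun h => h x) (Dl_scal n c f [k] (proj1 Hf) Hl)).
Qed.

Lemma Yop_plus n i f g : SR n f -> SR n g -> forall x, Yop n i (fun x => f x + g x) x = Yop n i f x + Yop n i g x.
Proof.
 intros Hf Hg x. unfold Yop. destruct (Nat.ltb_spec i n); [unfold mulx; ring|].
 destruct (Nat.ltb_spec i (2 * n)); [apply (pdr_plus n); auto; lia|ring].
Qed.

Lemma Yop_scal n i c f : SR n f -> forall x, Yop n i (fun x => c * f x) x = c * Yop n i f x.
Proof.
 intros Hf x. unfold Yop. destruct (Nat.ltb_spec i n); [unfold mulx; ring|].
 destruct (Nat.ltb_spec i (2 * n)); [apply (pdr_scal n); auto; lia|ring].
Qed.

Lemma Yop_adj n i f g : SR n f -> SR n g -> intRn n (fun x => Yop n i f x * g x)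
 = (if Nat.ltb i n then 1 else -1) * intRn n (fun x => f x * Yop n i g x).
Proof.
 intros Hf Hg. unfold Yop. destruct (Nat.ltb_spec i n).
 - rewrite Rmult_1_l. apply intRn_ext. intros x _. unfold mulx. ring.
 - destruct (Nat.ltb_spec i (2 * n)).
  + rewrite (intRn_by_parts n) by (auto; lia). ring.
  + rewrite (intRn_ext n (fun x => f x * 0) (fun x => 0 * g x)) by triv.
   destruct (En_mult n _ _ (SR_zero n) Hg) as [K HK].
   note (intRn_scal n _ 0 _ HK) as E.
   rewrite (intRn_ext n _ (fun x => 0 * g x)) in E by triv. lra.
Qed.

Lemma pdr_comm n i j f : SR n f -> (i < n)%nat -> (j < n)%nat -> pdr i (pdr j f) = pdr j (pdr i f).
Proof.
 intros Hf Hi Hj. destruct (Nat.eq_dec i j) as [->|Hij]; [pos|].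
 fext x.
 assert (Hl : lt_letters n [j; j; i]) by (repeat constructor; assumption).
 destruct (proj2 Hf [j; j; i] O Hl) as [K HK].
 apply (clairaut_bounded n f i j K (proj1 Hf) Hi Hj Hij). intros y. specialize (HK y). lra.
Qed.

Lemma pdr_mulx n i k f : SR n f -> (i < n)%nat ->
 forall x, pdr i (mulx k f) x = mulx k (pdr i f) x + (if Nat.eqb k i then f x else 0).
Proof.
 intros Hf Hi x.
 assert (Hd : isD i f (pdr i f)) by (apply (smoothR_isD n f [] i (proj1 Hf)); [pos|pos]).
 note (isD_pdr _ _ _ (isD_mult i _ _ _ _ (isD_coord i k) Hd)) as E.
 unfold mulx at 1. rewrite E. unfold mulx.
 destruct (Nat.eqb k i); ring.
Qed.

Definition ycomm (n i j : nat) : R :=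
 if andb (Nat.ltb i n) (Nat.eqb j (n + i)) then -1 else if andb (Nat.ltb j n) (Nat.eqb i (n + j)) then 1 else 0.

Lemma Yop_comm n i j f : SR n f -> forall x, Yop n i (Yop n j f) x = Yop n j (Yop n i f) x + ycomm n i j * f x.
Proof.
 intros Hf x. unfold ycomm.
 assert (Z : forall k, Yop n k (fun _ : nat -> R => 0) x = 0).
 { intros k. unfold Yop. destruct (Nat.ltb k n); [unfold mulx; ring|].
  destruct (Nat.ltb k (2 * n)); [exact (Derive_const 0 (x (k - n)%nat))|lra]. }
 unfold Yop at 2. unfold Yop at 3.
 destruct (Nat.ltb_spec i n) as [Hi|Hi], (Nat.ltb_spec j n) as [Hj|Hj]; simpl andb.
 - destruct (Nat.eqb_spec j (n + i)); [lia|]. destruct (Nat.eqb_spec i (n + j)); [lia|].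
  unfold Yop. destruct (Nat.ltb_spec i n), (Nat.ltb_spec j n); try lia. unfold mulx. ring.
 - destruct (Nat.ltb_spec j (2 * n)) as [Hj2|Hj2].
  + unfold Yop. destruct (Nat.ltb_spec i n), (Nat.ltb_spec j n), (Nat.ltb_spec j (2 * n)); try lia.
   rewrite (pdr_mulx n) by (auto; lia).
   destruct (Nat.eqb_spec i (j - n)), (Nat.eqb_spec j (n + i)); try lia; ring.
  + rewrite Z. unfold Yop. destruct (Nat.ltb_spec j n), (Nat.ltb_spec j (2 * n)); try lia.
   destruct (Nat.eqb_spec j (n + i)); [lia|]. ring.
 - destruct (Nat.ltb_spec i (2 * n)) as [Hi2|Hi2].
  + unfold Yop. destruct (Nat.ltb_spec i n), (Nat.ltb_spec i (2 * n)), (Nat.ltb_spec j n); try lia.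
   rewrite (pdr_mulx n) by (auto; lia).
   destruct (Nat.eqb_spec j (i - n)), (Nat.eqb_spec i (n + j)); try lia; ring.
  + rewrite Z. unfold Yop. destruct (Nat.ltb_spec i n), (Nat.ltb_spec i (2 * n)); try lia.
   destruct (Nat.eqb_spec i (n + j)); [lia|]. ring.
 - destruct (Nat.ltb_spec j (2 * n)) as [Hj2|Hj2], (Nat.ltb_spec i (2 * n)) as [Hi2|Hi2]; rewrite ?Z; unfold Yop;
   destruct (Nat.ltb_spec i n), (Nat.ltb_spec j n), (Nat.ltb_spec i (2 * n)), (Nat.ltb_spec j (2 * n)); try lia; try ring.
  rewrite (pdr_comm n (i - n) (j - n)) by (auto; lia). ring.
Qed.

Section Instance.
Variable n : nat.

Definition rs_add (f g : RS n) : RS n := exist _ _ (SR_plus n _ _ (proj2_sig f) (proj2_sig g)).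
Definition rs_scal (c : R) (f : RS n) : RS n := exist _ _ (SR_scal n c _ (proj2_sig f)).
Definition rs_Y (i : nat) (f : RS n) : RS n := exist _ _ (SR_Yop n i _ (proj2_sig f)).
Definition rs_ip (f g : RS n) : R := intRn n (fun x => proj1_sig f x * proj1_sig g x).

Lemma rs_ip_add f g h : rs_ip (rs_add f g) h = rs_ip f h + rs_ip g h.
Proof.
 destruct (En_mult n _ _ (proj2_sig f) (proj2_sig h)) as [K1 H1].
 destruct (En_mult n _ _ (proj2_sig g) (proj2_sig h)) as [K2 H2].
 unfold rs_ip. rewrite <- (intRn_plus n _ _ _ _ H1 H2). apply intRn_ext. intros; simpl; ring.
Qed.

Lemma rs_ip_scal c f h : rs_ip (rs_scal c f) h = c * rs_ip f h.
Proof.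
 destruct (En_mult n _ _ (proj2_sig f) (proj2_sig h)) as [K1 H1].
 unfold rs_ip. rewrite <- (intRn_scal n _ c _ H1). apply intRn_ext. intros; simpl; ring.
Qed.

Lemma rs_ip_sym f g : rs_ip f g = rs_ip g f.
Proof. apply intRn_ext. triv. Qed.

Lemma rs_ip_pos f : 0 <= rs_ip f f.
Proof.
 destruct (En_mult n _ _ (proj2_sig f) (proj2_sig f)) as [K1 H1].
 apply (intRn_nonneg n K1); [pos|]. triv.
Qed.

Lemma rs_ip_Y i f g : rs_ip (rs_Y i f) g = (if Nat.ltb i n then 1 else -1) * rs_ip f (rs_Y i g).
Proof. apply Yop_adj; apply proj2_sig. Qed.

Definition cs : Type := (RS n * RS n)%type.
Definition cs_add (u v : cs) : cs := (rs_add (fst u) (fst v), rs_add (snd u) (snd v)).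
Definition cs_sc (c : C) (u : cs) : cs :=
 (rs_add (rs_scal (fst c) (fst u)) (rs_scal (- snd c) (snd u)),
  rs_add (rs_scal (fst c) (snd u)) (rs_scal (snd c) (fst u))).
Definition cs_ip (u v : cs) : C :=
 (rs_ip (fst u) (fst v) + rs_ip (snd u) (snd v), rs_ip (snd u) (fst v) - rs_ip (fst u) (snd v)).
Definition yphase (i : nat) : C := if Nat.ltb i n then RtoC 1 else (0, -1).
Definition cs_Y (i : nat) (u : cs) : cs := (rs_Y i (fst u), rs_Y i (snd u)).
Definition cs_X (i : nat) (u : cs) : cs := cs_sc (yphase i) (cs_Y i u).
Definition cs_comm (i j : nat) : C := Cmult (Cmult (yphase i) (yphase j)) (RtoC (ycomm n i j)).

Ltac cs_solve := intros; unfold cs_add, cs_sc; apply injective_projections; apply RS_eq; intros; simpl; ring.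

Lemma cs_Y_sc i c u : cs_Y i (cs_sc c u) = cs_sc c (cs_Y i u).
Proof.
 apply injective_projections; apply RS_eq; intros x; simpl;
  rewrite Yop_plus by (apply SR_scal, proj2_sig); rewrite !Yop_scal by apply proj2_sig; reflexivity.
Qed.

Lemma cs_sc_sc a b u : cs_sc a (cs_sc b u) = cs_sc (Cmult a b) u.
Proof. cs_solve. Qed.

Lemma cs_X_sc i c u : cs_X i (cs_sc c u) = cs_sc c (cs_X i u).
Proof. unfold cs_X. rewrite cs_Y_sc, !cs_sc_sc. f_equal. ring. Qed.

Lemma cs_ip_sc c u v : cs_ip (cs_sc c u) v = Cmult c (cs_ip u v).
Proof.
 apply injective_projections; simpl; rewrite !rs_ip_add, !rs_ip_scal; ring.
Qed.

Lemma cs_ip_conj u v : cs_ip v u = Cconj (cs_ip u v).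
Proof.
 unfold cs_ip, Cconj. simpl. f_equal.
 - rewrite (rs_ip_sym (fst v) (fst u)), (rs_ip_sym (snd v) (snd u)). reflexivity.
 - rewrite (rs_ip_sym (snd v) (fst u)), (rs_ip_sym (fst v) (snd u)). ring.
Qed.

Lemma yphase_conj i : Cconj (yphase i) = Cmult (RtoC (if Nat.ltb i n then 1 else -1)) (yphase i).
Proof. unfold yphase. destruct (Nat.ltb i n); apply injective_projections; simpl; ring. Qed.

Lemma cs_X_sym i u v : cs_ip (cs_X i u) v = cs_ip u (cs_X i v).
Proof.
 unfold cs_X. rewrite cs_ip_sc, (cs_ip_conj _ u), cs_ip_sc, Cmult_conj, <- cs_ip_conj, yphase_conj.
 unfold cs_ip, cs_Y. simpl. rewrite !rs_ip_Y. destruct (Nat.ltb i n);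
 apply injective_projections; simpl; ring.
Qed.

Lemma cs_comm_le i j : Cmod (cs_comm i j) <= 1.
Proof.
 unfold cs_comm. rewrite !Cmod_mult, Cmod_R.
 assert (Hp : forall k, Cmod (yphase k) = 1).
 { intros k. unfold yphase. destruct (Nat.ltb k n); [apply Cmod_1|].
  unfold Cmod. simpl. replace (0 * (0 * 1) + -1 * (-1 * 1)) with 1 by ring. apply sqrt_1. }
 rewrite !Hp, !Rmult_1_l. unfold ycomm. destruct (andb _ _); [|destruct (andb _ _)];
  unfold Rabs; destruct (Rcase_abs _); lra.
Qed.

Lemma cs_X_comm i j u : cs_X i (cs_X j u) = cs_add (cs_X j (cs_X i u)) (cs_sc (cs_comm i j) u).
Proof.
 unfold cs_X. rewrite !cs_Y_sc, !cs_sc_sc.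
 apply injective_projections; apply RS_eq; intros x; simpl;
  rewrite !(Yop_comm n i j) by apply proj2_sig; ring.
Qed.

Lemma cs_X_add i u v : cs_X i (cs_add u v) = cs_add (cs_X i u) (cs_X i v).
Proof.
 apply injective_projections; apply RS_eq; intros x; simpl;
  rewrite !Yop_plus by apply proj2_sig; ring.
Qed.

Lemma cs_vadd_comm u v : cs_add u v = cs_add v u. Proof. cs_solve. Qed.
Lemma cs_vadd_assoc u v w : cs_add u (cs_add v w) = cs_add (cs_add u v) w. Proof. cs_solve. Qed.
Lemma cs_sc_1 u : cs_sc (RtoC 1) u = u. Proof. cs_solve. Qed.
Lemma cs_sc_0 u v : cs_sc (RtoC 0) u = cs_sc (RtoC 0) v. Proof. cs_solve. Qed.
Lemma cs_sc_plus a b u : cs_add (cs_sc a u) (cs_sc b u) = cs_sc (Cplus a b) u. Proof. cs_solve. Qed.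
Lemma cs_sc_add a u v : cs_sc a (cs_add u v) = cs_add (cs_sc a u) (cs_sc a v). Proof. cs_solve. Qed.
Lemma cs_ip_add u v w : cs_ip (cs_add u v) w = Cplus (cs_ip u w) (cs_ip v w).
Proof. apply injective_projections; simpl; rewrite !rs_ip_add; ring. Qed.
Lemma cs_ip_pos u : 0 <= fst (cs_ip u u).
Proof. apply Rplus_le_le_0_compat; apply rs_ip_pos. Qed.

Definition schwartz_space : opspace :=
 OpSpace cs cs_add cs_sc cs_ip cs_X cs_comm cs_vadd_comm cs_vadd_assoc cs_sc_1 cs_sc_0 cs_sc_sc
  cs_sc_plus cs_sc_add cs_ip_add cs_ip_sc cs_ip_conj cs_ip_pos cs_X_add cs_X_sc cs_X_sym cs_comm_le cs_X_comm.

(** * Eigenfunctions of the operator *)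

Definition rs_Yw (w : list nat) (f : RS n) : RS n := exist _ _ (SR_Yw n w _ (proj2_sig f)).
Definition wphase (w : list nat) : C := fold_right (fun i c => Cmult (yphase i) c) (RtoC 1) w.

Lemma W_schwartz w (u : cs) : W schwartz_space w u = cs_sc (wphase w) (rs_Yw w (fst u), rs_Yw w (snd u)).
Proof.
 induction w as [|i w IH].
 - rewrite cs_sc_1. apply injective_projections; apply RS_eq; reflexivity.
 - change (W schwartz_space (i :: w) u) with (cs_X i (W schwartz_space w u)). rewrite IH, cs_X_sc.
  unfold cs_X. rewrite cs_sc_sc. simpl wphase. rewrite (Cmult_comm (yphase i)).
  apply injective_projections; apply RS_eq; reflexivity.
Qed.

Lemma wphase_norm w : Cmod (wphase w) = 1.
Proof.
 induction w as [|i w IH]; simpl; [apply Cmod_1|]. rewrite Cmod_mult, IH, Rmult_1_r.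
 unfold yphase. destruct (Nat.ltb i n); [apply Cmod_1|].
 unfold Cmod. simpl. replace (0 * (0 * 1) + -1 * (-1 * 1)) with 1 by ring. apply sqrt_1.
Qed.

Definition rs_zero : RS n := exist _ _ (SR_zero n).

Lemma nrm2_W_real w (f : RS n) : nrm2 schwartz_space (W schwartz_space w (f, rs_zero)) = intRn n (fun x => Yw n w (proj1_sig f) x ^ 2).
Proof.
 rewrite W_schwartz, (nrm2_sc schwartz_space), wphase_norm, pow1, Rmult_1_l.
 unfold nrm2. simpl.
 assert (E : rs_ip (rs_Yw w rs_zero) (rs_Yw w rs_zero) = 0).
 { assert (Z : forall x, Yw n w (fun _ => 0) x = 0).
  { intros x. revert x. induction w as [|i w IH]; intros x; [pos|]. simpl.
   replace (Yw n w (fun _ => 0)) with (fun _ : nat -> R => 0) by (apply functional_extensionality; intros; rewrite IH; reflexivity).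
   unfold Yop. destruct (Nat.ltb i n); [unfold mulx; ring|].
   destruct (Nat.ltb i (2 * n)); [exact (Derive_const 0 (x (i - n)%nat))|lra]. }
  assert (Zw : rs_Yw w rs_zero = rs_scal 0 rs_zero) by (apply RS_eq; intros x; simpl; rewrite Z; ring).
  rewrite Zw, rs_ip_scal. ring. }
 rewrite E, Rplus_0_r. apply intRn_ext. intros x _. simpl. ring.
Qed.

Fixpoint xlist (m : nat) (b : nat -> nat) : list nat :=
 match m with O => [] | S k => repeat k (b k) ++ xlist k b end.
Definition mono_word (mo : monom) : list nat :=
 let '(c, a, b) := mo in xlist n b ++ map (fun k => (n + k)%nat) (dlist n a).
(** The power of [i] comes from writing each derivative as [i D]: the words are in the symmetric
    letters [x_k] and [D_k], and the top-degree symbol becomes the one in the ellipticity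
    hypothesis. *)
Definition mono_coef (mo : monom) : C := let '(c, a, b) := mo in Cmult (RtoC c) (Cpow_ Ci (sumN n a)).
Definition formF (Pl : list monom) : fs := map (fun mo => (mono_coef mo, mono_word mo)) Pl.
Definition mono_deg (mo : monom) : nat := let '(c, a, b) := mo in (sumN n a + sumN n b)%nat.

Definition PR (Pl : list monom) (f : (nat -> R) -> R) : (nat -> R) -> R :=
 fun x => lsum Pl (fun mo => let '(c, a, b) := mo in c * xpow n b x * Dl (dlist n a) f x).

Lemma applyP_PR Pl f x : applyP n Pl (ofR f) x = RtoC (PR Pl f x).
Proof.
 induction Pl as [|[[c a] b] Pl IH]; simpl; [pos|].
 rewrite IH, dxa_fold, fold_pdx_ofR. unfold ofR. rewrite <- RtoC_mult, <- RtoC_plus. pos.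
Qed.

Lemma xlist_lt m b : lt_letters m (xlist m b).
Proof. exact (dlist_lt m b). Qed.

Lemma sumN_dlist m a : length (dlist m a) = sumN m a.
Proof. induction m; simpl; [pos|]. rewrite length_app, repeat_length, IHm. lia. Qed.

Lemma mono_word_spec mo : lt_letters (2 * n) (mono_word mo) /\ length (mono_word mo) = mono_deg mo.
Proof.
 destruct mo as [[c a] b]. simpl. split.
 - apply Forall_app. split.
  + apply (lt_letters_le n); [lia|apply xlist_lt].
  + apply Forall_map. note (dlist_lt n a) as H. eapply Forall_impl; [|exact H]. simpl; intros; lia.
 - rewrite length_app, length_map, sumN_dlist. rewrite sumN_dlist. lia.
Qed.

Lemma Yw_xlist m b f x : (m <= n)%nat -> Yw n (xlist m b) f x = xpow m b x * f x.
Proof.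
 intros Hm. induction m as [|m IH]; simpl.
 - unfold xpow; simpl. ring.
 - rewrite Yw_app. unfold xpow; simpl. fold (xpow m b x).
  assert (H : forall r g, Yw n (repeat m r) g x = x m ^ r * g x).
  { induction r; intros g; simpl; [ring|]. unfold Yop. destruct (Nat.ltb_spec m n); [|lia].
   unfold mulx. rewrite IHr. ring. }
  rewrite H, IH by lia. ring.
Qed.

Lemma Yw_dlist ds f : lt_letters n ds -> Yw n (map (fun k => (n + k)%nat) ds) f = Dl ds f.
Proof.
 induction ds as [|k ds IH]; intros H; [pos|]. apply lt_letters_cons in H. destruct H as [Hk H].
 simpl. rewrite IH by exact H. unfold Yop. destruct (Nat.ltb_spec (n + k) n); [lia|].
 destruct (Nat.ltb_spec (n + k) (2 * n)); [|lia]. replace (n + k - n)%nat with k by lia. pos.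
Qed.

Lemma Yw_mono c a b f x : Yw n (mono_word (c, a, b)) f x = xpow n b x * Dl (dlist n a) f x.
Proof.
 unfold mono_word. rewrite Yw_app, Yw_xlist, Yw_dlist by (try apply dlist_lt; lia). lra.
Qed.

Lemma wphase_app a b : wphase (a ++ b) = Cmult (wphase a) (wphase b).
Proof. induction a; simpl; [ring|rewrite IHa; ring]. Qed.

Lemma mono_phase mo : Cmult (mono_coef mo) (wphase (mono_word mo)) = RtoC (fst (fst mo)).
Proof.
 destruct mo as [[c a] b]. simpl. rewrite wphase_app.
 assert (H1 : wphase (xlist n b) = RtoC 1).
 { assert (H : lt_letters n (xlist n b)) by apply xlist_lt. induction (xlist n b) as [|i l IH]; [pos|].
  apply lt_letters_cons in H. destruct H as [Hi H]. simpl. rewrite IH by exact H. unfold yphase.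
  destruct (Nat.ltb_spec i n); [ring|lia]. }
 assert (H2 : forall ds, Cmult (Cpow_ Ci (length ds)) (wphase (map (fun k => (n + k)%nat) ds)) = RtoC 1).
 { induction ds as [|k ds IH]; [simpl; ring|]. simpl. unfold yphase at 1. destruct (Nat.ltb_spec (n + k) n); [lia|].
  rewrite <- IH.
  apply injective_projections; simpl; ring. }
 rewrite H1. specialize (H2 (dlist n a)). rewrite sumN_dlist in H2.
 replace (Cmult (Cmult (RtoC c) (Cpow_ Ci (sumN n a))) (Cmult (RtoC 1) (wphase (map (fun k => (n + k)%nat) (dlist n a)))))
  with (Cmult (RtoC c) (Cmult (Cpow_ Ci (sumN n a)) (wphase (map (fun k => (n + k)%nat) (dlist n a))))) by ring.
 rewrite H2. ring.
Qed.

Lemma Op_formF Pl (u : cs) :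
 (forall x, proj1_sig (fst (Op schwartz_space (formF Pl) u : cs)) x = PR Pl (proj1_sig (fst u)) x) /\
 (forall x, proj1_sig (snd (Op schwartz_space (formF Pl) u : cs)) x = PR Pl (proj1_sig (snd u)) x).
Proof.
 induction Pl as [|mo Pl [IH1 IH2]].
 - split; intros x; simpl; unfold PR; simpl; ring.
 - assert (E : Op schwartz_space (formF (mo :: Pl)) u
   = cs_add (cs_sc (RtoC (fst (fst mo))) (rs_Yw (mono_word mo) (fst u), rs_Yw (mono_word mo) (snd u))) (Op schwartz_space (formF Pl) u)).
  { rewrite <- mono_phase, <- cs_sc_sc, <- W_schwartz. pos. }
  rewrite E. destruct mo as [[c a] b].
  split; intros x; cbn -[mono_word Yw PR Op formF].
  + rewrite IH1, !Yw_mono. unfold PR, lsum; cbn [fold_right]. ring.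
  + rewrite IH2, !Yw_mono. unfold PR, lsum; cbn [fold_right]. ring.
Qed.

End Instance.

Lemma ev_repeat z k r : ev z (repeat k r) = z k ^ r.
Proof. induction r; simpl; [lra|nra]. Qed.

Lemma ev_xlist z m b : ev z (xlist m b) = xpow m b z.
Proof.
 unfold xpow. induction m as [|m IH]; simpl; [lra|]. rewrite ev_app, IH, ev_repeat. ring.
Qed.

Lemma ev_map z h w : ev z (map h w) = ev (fun k => z (h k)) w.
Proof. induction w; simpl; congruence. Qed.

Lemma evF_formF n Pl z : evF z (formF n Pl)
 = csum Pl (fun mo => let '(c, a, b) := mo in
   Cmult (RtoC (c * xpow n b z * xpow n a (fun k => z (n + k)%nat))) (Cpow_ Ci (sumN n a))).
Proof.
 unfold evF, LF, formF. rewrite csum_map. apply csum_ext. intros [[c a] b] _. simpl.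
 rewrite ev_app, ev_xlist, ev_map. rewrite ev_xlist, !RtoC_mult. ring.
Qed.

Lemma principal_csum n m Pl x xi : principal n m Pl x xi
 = csum (filter (fun mo => Nat.eqb (mono_deg n mo) m) Pl) (fun mo => let '(c, a, b) := mo in
   Cmult (RtoC (c * xpow n b x * xpow n a xi)) (Cpow_ Ci (sumN n a))).
Proof.
 induction Pl as [|[[c a] b] Pl IH]; [pos|]. simpl.
 destruct (Nat.eqb _ m); simpl; rewrite IH; reflexivity.
Qed.

Lemma xpow_ext n a x y : (forall k, (k < n)%nat -> x k = y k) -> xpow n a x = xpow n a y.
Proof. intros H. apply prodR_ext. intros i Hi. rewrite H by exact Hi. lra. Qed.

Definition elliptic_form (n m : nat) (Pl : list monom) : Prop :=
 (forall c a b, In (c, a, b) Pl -> (sumN n a + sumN n b <= m)%nat) /\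
 (forall x xi, in_Rn n x -> in_Rn n xi ->
   (exists k, (k < n)%nat /\ (x k <> 0 \/ xi k <> 0)) -> principal n m Pl x xi <> RtoC 0).

Lemma principal_nonzero n m Pl z : elliptic_form n m Pl -> (exists i, (i < 2 * n)%nat /\ z i <> 0) ->
 evF z (formF n (filter (fun mo => Nat.eqb (mono_deg n mo) m) Pl)) <> RtoC 0.
Proof.
 intros [_ H] (i & Hi & Hz).
 assert (E : principal n m Pl (nproj n z) (nproj n (fun k => z (n + k)%nat)) <> RtoC 0).
 { apply H; [apply nproj_in_Rn|apply nproj_in_Rn|]. destruct (Nat.ltb_spec i n).
  - exists i. split; [pos|left]. rewrite nproj_at by assumption. exact Hz.
  - exists (i - n)%nat. split; [lia|right]. rewrite nproj_at by lia. replace (n + (i - n))%nat with i by lia. exact Hz. }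
 intros E0. apply E. rewrite principal_csum. rewrite evF_formF in E0. rewrite <- E0. apply csum_ext.
 intros [[c a] b] _. rewrite (xpow_ext n b (nproj n z) z) by (intros; apply nproj_at; assumption).
 rewrite (xpow_ext n a (nproj n _) (fun k => z (n + k)%nat))
  by (intros k Hk; apply (nproj_at n (fun k => z (n + k)%nat)); exact Hk). pos.
Qed.

Lemma PR_filter n (p : monom -> bool) Pl f x : PR n (filter p Pl) f x + PR n (filter (fun mo => negb (p mo)) Pl) f x = PR n Pl f x.
Proof.
 induction Pl as [|[[c a] b] Pl IH]; simpl; [ring|]. rewrite <- IH.
 destruct (p (c, a, b)); simpl; ring.
Qed.

Lemma Dl_zero ds x : Dl ds (fun _ => 0) x = 0.
Proof.
 revert x. induction ds as [|k ds IH]; intros x; [pos|]. simpl. unfold pdr.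
 rewrite (Derive_ext _ (fun _ => 0)) by pos. apply Derive_const.
Qed.

Lemma PR_zero n Pl x : PR n Pl (fun _ => 0) x = 0.
Proof. apply lsum_0. intros [[c a] b] _. rewrite Dl_zero. ring. Qed.

(** The monomials of degree [m] form the principal symbol, for which ellipticity provides the
    sum-of-squares certificate; the remaining monomials are of lower order. *)
Theorem eigenfunction_L2_bound n m Pl : (1 <= n)%nat -> (2 <= m)%nat -> elliptic_form n m Pl ->
 exists K A, 0 <= K /\ 1 <= A /\ forall f (lam Th : R), SR n f ->
 (forall x, PR n Pl f x = lam * f x) -> intRn n (fun x => f x ^ 2) = 1 -> 1 <= Th -> lam ^ 2 <= Th ^ m ->
 forall w, lt_letters (2 * n) w ->
  intRn n (fun x => Yw n w f x ^ 2) <= K * A ^ length w * (Th + INR (length w)) ^ length w.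
Proof.
 intros Hn Hm Hell. set (p := fun mo => Nat.eqb (mono_deg n mo) m).
 set (Pm := formF n (filter p Pl)). set (Pw := formF n (filter (fun mo => negb (p mo)) Pl)).
 assert (HPm : homog (2 * n) m Pm).
 { intros cw Hin. apply in_map_iff in Hin. destruct Hin as (mo & <- & Hin). apply filter_In in Hin.
  destruct Hin as [_ Hp]. apply Nat.eqb_eq in Hp. destruct (mono_word_spec n mo) as [H1 H2].
  split; [pos|simpl; lia]. }
 assert (HPw : low_order (2 * n) m Pw).
 { intros cw Hin. apply in_map_iff in Hin. destruct Hin as (mo & <- & Hin). apply filter_In in Hin.
  destruct Hin as [Hin Hp]. destruct (mono_word_spec n mo) as [H1 H2].
  split; [pos|]. destruct mo as [[c a] b]. unfold p in Hp.
  apply (proj1 Hell) in Hin. simpl in *. destruct (Nat.eqb_spec (sumN n a + sumN n b) m); [lra|lia]. }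
 destruct (sos_certificate (2 * n) m Pm ltac:(lia) ltac:(lia) HPm) as (c & N & L & Hc & HL & Hid).
 { intros z Hz. apply principal_nonzero; assumption. }
 set (Sp := schwartz_space n).
 destruct (eigen_word_bound Sp (2 * n) Pm Pw m N c L (fun u => vadd (Op Sp Pm u) (Op Sp Pw u)) HPm HPw Hm Hc HL Hid
  (fun u => eq_refl)) as (K & A & HK & HA & H).
 exists K, A. split; [lra|]. split; [lra|]. intros f lam Th Hf HPf H1 HT Hlam w Hw.
 set (fr := exist _ f Hf : RS n).
 change (fun x => Yw n w f x ^ 2) with (fun x => Yw n w (proj1_sig fr) x ^ 2).
 rewrite <- (nrm2_W_real n w fr). apply (H (fr, rs_zero n) lam Th); auto.
 - destruct (Op_formF n (filter p Pl) (fr, rs_zero n)) as [E1 E2].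
  destruct (Op_formF n (filter (fun mo => negb (p mo)) Pl) (fr, rs_zero n)) as [E3 E4].
  apply injective_projections; apply RS_eq; intros x; simpl; fold Sp; fold Pm; fold Pw.
  + rewrite E1, E3. rewrite PR_filter, HPf. ring.
  + rewrite E2, E4. rewrite !PR_zero. ring.
 - etransitivity; [exact (nrm2_W_real n [] fr)|]. exact H1.
Qed.

Lemma Yw_Dl n l f : lt_letters n l -> forall w, Dl l (Yw n w f) = Yw n (map (fun k => (n + k)%nat) l ++ w) f.
Proof. intros Hl w. rewrite Yw_app, Yw_dlist by exact Hl. pos. Qed.

(** Sobolev's inequality adds at most [n] derivative letters to the word, whence [length w + n]. *)
Theorem eigenfunction_sup_bound n m Pl : (1 <= n)%nat -> (2 <= m)%nat -> elliptic_form n m Pl ->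
 exists K A, 0 <= K /\ 1 <= A /\ forall f (lam Th : R), SR n f ->
 (forall x, PR n Pl f x = lam * f x) -> intRn n (fun x => f x ^ 2) = 1 -> 1 <= Th -> lam ^ 2 <= Th ^ m ->
 forall w x, lt_letters (2 * n) w ->
  Yw n w f x ^ 2 <= K * A ^ (length w + n) * (Th + INR (length w + n)) ^ (length w + n).
Proof.
 intros Hn Hm Hell. destruct (eigenfunction_L2_bound n m Pl Hn Hm Hell) as (K & A & HK & HA & H).
 exists (INR (length (subs n n)) * K), A. split; [pos|].
 split; [lra|]. intros f lam Th Hf HPf H1 HT Hlam w x Hw.
 bound (sobolev_sup n (Yw n w f) (SR_Yw n w f Hf) x).
 rewrite !Rmult_assoc, <- lsum_const. apply lsum_le. intros l Hl.
 apply subs_spec in Hl; [|lia]. destruct Hl as [Hl1 Hl2].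
 rewrite Yw_Dl by exact Hl1. set (v := map (fun k => (n + k)%nat) l ++ w).
 assert (Hv : lt_letters (2 * n) v).
 { apply Forall_app. split; [|pos]. apply Forall_map.
  eapply Forall_impl; [|exact Hl1]. simpl; intros; lia. }
 assert (Lv : (length v <= length w + n)%nat) by (unfold v; rewrite length_app, length_map; lia).
 eapply Rle_trans; [apply (H f lam Th); auto|]. rewrite Rmult_assoc. scale_l.
 note (pos_INR (length v)). assert (INR (length v) <= INR (length w + n)) by (apply le_INR; exact Lv).
 apply Rmult_le_compat; [pos|pos|mono|].
 via ((Th + INR (length w + n)) ^ length v); [mono|mono].
Qed.

(** * Gelfand-Shilov estimates with subexponential loss *)

Lemma fact_ge_1 S : 1 <= INR (fact S).
Proof. change 1 with (INR 1). apply le_INR. note (lt_O_fact S). lia. Qed.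

Lemma exp_pow x n : exp (INR n * x) = exp x ^ n.
Proof.
 induction n; [simpl; rewrite Rmult_0_l; apply exp_0|].
 rewrite S_INR, Rmult_plus_distr_r, Rmult_1_l, exp_plus, IHn. simpl. ring.
Qed.

Lemma pow_self_le_fact S : INR S ^ S <= exp (INR S) * INR (fact S).
Proof.
 induction S as [|S IH]; [simpl; rewrite exp_0; lra|].
 destruct S as [|S']; [simpl; rewrite !Rmult_1_r; note (exp_ineq1_le 1); lra|].
 set (S := Datatypes.S S') in *.
 assert (HS : 0 < INR S) by (apply lt_0_INR; unfold S; lia).
 assert (E : INR (Datatypes.S S) ^ S <= exp 1 * INR S ^ S).
 { rewrite S_INR. replace (INR S + 1) with (INR S * (1 + / INR S)) by (field; lra).
  rewrite Rpow_mult_distr, Rmult_comm. scale_r.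
  via (exp (/ INR S) ^ S).
  - apply pow_incr. split; [pos|apply exp_ineq1_le].
  - rewrite <- exp_pow. right. f_equal. field. lra. }
 rewrite <- tech_pow_Rmult, fact_simpl, mult_INR.
 via (INR (Datatypes.S S) * (exp 1 * (exp (INR S) * INR (fact S)))).
 - scale_l. eapply Rle_trans; [exact E|].
  scale_l; lra.
 - rewrite (S_INR S), exp_plus. lra.
Qed.

Lemma pow_le_fact_exp y S : 0 <= y -> y ^ S <= INR (fact S) * exp (INR S) * exp y.
Proof.
 intros Hy. destruct S as [|S'].
 - simpl. rewrite exp_0, !Rmult_1_l. note (exp_ineq1_le y). lra.
 - set (S := Datatypes.S S'). assert (HS : 0 < INR S) by (apply lt_0_INR; unfold S; lia).
  assert (E : y ^ S <= INR S ^ S * exp y).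
  { replace (y ^ S) with (INR S ^ S * (y / INR S) ^ S) by (rewrite <- Rpow_mult_distr; f_equal; field; lra).
   scale_l.
   via (exp (y / INR S) ^ S).
   - apply pow_incr. split; [pos|].
    note (exp_ineq1_le (y / INR S)). lra.
   - rewrite <- exp_pow. right. f_equal. field. lra. }
  eapply Rle_trans; [exact E|]. scale_r.
  rewrite Rmult_comm. apply pow_self_le_fact.
Qed.

Lemma Rpower_pos x y : 0 < Rpower x y.
Proof. pos. Qed.

Lemma Rpower_pow_l x s S : 0 < x -> Rpower (x ^ S) s = Rpower x s ^ S.
Proof.
 intros Hx. rewrite <- !Rpower_pow by (try apply Rpower_pos; exact Hx). rewrite !Rpower_mult. f_equal. ring.
Qed.

Lemma Rpower_exp z s : Rpower (exp z) s = exp (s * z).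
Proof. unfold Rpower. rewrite ln_exp. lra. Qed.

Lemma Rpower_le_l a b s : 0 <= s -> 0 < a -> a <= b -> Rpower a s <= Rpower b s.
Proof. intros. apply Rle_Rpower_l; lra. Qed.

Lemma Rpower_ge_1 a s : 0 <= s -> 1 <= a -> 1 <= Rpower a s.
Proof.
 intros Hs Ha. rewrite <- (Rpower_1 1) by lra. replace (Rpower 1 1) with (Rpower 1 s).
 - apply Rpower_le_l; lra.
 - unfold Rpower. rewrite ln_1, !Rmult_0_r. lra.
Qed.

(** Since [y^S <= S! e^S e^y], a power of [x] is a factorial times an exponential whose rate can be
    made small at the expense of the geometric constant. The trade of eigenvalue powers for Gevrey
    order rests on this. *)
Lemma power_absorb s eps : 0 < s -> 0 < eps -> exists C, 1 <= C /\ forall x S, 0 < x ->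
 Rpower (x ^ S) s <= C ^ S * Rpower (INR (fact S)) s * exp (eps * x).
Proof.
 intros Hs He. set (q := s / eps * exp 1).
 assert (Hq0 : 0 < s / eps) by pos.
 assert (Hq : 0 < q) by (apply Rmult_lt_0_compat; [lra|pos]).
 exists (Rmax 1 (Rpower q s)). split; [apply Rmax_l|]. intros x S Hx.
 note (fact_ge_1 S) as Hf.
 assert (E : x ^ S <= q ^ S * INR (fact S) * exp (eps / s * x)).
 { assert (Hy : 0 <= eps / s * x).
  { pos. }
  note (pow_le_fact_exp (eps / s * x) S Hy) as H.
  replace (x ^ S) with ((s / eps) ^ S * (eps / s * x) ^ S).
  - rewrite (Rpow_mult_distr (s / eps) (exp 1)), <- exp_pow, Rmult_1_r.
   replace ((s / eps) ^ S * exp (INR S) * INR (fact S) * exp (eps / s * x))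
    with ((s / eps) ^ S * (INR (fact S) * exp (INR S) * exp (eps / s * x))) by ring.
   scale_l; lra.
  - rewrite <- Rpow_mult_distr. f_equal. field. lra. }
 via (Rpower (q ^ S * INR (fact S) * exp (eps / s * x)) s).
 - apply Rpower_le_l; [lra|pos|lra].
 - assert (Hqs : 0 < q ^ S) by pos.
  rewrite <- !Rpower_mult_distr; try apply exp_pos; try (apply Rmult_lt_0_compat; lra); try lra.
  rewrite Rpower_exp. replace (s * (eps / s * x)) with (eps * x) by (field; lra).
  rewrite Rpower_pow_l by exact Hq. scale_r.
  scale_r. apply pow_incr.
  split; [pos|apply Rmax_r].
Qed.

Lemma fact_add_le a b : INR (fact (a + b)) <= 2 ^ (a + b) * INR (fact a) * INR (fact b).
Proof.
 assert (H : binom (a + b) a <= 2 ^ (a + b)).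
 { note (binomial 1 1 (a + b)) as E. replace (1 + 1) with 2 in E by ring. rewrite E.
  rewrite <- lsum_sum_f_R0. bound_by (lsum_mem (seq 0 (S (a + b))) (fun i => Binomial.C (a + b) i * 1 ^ i * 1 ^ (a + b - i)) a).
  - rewrite !pow1. unfold binom. lra.
  - intros i _. rewrite !pow1, !Rmult_1_r. apply (binom_pos (a + b) i).
  - apply in_seq. lia. }
 unfold binom, Binomial.C in H. replace (a + b - a)%nat with b in H by lia.
 assert (Hp : 0 < INR (fact a) * INR (fact b)) by pos.
 apply (Rmult_le_compat_r (INR (fact a) * INR (fact b))) in H; [|lra].
 unfold Rdiv in H. rewrite Rmult_assoc, Rinv_l, Rmult_1_r in H by lra. lra.
Qed.

(** The natural scale of the problem: [|lam k|] is of order [xk ^ (m mu)], coefficients of functions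
    in [F_mu] decay like [exp (- eps xk)], and condition (A) tolerates a loss of exactly this
    kind. *)
Definition xk (n : nat) (mu : R) (k : nat) : R := Rpower (INR (S k)) (1 / (2 * INR n * mu)).

Lemma INR_S_ge_1 k : 1 <= INR (S k).
Proof. change 1 with (INR 1). apply le_INR. lia. Qed.

Lemma xk_ge_1 n mu k : (1 <= n)%nat -> 0 < mu -> 1 <= xk n mu k.
Proof.
 intros Hn Hmu. assert (0 < INR n) by (apply lt_0_INR; lia).
 apply Rpower_ge_1; [|apply INR_S_ge_1]. pos.
Qed.

Lemma xk_power n mu k t : (1 <= n)%nat -> 0 < mu -> Rpower (INR (S k)) (t / (2 * INR n)) = Rpower (xk n mu k) (t * mu).
Proof.
 intros Hn Hmu. unfold xk. rewrite Rpower_mult. f_equal. assert (0 < INR n) by (apply lt_0_INR; lia). field. lra.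
Qed.

(** With [Th = C0 x^(2 mu)], the power [Th^S] becomes [S!^(2 mu)] times a small exponential, while
    [S^S] is at most [e^S S!]; taking square roots leaves the factorial to the power [mu]. *)
Lemma sup_bound_absorb n mu C0 K A eps : (1 <= n)%nat -> 1 / 2 <= mu -> 1 <= C0 -> 0 <= K -> 1 <= A -> 0 < eps ->
 exists K' C', 0 <= K' /\ 1 <= C' /\ forall x T y, 1 <= x ->
  y ^ 2 <= K * A ^ (T + n) * (C0 * Rpower x (2 * mu) + INR (T + n)) ^ (T + n) ->
  Rabs y <= K' * C' ^ T * Rpower (INR (fact T)) mu * exp (eps * x).
Proof.
 intros Hn Hmu HC0 HK HA He.
 destruct (power_absorb (2 * mu) (2 * eps) ltac:(lra) ltac:(lra)) as (C1 & HC1 & Habs).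
 set (B := A * 2 * (C0 * C1 + exp 1) * Rpower 2 (2 * mu)).
 assert (He1 : 1 <= exp 1) by (note (exp_ineq1_le 1); lra).
 assert (H2m : 1 <= Rpower 2 (2 * mu)) by (apply Rpower_ge_1; lra).
 assert (HCC : 1 <= C0 * C1) by nra.
 assert (HA2 : 1 <= A * 2 * (C0 * C1 + exp 1)).
 { nra. }
 assert (HB : 1 <= B) by (unfold B; nra).
 set (D := K * B ^ n * Rpower (INR (fact n)) (2 * mu)).
 assert (HD : 0 <= D).
 { repeat apply Rmult_le_pos; [lra|pos|pos]. }
 exists (sqrt D), (sqrt B). split; [pos|]. split.
 { rewrite <- sqrt_1. apply sqrt_le_1_alt. exact HB. }
 intros x T y Hx Hy. set (S := (T + n)%nat) in *.
 note (pos_INR S) as HS0.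
 set (th := C0 * Rpower x (2 * mu)) in *.
 assert (Hth : 0 < th) by (apply Rmult_lt_0_compat; [lra|pos]).
 assert (Hx0 : 0 < x) by lra.
 note (fact_ge_1 S) as HfS.
 set (F := Rpower (INR (fact S)) (2 * mu) * exp (2 * eps * x)).
 assert (HF : 0 <= F) by (apply Rmult_le_pos; left; [pos|pos]).
 assert (E1 : th ^ S <= (C0 * C1) ^ S * F).
 { unfold th. rewrite !Rpow_mult_distr, <- Rpower_pow_l by exact Hx0. specialize (Habs x S Hx0).
  rewrite Rmult_assoc. scale_l. unfold F. lra. }
 assert (E2 : INR S ^ S <= exp 1 ^ S * F).
 { bound pow_self_le_fact. rewrite <- exp_pow, Rmult_1_r.
  scale_l.
  via (INR (fact S) * 1); [lra|]. apply Rmult_le_compat; [lra|lra| |].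
  (* Here [2 mu >= 1] enters: the plain factorial from [S^S] is dominated by [S!^(2 mu)]. *)
  - rewrite <- (Rpower_1 (INR (fact S))) at 1 by lra. apply Rle_Rpower; lra.
  - note (exp_ineq1_le (2 * eps * x)). nra. }
 assert (E3 : (th + INR S) ^ S <= 2 ^ S * ((C0 * C1 + exp 1) ^ S * F)).
 { via (2 ^ S * (Rmax th (INR S)) ^ S).
  - rewrite <- Rpow_mult_distr. apply pow_incr. note (Rmax_l th (INR S)). note (Rmax_r th (INR S)). lra.
  - scale_l.
   unfold Rmax. destruct (Rle_dec th (INR S)).
   + eapply Rle_trans; [exact E2|]. scale_r. apply pow_incr. lra.
   + eapply Rle_trans; [exact E1|]. mono. }
 assert (E4 : Rpower (INR (fact S)) (2 * mu) <= Rpower 2 (2 * mu) ^ S * Rpower (INR (fact n)) (2 * mu) * Rpower (INR (fact T)) (2 * mu)).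
 { rewrite <- Rpower_pow_l by lra. note (fact_ge_1 n). note (fact_ge_1 T).
  assert (0 < 2 ^ S) by pos.
  rewrite !Rpower_mult_distr; try lra; [|pos].
  apply Rpower_le_l; [lra|lra|]. note (fact_add_le T n) as H2. fold S in H2. lra. }
 assert (E5 : y ^ 2 <= D * B ^ T * Rpower (INR (fact T)) (2 * mu) * exp (2 * eps * x)).
 { eapply Rle_trans; [exact Hy|].
  via (K * A ^ S * (2 ^ S * ((C0 * C1 + exp 1) ^ S * F))).
  - scale_l; lra.
  - via (K * A ^ S * (2 ^ S * ((C0 * C1 + exp 1) ^ S *
     ((Rpower 2 (2 * mu) ^ S * Rpower (INR (fact n)) (2 * mu) * Rpower (INR (fact T)) (2 * mu)) * exp (2 * eps * x))))).
   + scale_l.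
    scale_l. scale_l.
    scale_r; lra.
   + right. unfold D. replace (B ^ n * Rpower (INR (fact n)) (2 * mu)) with (Rpower (INR (fact n)) (2 * mu) * B ^ n) by ring.
    assert (EB : B ^ n * B ^ T = A ^ S * 2 ^ S * (C0 * C1 + exp 1) ^ S * Rpower 2 (2 * mu) ^ S).
    { rewrite <- pow_add. unfold B. rewrite !Rpow_mult_distr. replace (n + T)%nat with S by lia. lra. }
    replace (K * B ^ n * Rpower (INR (fact n)) (2 * mu) * B ^ T) with (K * Rpower (INR (fact n)) (2 * mu) * (B ^ n * B ^ T)) by ring.
    rewrite EB. ring. }
 apply Rsqr_incr_0_var.
 - rewrite <- Rsqr_abs, !Rsqr_mult. rewrite Rsqr_sqrt by exact HD.
  replace (Rsqr (sqrt B ^ T)) with (B ^ T).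
  2:{ rewrite <- (Rsqr_sqrt B) at 1 by lra. unfold Rsqr. rewrite Rpow_mult_distr. lra. }
  replace (Rsqr (Rpower (INR (fact T)) mu)) with (Rpower (INR (fact T)) (2 * mu)).
  2:{ unfold Rsqr. rewrite <- Rpower_plus. f_equal. ring. }
  replace (Rsqr (exp (eps * x))) with (exp (2 * eps * x)).
  2:{ unfold Rsqr. rewrite <- exp_plus. f_equal. ring. }
  simpl in E5. rewrite Rmult_1_r in E5. exact E5.
 - pos.
Qed.

(** * Decay of eigenfunction coefficients *)

Lemma Yw_plus n w f g : SR n f -> SR n g -> Yw n w (fun x => f x + g x) = fun x => Yw n w f x + Yw n w g x.
Proof.
 intros Hf Hg. induction w as [|i w IH]; [pos|]. simpl. rewrite IH.
 fext x. apply Yop_plus; apply SR_Yw; assumption.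
Qed.

Lemma Yw_scal n w c f : SR n f -> Yw n w (fun x => c * f x) = fun x => c * Yw n w f x.
Proof.
 intros Hf. induction w as [|i w IH]; [pos|]. simpl. rewrite IH.
 fext x. apply Yop_scal, SR_Yw, Hf.
Qed.

Definition decr (a : nat -> nat) (k : nat) : nat -> nat := fun j => if Nat.eqb j k then pred (a j) else a j.
Definition zeroat (a : nat -> nat) (k : nat) : nat -> nat := fun j => if Nat.eqb j k then O else a j.

Lemma xpow_split n a k x : (k < n)%nat -> xpow n a x = x k ^ a k * xpow n (zeroat a k) x.
Proof.
 unfold xpow, zeroat. induction n as [|n IH]; intros Hk; [lia|]. simpl.
 destruct (Nat.eqb_spec n k) as [->|Hn].
 - rewrite (prodR_ext k (fun j => x j ^ (if Nat.eqb j k then O else a j)) (fun j => x j ^ a j)); [lra|].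
  intros i Hi. destruct (Nat.eqb_spec i k); [lia|lra].
 - rewrite IH by lia. ring.
Qed.

Lemma xpow_zeroat_upd n a k x s : xpow n (zeroat a k) (upd x k s) = xpow n (zeroat a k) x.
Proof.
 apply prodR_ext. intros i _. unfold zeroat, upd. destruct (Nat.eqb i k); reflexivity.
Qed.

Lemma isD_xpow n a k : (k < n)%nat -> isD k (xpow n a) (fun x => INR (a k) * xpow n (decr a k) x).
Proof.
 intros Hk x. rewrite (xpow_split n (decr a k) k) by exact Hk.
 replace (decr a k k) with (pred (a k)) by (unfold decr; rewrite Nat.eqb_refl; reflexivity).
 replace (xpow n (zeroat (decr a k) k) x) with (xpow n (zeroat a k) x).
 2:{ apply prodR_ext. intros i _. unfold zeroat, decr. destruct (Nat.eqb i k); reflexivity. }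
 apply (is_derive_ext (fun s => s ^ a k * xpow n (zeroat a k) x)).
 - intros s. rewrite (xpow_split n a k (upd x k s)) by exact Hk. rewrite upd_same, xpow_zeroat_upd. reflexivity.
 - auto_derive; [lra|]. ring.
Qed.

Lemma xpow_incr n a k x : (k < n)%nat -> xpow n (incr a k) x = x k * xpow n a x.
Proof.
 intros Hk. rewrite (xpow_split n (incr a k) k), (xpow_split n a k) by exact Hk.
 replace (xpow n (zeroat (incr a k) k) x) with (xpow n (zeroat a k) x).
 - unfold incr at 1. rewrite Nat.eqb_refl. simpl. ring.
 - apply prodR_ext. intros i _. unfold zeroat, incr. destruct (Nat.eqb i k); reflexivity.
Qed.

Lemma sumN_ext n a b : (forall i, (i < n)%nat -> a i = b i) -> sumN n a = sumN n b.
Proof. induction n; intros H; simpl; [pos|]. rewrite IHn, H; auto. Qed.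

Lemma sumN_incr n a k : (k < n)%nat -> sumN n (incr a k) = S (sumN n a).
Proof.
 induction n as [|n IH]; intros H; [lia|]. simpl. unfold incr at 2. destruct (Nat.eqb_spec n k) as [->|].
 - rewrite (sumN_ext k (incr a k) a); [lia|]. intros i Hi. unfold incr. destruct (Nat.eqb_spec i k); [lia|pos].
 - lia.
Qed.

Lemma sumN_decr n a k : (k < n)%nat -> (0 < a k)%nat -> S (sumN n (decr a k)) = sumN n a.
Proof.
 intros Hk Ha. rewrite <- sumN_incr with (k := k) by exact Hk. apply sumN_ext. intros i _.
 unfold incr, decr. destruct (Nat.eqb_spec i k); subst; lia.
Qed.

Lemma sumN_ge n a k : (k < n)%nat -> (a k <= sumN n a)%nat.
Proof.
 induction n as [|n IH]; intros H; [lia|]. simpl. destruct (Nat.eq_dec k n) as [->|]; [lia|]. lia.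
Qed.

Lemma fact_mult_le a b : INR (fact a) * INR (fact b) <= INR (fact (a + b)).
Proof.
 rewrite <- mult_INR. apply le_INR. induction a as [|a IH]; simpl; [lia|]. nia.
Qed.

Lemma mfact_le n a : mfact n a <= INR (fact (sumN n a)).
Proof.
 unfold mfact. induction n as [|n IH]; simpl prodR; simpl sumN; [easy|].
 bound_by fact_mult_le. mono.
Qed.

Lemma mfact_pos n a : 0 < mfact n a.
Proof. apply prodR_pos. pos. Qed.

Definition gs_bound (n : nat) (mu K C : R) (f : (nat -> R) -> R) : Prop :=
 forall a b x, Rabs (xpow n a x) * Rabs (Dl (dlist n b) f x)
  <= K * C ^ (sumN n a + sumN n b) * Rpower (mfact n a * mfact n b) mu.

(** The letter next to the function is absorbed into [x^a d^b f]. A derivative meeting [x^a] splits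
    the term in two, whence [2 ^ l]; the term with the factor [a k] has two letters less, and the
    factorial growth thus saved pays for that factor. *)
Lemma gs_word_bound n mu K C f : 1 / 2 <= mu -> 0 <= K -> 1 <= C -> SR n f -> gs_bound n mu K C f ->
 forall w x, lt_letters (2 * n) w ->
 Rabs (Yw n w f x) <= K * (2 * C) ^ length w * Rpower (INR (fact (length w))) mu.
Proof.
 intros Hmu HK HC Hf HB.
 assert (HBd : forall b, exists B, forall x, Rabs (Dl (dlist n b) f x) <= B).
 { intros b. destruct (proj2 Hf (dlist n b) O (dlist_lt n b)) as [B H]. exists B. intros x. specialize (H x). lra. }
 set (g := fun a b x => xpow n a x * Dl (dlist n b) f x).
 assert (Hg : forall a b, SR n (g a b)).
 { intros a b. replace (g a b) with (Yw n (xlist n a) (Dl (dlist n b) f)).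
  - apply SR_Yw, SR_Dl; [pos|apply dlist_lt].
  - fext x. apply Yw_xlist. lia. }
 assert (H : forall l w a b x, length w = l -> lt_letters (2 * n) w ->
  Rabs (Yw n w (g a b) x) <= K * 2 ^ l * C ^ (l + (sumN n a + sumN n b)) * Rpower (INR (fact (l + (sumN n a + sumN n b)))) mu).
 { induction l as [|l IH]; intros w a b x Hl Hw.
  - destruct w; [|easy]. simpl. unfold g. rewrite Rabs_mult. bound HB.
   rewrite Rmult_1_r. scale_l.
   apply Rpower_le_l; [lra|apply Rmult_lt_0_compat; apply mfact_pos|].
   bound_by fact_mult_le. apply Rmult_le_compat; try (left; apply mfact_pos); apply mfact_le.
  - destruct (exists_last (l := w)) as (w' & i & ->); [intros ->; discriminate|].
   rewrite length_app in Hl. simpl in Hl. assert (Hl' : length w' = l) by lia.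
   apply Forall_app in Hw. destruct Hw as [Hw Hi]. inversion_clear Hi.
   rewrite Yw_app. set (s := (sumN n a + sumN n b)%nat) in *.
   assert (HL : 0 <= K * 2 ^ l) by pos.
   set (Phi := K * 2 ^ l * C ^ (S l + s) * Rpower (INR (fact (S l + s))) mu).
   assert (HPhi : 0 <= Phi).
   { apply Rmult_le_pos; [pos|pos]. }
   replace (K * 2 ^ S l * C ^ (S l + s) * Rpower (INR (fact (S l + s))) mu) with (Phi + Phi) by (unfold Phi; simpl; ring).
   destruct (Nat.lt_ge_cases i n) as [Hin|Hin].
   + replace (Yw n [i] (g a b)) with (g (incr a i) b).
    * eapply Rle_trans; [apply IH; assumption|]. rewrite sumN_incr by exact Hin.
     replace (l + (S (sumN n a) + sumN n b))%nat with (S l + s)%nat by lia. fold Phi. lra.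
    * fext y. simpl. unfold Yop. destruct (Nat.ltb_spec i n); [|lia].
     unfold mulx, g. rewrite xpow_incr by exact Hin. ring.
   + set (k := (i - n)%nat). assert (Hk : (k < n)%nat) by lia.
    replace (Yw n [i] (g a b)) with (fun y => g a (incr b k) y + INR (a k) * g (decr a k) b y).
    * rewrite (Yw_plus n w' (g a (incr b k))) by (try apply SR_scal; apply Hg). rewrite Yw_scal by apply Hg.
     bound Rabs_triang. apply Rplus_le_compat.
     -- eapply Rle_trans; [apply IH; assumption|]. rewrite sumN_incr by exact Hk.
       replace (l + (sumN n a + S (sumN n b)))%nat with (S l + s)%nat by lia. apply Rle_refl.
     -- rewrite Rabs_mult, (Rabs_pos_eq (INR (a k))) by apply pos_INR.
       destruct (a k) as [|p] eqn:Eak; [simpl; rewrite Rmult_0_l; exact HPhi|].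
       assert (Hd : S (sumN n (decr a k)) = sumN n a) by (apply sumN_decr; lia).
       note (sumN_ge n a k Hk) as Hge.
       via (INR s * (K * 2 ^ l * C ^ (l + (sumN n (decr a k) + sumN n b))
        * Rpower (INR (fact (l + (sumN n (decr a k) + sumN n b)))) mu)).
       ++ apply Rmult_le_compat; [pos|pos|apply le_INR; unfold s; lia|pos].
       ++ set (q := (l + (sumN n (decr a k) + sumN n b))%nat).
        assert (Eq : (S l + s)%nat = S (S q)) by lia.
        unfold Phi. rewrite Eq.
        assert (Hs1 : 1 <= INR s) by (change 1 with (INR 1); apply le_INR; unfold s; lia).
        assert (HsF : INR s * Rpower (INR (fact q)) mu <= Rpower (INR (fact (S (S q)))) mu).
        { rewrite !fact_simpl, !mult_INR, <- Rmult_assoc.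
         assert (H1 : INR s <= INR (S (S q))) by (apply le_INR; unfold s, q; lia).
         assert (H2 : INR s <= INR (S q)) by (apply le_INR; unfold s, q; lia).
         rewrite <- Rpower_mult_distr by pos.
         scale_r.
         (* The first comparison holds because [2 mu >= 1]. *)
         via (Rpower (INR s * INR s) mu).
         - rewrite <- Rpower_mult_distr, <- Rpower_plus by lra.
          rewrite <- (Rpower_1 (INR s)) at 1 by lra. apply Rle_Rpower; lra.
         - apply Rpower_le_l; [lra|nra|]. mono. }
        replace (INR s * (K * 2 ^ l * C ^ q * Rpower (INR (fact q)) mu))
         with (K * 2 ^ l * C ^ q * (INR s * Rpower (INR (fact q)) mu)) by ring.
        apply Rmult_le_compat.
        ** apply Rmult_le_pos; [lra|pos].
        ** apply Rmult_le_pos; [lra|pos].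
        ** scale_l. apply Rle_pow; [lra|lia].
        ** exact HsF.
    * fext y. simpl. unfold Yop.
     destruct (Nat.ltb_spec i n); [lia|]. destruct (Nat.ltb_spec i (2 * n)); [|lia]. fold k.
     assert (D1 : isD k (Dl (dlist n b) f) (Dl (dlist n (incr b k)) f)).
     { rewrite <- (Dl_insert n f (proj1 Hf) HBd n k b (le_n n) Hk).
      apply (smoothR_isD n f (dlist n b) k (proj1 Hf)); [apply dlist_lt|pos]. }
     note (isD_pdr _ _ _ (isD_mult k _ _ _ _ (isD_xpow n a k Hk) D1)) as E.
     unfold g at 3. rewrite E. unfold g. ring. }
 intros w x Hw.
 specialize (H (length w) w (fun _ => O) (fun _ => O) x eq_refl Hw).
 assert (Z : sumN n (fun _ => O) = O) by (clear; induction n; simpl; lia).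
 rewrite Z, !Nat.add_0_r in H. rewrite Rpow_mult_distr, <- Rmult_assoc.
 replace (g (fun _ => O) (fun _ => O)) with f in H; [lra|].
 fext y. unfold g. replace (xpow n (fun _ => O) y) with 1.
 - replace (dlist n (fun _ => O)) with (@nil nat); [simpl; ring|]. clear. induction n; simpl; auto.
 - symmetry. apply prodR_one. pos.
Qed.

Lemma PR_words n Pl f x : PR n Pl f x = lsum Pl (fun mo => fst (fst mo) * Yw n (mono_word n mo) f x).
Proof.
 apply lsum_ext. intros [[c a] b] _. rewrite Yw_mono. simpl. ring.
Qed.

Lemma SR_lsum {A} n (l : list A) (h : A -> (nat -> R) -> R) : (forall a, In a l -> SR n (h a)) -> SR n (fun x => lsum l (fun a => h a x)).
Proof.
 induction l as [|a l IH]; intros H; [apply SR_zero|]. apply (SR_plus n (h a)); [apply H; simpl; auto|apply IH; intros; apply H; simpl; auto].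
Qed.

Lemma Yw_lsum {A} n w (l : list A) (h : A -> (nat -> R) -> R) : (forall a, In a l -> SR n (h a)) ->
 Yw n w (fun x => lsum l (fun a => h a x)) = fun x => lsum l (fun a => Yw n w (h a) x).
Proof.
 induction l as [|a l IH]; intros H.
 - simpl. induction w as [|i w IHw]; [pos|]. simpl. rewrite IHw. fext x.
  unfold Yop. destruct (Nat.ltb i n); [unfold mulx; ring|].
  destruct (Nat.ltb i (2 * n)); [exact (Derive_const 0 (x (i - n)%nat))|lra].
 - simpl. rewrite (Yw_plus n w (h a)); [rewrite IH; [pos|]| |].
  + intros; apply H; simpl; auto.
  + apply H; simpl; auto.
  + apply SR_lsum. intros; apply H; simpl; auto.
Qed.

Lemma SR_PR n Pl f : SR n f -> SR n (PR n Pl f).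
Proof.
 intros Hf. replace (PR n Pl f) with (fun x => lsum Pl (fun mo => fst (fst mo) * Yw n (mono_word n mo) f x)).
 - apply (SR_lsum n Pl (fun mo x => fst (fst mo) * Yw n (mono_word n mo) f x)). intros mo _. apply SR_scal, SR_Yw, Hf.
 - fext x. symmetry. apply PR_words.
Qed.

Lemma SR_PR_iter n Pl f N : SR n f -> SR n (Nat.iter N (PR n Pl) f).
Proof. intros Hf. induction N; simpl; [pos|apply SR_PR, IHN]. Qed.

Lemma PR_iter_word_bound n m Pl mu K C f : 0 <= mu -> 0 <= K -> 1 <= C -> SR n f ->
 (forall c a b, In (c, a, b) Pl -> (sumN n a + sumN n b <= m)%nat) ->
 (forall w x, lt_letters (2 * n) w -> Rabs (Yw n w f x) <= K * C ^ length w * Rpower (INR (fact (length w))) mu) ->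
 forall N w x, lt_letters (2 * n) w ->
  Rabs (Yw n w (Nat.iter N (PR n Pl) f) x) <= lsum Pl (fun mo => Rabs (fst (fst mo))) ^ N *
   (K * C ^ (length w + m * N) * Rpower (INR (fact (length w + m * N))) mu).
Proof.
 intros Hmu HK HC Hf Hdeg HB. set (cs := lsum Pl (fun mo => Rabs (fst (fst mo)))).
 assert (Hcs : 0 <= cs) by (apply lsum_nonneg; intros; apply Rabs_pos).
 assert (Hmono : forall p q, (p <= q)%nat -> K * C ^ p * Rpower (INR (fact p)) mu <= K * C ^ q * Rpower (INR (fact q)) mu).
 { intros p q Hpq. apply Rmult_le_compat.
  - apply Rmult_le_pos; [lra|pos].
  - left; apply Rpower_pos.
  - scale_l; mono.
  - apply Rpower_le_l; [lra|pos|]. apply le_INR, fact_le, Hpq. }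
 induction N as [|N IH]; intros w x Hw.
 - rewrite Nat.mul_0_r, Nat.add_0_r, Rmult_1_l. apply HB, Hw.
 - simpl Nat.iter. set (g := Nat.iter N (PR n Pl) f) in *.
  assert (Hg : SR n g) by (apply SR_PR_iter, Hf).
  replace (PR n Pl g) with (fun x => lsum Pl (fun mo => fst (fst mo) * Yw n (mono_word n mo) g x)).
  2:{ fext y. symmetry. apply PR_words. }
  rewrite (Yw_lsum n w Pl (fun mo x => fst (fst mo) * Yw n (mono_word n mo) g x)) by (intros; apply SR_scal, SR_Yw, Hg).
  bound lsum_abs.
  simpl pow. rewrite Rmult_assoc. unfold cs at 1. rewrite Rmult_comm, <- lsum_scal. apply lsum_le. intros mo Hin.
  rewrite Yw_scal by (apply SR_Yw, Hg). rewrite Rabs_mult, Rmult_comm, <- Yw_app.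
  scale_r.
  destruct (mono_word_spec n mo) as [H1 H2].
  eapply Rle_trans; [apply IH; apply Forall_app; split; assumption|].
  scale_l. apply Hmono. rewrite length_app, H2.
  destruct mo as [[c a] b]. apply Hdeg in Hin. simpl. lia.
Qed.

(** Products of squares [x_k^2] over all sets of coordinates below [m]: their sum is multiplication
    by the product of the [1 + x_k^2], the inverse of [iw]. *)
Fixpoint wts (m : nat) : list (list nat) :=
 match m with O => [[]] | S k => flat_map (fun w => [w; k :: k :: w]) (wts k) end.

Lemma wts_spec n m w : (m <= n)%nat -> In w (wts m) -> lt_letters n w /\ (length w <= 2 * m)%nat.
Proof.
 revert w; induction m; intros w Hm Hin; simpl in Hin.
 - destruct Hin as [<-|[]]. split; [pos|pos].
 - apply in_flat_map in Hin. destruct Hin as (b & Hb & Hin). apply IHm in Hb; [|lia]. destruct Hb as [H1 H2].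
  destruct Hin as [<-|[<-|[]]]; [triv|].
  split; [constructor; [lia|pos]|simpl; lia].
Qed.

Lemma wts_sum n m f x : (m <= n)%nat -> lsum (wts m) (fun w => Yw n w f x) * iw m x = f x.
Proof.
 induction m as [|m IH]; intros Hm; [unfold iw; simpl; ring|].
 cbn [wts]. rewrite lsum_flat_map.
 rewrite (lsum_ext _ _ (fun w => (1 + x m ^ 2) * Yw n w f x)).
 - rewrite lsum_scal. unfold iw. cbn [prodR]. fold (iw m x). rewrite <- IH by lia.
  unfold w1. field. note (pow2_ge_0 (x m)). lra.
 - intros w _. unfold lsum. cbn [fold_right]. simpl Yw. unfold Yop. destruct (Nat.ltb_spec m n); [|lia].
  unfold mulx. ring.
Qed.

Lemma weighted_word_bound n f B : (forall w x, lt_letters (2 * n) w -> (length w <= 2 * n)%nat -> Rabs (Yw n w f x) <= B) ->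
 forall x, Rabs (f x) <= INR (length (wts n)) * B * iw n x.
Proof.
 intros H x. rewrite <- (wts_sum n n f x (le_n n)), Rabs_mult, (Rabs_pos_eq (iw n x)) by (left; apply iw_pos).
 apply Rmult_le_compat_r; [left; apply iw_pos|]. bound lsum_abs.
 rewrite <- lsum_const. apply lsum_le. intros w Hw. apply (wts_spec n) in Hw; [|lia]. destruct Hw as [H1 H2].
 apply H; [apply (lt_letters_le n); [lia|pos]|pos].
Qed.

Lemma intRn_pair_le n f g B : SR n f -> SR n g -> 0 < B -> intRn n (fun x => f x * f x) <= B ^ 2 ->
 intRn n (fun x => g x * g x) = 1 -> Rabs (intRn n (fun x => f x * g x)) <= B.
Proof.
 intros Hf Hg HB Hff Hgg.
 set (fr := exist _ f Hf : RS n). set (gr := exist _ g Hg : RS n).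
 assert (H : forall s, s ^ 2 = 1 -> 0 <= B ^ 2 + B ^ 2 + 2 * s * B * rs_ip n fr gr).
 { intros s Hs. note (rs_ip_pos n (rs_add n fr (rs_scal n (s * B) gr))) as H.
  rewrite rs_ip_add, (rs_ip_sym n fr), (rs_ip_sym n (rs_scal n (s * B) gr)), !rs_ip_add, !rs_ip_scal in H.
  rewrite (rs_ip_sym n fr (rs_scal n (s * B) gr)), (rs_ip_sym n gr (rs_scal n (s * B) gr)), !rs_ip_scal in H.
  change (rs_ip n fr fr <= B ^ 2) in Hff. change (rs_ip n gr gr = 1) in Hgg.
  rewrite (rs_ip_sym n gr fr) in H.
  nra. }
 note (H 1 ltac:(ring)) as H1. note (H (-1) ltac:(ring)) as H2.
 change (Rabs (rs_ip n fr gr) <= B). apply Rabs_le. nra.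
Qed.

Lemma fact_le_pow M : INR (fact M) <= INR M ^ M.
Proof.
 assert (H : forall k, (k <= M)%nat -> INR (fact k) <= INR M ^ k).
 { induction k as [|k IH]; intros Hk; [easy|]. rewrite fact_simpl, mult_INR.
  apply Rmult_le_compat; try apply pos_INR; [apply le_INR; exact Hk|apply IH; lia]. }
 pos.
Qed.

(** The number [N] of iterations is chosen so that [m N] is about [x / (e r)]. *)
Lemma decay_from_iterates m mu R0 c : (1 <= m)%nat -> 0 < mu -> 0 < R0 -> 0 < c ->
 exists eps K2, 0 < eps /\ 0 <= K2 /\ forall K1 x lam v, 0 <= K1 -> 1 <= x -> c * Rpower x (INR m * mu) <= lam ->
 (forall N, lam ^ N * v <= K1 * (R0 ^ N * Rpower (INR (fact (m * N))) mu)) -> 0 <= v -> v <= K1 * K2 * exp (- eps * x).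
Proof.
 intros Hm Hmu HR Hc. assert (Hm0 : 0 < INR m) by (apply lt_0_INR; lia).
 (* [r] rescales [x] so that the geometric constant [R0] and the lower constant [c] of the
    eigenvalues cancel in [EX]. *)
 set (r := Rpower (R0 / c) (1 / (INR m * mu))).
 assert (Hr : 0 < r) by apply Rpower_pos.
 set (e1 := exp 1). assert (He1 : 0 < e1) by apply exp_pos.
 (* Rounding down to a multiple of [m] loses at most [m], which costs the constant
    [exp (mu * INR m)]. *)
 exists (mu / (e1 * r)), (exp (mu * INR m)).
 split; [pos|]. split; [pos|].
 intros K1 x lam v HK1 Hx Hlam HN Hv.
 assert (Hy : 0 <= x / (e1 * r * INR m)).
 { pos. }
 destruct (nfloor_ex _ Hy) as [N [HN1 HN2]]. specialize (HN N).
 set (M := (m * N)%nat) in *.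
 assert (EM : INR M = INR m * INR N) by apply mult_INR.
 assert (HM1 : INR M <= x / (e1 * r)).
 { apply (Rmult_le_compat_l (INR m)) in HN1; [|lra].
  replace (INR m * (x / (e1 * r * INR m))) with (x / (e1 * r)) in HN1 by (field; lra). lra. }
 assert (HM2 : x / (e1 * r) <= INR M + INR m).
 { apply Rlt_le in HN2. apply (Rmult_le_compat_l (INR m)) in HN2; [|lra].
  replace (INR m * (x / (e1 * r * INR m))) with (x / (e1 * r)) in HN2 by (field; lra). lra. }
 assert (Hxer : 0 < x / (e1 * r)) by pos.
 assert (EF : Rpower (INR (fact M)) mu <= Rpower (x / (e1 * r)) mu ^ M).
 { rewrite <- Rpower_pow_l by exact Hxer. apply Rpower_le_l; [lra|pos|].
  bound fact_le_pow. mono. }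
 assert (EX : Rpower (x / (e1 * r)) mu ^ M * R0 ^ N = exp (- mu * INR M) * (c * Rpower x (INR m * mu)) ^ N).
 { unfold Rdiv. rewrite Rinv_mult.
  rewrite <- !Rpower_mult_distr; try lra; try (apply Rinv_0_lt_compat; lra);
   [|apply Rmult_lt_0_compat; apply Rinv_0_lt_compat; lra].
  rewrite !Rpow_mult_distr.
  replace (Rpower (/ e1) mu ^ M) with (exp (- mu * INR M)).
  2:{ unfold e1. rewrite <- exp_Ropp, Rpower_exp, <- exp_pow. f_equal. ring. }
  replace (Rpower (/ r) mu ^ M) with ((c / R0) ^ N).
  2:{ rewrite <- !Rpower_pow by pos.
    unfold r. replace (/ Rpower (R0 / c) (1 / (INR m * mu))) with (Rpower (c / R0) (1 / (INR m * mu))).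
    - rewrite !Rpower_mult, EM. f_equal. field. lra.
    - rewrite <- Rpower_Ropp. unfold Rpower.
     replace (ln (c / R0)) with (- ln (R0 / c)); [f_equal; ring|].
     rewrite <- ln_Rinv by pos. f_equal. field. lra. }
  replace (Rpower x mu ^ M) with (Rpower x (INR m * mu) ^ N).
  2:{ rewrite <- !Rpower_pow by apply Rpower_pos. rewrite !Rpower_mult, EM. f_equal. ring. }
  replace (c ^ N) with ((c / R0) ^ N * R0 ^ N).
  - ring.
  - rewrite <- Rpow_mult_distr. f_equal. field. lra. }
 set (Lm := c * Rpower x (INR m * mu)) in *.
 assert (HL : 0 < Lm) by (apply Rmult_lt_0_compat; [lra|pos]).
 assert (HLN : 0 < Lm ^ N) by pos.
 assert (E1 : Lm ^ N * v <= K1 * (exp (- mu * INR M) * Lm ^ N)).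
 { rewrite <- EX. via (lam ^ N * v).
  - scale_r. apply pow_incr. lra.
  - eapply Rle_trans; [exact HN|]. scale_l.
   rewrite Rmult_comm. mono. }
 assert (E2 : v <= K1 * exp (- mu * INR M)).
 { nra. }
 eapply Rle_trans; [exact E2|]. rewrite Rmult_assoc. scale_l.
 rewrite <- exp_plus.
 destruct (Rle_lt_or_eq_dec (- mu * INR M) (mu * INR m + - (mu / (e1 * r)) * x)) as [Hlt|Heq].
 - apply (Rmult_le_compat_l mu) in HM2; [|lra]. lra.
 - left. apply exp_increasing, Hlt.
 - right. triv.
Qed.

(** * Gevrey bounds for solutions of linear systems *)

(** Families are normalised as Taylor coefficients [f_j = f^(j) / j!], for which the Leibniz formula is a Cauchy product. *)
Definition taylor_family (f : nat -> R -> R) : Prop := forall j t, is_derive (f j) t (INR (S j) * f (S j) t).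
Definition cauchy (f g : nat -> R -> R) (j : nat) (t : R) : R := sum_f_R0 (fun i => f i t * g (j - i)%nat t) j.

Lemma is_derive_sum_f_R0 (f f' : nat -> R -> R) t N : (forall i, (i <= N)%nat -> is_derive (f i) t (f' i t)) ->
 is_derive (fun s => sum_f_R0 (fun i => f i s) N) t (sum_f_R0 (fun i => f' i t) N).
Proof.
 induction N as [|N IH]; intros H; simpl; [pos|].
 apply (is_derive_plus (fun s => sum_f_R0 (fun i => f i s) N) (f (S N))); [pos|pos].
Qed.

Lemma cauchy_derive f g j t : (forall i, (i <= j)%nat -> is_derive (f i) t (INR (S i) * f (S i) t)) ->
 (forall i, (i <= j)%nat -> is_derive (g i) t (INR (S i) * g (S i) t)) -> is_derive (cauchy f g j) t (INR (S j) * cauchy f g (S j) t).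
Proof.
 intros Hf Hg.
 replace (INR (S j) * cauchy f g (S j) t) with
  (sum_f_R0 (fun i => INR (S i) * f (S i) t * g (j - i)%nat t + f i t * (INR (S (j - i)) * g (S (j - i)) t)) j).
 - apply (is_derive_sum_f_R0 (fun i s => f i s * g (j - i)%nat s)
   (fun i t => INR (S i) * f (S i) t * g (j - i)%nat t + f i t * (INR (S (j - i)) * g (S (j - i)) t))).
  intros i Hi. apply (is_derive_mult (f i) (g (j - i)%nat) t (INR (S i) * f (S i) t) (INR (S (j - i)) * g (S (j - i)) t)).
  + apply Hf, Hi.
  + apply Hg. lia.
  + exact Rmult_comm.
 - unfold cauchy. rewrite scal_sum, sum_plus.
  rewrite (sum_eq (fun i => f i t * g (S j - i)%nat t * INR (S j))
   (fun i => INR i * f i t * g (S j - i)%nat t + f i t * (INR (S j - i) * g (S j - i)%nat t)) (S j)).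
  2:{ intros i Hi. rewrite minus_INR by exact Hi. ring. }
  rewrite sum_plus. f_equal.
  + rewrite (decomp_sum _ (S j)) by lia. rewrite !Rmult_0_l, Rplus_0_l. reflexivity.
  + rewrite tech5, Nat.sub_diag. rewrite Rmult_0_l, Rmult_0_r, Rplus_0_r.
   apply sum_eq. intros i Hi. replace (S j - i)%nat with (S (j - i)) by lia. lra.
Qed.

Definition gw (s : R) (j : nat) : R := Rpower (INR (fact j)) s.

Lemma gw_0 s : gw s 0 = 1.
Proof. unfold gw. simpl. unfold Rpower. rewrite ln_1, Rmult_0_r, exp_0. lra. Qed.

Lemma gw_le_mult s i j : 0 <= s -> (i <= j)%nat -> gw s i * gw s (j - i) <= gw s j.
Proof.
 intros Hs Hi. unfold gw. rewrite Rpower_mult_distr by apply INR_fact_lt_0.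
 apply Rpower_le_l; [lra|pos|].
 replace j with (i + (j - i))%nat at 2 by lia. apply fact_mult_le.
Qed.

Lemma gw_mono s i j : 0 <= s -> (i <= j)%nat -> gw s i <= gw s j.
Proof. intros Hs Hi. apply Rpower_le_l; [lra|pos|apply le_INR, fact_le, Hi]. Qed.

Lemma gw_le s s' j : s <= s' -> gw s j <= gw s' j.
Proof. intros H. apply Rle_Rpower; [apply fact_ge_1|lra]. Qed.

(** The subtracted [C ^ j] makes the induction close, since [D - C >= C]. *)
Lemma geometric_convolution C D j : 0 <= C -> 2 * C <= D -> sum_f_R0 (fun i => C ^ i * D ^ (j - i)) j <= 2 * D ^ j - C ^ j.
Proof.
 intros HC HD. induction j as [|j IH]; [simpl; lra|].
 rewrite tech5, Nat.sub_diag, (sum_eq _ (fun i => C ^ i * D ^ (j - i) * D)).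
 - rewrite <- scal_sum. simpl. note (pow_le C j HC). nra.
 - intros i Hi. replace (S j - i)%nat with (S (j - i)) by lia. simpl. ring.
Qed.

Lemma cauchy_bound s A B C D f g j t : 0 <= s -> 0 <= A -> 0 <= B -> 0 <= C -> 2 * C <= D ->
 (forall i, (i <= j)%nat -> Rabs (f i t) <= A * C ^ i * gw s i) -> (forall i, (i <= j)%nat -> Rabs (g i t) <= B * D ^ i * gw s i) ->
 Rabs (cauchy f g j t) <= 2 * A * B * D ^ j * gw s j.
Proof.
 intros Hs HA HB HC HD Hf Hg. bound Rsum_abs.
 via (sum_f_R0 (fun i => C ^ i * D ^ (j - i) * (A * B * gw s j)) j).
 - apply sum_Rle. intros i Hi. rewrite Rabs_mult.
  eapply Rle_trans; [apply Rmult_le_compat; [pos|pos|apply Hf; exact Hi|apply Hg; lia]|].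
  replace (A * C ^ i * gw s i * (B * D ^ (j - i) * gw s (j - i))) with (C ^ i * D ^ (j - i) * (A * B) * (gw s i * gw s (j - i))) by ring.
  rewrite <- !Rmult_assoc. rewrite Rmult_assoc. apply Rmult_le_compat_l; [|apply gw_le_mult; assumption].
  apply Rmult_le_pos; [pos|pos].
 - rewrite <- scal_sum. note (geometric_convolution C D j HC HD). note (pow_le C j HC).
  assert (0 <= A * B * gw s j) by (apply Rmult_le_pos; [pos|left; apply Rpower_pos]).
  nra.
Qed.

Section System.
Variables (F1 F2 p q : nat -> R -> R) (y1 y2 : R -> R).
Hypothesis (TF1 : taylor_family F1) (TF2 : taylor_family F2) (Tp : taylor_family p) (Tq : taylor_family q)
 (D1 : forall t, is_derive y1 t (F1 O t + p O t * y1 t + q O t * y2 t))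
 (D2 : forall t, is_derive y2 t (F2 O t + p O t * y2 t - q O t * y1 t)).

Let Y1 (j : nat) (t : R) : R := / INR (fact j) * Derive_n y1 j t.
Let Y2 (j : nat) (t : R) : R := / INR (fact j) * Derive_n y2 j t.
Let R1 (j : nat) (t : R) : R := F1 j t + (cauchy p Y1 j t + cauchy q Y2 j t).
Let R2 (j : nat) (t : R) : R := F2 j t + (cauchy p Y2 j t + -1 * cauchy q Y1 j t).

Lemma taylor_succ (y : R -> R) j t (l : R) : is_derive (fun s => / INR (fact j) * Derive_n y j s) t l ->
 l = INR (S j) * (/ INR (fact (S j)) * Derive_n y (S j) t).
Proof.
 intros H. apply is_derive_unique in H. rewrite Derive_scal in H. rewrite <- H. simpl Derive_n.
 rewrite fact_simpl, mult_INR. field. split; [apply INR_fact_neq_0|apply not_0_INR; lia].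
Qed.

(** Smoothness of [y1] and [y2] is not assumed: differentiability of the [j]-th coefficients and the
    recurrence for the next ones come together, by strong induction, from the equation. *)
Lemma system_taylor j : forall t, is_derive (Y1 j) t (R1 j t) /\ is_derive (Y2 j) t (R2 j t).
Proof.
 induction j as [j IH] using (well_founded_induction lt_wf).
 destruct j as [|j].
 - assert (E1 : forall s, Y1 O s = y1 s) by (intros; unfold Y1; simpl; field).
  assert (E2 : forall s, Y2 O s = y2 s) by (intros; unfold Y2; simpl; field). split.
  + apply (is_derive_ext y1); [pos|]. unfold R1, cauchy. simpl. rewrite E1, E2.
   replace (F1 O t + (p O t * y1 t + q O t * y2 t)) with (F1 O t + p O t * y1 t + q O t * y2 t) by ring. apply D1.
  + apply (is_derive_ext y2); [pos|]. unfold R2, cauchy. simpl. rewrite E1, E2.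
   replace (F2 O t + (p O t * y2 t + -1 * (q O t * y1 t))) with (F2 O t + p O t * y2 t - q O t * y1 t) by ring. apply D2.
 - intros t.
  assert (T1 : forall i, (i <= j)%nat -> is_derive (Y1 i) t (INR (S i) * Y1 (S i) t)).
  { intros i Hi. destruct (IH i ltac:(lia) t) as [H _]. rewrite (taylor_succ y1 i t _ H) in H. exact H. }
  assert (T2 : forall i, (i <= j)%nat -> is_derive (Y2 i) t (INR (S i) * Y2 (S i) t)).
  { intros i Hi. destruct (IH i ltac:(lia) t) as [_ H]. rewrite (taylor_succ y2 i t _ H) in H. exact H. }
  assert (HS : INR (S j) <> 0) by (apply not_0_INR; lia). split.
  + assert (E : forall s, / INR (S j) * R1 j s = Y1 (S j) s).
   { intros s. destruct (IH j ltac:(lia) s) as [H _]. rewrite (taylor_succ y1 j s _ H). unfold Y1. field. split; [apply INR_fact_neq_0|lra]. }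
   apply (is_derive_ext (fun s => / INR (S j) * R1 j s)); [pos|].
   replace (R1 (S j) t) with (/ INR (S j) * (INR (S j) * F1 (S j) t + (INR (S j) * cauchy p Y1 (S j) t + INR (S j) * cauchy q Y2 (S j) t)))
    by (unfold R1; field; exact HS).
   apply is_derive_scal, (is_derive_plus (F1 j)); [pos|].
   apply (is_derive_plus (cauchy p Y1 j) (cauchy q Y2 j)); apply cauchy_derive; auto.
  + assert (E : forall s, / INR (S j) * R2 j s = Y2 (S j) s).
   { intros s. destruct (IH j ltac:(lia) s) as [_ H]. rewrite (taylor_succ y2 j s _ H). unfold Y2. field. split; [apply INR_fact_neq_0|lra]. }
   apply (is_derive_ext (fun s => / INR (S j) * R2 j s)); [pos|].
   replace (R2 (S j) t) with (/ INR (S j) * (INR (S j) * F2 (S j) t + (INR (S j) * cauchy p Y2 (S j) t + -1 * (INR (S j) * cauchy q Y1 (S j) t))))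
    by (unfold R2; field; exact HS).
   apply is_derive_scal, (is_derive_plus (F2 j)); [pos|].
   apply (is_derive_plus (cauchy p Y2 j) (fun s => -1 * cauchy q Y1 j s)); [|apply is_derive_scal]; apply cauchy_derive; auto.
Qed.

(** [Q] stands for the size of the eigenvalue and enters only through the rate. Order [s] on Taylor
    coefficients is order [s + 1] on derivatives. *)
Lemma system_gevrey s M h Q C : 0 <= s -> 0 <= M -> 0 <= h -> 1 <= Q -> 1 <= C ->
 (forall j t, Rabs (p j t) <= h * Q * C ^ j * gw s j) -> (forall j t, Rabs (q j t) <= h * Q * C ^ j * gw s j) ->
 (forall j t, Rabs (F1 j t) <= M * C ^ j * gw s j) -> (forall j t, Rabs (F2 j t) <= M * C ^ j * gw s j) ->
 (forall t, Rabs (y1 t) <= M) -> (forall t, Rabs (y2 t) <= M) ->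
 forall j t, ex_derive (Derive_n y1 j) t /\ ex_derive (Derive_n y2 j) t /\
  Rabs (Derive_n y1 j t) <= M * (Q * (2 * C + 4 * h + 1)) ^ j * gw (s + 1) j /\
  Rabs (Derive_n y2 j t) <= M * (Q * (2 * C + 4 * h + 1)) ^ j * gw (s + 1) j.
Proof.
 intros Hs HM Hh HQ HC Hp Hq HF1 HF2 B1 B2. set (A := 2 * C + 4 * h + 1). set (D := Q * A).
 assert (HD : 2 * C <= D) by (unfold D, A; nra).
 assert (HhQ : 0 <= h * Q) by nra.
 assert (key : forall j t, Rabs (Y1 j t) <= M * D ^ j * gw s j /\ Rabs (Y2 j t) <= M * D ^ j * gw s j).
 { induction j as [j IH] using (well_founded_induction lt_wf). intros t. destruct j as [|j].
  - unfold Y1, Y2. rewrite gw_0. simpl. rewrite Rinv_1, !Rmult_1_l, !Rmult_1_r. auto.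
  - assert (I1 : forall i, (i <= j)%nat -> Rabs (Y1 i t) <= M * D ^ i * gw s i) by (intros; apply IH; lia).
   assert (I2 : forall i, (i <= j)%nat -> Rabs (Y2 i t) <= M * D ^ i * gw s i) by (intros; apply IH; lia).
   assert (HR : Rabs (R1 j t) <= M * D ^ S j * gw s (S j) /\ Rabs (R2 j t) <= M * D ^ S j * gw s (S j)).
   { assert (HC0 : 0 <= C) by lra.
    note (cauchy_bound s (h * Q) M C D p Y1 j t Hs HhQ HM HC0 HD ltac:(intros; apply Hp) I1) as b1.
    note (cauchy_bound s (h * Q) M C D q Y2 j t Hs HhQ HM HC0 HD ltac:(intros; apply Hq) I2) as b2.
    note (cauchy_bound s (h * Q) M C D p Y2 j t Hs HhQ HM HC0 HD ltac:(intros; apply Hp) I2) as b3.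
    note (cauchy_bound s (h * Q) M C D q Y1 j t Hs HhQ HM HC0 HD ltac:(intros; apply Hq) I1) as b4.
    set (W := M * D ^ j * gw s j). assert (HW : 0 <= W).
    { apply Rmult_le_pos; [pos|left; apply Rpower_pos]. }
    assert (HF : M * C ^ j * gw s j <= W).
    { apply Rmult_le_compat_r; [left; apply Rpower_pos|]. mono. }
    assert (HT : W + 4 * (h * Q) * W <= M * D ^ S j * gw s (S j)).
    { via (D * W).
     - via ((1 + 4 * (h * Q)) * W); [lra|]. scale_r. unfold D, A. nra.
     - replace (D * W) with (M * D ^ S j * gw s j) by (unfold W; simpl; ring).
      apply Rmult_le_compat_l; [pos|apply gw_mono; [lra|lia]]. }
    replace (2 * (h * Q) * M * D ^ j * gw s j) with (2 * (h * Q) * W) in b1, b2, b3, b4 by (unfold W; ring).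
    split.
    - bound Rabs_triang. eapply Rle_trans; [apply Rplus_le_compat_l, Rabs_triang|]. specialize (HF1 j t). lra.
    - bound Rabs_triang. eapply Rle_trans; [apply Rplus_le_compat_l, Rabs_triang|].
     rewrite Rabs_mult, Rabs_m1, Rmult_1_l. specialize (HF2 j t). lra. }
   assert (HS : 1 <= INR (S j)) by (apply INR_S_ge_1).
   destruct (system_taylor j t) as [E1 E2]. apply taylor_succ in E1. apply taylor_succ in E2.
   fold (Y1 (S j) t) in E1. fold (Y2 (S j) t) in E2. rewrite E1, E2, !Rabs_mult, (Rabs_pos_eq (INR (S j))) in HR by lra.
   note (Rabs_pos (Y1 (S j) t)). note (Rabs_pos (Y2 (S j) t)). nra. }
 intros j t. destruct (system_taylor j t) as [E1 E2]. destruct (key j t) as [K1 K2].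
 assert (HJ : INR (fact j) <> 0) by apply INR_fact_neq_0. note (INR_fact_lt_0 j) as HJ2.
 assert (X : forall y, ex_derive (fun s => / INR (fact j) * Derive_n y j s) t -> ex_derive (Derive_n y j) t).
 { intros y Hy. assert (E : forall s, INR (fact j) * (/ INR (fact j) * Derive_n y j s) = Derive_n y j s) by (intros; field; exact HJ).
  apply (ex_derive_ext (fun s => INR (fact j) * (/ INR (fact j) * Derive_n y j s))); [pos|].
  apply ex_derive_scal. exact Hy. }
 assert (Z : forall y, Rabs (/ INR (fact j) * Derive_n y j t) <= M * D ^ j * gw s j -> Rabs (Derive_n y j t) <= M * D ^ j * gw (s + 1) j).
 { intros y Hy. rewrite Rabs_mult, Rabs_pos_eq in Hy by pos.
  unfold gw. rewrite Rpower_plus, Rpower_1 by exact HJ2. fold (gw s j).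
  apply (Rmult_le_compat_l (INR (fact j))) in Hy; [|lra]. rewrite <- Rmult_assoc, Rinv_r, Rmult_1_l in Hy by exact HJ. lra. }
 split; [apply X; eexists; exact E1|]. split; [apply X; eexists; exact E2|]. pos.
Qed.
End System.

(** * Periodic functions and their primitives *)

Notation periodic f := (forall t, f (t + 2 * PI) = f t).
Definition continuous_periodic (f : R -> R) : Prop := (forall s, continuous f s) /\ periodic f.

Lemma periodic_iff (P : R -> Prop) : (forall t, P (t + 2 * PI) <-> P t) -> forall z t, P (t + 2 * PI * IZR z) <-> P t.
Proof.
 intros H. assert (Hn : forall (n : nat) t, P (t + 2 * PI * INR n) <-> P t).
 { induction n as [|n IH]; intros t; [simpl; rewrite Rmult_0_r, Rplus_0_r; reflexivity|].
  rewrite <- (IH t), <- (H (t + 2 * PI * INR n)), S_INR. replace (t + 2 * PI * (INR n + 1)) with (t + 2 * PI * INR n + 2 * PI) by ring. triv. }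
 intros z t. destruct (Z_le_gt_dec 0 z).
 - rewrite <- (Z2Nat.id z), <- INR_IZR_INZ by assumption. apply Hn.
 - rewrite <- (Hn (Z.to_nat (- z)) (t + _)), INR_IZR_INZ, Z2Nat.id, opp_IZR by lia.
  replace (t + 2 * PI * IZR z + 2 * PI * - IZR z) with t by ring. triv.
Qed.

Lemma periodic_eq (f : R -> R) z t : periodic f -> f (t + 2 * PI * IZR z) = f t.
Proof. intros H. apply (periodic_iff (fun s => f s = f t)); [|lra]. triv. Qed.

Lemma cos_periodic_Z z t : cos (t + 2 * PI * IZR z) = cos t.
Proof. apply periodic_eq. intros s. rewrite cos_plus, cos_2PI, sin_2PI. ring. Qed.

Lemma sin_periodic_Z z t : sin (t + 2 * PI * IZR z) = sin t.
Proof. apply periodic_eq. intros s. rewrite sin_plus, cos_2PI, sin_2PI. ring. Qed.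

Lemma representative t0 t : exists z, t0 <= t + 2 * PI * IZR z < t0 + 2 * PI.
Proof.
 note PI_RGT_0. exists (- Int_part ((t - t0) / (2 * PI)))%Z. rewrite opp_IZR.
 destruct (base_Int_part ((t - t0) / (2 * PI))) as [H1 H2].
 assert (E : t - t0 = 2 * PI * ((t - t0) / (2 * PI))) by (field; lra). nra.
Qed.

Lemma nearest_integer x : exists z, Rabs (x - IZR z) <= 1 / 2.
Proof. exists (Int_part (x + 1 / 2)). destruct (base_Int_part (x + 1 / 2)). apply Rabs_le. lra. Qed.

Lemma periodic_extend (P : R -> Prop) t0 : (forall t, P (t + 2 * PI) <-> P t) -> (forall t, t0 <= t <= t0 + 2 * PI -> P t) -> forall t, P t.
Proof. intros HP H t. destruct (representative t0 t) as [z Hz]. apply (periodic_iff P HP z). apply H. lra. Qed.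

Lemma periodic_max (f : R -> R) : continuous_periodic f -> exists t0, forall t, f t <= f t0.
Proof.
 intros [Hc Hp]. note PI_RGT_0. destruct (continuity_ab_maj f 0 (2 * PI)) as [t0 [H0 _]]; [lra|intros; apply continuity_pt_filterlim, Hc|].
 exists t0. apply (periodic_extend _ 0); [triv|]. intros t Ht. apply H0. lra.
Qed.

Lemma periodic_bounded (f : R -> R) : continuous_periodic f -> exists M, forall t, Rabs (f t) <= M.
Proof.
 intros [Hc Hp]. destruct (periodic_max f (conj Hc Hp)) as [t1 H1].
 destruct (periodic_max (fun s => - f s)) as [t2 H2]; [split; intros; [apply continuous_Ropp, Hc|triv]|].
 exists (Rabs (f t1) + Rabs (f t2)). intros t. specialize (H1 t). specialize (H2 t).
 note (Rle_abs (f t1)). note (Rle_abs (- f t2)). rewrite Rabs_Ropp in *.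
 note (Rabs_pos (f t1)). note (Rabs_pos (f t2)). apply Rabs_le. lra.
Qed.

Lemma square_le x y : Rabs x <= y -> x ^ 2 <= y ^ 2.
Proof. rewrite <- pow2_abs. triv. Qed.

Lemma sum_squares_zero x y : x ^ 2 + y ^ 2 = 0 -> x = 0 /\ y = 0.
Proof. nra. Qed.

Definition prim (a : R -> R) (t : R) : R := RInt a 0 t.

Lemma prim_derive (a : R -> R) (t : R) : (forall s, continuous a s) -> is_derive (prim a) t (a t).
Proof.
 intros Ha. apply (is_derive_RInt a (prim a) 0 t); [|pos].
 apply filter_forall. intros x. apply (RInt_correct (V := R_CompleteNormedModule) a 0 x), (ex_RInt_continuous (V := R_CompleteNormedModule)). pos.
Qed.

Lemma prim_0 a : prim a 0 = 0.
Proof. exact (RInt_point (V := R_CompleteNormedModule) 0 a). Qed.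

Lemma lipschitz_of_derivative (f f' : R -> R) C : (forall s, is_derive f s (f' s)) -> (forall s, Rabs (f' s) <= C) ->
 forall s t, Rabs (f s - f t) <= C * Rabs (s - t).
Proof.
 intros D HC s t. destruct (mean_value f f' t s D) as (c & _ & _ & E). rewrite E, Rabs_mult. scale_r; apply HC.
Qed.

Lemma constant_of_derive (h : R -> R) : (forall s, is_derive h s 0) -> forall s t, h s = h t.
Proof.
 intros H s t. note (lipschitz_of_derivative h (fun _ => 0) 0 H ltac:(intros; cbv beta; rewrite Rabs_R0; lra) s t) as B.
 apply Rminus_diag_uniq, cond_eq. intros e He. rewrite Rminus_0_r. lra.
Qed.

Lemma eq_of_derive (h k : R -> R) (d : R -> R) t0 : (forall s, is_derive h s (d s)) -> (forall s, is_derive k s (d s)) ->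
 h t0 = k t0 -> forall t, h t = k t.
Proof.
 intros H1 H2 E t. assert (Hc : h t - k t = h t0 - k t0).
 { apply (constant_of_derive (fun s => h s - k s)). intros s. replace 0 with (d s - d s) by ring.
  apply (is_derive_minus h k s (d s) (d s)); auto. }
 lra.
Qed.

Lemma is_derive_shift (h : R -> R) c t l : is_derive h (t + c) l -> is_derive (fun s => h (s + c)) t l.
Proof.
 intros H. replace l with (1 * l) by ring. apply (is_derive_comp h (fun s => s + c)); [pos|].
 auto_derive; [lra|ring].
Qed.

Lemma is_derive_bilinear (p q x y : R -> R) p' q' x' y' t : is_derive p t p' -> is_derive q t q' -> is_derive x t x' -> is_derive y t y' ->
 is_derive (fun s => p s * x s + q s * y s) t (p' * x t + p t * x' + (q' * y t + q t * y')).
Proof.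
 intros H1 H2 H3 H4. apply (is_derive_plus (fun s => p s * x s) (fun s => q s * y s) t (p' * x t + p t * x') (q' * y t + q t * y')).
 - apply (is_derive_mult p x t p' x' H1 H3). exact Rmult_comm.
 - apply (is_derive_mult q y t q' y' H2 H4). exact Rmult_comm.
Qed.

Lemma prim_shift (a : R -> R) (t : R) : continuous_periodic a -> prim a (t + 2 * PI) = prim a t + prim a (2 * PI).
Proof.
 intros [Ha Hp]. apply (eq_of_derive (fun s => prim a (s + 2 * PI)) (fun s => prim a s + prim a (2 * PI)) a 0).
 - intros s. rewrite <- Hp. apply is_derive_shift, prim_derive, Ha.
 - intros s. replace (a s) with (a s + 0) by ring.
  apply (is_derive_plus (prim a) (fun _ => prim a (2 * PI)) s (a s) 0); [apply prim_derive, Ha|apply is_derive_cst].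
 - rewrite prim_0, !Rplus_0_l. lra.
Qed.

Lemma prim_zero t : prim (fun _ => 0) t = 0.
Proof.
 apply (eq_of_derive (prim (fun _ => 0)) (fun _ => 0) (fun _ => 0) 0); [intros; apply (prim_derive (fun _ => 0)); intros; apply continuous_const| |apply prim_0].
 apply is_derive_cst.
Qed.

Lemma bounded_below_increment h t1 t2 s1 s2 c (h' : R -> R) : (forall t, is_derive h t (h' t)) -> t1 <= s1 <= s2 -> s2 <= t2 ->
 (forall t, t1 <= t <= t2 -> 0 <= h' t) -> (forall t, s1 <= t <= s2 -> c <= h' t) -> c * (s2 - s1) <= h t2 - h t1.
Proof.
 intros D Hs1 Hs2 H0 Hc.
 assert (M : forall x y, x <= y -> exists z, x <= z <= y /\ h y - h x = h' z * (y - x)).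
 { intros x y Hxy. destruct (mean_value h h' x y D) as (z & Hz & _ & E). triv. }
 destruct (M t1 s1 ltac:(lra)) as (z1 & Hz1 & E1). destruct (M s1 s2 ltac:(lra)) as (z2 & Hz2 & E2). destruct (M s2 t2 ltac:(lra)) as (z3 & Hz3 & E3).
 specialize (Hc z2 Hz2). note (H0 z1 ltac:(lra)). note (H0 z3 ltac:(lra)). nra.
Qed.

Lemma near_sign (b : R -> R) t : continuous b t -> 0 < b t -> exists eta, 0 < eta <= 1 /\ forall s, Rabs (s - t) <= 2 * eta -> b t / 2 <= b s.
Proof.
 intros Hc Hb. apply (proj1 (filterlim_locally _ _)) with (eps := pos_div_2 (mkposreal _ Hb)) in Hc. destruct Hc as [d Hd].
 note (cond_pos d). exists (Rmin 1 (d / 3)). note (Rmin_l 1 (d / 3)). note (Rmin_r 1 (d / 3)).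
 split; [triv|]. intros s Hs. assert (Hq : ball t d s) by (change (Rabs (s - t) < d); lra).
 specialize (Hd s Hq). change (Rabs (b s - b t) < b t / 2) in Hd. apply Rabs_def2 in Hd. lra.
Qed.

Lemma cos_ge_abs x y : Rabs x <= y <= PI -> cos y <= cos x.
Proof.
 intros H. replace (cos x) with (cos (Rabs x)) by (unfold Rabs; destruct (Rcase_abs x); [apply cos_neg|lra]).
 note (Rabs_pos x). apply cos_decr_1; lra.
Qed.

Lemma exp_le x y : x <= y -> exp x <= exp y.
Proof. intros [H | ->]; [left; apply exp_increasing, H|lra]. Qed.

Lemma sin_ge_half x : 0 <= x <= PI / 2 -> x / 2 <= sin x.
Proof.
 intros Hx. destruct (mean_value sin cos 0 (x / 2)) as (c & Hc & _ & E).
 - intros; apply is_derive_sin.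
 - rewrite sin_0, !Rminus_0_r in E.
  replace x with (2 * (x / 2)) at 2 by field. rewrite sin_2a, E.
  assert (Hq : forall y, 0 <= y <= PI / 4 -> 1 / sqrt 2 <= cos y) by (intros y Hy; rewrite <- cos_PI4; apply cos_decr_1; lra).
  note (Hq c ltac:(lra)). note (Hq (x / 2) ltac:(lra)). note (sqrt_lt_R0 2 ltac:(lra)) as Hs.
  assert (E2 : 1 / sqrt 2 * (1 / sqrt 2) = 1 / 2) by (rewrite <- (sqrt_sqrt 2) at 3 by lra; field; lra).
  assert (0 < 1 / sqrt 2) by pos.
  assert (1 / 2 <= cos c * cos (x / 2)) by nra. nra.
Qed.

Lemma cos_quadratic x : - PI <= x <= PI -> x ^ 2 / 8 <= 1 - cos x <= x ^ 2 / 2.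
Proof.
 assert (H : forall x, 0 <= x <= PI -> x ^ 2 / 8 <= 1 - cos x <= x ^ 2 / 2).
 { intros y Hy. replace (cos y) with (1 - 2 * sin (y / 2) * sin (y / 2)) by (rewrite <- cos_2a_sin; f_equal; field).
  note (sin_ge_half (y / 2) ltac:(lra)). assert (sin (y / 2) <= y / 2).
  { destruct (Req_dec y 0) as [->|]; [replace (0 / 2) with 0 by field; rewrite sin_0; lra|left; apply sin_lt_x; lra]. }
  nra. }
 intros Hx. destruct (Rle_lt_dec 0 x); [apply H; lra|]. specialize (H (- x) ltac:(lra)). rewrite cos_neg in H. nra.
Qed.

(** Compares [|exp (- y + i v) - 1|] with [|y + i v|], capped because the former stays bounded. The
    range of [v] is reached by subtracting the nearest multiple of [2 PI]. *)
Lemma unit_distance y v : 0 <= y -> - PI <= v <= PI ->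
 Rmin 1 (y ^ 2 + v ^ 2) <= 8 * ((exp (- y) * cos v - 1) ^ 2 + (exp (- y) * sin v) ^ 2).
Proof.
 intros Hy Hv. set (r := exp (- y)). assert (Hr : 0 < r) by apply exp_pos.
 assert (E : (r * cos v - 1) ^ 2 + (r * sin v) ^ 2 = (1 - r) ^ 2 + 2 * r * (1 - cos v)).
 { note (sin2_cos2 v) as H. unfold Rsqr in H. nra. }
 destruct (cos_quadratic v Hv) as [H1 _]. destruct (Rle_lt_dec r (1 / 2)).
 - bound Rmin_l. nra.
 - bound Rmin_r. assert (y / 2 <= 1 - r).
  { note (exp_ineq1_le y) as Hey. assert (Er : exp y * r = 1) by (unfold r; rewrite <- exp_plus; replace (y + - y) with 0 by ring; apply exp_0). nra. }
  nra.
Qed.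

(** * Superlevel sets and alternation *)

(** All four points lie within one period, so the pattern is cyclic. The inequalities at the low
    points are not strict because the superlevel sets are. *)
Definition alternating (G : R -> R) : Prop := exists x1 y1 x2 y2 r, x1 < y1 /\ y1 < x2 /\ x2 < y2 /\ y2 < x1 + 2 * PI /\
 G y1 <= r /\ G y2 <= r /\ r < G x1 /\ r < G x2.

(** A negative factor exchanges high and low, and a cyclic shift by one point restores the
    pattern. *)
Lemma alternating_scal (G : R -> R) l : periodic G -> alternating (fun t => l * G t) -> alternating G.
Proof.
 intros HP (x1 & y1 & x2 & y2 & r & H1 & H2 & H3 & H4 & H5 & H6 & H7 & H8).
 destruct (Rtotal_order l 0) as [Hl|[->|Hl]]; [|lra|].
 - exists y1, x2, y2, (x1 + 2 * PI), (Rmax (G x1) (G x2)). rewrite HP.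
  assert (Hx : forall y, l * G y <= r -> Rmax (G x1) (G x2) < G y) by (intros y Hy; apply Rmax_lub_lt; nra).
  repeat split; try lra; [apply Rmax_r|apply Rmax_l|auto..].
 - exists x1, y1, x2, y2, (Rmax (G y1) (G y2)).
  assert (Hx : forall x, r < l * G x -> Rmax (G y1) (G y2) < G x) by (intros x Hx; apply Rmax_lub_lt; nra).
  repeat split; try lra; [apply Rmax_l|apply Rmax_r|auto..].
Qed.

(** [t0] is a maximum point of [G]; on the chosen arc the integrating factor [exp (- G)] is largest at [t]. *)
Lemma arcs_of_not_alternating (G : R -> R) : continuous_periodic G -> ~ alternating G -> exists t0, forall t, t0 <= t <= t0 + 2 * PI ->
 (forall s, t0 <= s <= t -> - G s <= - G t) \/ (forall s, t <= s <= t0 + 2 * PI -> - G s <= - G t).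
Proof.
 intros [Hc Hp] Hna. destruct (periodic_max G (conj Hc Hp)) as [t0 H0]. exists t0. intros t Ht.
 destruct (classic (forall s, t0 <= s <= t -> - G s <= - G t)) as [|N1]; [pos|].
 destruct (classic (forall s, t <= s <= t0 + 2 * PI -> - G s <= - G t)) as [|N2]; [pos|]. exfalso. apply Hna.
 apply not_all_ex_not in N1. destruct N1 as [s1 N1]. apply not_all_ex_not in N2. destruct N2 as [s2 N2].
 assert (A : forall x y, G x < G y -> x <> y) by (intros x y H ->; lra). note (H0 t). note (Hp t0).
 note (A s1 t ltac:(lra)). note (A s1 t0 ltac:(lra)). note (A s2 t ltac:(lra)). note (A s2 (t0 + 2 * PI) ltac:(lra)).
 assert (Rmax (G s1) (G s2) < G t) by (apply Rmax_lub_lt; lra).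
 exists t0, s1, t, s2, (Rmax (G s1) (G s2)). repeat split; try lra; [apply Rmax_l|apply Rmax_r].
Qed.

(** At the supremum of the initial segments contained in [U], membership in either open set leads to
    a contradiction. *)
Lemma interval_connected (U V : R -> Prop) s e : open U -> open V -> s <= e -> (forall t, s <= t <= e -> U t \/ V t) ->
 (forall t, s <= t <= e -> U t -> V t -> False) -> U s -> V e -> False.
Proof.
 intros OU OV Hse HUV Hd Us Ve.
 destruct (completeness (fun x => s <= x <= e /\ forall y, s <= y <= x -> U y)) as [c [Hub Hlub]].
 - exists e. intros x [Hx _]. lra.
 - exists s. split; [lra|]. intros y Hy. replace y with s by lra. exact Us.
 - assert (Hc : s <= c <= e).
  { split; [apply Hub; split; [lra|]; intros y Hy; replace y with s by lra; exact Us|]. apply Hlub. easy. }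
  assert (Hlt : forall d, 0 < d -> exists x, c - d < x <= c /\ s <= x <= e /\ forall y, s <= y <= x -> U y).
  { intros d Hd0. apply NNPP. intros N. assert (HH : c <= c - d); [|lra]. apply Hlub. intros x Hx.
   destruct (Rle_lt_dec x (c - d)) as [|Hxd]; [lra|]. exfalso. apply N. triv. }
  destruct (HUV c Hc) as [Uc|Vc].
  + destruct (OU c Uc) as [d HdU]. assert (Hce : c < e) by (destruct (Req_dec c e) as [->|]; [destruct (Hd e Hc Uc Ve)|lra]).
   set (x := Rmin e (c + d / 2)). note (cond_pos d) as Hdp. assert (Hx : c < x <= c + d / 2 /\ x <= e) by (unfold x; split; [split; [apply Rmin_glb_lt; lra|apply Rmin_r]|apply Rmin_l]).
   assert (HH : x <= c); [|lra]. apply Hub. split; [lra|]. intros y Hy. destruct (Rlt_le_dec y c) as [Hyc|Hyc].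
   * destruct (Hlt (c - y) ltac:(lra)) as (z & Hz & _ & HU). apply HU. lra.
   * apply HdU. change (Rabs (y - c) < d). apply Rabs_def1; lra.
  + destruct (OV c Vc) as [d HdV]. note (cond_pos d) as Hdp. destruct (Hlt d Hdp) as (x & Hx & Hxe & HU).
   apply (Hd x Hxe); [apply HU; lra|]. apply HdV. change (Rabs (x - c) < d). apply Rabs_def1; lra.
Qed.

Lemma Omega_iff b r : periodic (prim b) -> forall t, Omega b r t <-> r < prim b t.
Proof.
 intros HP t. assert (E : forall k, prim b (t - 2 * PI * IZR k) = prim b t).
 { intros k. rewrite <- (periodic_eq (prim b) (- k) t HP), opp_IZR. f_equal. ring. }
 split.
 - intros [k [_ Hk]]. rewrite <- (E k). exact Hk.
 - destruct (representative 0 t) as [z Hz]. exists (- z)%Z. split; [rewrite opp_IZR; lra|].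
  change (prim b (t - 2 * PI * IZR (- z)) > r). rewrite E. exact H.
Qed.

Lemma connected_iff_not_alternating b : periodic (prim b) ->
 ((forall r, connected_T (Omega b r)) <-> ~ alternating (prim b)).
Proof.
 intros HP. split.
 - intros HC (x1 & y1 & x2 & y2 & r & H1 & H2 & H3 & H4 & H5 & H6 & H7 & H8).
  (* The separating sets are the periodic hulls of the two arcs between the consecutive low points
     [y2 - 2 PI], [y1] and [y2], all of which the superlevel set misses. *)
  set (hull := fun p q t => exists z, p < t + 2 * PI * IZR z < q).
  assert (Hper : forall p q, periodic_set (hull p q)).
  { split; intros [z Hz]; [exists (z + 1)%Z|exists (z - 1)%Z]; rewrite ?plus_IZR, ?minus_IZR in *; lra. }
  assert (Hopen : forall p q, open (hull p q)).
  { intros p q t [z Hz]. assert (Hd : 0 < Rmin (t + 2 * PI * IZR z - p) (q - (t + 2 * PI * IZR z))) by pos.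
   exists (mkposreal _ Hd). intros y Hy. exists z. change (Rabs (y - t) < Rmin (t + 2 * PI * IZR z - p) (q - (t + 2 * PI * IZR z))) in Hy.
   note (Rmin_l (t + 2 * PI * IZR z - p) (q - (t + 2 * PI * IZR z))). note (Rmin_r (t + 2 * PI * IZR z - p) (q - (t + 2 * PI * IZR z))).
   apply Rabs_def2 in Hy. lra. }
  apply (HC r). exists (hull (y2 - 2 * PI) y1), (hull y1 y2).
  split; [pos|]. split; [pos|]. split; [pos|]. split; [pos|]. split; [|split; [|split]].
  + intros t Ht. apply (Omega_iff b r HP) in Ht. destruct (representative (y2 - 2 * PI) t) as [z Hz].
   rewrite <- (periodic_eq (prim b) z t HP) in Ht. set (s := t + 2 * PI * IZR z) in *.
   assert (Hs : s <> y1) by (intros ->; lra). assert (Hs2 : s <> y2 - 2 * PI) by (intros Es; rewrite <- (HP s), Es in Ht; replace (y2 - 2 * PI + 2 * PI) with y2 in Ht by ring; lra).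
   destruct (Rlt_le_dec s y1); [left|right]; exists z; fold s; lra.
  + exists x1. split; [apply (Omega_iff b r HP); exact H7|]. exists 0%Z. lra.
  + exists x2. split; [apply (Omega_iff b r HP); exact H8|]. exists 0%Z. lra.
  + intros t _ [z Hz] [z' Hz']. destruct (Z_lt_le_dec z z') as [Hl|Hl].
   * assert (Q : IZR z + 1 <= IZR z') by (rewrite <- plus_IZR; apply IZR_le; lia). nra.
   * apply IZR_le in Hl. nra.
 - intros Hna r (U & V & PU & PV & OU & OV & HUV & [t1 [S1 U1]] & [t2 [S2 V2]] & Hd). apply Hna.
  destruct (representative t1 t2) as [z Hz]. rewrite <- (periodic_iff V PV z) in V2. apply (Omega_iff b r HP) in S2. rewrite <- (periodic_eq (prim b) z t2 HP) in S2.
  set (t2' := t2 + 2 * PI * IZR z) in *.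
  assert (Hout : forall (P Q : R -> Prop) p q, open P -> open Q -> (forall t, Omega b r t -> P t \/ Q t) -> (forall t, Omega b r t -> P t -> Q t -> False) ->
   p <= q -> P p -> Q q -> exists y, p <= y <= q /\ prim b y <= r).
  { intros P Q p q OP OQ HPQ Hd' Hpq Pp Qq. apply NNPP. intros N.
   assert (HO : forall t, p <= t <= q -> Omega b r t).
   { intros t Ht. apply (Omega_iff b r HP). destruct (Rlt_le_dec r (prim b t)) as [|Hle]; [lra|]. exfalso. apply N. exists t. auto. }
   apply (interval_connected P Q p q OP OQ Hpq); auto. intros t Ht. apply Hd', HO, Ht. }
  apply (Omega_iff b r HP) in S1.
  destruct (Hout U V t1 t2' OU OV HUV Hd ltac:(lra) U1 V2) as [y1 [Hy1 B1]].
  destruct (Hout V U t2' (t1 + 2 * PI) OV OU) as [y2 [Hy2 B2]]; [intros t Ht; destruct (HUV t Ht); auto|intros t Ht H1 H2; exact (Hd t Ht H2 H1)|lra|pos|apply PU, U1|].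
  assert (y1 <> t1) by (intros ->; lra). assert (y1 <> t2') by (intros ->; lra). assert (y2 <> t2') by (intros ->; lra).
  assert (y2 <> t1 + 2 * PI) by (intros ->; rewrite HP in B2; lra).
  exists t1, y1, t2', y2, r. lra.
Qed.

(** * Oscillating test data and the geometry of the primitive *)

Definition phase (a : R -> R) (l psi th t : R) : R := - (l * prim a t) + psi * t + th.
(** The phase cancels that of the integrating factor [exp (i l (A + i B))], leaving [w exp (- l B)]
    times [exp (i (psi t + th))]. The shift [psi] restores periodicity when [l] times the increment
    of [A] over a period is not a multiple of [2 PI]. *)
Definition wave (a : R -> R) (l psi th : R) (w g : R -> R) (t : R) : R := w t * g (phase a l psi th t).

(** On [[s1, s2]] the factor [exp (- G)] is at least [exp delta] times its value at [ts]. Which end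
    of the period serves as [ts] depends on the sign of [G (2 PI)], so that the multiplier over a
    period can be controlled. *)
Definition growth_data (G : R -> R) (T ts s1 s2 eta delta : R) : Prop :=
 0 < eta <= 1 /\ 0 < delta /\ T + eta <= s1 < s2 /\ s2 <= T + 2 * PI - eta /\ (forall s, s1 <= s <= s2 -> G s <= G ts - delta) /\
 ((ts = T /\ 0 <= G (2 * PI)) \/ (ts = T + 2 * PI /\ G (2 * PI) <= 0)).

(** The period is cut where [s b] has the right sign: negative if the primitive has a nonnegative
    total increment, so that it drops just after the start, and positive otherwise, so that it is
    lower just before the end. *)
Lemma growth_exists s b : s ^ 2 = 1 -> continuous_periodic b -> changes_sign b ->
 exists T ts s1 s2 eta delta, growth_data (fun t => s * prim b t) T ts s1 s2 eta delta.
Proof.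
 intros Hs [Hc Hp] (t1 & t2 & Hm & Hpl). note PI2_3_2 as Hpi.
 assert (Hg : exists tm tp, s * b tm < 0 < s * b tp) by (destruct (Rtotal_order s 0) as [|[->|]]; [exists t2, t1|lra|exists t1, t2]; nra).
 destruct Hg as (tm & tp & Hg1 & Hg2).
 assert (M : forall x y, x <= y -> exists z, x <= z <= y /\ s * prim b y - s * prim b x = s * b z * (y - x)).
 { intros x y Hxy. destruct (mean_value (fun t => s * prim b t) (fun t => s * b t) x y) as (z & Hz & _ & E); [intros; apply is_derive_scal, prim_derive, Hc|]. exists z. auto. }
 assert (Cg : forall t, continuous (fun t => s * b t) t) by (intros; apply (continuous_scal_r (V := R_NormedModule)), Hc).
 destruct (Rle_lt_dec 0 (s * prim b (2 * PI))) as [HB|HB].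
 - destruct (near_sign (fun t => - (s * b t)) tm) as [eta [He Hn]]; [apply continuous_Ropp, Cg|lra|].
  exists tm, tm, (tm + eta), (tm + 2 * eta), eta, (- (s * b tm) / 2 * eta).
  split; [lra|]. split; [nra|]. split; [lra|]. split; [lra|]. split; [|lra].
  intros r Hr. destruct (M tm r ltac:(lra)) as (z & Hz & E). specialize (Hn z ltac:(apply Rabs_le; lra)). nra.
 - destruct (near_sign (fun t => s * b t) tp) as [eta [He Hn]]; [triv|lra|].
  exists (tp - 2 * PI), tp, (tp - 2 * eta), (tp - eta), eta, (s * b tp / 2 * eta).
  split; [lra|]. split; [nra|]. split; [lra|]. split; [lra|]. split; [|lra].
  intros r Hr. destruct (M r tp ltac:(lra)) as (z & Hz & E). specialize (Hn z ltac:(apply Rabs_le; lra)). nra.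
Qed.

(** The height that [bump] has reached at distance [e] inside an arc of half-length [w]. *)
Definition sag (w e : R) : R := cos (w - e) - cos w.

Lemma sag_pos w e : 0 < e <= w -> w < PI -> 0 < sag w e.
Proof. intros H1 H2. unfold sag. assert (cos w < cos (w - e)) by (apply cos_decreasing_1; lra). lra. Qed.

(** A function vanishing at [p] and [q], positive on the arc from [p] to [q] and negative on the complementary arc. *)
Definition bump (p q t : R) : R := cos (t - (p + q) / 2) - cos ((q - p) / 2).

Lemma bump_ge p q t e : 0 <= e -> p + e <= t <= q - e -> q < p + 2 * PI -> sag ((q - p) / 2) e <= bump p q t.
Proof. intros He Ht Hq. unfold bump, sag. note (cos_ge_abs (t - (p + q) / 2) ((q - p) / 2 - e) ltac:(split; [apply Rabs_le|]; lra)). lra. Qed.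

Lemma bump_bound p q t : Rabs (bump p q t) <= 2.
Proof. unfold bump. note (COS_bound (t - (p + q) / 2)). note (COS_bound ((q - p) / 2)). apply Rabs_le. lra. Qed.

Lemma bump_opp p q t : bump q (p + 2 * PI) t = - bump p q t.
Proof.
 unfold bump. replace (t - (q + (p + 2 * PI)) / 2) with (t - (p + q) / 2 - PI) by field. replace ((p + 2 * PI - q) / 2) with (PI - (q - p) / 2) by field.
 rewrite (cos_minus (t - (p + q) / 2) PI), (cos_minus PI), cos_PI, sin_PI. ring.
Qed.

Definition alternation_data (G : R -> R) (x1 y1 x2 y2 r d e : R) : Prop := 0 < e /\ 0 < d /\ x1 + e <= y1 - e /\ y1 + e <= x2 - e /\
 x2 + e <= y2 - e /\ y2 + e <= x1 + 2 * PI - e /\ (forall s, Rabs (s - y1) <= e \/ Rabs (s - y2) <= e -> G s <= r) /\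
 r + d <= G x1 /\ r + d <= G x2.

Lemma alternation_exists G : (forall t, continuous G t) -> alternating G -> exists x1 y1 x2 y2 r d e, alternation_data G x1 y1 x2 y2 r d e.
Proof.
 intros Hc (x1 & y1 & x2 & y2 & r & H1 & H2 & H3 & H4 & H5 & H6 & H7 & H8).
 set (M := Rmin (G x1) (G x2)). assert (HM : r < M) by (apply Rmin_glb_lt; assumption).
 assert (Hn : forall y, G y <= r -> exists eta, 0 < eta <= 1 /\ forall s, Rabs (s - y) <= 2 * eta -> G s <= (M + r) / 2).
 { intros y Hy. destruct (near_sign (fun s => M - G s) y) as [eta [He Hs]]; [|lra|exists eta; split; [lra|intros s Hss; specialize (Hs s Hss); lra]].
  apply (continuous_minus (V := R_NormedModule) (fun _ => M) G); [apply continuous_const|triv]. }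
 destruct (Hn y1 H5) as [e1 [He1 N1]]. destruct (Hn y2 H6) as [e2 [He2 N2]].
 set (q := Rmin (Rmin (y1 - x1) (x2 - y1)) (Rmin (y2 - x2) (x1 + 2 * PI - y2))). set (e := Rmin (Rmin e1 e2) (q / 2)).
 assert (Hq : q <= y1 - x1 /\ q <= x2 - y1 /\ q <= y2 - x2 /\ q <= x1 + 2 * PI - y2).
 { assert (q <= Rmin (y1 - x1) (x2 - y1)) by apply Rmin_l. assert (q <= Rmin (y2 - x2) (x1 + 2 * PI - y2)) by apply Rmin_r.
  note (Rmin_l (y1 - x1) (x2 - y1)). note (Rmin_r (y1 - x1) (x2 - y1)). note (Rmin_l (y2 - x2) (x1 + 2 * PI - y2)). note (Rmin_r (y2 - x2) (x1 + 2 * PI - y2)). lra. }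
 assert (Hq0 : 0 < q) by (repeat apply Rmin_glb_lt; lra).
 assert (He : 0 < e /\ e <= e1 /\ e <= e2 /\ e <= q / 2).
 { assert (e <= Rmin e1 e2) by apply Rmin_l. note (Rmin_l e1 e2). note (Rmin_r e1 e2).
  split; [repeat apply Rmin_glb_lt; lra|]. split; [lra|]. split; [lra|apply Rmin_r]. }
 exists x1, y1, x2, y2, ((M + r) / 2), ((M - r) / 2), e. note (Rmin_l (G x1) (G x2)) as M1. note (Rmin_r (G x1) (G x2)) as M2. fold M in M1, M2.
 repeat split; try lra. intros s [Hs|Hs]; [apply N1|apply N2]; lra.
Qed.

(** * The periodic scalar equation *)

(** Real and imaginary parts of [u' = i f - i l c u], that is of [D_t u + l c u = f]. *)
Definition coef_ode (a b : R -> R) (l : R) (f1 f2 u1 u2 : R -> R) : Prop := forall t,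
 is_derive u1 t (l * (b t * u1 t + a t * u2 t) - f2 t) /\ is_derive u2 t (l * (b t * u2 t - a t * u1 t) + f1 t).

Definition orthogonality (a b : R -> R) (l : R) (f1 f2 : R -> R) : Prop :=
 RInt (V := C_R_CompleteNormedModule)
  (fun t => Cmult (Cexp_ (Cmult (0, l) (RInt a 0 t, RInt b 0 t))) (f1 t, f2 t)) 0 (2 * PI) = RtoC 0.

Section ScalarEquation.
Variables (a b : R -> R) (l : R).
Hypothesis (Ha : continuous_periodic a) (Hb : continuous_periodic b).
Notation A2 := (prim a (2 * PI)).
Notation B2 := (prim b (2 * PI)).
Notation ep t := (exp (- (l * prim b t))).

(** [er + i ei = exp (i l (A + i B))] is the integrating factor, and [zr + i zi] its multiplier over a period. *)
Definition er (t : R) : R := ep t * cos (l * prim a t).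
Definition ei (t : R) : R := ep t * sin (l * prim a t).
Definition zr : R := er (2 * PI).
Definition zi : R := ei (2 * PI).
(** [tw1 + i tw2] is the integrating factor times [u]; its derivative [g1 + i g2] is the factor
    times [i f]. *)
Definition tw1 (u1 u2 : R -> R) (t : R) : R := er t * u1 t + - ei t * u2 t.
Definition tw2 (u1 u2 : R -> R) (t : R) : R := ei t * u1 t + er t * u2 t.
Definition g1 (f1 f2 : R -> R) (t : R) : R := - (ei t * f1 t + er t * f2 t).
Definition g2 (f1 f2 : R -> R) (t : R) : R := er t * f1 t + - ei t * f2 t.

Lemma phase_derive t : is_derive er t (- l * b t * er t - l * a t * ei t) /\ is_derive ei t (l * a t * er t - l * b t * ei t).
Proof.
 note (prim_derive a t (proj1 Ha)) as DA. note (prim_derive b t (proj1 Hb)) as DB.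
 assert (EA : Derive (fun s => prim a s) t = a t) by (apply is_derive_unique; exact DA).
 assert (EB : Derive (fun s => prim b s) t = b t) by (apply is_derive_unique; exact DB).
 unfold er, ei. split; (auto_derive; [repeat split; eexists; eassumption|nra]).
Qed.

Lemma phase_norm t : er t ^ 2 + ei t ^ 2 = ep t ^ 2.
Proof.
 unfold er, ei. note (sin2_cos2 (l * prim a t)) as H. unfold Rsqr in H.
 nra.
Qed.

Lemma phase_shift t : er (t + 2 * PI) = zr * er t - zi * ei t /\ ei (t + 2 * PI) = zi * er t + zr * ei t.
Proof.
 unfold zr, zi, er, ei. rewrite (prim_shift a), (prim_shift b) by assumption.
 rewrite !Rmult_plus_distr_l, Ropp_plus_distr, exp_plus, cos_plus, sin_plus. lra.
Qed.

Lemma ep_shift t : ep (t + 2 * PI) = exp (- (l * B2)) * ep t.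
Proof. rewrite (prim_shift b) by exact Hb. rewrite <- exp_plus. f_equal. ring. Qed.

Lemma w_norm u1 u2 t : tw1 u1 u2 t ^ 2 + tw2 u1 u2 t ^ 2 = ep t ^ 2 * (u1 t ^ 2 + u2 t ^ 2).
Proof. rewrite <- phase_norm. unfold tw1, tw2. ring. Qed.

(** The squared distance from 1 of the multiplier over a period; [resonance z] is its linearization,
    the squared distance of [2 PI l c0] from [2 PI z]. *)
Definition defect : R := (zr - 1) ^ 2 + zi ^ 2.
Definition resonance (z : Z) : R := (l * A2 - 2 * PI * IZR z) ^ 2 + (l * B2) ^ 2.

Lemma defect_formula z : defect = 1 - 2 * exp (- (l * B2)) * cos (l * A2 - 2 * PI * IZR z) + exp (- (l * B2)) ^ 2.
Proof.
 unfold defect, zr, zi, er, ei. rewrite <- (cos_periodic_Z z (_ - _)).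
 replace (l * A2 - 2 * PI * IZR z + 2 * PI * IZR z) with (l * A2) by ring.
 note (sin2_cos2 (l * A2)) as H. unfold Rsqr in H. nra.
Qed.

(** [z] is the integer nearest to [l A2 / (2 PI)]. When [l B2 <= 0] the multiplier has modulus at
    least 1; it is divided out and its inverse is compared with 1. *)
Lemma defect_lower : exists z, (0 <= l * B2 -> Rmin 1 (resonance z) <= 8 * defect) /\
 (l * B2 <= 0 -> Rmin 1 (resonance z) * exp (- (l * B2)) ^ 2 <= 8 * defect).
Proof.
 note PI_RGT_0 as Hpi. destruct (nearest_integer (l * A2 / (2 * PI))) as [z Hz]. exists z. unfold resonance. rewrite (defect_formula z).
 set (v := l * A2 - 2 * PI * IZR z). set (r := exp (- (l * B2))).
 assert (Hv : - PI <= v <= PI).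
 { assert (E : v = 2 * PI * (l * A2 / (2 * PI) - IZR z)) by (unfold v; field; lra). apply Rcomplements.Rabs_le_between in Hz. nra. }
 note (sin2_cos2 v) as H. unfold Rsqr in H. split; intros HB.
 - note (unit_distance (l * B2) v HB Hv) as D. fold r in D. rewrite Rplus_comm in D. nra.
 - note (unit_distance (- (l * B2)) v ltac:(lra) Hv) as D. replace ((- (l * B2)) ^ 2) with ((l * B2) ^ 2) in D by ring. rewrite Rplus_comm in D.
  assert (Er : exp (- - (l * B2)) * r = 1) by (unfold r; rewrite <- exp_plus; replace (- - (l * B2) + - (l * B2)) with 0 by ring; apply exp_0).
  set (q := exp (- - (l * B2))) in *. note (pow2_ge_0 r) as Hr.
  apply (Rmult_le_compat_r (r ^ 2) _ _ Hr) in D. eapply Rle_trans; [exact D|]. right.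
  transitivity (8 * ((q * r) ^ 2 * (sin v * sin v + cos v * cos v) - 2 * (q * r) * r * cos v + r ^ 2)); [ring|]. rewrite H, Er. ring.
Qed.

Lemma defect_zero : defect = 0 <-> exists z, l * A2 = 2 * PI * IZR z /\ l * B2 = 0.
Proof.
 split.
 - destruct defect_lower as [z [H1 H2]]. exists z.
  assert (HR : Rmin 1 (resonance z) <= 0).
  { note (pow_lt _ 2 (exp_pos (- (l * B2)))). nra. }
  unfold resonance, Rmin in HR. destruct (Rle_dec 1 _) in HR; [lra|].
  destruct (sum_squares_zero (l * A2 - 2 * PI * IZR z) (l * B2)); [|lra]. note (pow2_ge_0 (l * A2 - 2 * PI * IZR z)). note (pow2_ge_0 (l * B2)). lra.
 - intros [z [H1 H2]]. rewrite (defect_formula z), H1, H2, Ropp_0, exp_0. replace (2 * PI * IZR z - 2 * PI * IZR z) with 0 by ring. rewrite cos_0. ring.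
Qed.

Lemma g_wave psi th w t : g1 (wave a l psi th w cos) (wave a l psi th w sin) t = - (ep t * (w t * sin (psi * t + th))) /\
 g2 (wave a l psi th w cos) (wave a l psi th w sin) t = ep t * (w t * cos (psi * t + th)).
Proof.
 unfold g1, g2, er, ei, wave. replace (psi * t + th) with (l * prim a t + phase a l psi th t) by (unfold phase; ring).
 rewrite sin_plus, cos_plus. lra.
Qed.

Lemma g_wave_0 w : g1 (wave a l 0 0 w cos) (wave a l 0 0 w sin) = (fun _ => 0) /\ g2 (wave a l 0 0 w cos) (wave a l 0 0 w sin) = fun t => ep t * w t.
Proof.
 split; fext t; destruct (g_wave 0 0 w t) as [E1 E2]; rewrite ?E1, ?E2; replace (0 * t + 0) with 0 by ring; rewrite ?sin_0, ?cos_0; ring.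
Qed.

Variables (f1 f2 : R -> R).
Definition G1 : R -> R := prim (g1 f1 f2).
Definition G2 : R -> R := prim (g2 f1 f2).
Definition solves (u1 u2 : R -> R) : Prop := coef_ode a b l f1 f2 u1 u2 /\ periodic u1 /\ periodic u2.

Lemma w_derive u1 u2 t : coef_ode a b l f1 f2 u1 u2 -> is_derive (tw1 u1 u2) t (g1 f1 f2 t) /\ is_derive (tw2 u1 u2) t (g2 f1 f2 t).
Proof.
 intros H. destruct (H t) as [H1 H2]. destruct (phase_derive t) as [D1 D2].
 assert (D3 : is_derive (fun s => - ei s) t (- (l * a t * er t - l * b t * ei t))) by (apply (is_derive_opp ei); exact D2).
 note (is_derive_bilinear _ _ _ _ _ _ _ _ t D1 D3 H1 H2) as E1. note (is_derive_bilinear _ _ _ _ _ _ _ _ t D2 D1 H1 H2) as E2.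
 split; [match type of E1 with is_derive _ _ ?r => replace (g1 f1 f2 t) with r by (unfold g1; ring) end; exact E1
  |match type of E2 with is_derive _ _ ?r => replace (g2 f1 f2 t) with r by (unfold g2; ring) end; exact E2].
Qed.

Hypothesis (Hf1 : continuous_periodic f1) (Hf2 : continuous_periodic f2).

Lemma g_continuous t : continuous (g1 f1 f2) t /\ continuous (g2 f1 f2) t.
Proof.
 assert (c1 : continuous er t) by (apply (is_derive_continuous _ _ _ (proj1 (phase_derive t)))).
 assert (c2 : continuous ei t) by (apply (is_derive_continuous _ _ _ (proj2 (phase_derive t)))).
 destruct Hf1 as [C1 _], Hf2 as [C2 _]. split.
 - apply continuous_Ropp, (continuous_plus (V := R_NormedModule) (fun s => ei s * f1 s) (fun s => er s * f2 s));
   apply (continuous_mult (K := R_AbsRing)); auto.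
 - apply (continuous_plus (V := R_NormedModule) (fun s => er s * f1 s) (fun s => - ei s * f2 s));
   apply (continuous_mult (K := R_AbsRing)); auto. apply continuous_Ropp, c2.
Qed.

Lemma G_derive t : is_derive G1 t (g1 f1 f2 t) /\ is_derive G2 t (g2 f1 f2 t).
Proof. split; apply prim_derive; intros; apply g_continuous. Qed.

Lemma g_shift t : g1 f1 f2 (t + 2 * PI) = zr * g1 f1 f2 t + - zi * g2 f1 f2 t /\ g2 f1 f2 (t + 2 * PI) = zi * g1 f1 f2 t + zr * g2 f1 f2 t.
Proof. destruct (phase_shift t) as [T1 T2]. unfold g1, g2. rewrite T1, T2, (proj2 Hf1), (proj2 Hf2). nra. Qed.

Lemma orthogonality_primitive : orthogonality a b l f1 f2 <-> G1 (2 * PI) = 0 /\ G2 (2 * PI) = 0.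
Proof.
 unfold orthogonality.
 assert (HI : forall h : R -> R, (forall s, continuous h s) -> is_RInt (V := R_NormedModule) h 0 (2 * PI) (prim h (2 * PI))).
 { intros h Hh. apply (RInt_correct (V := R_CompleteNormedModule) h), (ex_RInt_continuous (V := R_CompleteNormedModule)). pos. }
 rewrite (RInt_ext (V := C_R_CompleteNormedModule) _ (fun t => (g2 f1 f2 t, - g1 f1 f2 t) : C)).
 2:{ intros t _. unfold g1, g2, er, ei, Cexp_, Cmult, prim. cbn [fst snd].
   replace (0 * RInt a 0 t - l * RInt b 0 t) with (- (l * RInt b 0 t)) by ring. replace (0 * RInt b 0 t + l * RInt a 0 t) with (l * RInt a 0 t) by ring.
   apply injective_projections; cbn [fst snd]; ring. }
 rewrite (is_RInt_unique (V := C_R_CompleteNormedModule) _ _ _ (G2 (2 * PI), - G1 (2 * PI))).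
 - split; [intros E; injection E; lra|]. intros [-> ->]. rewrite Ropp_0. reflexivity.
 - apply (is_RInt_fct_extend_pair (U := R_NormedModule) (V := R_NormedModule)); cbn [fst snd].
  + apply HI. intros; apply g_continuous.
  + apply (is_RInt_opp (V := R_NormedModule)), HI. intros; apply g_continuous.
Qed.

(** [u] is recovered as [N] times the conjugate factor times [W], with [N] the inverse squared
    modulus of the factor. [W] and the factor acquire the same multiplier over a period, so [u] is
    periodic. *)
Lemma solution_of_primitive W1 W2 : (forall t, is_derive W1 t (g1 f1 f2 t)) -> (forall t, is_derive W2 t (g2 f1 f2 t)) ->
 (forall t, W1 (t + 2 * PI) = zr * W1 t + - zi * W2 t /\ W2 (t + 2 * PI) = zi * W1 t + zr * W2 t) ->
 exists u1 u2, solves u1 u2 /\ forall t, tw1 u1 u2 t = W1 t /\ tw2 u1 u2 t = W2 t.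
Proof.
 intros D1 D2 HP. set (N := fun t => exp (2 * (l * prim b t))).
 assert (HN : forall t, N t * (er t ^ 2 + ei t ^ 2) = 1).
 { intros t. rewrite phase_norm. unfold N. simpl. rewrite Rmult_1_r, <- !exp_plus, <- exp_0. f_equal. ring. }
 assert (HZ : forall t, N (t + 2 * PI) * (zr ^ 2 + zi ^ 2) = N t).
 { intros t. destruct (phase_shift t) as [S1 S2]. note (HN t) as E1. note (HN (t + 2 * PI)) as E2.
  apply Rmult_eq_reg_r with (er t ^ 2 + ei t ^ 2); [|intros E0; rewrite E0 in E1; lra].
  nra. }
 set (v1 := fun t => er t * W1 t + ei t * W2 t). set (v2 := fun t => er t * W2 t + - ei t * W1 t).
 exists (fun t => N t * v1 t), (fun t => N t * v2 t). split; [split; [intros t; split|split]|intros t; split].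
 - destruct (phase_derive t) as [E1 E2].
  assert (EN : is_derive N t (2 * l * b t * N t)).
  { note (prim_derive b t (proj1 Hb)) as DB. assert (EB : Derive (fun s => prim b s) t = b t) by (apply is_derive_unique; exact DB).
   unfold N. auto_derive; [repeat split; eexists; eassumption|nra]. }
  note (is_derive_bilinear _ _ _ _ _ _ _ _ t E1 E2 (D1 t) (D2 t)) as V1.
  note (is_derive_mult N v1 t _ _ EN V1 Rmult_comm) as M1.
  match type of M1 with is_derive _ _ ?r => replace (l * (b t * (N t * v1 t) + a t * (N t * v2 t)) - f2 t) with r; [pos|] end.
  unfold plus, mult; simpl. unfold v1, v2, g1, g2. apply Rminus_diag_uniq.
  transitivity (f2 t * (1 - N t * (er t ^ 2 + ei t ^ 2))); [ring|rewrite HN; ring].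
 - destruct (phase_derive t) as [E1 E2].
  assert (E3 : is_derive (fun s => - ei s) t (- (l * a t * er t - l * b t * ei t))) by (apply (is_derive_opp ei); exact E2).
  assert (EN : is_derive N t (2 * l * b t * N t)).
  { note (prim_derive b t (proj1 Hb)) as DB. assert (EB : Derive (fun s => prim b s) t = b t) by (apply is_derive_unique; exact DB).
   unfold N. auto_derive; [repeat split; eexists; eassumption|nra]. }
  note (is_derive_bilinear _ _ _ _ _ _ _ _ t E1 E3 (D2 t) (D1 t)) as V2.
  note (is_derive_mult N v2 t _ _ EN V2 Rmult_comm) as M2.
  match type of M2 with is_derive _ _ ?r => replace (l * (b t * (N t * v2 t) - a t * (N t * v1 t)) + f1 t) with r; [pos|] end.
  unfold plus, mult; simpl. unfold v1, v2, g1, g2. apply Rminus_diag_uniq.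
  transitivity (f1 t * (N t * (er t ^ 2 + ei t ^ 2) - 1)); [ring|rewrite HN; ring].
 - intros t. destruct (HP t) as [Q1 Q2]. destruct (phase_shift t) as [S1 S2].
  unfold v1. rewrite <- (HZ t), S1, S2, Q1, Q2. ring.
 - intros t. destruct (HP t) as [Q1 Q2]. destruct (phase_shift t) as [S1 S2].
  unfold v2. rewrite <- (HZ t), S1, S2, Q1, Q2. ring.
 - unfold tw1, v1, v2. transitivity (N t * (er t ^ 2 + ei t ^ 2) * W1 t); [ring|rewrite HN; ring].
 - unfold tw2, v1, v2. transitivity (N t * (er t ^ 2 + ei t ^ 2) * W2 t); [ring|rewrite HN; ring].
Qed.

Lemma periodic_solution t0 k1 k2 : k1 + (G1 (t0 + 2 * PI) - G1 t0) = zr * k1 - zi * k2 ->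
 k2 + (G2 (t0 + 2 * PI) - G2 t0) = zi * k1 + zr * k2 ->
 exists u1 u2, solves u1 u2 /\ forall t, tw1 u1 u2 t = k1 + (G1 t - G1 t0) /\ tw2 u1 u2 t = k2 + (G2 t - G2 t0).
Proof.
 intros E1 E2.
 assert (D : forall h k c t d, is_derive h t d -> is_derive (fun s => k + (h s - c)) t d).
 { intros h k c t d H. replace d with (0 + (d - 0)) by ring.
  apply (is_derive_plus (fun _ => k) (fun s => h s - c)); [apply is_derive_cst|].
  apply (is_derive_minus h (fun _ => c)); [pos|apply is_derive_cst]. }
 set (W1 := fun s => k1 + (G1 s - G1 t0)). set (W2 := fun s => k2 + (G2 s - G2 t0)).
 assert (HG1 : forall t, is_derive W1 t (g1 f1 f2 t)) by (intros; apply D, G_derive).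
 assert (HG2 : forall t, is_derive W2 t (g2 f1 f2 t)) by (intros; apply D, G_derive).
 assert (L : forall p q t, is_derive (fun s => p * W1 s + q * W2 s) t (p * g1 f1 f2 t + q * g2 f1 f2 t)).
 { intros p q t. apply (is_derive_plus (fun s => p * W1 s) (fun s => q * W2 s)); apply is_derive_scal; auto. }
 apply (solution_of_primitive _ _ HG1 HG2). split.
 - apply (eq_of_derive (fun s => W1 (s + 2 * PI)) (fun s => zr * W1 s + - zi * W2 s) (fun s => zr * g1 f1 f2 s + - zi * g2 f1 f2 s) t0); [|easy|unfold W1, W2; rewrite E1; ring].
  intros s. rewrite <- (proj1 (g_shift s)). apply is_derive_shift, HG1.
 - apply (eq_of_derive (fun s => W2 (s + 2 * PI)) (fun s => zi * W1 s + zr * W2 s) (fun s => zi * g1 f1 f2 s + zr * g2 f1 f2 s) t0); [|easy|unfold W1, W2; lra].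
  intros s. rewrite <- (proj2 (g_shift s)). apply is_derive_shift, HG2.
Qed.

Lemma nonresonant_solution : defect <> 0 -> exists u1 u2, solves u1 u2.
Proof.
 intros HD. set (I1 := G1 (0 + 2 * PI) - G1 0). set (I2 := G2 (0 + 2 * PI) - G2 0).
 (* The initial value solves [(z - 1) k = I], with [z] the multiplier and [I] the increment of the
    primitive: it is [I] times the conjugate of [z - 1] over [defect]. *)
 destruct (periodic_solution 0 ((I1 * (zr - 1) + I2 * zi) / defect) ((I2 * (zr - 1) - I1 * zi) / defect)) as (u1 & u2 & H & _).
 - fold I1. unfold defect in *. field. exact HD.
 - fold I2. unfold defect in *. field. exact HD.
 - triv.
Qed.

Lemma resonant_solution t0 : defect = 0 -> G1 (2 * PI) = 0 -> G2 (2 * PI) = 0 ->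
 exists u1 u2, solves u1 u2 /\ tw1 u1 u2 t0 = 0 /\ tw2 u1 u2 t0 = 0.
Proof.
 intros HD Z1 Z2. apply sum_squares_zero in HD. destruct HD as [Er Ei]. assert (Ez : zr = 1) by lra.
 assert (P : G1 (t0 + 2 * PI) = G1 t0 /\ G2 (t0 + 2 * PI) = G2 t0).
 { split.
  - apply (eq_of_derive (fun s => G1 (s + 2 * PI)) G1 (g1 f1 f2) 0); [|apply G_derive|rewrite Rplus_0_l, Z1; symmetry; apply prim_0].
   intros s. replace (g1 f1 f2 s) with (g1 f1 f2 (s + 2 * PI)); [apply is_derive_shift, G_derive|rewrite (proj1 (g_shift s)), Ez, Ei; ring].
  - apply (eq_of_derive (fun s => G2 (s + 2 * PI)) G2 (g2 f1 f2) 0); [|apply G_derive|rewrite Rplus_0_l, Z2; symmetry; apply prim_0].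
   intros s. replace (g2 f1 f2 s) with (g2 f1 f2 (s + 2 * PI)); [apply is_derive_shift, G_derive|rewrite (proj2 (g_shift s)), Ez, Ei; ring]. }
 destruct (periodic_solution t0 0 0) as (u1 & u2 & H & H4); [lra|lra|].
 exists u1, u2. destruct (H4 t0) as [-> ->]. split; [pos|]. lra.
Qed.

Variables (u1 u2 : R -> R).
Hypothesis Hu : solves u1 u2.
Notation W1 := (tw1 u1 u2).
Notation W2 := (tw2 u1 u2).

(** Periodicity of [u] turns the increment into [z - 1] times [W t], with [z] the multiplier. Upper
    bounds on the increment control [u] by the data; lower bounds force [u] to be large for the test
    data. *)
Lemma w_period_increment t : (W1 (t + 2 * PI) - W1 t) ^ 2 + (W2 (t + 2 * PI) - W2 t) ^ 2 = defect * ep t ^ 2 * (u1 t ^ 2 + u2 t ^ 2).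
Proof.
 rewrite Rmult_assoc, <- w_norm. destruct Hu as (_ & P1 & P2), (phase_shift t) as [S1 S2]. unfold defect, tw1, tw2. rewrite S1, S2, P1, P2. ring.
Qed.

Section Bounds.
Variable S : R.
Hypothesis (HS : forall s, Rabs (f1 s) <= S /\ Rabs (f2 s) <= S).

Lemma increment_square t1 t2 m : t1 <= t2 <= t1 + 2 * PI -> (forall s, t1 <= s <= t2 -> - (l * prim b s) <= m) ->
 (W1 t2 - W1 t1) ^ 2 + (W2 t2 - W2 t1) ^ 2 <= 2 * (4 * PI * S) ^ 2 * exp m ^ 2.
Proof.
 intros Ht Hm.
 assert (Hg : forall s, t1 <= s <= t2 -> Rabs (g1 f1 f2 s) <= 2 * S * exp m /\ Rabs (g2 f1 f2 s) <= 2 * S * exp m).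
 { intros s Hs. specialize (Hm s Hs). destruct (HS s) as [B1 B2]. note (exp_le _ _ Hm) as He.
  assert (E : forall y, -1 <= y <= 1 -> Rabs (ep s * y) <= exp m).
  { intros y Hy. rewrite Rabs_mult, (Rabs_pos_eq (ep s)) by pos. note (exp_pos (- (l * prim b s))). assert (Rabs y <= 1) by (apply Rabs_le; lra). nra. }
  note (E _ (COS_bound (l * prim a s))) as E1. note (E _ (SIN_bound (l * prim a s))) as E2. fold (er s) in E1. fold (ei s) in E2.
  assert (Q : forall x y, Rabs x <= exp m -> Rabs y <= S -> Rabs (x * y) <= S * exp m).
  { intros x y Hx Hy. rewrite Rabs_mult, Rmult_comm. mono. }
  note (Q _ _ E1 B1). note (Q _ _ E1 B2). note (Q _ _ E2 B1). note (Q _ _ E2 B2). unfold g1, g2. split.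
  - rewrite Rabs_Ropp. bound Rabs_triang. lra.
  - bound Rabs_triang. rewrite <- Ropp_mult_distr_l, Rabs_Ropp. lra. }
 assert (K : forall h h' : R -> R, (forall t, is_derive h t (h' t)) -> (forall s, t1 <= s <= t2 -> Rabs (h' s) <= 2 * S * exp m) ->
  (h t2 - h t1) ^ 2 <= (4 * PI * S * exp m) ^ 2).
 { intros h h' Dh Hh. apply square_le. destruct (mean_value h h' t1 t2 Dh) as (c & Hc & _ & E). rewrite E, Rabs_mult, (Rabs_pos_eq (t2 - t1)) by lra.
  specialize (Hh c (Hc ltac:(lra))). note (Rabs_pos (h' c)). nra. }
 note (K W1 (g1 f1 f2) (fun t => proj1 (w_derive _ _ t (proj1 Hu))) (fun s Hs => proj1 (Hg s Hs))).
 note (K W2 (g2 f1 f2) (fun t => proj2 (w_derive _ _ t (proj1 Hu))) (fun s Hs => proj2 (Hg s Hs))). lra.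
Qed.

(** The period of integration starts at [t] if [l b >= 0] and ends at [t] otherwise; in both cases
    [exp (- l B)] is largest at [t] and cancels from the estimate. The constant is
    [8 * 2 * (4 PI)^2 = (16 PI)^2]. *)
Lemma one_signed_bound : (forall s, 0 <= l * b s) \/ (forall s, l * b s <= 0) ->
 exists z, forall t, Rmin 1 (resonance z) * (u1 t ^ 2 + u2 t ^ 2) <= (16 * PI * S) ^ 2.
Proof.
 intros Hsg. note PI_RGT_0 as Hpi. destruct defect_lower as [z [L1 L2]]. exists z. intros t.
 assert (Mon : forall s s', exists c, l * prim b s' - l * prim b s = (l * b c) * (s' - s)).
 { intros s s'. destruct (mean_value (fun r => l * prim b r) (fun r => l * b r) s s') as (c & _ & _ & E); [|triv].
  intros. apply is_derive_scal, prim_derive, Hb. }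
 destruct (Mon 0 (2 * PI)) as [c0 E0]. rewrite prim_0 in E0. destruct Hsg as [Hs|Hs].
 - assert (HB : 0 <= l * B2) by (specialize (Hs c0); nra).
  note (increment_square t (t + 2 * PI) (- (l * prim b t)) ltac:(lra)) as H.
  rewrite w_period_increment in H. note (pow_lt _ 2 (exp_pos (- (l * prim b t)))) as He.
  assert (H' : defect * (u1 t ^ 2 + u2 t ^ 2) * ep t ^ 2 <= 2 * (4 * PI * S) ^ 2 * ep t ^ 2).
  { bound_by H; [lra|]. intros s Hs'. destruct (Mon t s) as [c E]. specialize (Hs c). nra. }
  apply Rmult_le_reg_r in H'; [|lra]. nra.
 - assert (HB : l * B2 <= 0) by (specialize (Hs c0); nra).
  set (t' := t - 2 * PI). assert (Et : t = t' + 2 * PI) by (unfold t'; ring). clearbody t'. subst t.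
  note (increment_square t' (t' + 2 * PI) (- (l * prim b (t' + 2 * PI))) ltac:(lra)) as H.
  rewrite w_period_increment, ep_shift in H. note (pow_lt _ 2 (exp_pos (- (l * prim b t')))) as He. note (pow_lt _ 2 (exp_pos (- (l * B2)))) as Hr.
  destruct Hu as (_ & Pu1 & Pu2). rewrite Pu1, Pu2 in *.
  assert (H' : defect * (u1 t' ^ 2 + u2 t' ^ 2) * ep t' ^ 2 <= 2 * (4 * PI * S) ^ 2 * exp (- (l * B2)) ^ 2 * ep t' ^ 2).
  { eapply Rle_trans; [|bound H]; [lra| |lra]. intros s Hs'. destruct (Mon s (t' + 2 * PI)) as [c E]. specialize (Hs c). nra. }
  apply Rmult_le_reg_r in H'; [|lra]. nra.
Qed.

(** [W] vanishes at [t0] and, the multiplier being 1, at [t0 + 2 PI]; so [W t] is, up to sign, the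
    integral over whichever arc has its largest weight at [t]. *)
Lemma resonant_bound t0 : W1 t0 = 0 -> W2 t0 = 0 -> defect = 0 ->
 (forall t, t0 <= t <= t0 + 2 * PI -> (forall s, t0 <= s <= t -> - (l * prim b s) <= - (l * prim b t)) \/
  (forall s, t <= s <= t0 + 2 * PI -> - (l * prim b s) <= - (l * prim b t))) ->
 forall t, u1 t ^ 2 + u2 t ^ 2 <= (16 * PI * S) ^ 2.
Proof.
 intros Z1 Z2 HD Harc. destruct Hu as (_ & Pu1 & Pu2). apply (periodic_extend _ t0); [triv|]. intros t Ht.
 note (w_period_increment t0) as HE. rewrite HD, Z1, Z2, !Rmult_0_l in HE. apply sum_squares_zero in HE.
 note (pow_lt _ 2 (exp_pos (- (l * prim b t)))) as He.
 apply Rmult_le_reg_r with (ep t ^ 2); [lra|].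
 rewrite Rmult_comm, <- w_norm. via (2 * (4 * PI * S) ^ 2 * ep t ^ 2); [|nra].
 destruct (Harc t Ht) as [Hs|Hs].
 - bound_by (increment_square t0 t _ ltac:(lra) Hs). rewrite Z1, Z2. right; ring.
 - bound_by (increment_square t (t0 + 2 * PI) _ ltac:(lra) Hs). nra.
Qed.
End Bounds.

(** With [th = - psi (T + PI)] the remaining phase is [psi (t - T - PI)], at most [PI / 2] in
    modulus over the period since [|psi| <= 1/2]. The derivative of [W2] is therefore nonnegative,
    with a positive lower bound away from the ends of the period. *)
Lemma wave_increment T s1 s2 eta r psi m : 0 < eta <= PI -> T + eta <= s1 < s2 -> s2 <= T + 2 * PI - eta ->
 (forall s, s1 <= s <= s2 -> m <= - (l * prim b s)) -> 0 <= r -> Rabs psi <= 1 / 2 ->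
 f1 = wave a l psi (- psi * (T + PI)) (fun _ => r) cos -> f2 = wave a l psi (- psi * (T + PI)) (fun _ => r) sin ->
 (exp m * (r * (cos ((PI - eta) / 2) * (s2 - s1)))) ^ 2 <= defect * ep T ^ 2 * (u1 T ^ 2 + u2 T ^ 2).
Proof.
 intros He Hs1 Hs2 HB Hr Hpsi E1 E2. set (th := - psi * (T + PI)) in *.
 assert (HD : forall t, is_derive W2 t (ep t * (r * cos (psi * t + th)))).
 { intros t. rewrite <- (proj2 (g_wave psi th (fun _ => r) t)), <- E1, <- E2. apply w_derive, Hu. }
 assert (Hcos : forall t y, Rabs (t - T - PI) <= y -> y <= PI -> cos (y / 2) <= cos (psi * t + th)).
 { intros t y Ht Hy. apply cos_ge_abs. replace (psi * t + th) with (psi * (t - T - PI)) by (unfold th; ring). rewrite Rabs_mult.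
  note (Rabs_pos (t - T - PI)). nra. }
 set (c0 := cos ((PI - eta) / 2)). assert (Hc0 : 0 < c0) by (apply cos_gt_0; lra).
 note (bounded_below_increment W2 T (T + 2 * PI) s1 s2 (exp m * (r * c0)) _ HD ltac:(lra) ltac:(lra)) as HI.
 rewrite <- w_period_increment. via ((W2 (T + 2 * PI) - W2 T) ^ 2); [|note (pow2_ge_0 (W1 (T + 2 * PI) - W1 T)); lra].
 apply pow_incr. split; [triv|]. bound_by HI.
 - right; ring.
 - intros t Ht. note (Hcos t PI ltac:(apply Rabs_le; lra) ltac:(lra)) as Hc. rewrite cos_PI2 in Hc. pos.
 - intros t Ht. note (Hcos t (PI - eta) ltac:(apply Rabs_le; lra) ltac:(lra)) as Hc.
  apply Rmult_le_compat; [pos|pos|apply exp_le, HB, Ht|mono].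
Qed.

Section Necessity.
Variable s : R.
Hypothesis (Hs : s ^ 2 = 1) (Hsl : 0 <= s * l).

Lemma growth_bound T ts s1 s2 eta delta r psi : growth_data (fun t => s * prim b t) T ts s1 s2 eta delta -> 0 <= r -> Rabs psi <= 1 / 2 ->
 f1 = wave a l psi (- psi * (T + PI)) (fun _ => r) cos -> f2 = wave a l psi (- psi * (T + PI)) (fun _ => r) sin ->
 (exp (s * l * delta) * (r * (cos ((PI - eta) / 2) * (s2 - s1)))) ^ 2 <= 4 * (u1 ts ^ 2 + u2 ts ^ 2).
Proof.
 intros (He & Hd & Hs1 & Hs2 & HB & Hts) Hr Hpsi E1 E2.
 assert (El : forall t, l * prim b t = s * l * (s * prim b t)) by (intros t; rewrite <- (Rmult_1_l (l * _)), <- Hs; ring).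
 note (wave_increment T s1 s2 eta r psi (- (l * prim b ts) + s * l * delta) ltac:(lra) Hs1 Hs2
  ltac:(intros t Ht; specialize (HB t Ht); rewrite !El; nra) Hr Hpsi E1 E2) as HI.
 rewrite exp_plus, Rmult_assoc, Rpow_mult_distr in HI.
 assert (Hep : 0 < ep ts ^ 2) by pos. apply Rmult_le_reg_l with (ep ts ^ 2); [nra|]. eapply Rle_trans; [exact HI|].
 set (rho := exp (- (l * B2))). assert (Hrho : 0 < rho) by apply exp_pos.
 (* The defect is at most 4 if [rho <= 1] and [4 rho^2] if [rho >= 1]; in the second case [ts] is
    the far end and the weight there contains the factor [rho]. *)
 assert (HDf : defect <= (1 + rho) ^ 2).
 { rewrite (defect_formula 0). fold rho. match goal with |- context [cos ?y] => note (COS_bound y); set (cc := cos y) in * end. nra. }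
 destruct Hts as [[-> H2] | [-> H2]].
 - assert (rho <= 1) by (unfold rho; rewrite <- exp_0; apply exp_le; rewrite El; nra).
  via (4 * (ep T ^ 2 * (u1 T ^ 2 + u2 T ^ 2))); [|lra]. rewrite Rmult_assoc. apply Rmult_le_compat_r; [pos|nra].
 - destruct Hu as (_ & Pu1 & Pu2). rewrite Pu1, Pu2, ep_shift in *. fold rho. assert (1 <= rho) by (unfold rho; rewrite <- exp_0; apply exp_le; rewrite El; nra).
  via (4 * rho ^ 2 * (ep T ^ 2 * (u1 T ^ 2 + u2 T ^ 2))); [|nra]. rewrite Rmult_assoc. apply Rmult_le_compat_r; [pos|nra].
Qed.

(** At the two high points [W2] is small because the integrating factor is, while between them the
    integrand keeps one sign and has a large weight near a low point. The sign of [kappa] selects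
    the arc on which the correction by [kappa] is favourable. *)
Lemma alternating_bound x1 y1 x2 y2 r d e kappa r0 U : periodic (prim b) -> alternation_data (fun t => s * prim b t) x1 y1 x2 y2 r d e -> 0 <= r0 ->
 f1 = wave a l 0 0 (fun t => r0 * (bump x1 x2 t - kappa)) cos -> f2 = wave a l 0 0 (fun t => r0 * (bump x1 x2 t - kappa)) sin ->
 (forall t, Rabs (u1 t) <= U /\ Rabs (u2 t) <= U) ->
 r0 * Rmin (sag ((x2 - x1) / 2) e) (sag ((x1 + 2 * PI - x2) / 2) e) * (2 * e) * exp (s * l * d) <= 4 * U.
Proof.
 intros HP (He & Hd & O1 & O2 & O3 & O4 & HB & HX1 & HX2) Hr0 E1 E2 BU.
 set (sg := Rmin _ _). set (L := s * l) in *.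
 assert (El : forall t, l * prim b t = L * (s * prim b t)) by (intros t; unfold L; rewrite <- (Rmult_1_l (l * _)), <- Hs; ring).
 assert (Hsg : sg <= sag ((x2 - x1) / 2) e /\ sg <= sag ((x1 + 2 * PI - x2) / 2) e) by (split; [apply Rmin_l|apply Rmin_r]).
 assert (Hsg0 : 0 < sg) by (apply Rmin_glb_lt; apply sag_pos; lra).
 assert (HD : forall t, is_derive W2 t (ep t * (r0 * (bump x1 x2 t - kappa)))).
 { intros t. note (proj2 (w_derive u1 u2 t (proj1 Hu))) as D. rewrite E1, E2, (proj2 (g_wave_0 _)) in D. exact D. }
 assert (HW : forall x, r + d <= s * prim b x -> Rabs (W2 x) <= 2 * U * exp (- (L * (r + d)))).
 { intros x Hx. note (w_norm u1 u2 x) as N. destruct (BU x) as [B1 B2].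
  assert (HU : 0 <= U) by (note (Rabs_pos (u1 x)); lra). apply square_le in B1. apply square_le in B2.
  via (2 * U * ep x).
  - apply Rsqr_incr_0_var; [|pos]. rewrite <- Rsqr_abs. unfold Rsqr.
   nra.
  - scale_l. apply exp_le. rewrite El. nra. }
 assert (key : forall h p q y, (forall t, is_derive (fun s => h * W2 s) t (ep t * (r0 * (bump p q t + Rabs kappa)))) -> Rabs h = 1 -> p + e <= y - e -> y + e <= q - e -> q < p + 2 * PI ->
  (forall t, Rabs (t - y) <= e -> s * prim b t <= r) -> sg <= sag ((q - p) / 2) e -> r + d <= s * prim b p -> r + d <= s * prim b q ->
  r0 * sg * (2 * e) * exp (L * d) <= 4 * U).
 { intros h p q y Dh Hh Hp Hq Hpq Hy Hsq Wp Wq. apply HW in Wp. apply HW in Wq. note (Rabs_pos kappa).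
  note (bounded_below_increment _ p q (y - e) (y + e) (exp (- (L * r)) * (r0 * sg)) _ Dh ltac:(lra) ltac:(lra)) as HI.
  assert (Hinc : exp (- (L * r)) * (r0 * sg) * (y + e - (y - e)) <= h * W2 q - h * W2 p).
  { apply HI; intros t Ht.
   - note (bump_ge p q t 0 ltac:(lra) ltac:(lra) Hpq) as Hbp. unfold sag in Hbp. rewrite Rminus_0_r in Hbp. pos.
   - note (bump_ge p q t e ltac:(lra) ltac:(lra) Hpq) as Hbp.
    specialize (Hy t ltac:(apply Rabs_le; lra)). apply Rmult_le_compat; [pos|pos|apply exp_le; rewrite El; nra|mono]. }
  assert (Hup : h * W2 q - h * W2 p <= 4 * U * exp (- (L * (r + d)))).
  { note (Rle_abs (h * W2 q)). note (Rle_abs (- (h * W2 p))). rewrite Rabs_Ropp in *. rewrite !Rabs_mult, Hh in *. lra. }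
  replace (exp (- (L * (r + d)))) with (exp (- (L * r)) * / exp (L * d)) in Hup by (rewrite <- exp_Ropp, <- exp_plus; f_equal; ring).
  note (exp_pos (L * d)) as Hx1. apply Rmult_le_reg_l with (exp (- (L * r)) * / exp (L * d)); [pos|].
  replace (exp (- (L * r)) * / exp (L * d) * (r0 * sg * (2 * e) * exp (L * d))) with (exp (- (L * r)) * (r0 * sg) * (y + e - (y - e))) by (field; lra). lra. }
 destruct (Rle_lt_dec kappa 0) as [Hk|Hk].
 - apply (key 1 x1 x2 y1); try lra; auto; [|apply Rabs_R1].
  intros t. rewrite (Rabs_left1 kappa Hk). apply (is_derive_ext W2); [triv|]. apply HD.
 - apply (key (-1) x2 (x1 + 2 * PI) y2); try lra; auto.
  + intros t. rewrite (Rabs_pos_eq kappa) by lra. rewrite bump_opp. replace (ep t * (r0 * (- bump x1 x2 t + kappa))) with (-1 * (ep t * (r0 * (bump x1 x2 t - kappa)))) by ring.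
   apply is_derive_scal, HD.
  + apply Rabs_m1.
  + triv.
Qed.
End Necessity.
End ScalarEquation.

(** [kappa] is the value of the bump at the point given by Cauchy's mean value theorem. *)
Lemma compatible_mean a b l p q : continuous_periodic b -> exists kappa, Rabs kappa <= 2 /\ forall r0, let w := fun t => r0 * (bump p q t - kappa) in
 G1 a b l (wave a l 0 0 w cos) (wave a l 0 0 w sin) (2 * PI) = 0 /\ G2 a b l (wave a l 0 0 w cos) (wave a l 0 0 w sin) (2 * PI) = 0.
Proof.
 intros Hb. note PI_RGT_0 as Hpi. set (ep := fun t => exp (- (l * prim b t))). set (eb := fun t => ep t * bump p q t).
 assert (Cep : forall t, continuous ep t).
 { intros t. apply derive_continuous. unfold ep. auto_derive. eexists. apply prim_derive, Hb. }
 assert (Ceb : forall t, continuous eb t).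
 { intros t. apply (continuous_mult (K := R_AbsRing)); [pos|]. apply derive_continuous. unfold bump. auto_derive. exact I. }
 assert (D : forall x y t, is_derive (fun s => x * prim eb s + y * prim ep s) t (x * eb t + y * ep t)).
 { intros x y t. apply (is_derive_plus (fun s => x * prim eb s) (fun s => y * prim ep s)); apply is_derive_scal, prim_derive; assumption. }
 set (P := prim eb (2 * PI)). set (Q := prim ep (2 * PI)).
 destruct (mean_value _ _ 0 (2 * PI) (D Q (- P))) as (x & _ & _ & E). rewrite !prim_0 in E. fold P Q in E.
 note (exp_pos (- (l * prim b x))) as Hx. fold (ep x) in Hx.
 assert (EP : P = bump p q x * Q).
 { assert (H : ep x * (Q * bump p q x - P) = 0) by (unfold eb in E; nra). nra. }
 exists (bump p q x). split; [apply bump_bound|]. intros r0 w. destruct (g_wave_0 a b l w) as [E1 E2]. unfold G1, G2. rewrite E1, E2. split; [apply prim_zero|].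
 set (k := - (r0 * bump p q x)).
 assert (C : forall t, continuous (fun t => r0 * eb t + k * ep t) t).
 { intros t. apply (continuous_plus (V := R_NormedModule) (fun t => r0 * eb t)); apply (continuous_scal_r (V := R_NormedModule)); auto. }
 replace (fun t => exp (- (l * prim b t)) * w t) with (fun t => r0 * eb t + k * ep t) by (fext t; unfold w, k, eb, ep; ring).
 rewrite (eq_of_derive _ _ _ 0 (fun t => prim_derive _ t C) (D r0 k)); rewrite ?prim_0; [|ring]. fold P Q. rewrite EP. unfold k. ring.
Qed.

(** * Factorials of multi-indices and summability over the spectrum *)

Lemma fact_sumN_le n a : INR (fact (sumN n a)) <= (2 ^ n) ^ sumN n a * mfact n a.
Proof.
 unfold mfact. induction n as [|n IH]; simpl sumN; simpl prodR; [simpl; lra|].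
 bound fact_add_le.
 note (INR_fact_lt_0 (sumN n a)).
 assert (H2 : 1 <= 2 ^ n) by (apply pow_R1_Rle; lra).
 assert (H3 : 1 <= (2 ^ n) ^ a n) by (apply pow_R1_Rle; lra).
 replace ((2 ^ S n) ^ (sumN n a + a n)) with (2 ^ (sumN n a + a n) * ((2 ^ n) ^ sumN n a * (2 ^ n) ^ a n)).
 2:{ rewrite <- pow_add, <- Rpow_mult_distr. f_equal. }
 rewrite !Rmult_assoc. scale_l. rewrite <- !Rmult_assoc.
 scale_r. nra.
Qed.

Lemma ex_series_bounded (u : nat -> R) B : (forall k, 0 <= u k) -> (forall N, sum_n u N <= B) -> ex_series u.
Proof.
 intros Hu HB. destruct (ex_finite_lim_seq_incr (sum_n u) B) as [l Hl].
 - intros N. rewrite sum_Sn. unfold plus; simpl. specialize (Hu (S N)). lra.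
 - exact HB.
 - exists l. exact Hl.
Qed.

Lemma ex_series_inv_square : ex_series (fun k => / INR (S k) ^ 2).
Proof.
 apply (ex_series_bounded _ 2).
 - left. apply Rinv_0_lt_compat, pow_lt, lt_0_INR. lia.
 - assert (H : forall N, sum_n (fun k => / INR (S k) ^ 2) N <= 2 - / INR (S N)).
  { induction N as [|N IH].
   - rewrite sum_O. simpl. lra.
   - rewrite sum_Sn. change (sum_n (fun k => / INR (S k) ^ 2) N + / INR (S (S N)) ^ 2 <= 2 - / INR (S (S N))).
    rewrite (S_INR (S N)). set (x := INR (S N)) in *. assert (Hx : 1 <= x) by apply INR_S_ge_1.
    replace ((x + 1) ^ 2) with ((x + 1) * (x + 1)) by ring.
    assert (/ ((x + 1) * (x + 1)) <= / x - / (x + 1)).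
    { replace (/ x - / (x + 1)) with (/ (x * (x + 1))) by (field; lra). apply Rinv_le_contravar; nra. }
    lra. }
  intros N. specialize (H N). assert (0 < / INR (S N)) by (apply Rinv_0_lt_compat, lt_0_INR; lia). lra.
Qed.

Lemma exp_xk_summable n mu eps : (1 <= n)%nat -> 0 < mu -> 0 < eps -> ex_series (fun k => exp (- eps * xk n mu k)).
Proof.
 intros Hn Hmu He. assert (HN : 0 < INR n) by (apply lt_0_INR; lia).
 (* With [S >= 4 n mu] the power [x^S] dominates [(k + 1)^2], and the exponential beats [x^S]. *)
 destruct (nfloor_ex (4 * INR n * mu)) as [S0 [_ HS0]]; [pos|].
 set (S := Datatypes.S S0). assert (HS : 4 * INR n * mu <= INR S) by (unfold S; rewrite S_INR; lra).
 set (D := INR (fact S) * exp (INR S) * (/ eps) ^ S).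
 apply (ex_series_le (K := R_AbsRing) (V := R_CompleteNormedModule) _ (fun k => D * / INR (Datatypes.S k) ^ 2)).
 - intros k.
  rewrite Rabs_pos_eq by pos.
  set (x := xk n mu k). assert (Hx : 1 <= x) by (apply xk_ge_1; assumption).
  note (pow_le_fact_exp (eps * x) S ltac:(apply Rmult_le_pos; lra)) as H.
  assert (Hkx : INR (Datatypes.S k) ^ 2 <= x ^ S).
  { rewrite <- !Rpower_pow by (try (apply lt_0_INR; lia); lra). unfold x, xk. rewrite Rpower_mult.
   apply Rle_Rpower; [apply INR_S_ge_1|]. simpl (INR 2). apply Rmult_le_reg_r with (2 * INR n * mu).
   - repeat apply Rmult_lt_0_compat; lra.
   - field_simplify; lra. }
  assert (Hk2 : 0 < INR (Datatypes.S k) ^ 2) by (apply pow_lt, lt_0_INR; lia).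
  apply Rmult_le_reg_r with (INR (Datatypes.S k) ^ 2); [lra|].
  rewrite Rmult_assoc, Rinv_l, Rmult_1_r by lra.
  via (exp (- eps * x) * x ^ S); [mono|].
  replace (x ^ S) with ((/ eps) ^ S * (eps * x) ^ S) by (rewrite <- Rpow_mult_distr; f_equal; field; lra).
  via (exp (- eps * x) * ((/ eps) ^ S * (INR (fact S) * exp (INR S) * exp (eps * x)))).
  + scale_l. apply Rmult_le_compat_l; [|lra].
   apply pow_le; left; apply Rinv_0_lt_compat, He.
  + right. unfold D. replace (exp (- eps * x)) with (/ exp (eps * x)).
   * field. note (exp_pos (eps * x)). lra.
   * rewrite <- exp_Ropp. f_equal. ring.
 - apply (ex_series_Rscal D). apply ex_series_inv_square.
Qed.

Lemma applyP_components n (l : list monom) g x : in_Rn n x ->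
 applyP n l g x = (PR n l (fun y => fst (g (nproj n y))) x, PR n l (fun y => snd (g (nproj n y))) x).
Proof.
 intros Hx. induction l as [|[[c a] b] l IH]; simpl; [pos|].
 rewrite IH, dxa_fold, (Dl_components n g _ (dlist_lt n a) x Hx).
 apply injective_projections; simpl; ring.
Qed.

(** * Eigenvalue asymptotics, eigenfunction bounds and coefficient decay *)

Section EigenSystem.
Variables (n m : nat) (Pl : list monom) (lam : nat -> R) (phi : nat -> (nat -> R) -> R) (mu : R).
Hypothesis (Hn : (1 <= n)%nat) (Hm : (2 <= m)%nat) (Hop : good_operator n m Pl)
 (Heig : eigen_system n m Pl lam phi) (Hmu : 1 / 2 <= mu).

Definition ph (k : nat) : (nat -> R) -> R := fun x => phi k (nproj n x).

Lemma ph_SR k : SR n (ph k).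
Proof. exact (proj1 (Schwartz_SR n (ofR (phi k)) (proj1 Heig k))). Qed.

Lemma PR_proj_inv f : SR n f -> proj_inv n (PR n Pl f).
Proof. intros Hf. apply (SR_PR n Pl f Hf). Qed.

Lemma ph_PR k x : PR n Pl (ph k) x = lam k * ph k x.
Proof.
 rewrite (PR_proj_inv (ph k) (ph_SR k) x), ((proj1 (proj1 (ph_SR k))) x).
 note (proj1 (proj2 Heig) k (nproj n x) (nproj_in_Rn n x)) as H.
 rewrite applyP_components in H by apply nproj_in_Rn. apply (f_equal fst) in H.
 unfold ph at 2. rewrite (nproj_id n (nproj n x)) by apply nproj_in_Rn. exact H.
Qed.

Lemma ph_orth j k : intRn n (fun x => ph j x * ph k x) = if Nat.eqb j k then 1 else 0.
Proof.
 rewrite <- (proj1 (proj2 (proj2 Heig)) j k). apply intRn_ext. intros x Hx. unfold ph.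
 rewrite nproj_id by exact Hx. lra.
Qed.

Lemma ph_norm k : intRn n (fun x => ph k x * ph k x) = 1.
Proof. rewrite ph_orth, Nat.eqb_refl. lra. Qed.

Lemma parseval f : SR n f -> is_series (fun k => (intRn n (fun x => f x * ph k x)) ^ 2) (intRn n (fun x => f x ^ 2)).
Proof.
 intros Hf. note (proj1 (proj2 (proj2 (proj2 Heig))) f (SR_Schwartz n f Hf)) as H.
 eapply is_series_ext; [|exact H]. intros k. simpl. f_equal; [|f_equal];
  apply intRn_ext; intros x Hx; unfold ph; rewrite nproj_id by exact Hx; reflexivity.
Qed.

Lemma PR_sym f g : SR n f -> SR n g -> intRn n (fun x => PR n Pl f x * g x) = intRn n (fun x => f x * PR n Pl g x).
Proof.
 intros Hf Hg. note (proj2 (proj2 Hop) f g (SR_Schwartz n f Hf) (SR_Schwartz n g Hg)) as H.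
 rewrite (intRn_ext n _ (fun x => PR n Pl f x * g x)) in H by (intros; rewrite applyP_PR; reflexivity).
 rewrite H. apply intRn_ext. intros. rewrite applyP_PR. pos.
Qed.

Lemma PR_iter_coef f N k : SR n f -> intRn n (fun x => Nat.iter N (PR n Pl) f x * ph k x) = lam k ^ N * intRn n (fun x => f x * ph k x).
Proof.
 intros Hf. induction N as [|N IH]; [simpl; ring|]. simpl.
 rewrite (PR_sym _ _ (SR_PR_iter n Pl f N Hf) (ph_SR k)).
 destruct (En_mult n _ _ (SR_PR_iter n Pl f N Hf) (ph_SR k)) as [K HK].
 rewrite Rmult_assoc, <- IH, <- (intRn_scal n K _ _ HK). apply intRn_ext. intros x _. rewrite ph_PR. ring.
Qed.

Lemma mu_pos : 0 < mu. Proof. lra. Qed.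

Notation xx := (xk n mu).

Lemma xx_ge_1 k : 1 <= xx k.
Proof. apply xk_ge_1; [triv|nra]. Qed.

Lemma exp_xx_le_1 eps k : 0 <= eps -> exp (- eps * xx k) <= 1.
Proof. intros He. rewrite <- exp_0. apply exp_le. note (xx_ge_1 k). nra. Qed.

Lemma lam_ratio : exists rho, 0 < rho /\ is_lim_seq (fun k => Rabs (lam k) / (rho * Rpower (xx k) (INR m * mu))) 1.
Proof.
 destruct (proj2 (proj2 (proj2 (proj2 Heig)))) as [rho [Hr H]]. exists rho. split; [lra|].
 eapply is_lim_seq_ext; [|exact H]. intros k. rewrite <- xk_power; [pos|pos|lra].
Qed.

Lemma lam_upper : exists C1, 0 <= C1 /\ forall k, Rabs (lam k) <= C1 * Rpower (xx k) (INR m * mu).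
Proof.
 destruct lam_ratio as [rho [Hr H]].
 assert (HB : exists M, forall k, Rabs (lam k) / (rho * Rpower (xx k) (INR m * mu)) <= M).
 { apply is_lim_seq_spec in H. destruct (H (mkposreal 1 Rlt_0_1)) as [N HN]. simpl in HN.
  assert (HF : forall N, exists M, forall k, (k < N)%nat -> Rabs (lam k) / (rho * Rpower (xx k) (INR m * mu)) <= M).
  { induction N0 as [|N0 [M HM]]; [exists 0; intros; lia|].
   exists (Rmax M (Rabs (lam N0) / (rho * Rpower (xx N0) (INR m * mu)))). intros k Hk.
   destruct (Nat.eq_dec k N0) as [->|]; [apply Rmax_r|]. eapply Rle_trans; [apply HM; lia|apply Rmax_l]. }
  destruct (HF N) as [M HM]. exists (Rmax M 2). intros k. destruct (Nat.lt_ge_cases k N).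
  - eapply Rle_trans; [apply HM; assumption|apply Rmax_l].
  - bound_by Rmax_r. specialize (HN k ltac:(assumption)). apply Rabs_def2 in HN. lra. }
 destruct HB as [M HM]. exists (Rabs M * rho). split; [pos|].
 intros k. specialize (HM k). assert (Hp : 0 < rho * Rpower (xx k) (INR m * mu)) by pos.
 rewrite Rmult_assoc. apply (Rmult_le_compat_r (rho * Rpower (xx k) (INR m * mu))) in HM; [|lra].
 unfold Rdiv in HM. rewrite Rmult_assoc, Rinv_l, Rmult_1_r in HM by lra.
 eapply Rle_trans; [exact HM|]. scale_r; apply Rle_abs.
Qed.

Lemma lam_lower : exists c N, 0 < c /\ forall k, (N <= k)%nat -> c * Rpower (xx k) (INR m * mu) <= Rabs (lam k).
Proof.
 destruct lam_ratio as [rho [Hr H]]. apply is_lim_seq_spec in H.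
 destruct (H (mkposreal (1 / 2) ltac:(lra))) as [N HN]. simpl in HN.
 exists (rho / 2), N. split; [lra|]. intros k Hk. specialize (HN k Hk). apply Rabs_def2 in HN.
 assert (Hp : 0 < rho * Rpower (xx k) (INR m * mu)) by pos.
 assert (E : 1 / 2 < Rabs (lam k) / (rho * Rpower (xx k) (INR m * mu))) by lra.
 apply (Rmult_lt_compat_r (rho * Rpower (xx k) (INR m * mu))) in E; [|lra].
 unfold Rdiv in E at 2. rewrite Rmult_assoc, Rinv_l, Rmult_1_r in E by lra. lra.
Qed.

Lemma xk_mono j k : (j <= k)%nat -> xx j <= xx k.
Proof.
 intros H. apply Rpower_le_l.
 - assert (0 < INR n) by (apply lt_0_INR; lia). left. apply Rdiv_lt_0_compat; [lra|].
  repeat apply Rmult_lt_0_compat; lra.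
 - apply lt_0_INR; lia.
 - apply le_INR; lia.
Qed.

Lemma ph_sup eps : 0 < eps -> exists K C, 0 <= K /\ 1 <= C /\ forall k w x, lt_letters (2 * n) w ->
 Rabs (Yw n w (ph k) x) <= K * C ^ length w * Rpower (INR (fact (length w))) mu * exp (eps * xx k).
Proof.
 intros He. destruct (eigenfunction_sup_bound n m Pl Hn Hm (conj (proj1 Hop) (proj1 (proj2 Hop)))) as (K & A & HK & HA & H).
 destruct lam_upper as [C1 [HC1 Hlam]].
 (* Then [Th], taken as [C0] times [xx k] to the power [2 mu], satisfies both [1 <= Th] and
    [lam k ^ 2 <= Th ^ m]. *)
 set (C0 := 1 + C1 ^ 2). assert (HC0 : 1 <= C0) by (unfold C0; note (pow2_ge_0 C1); lra).
 destruct (sup_bound_absorb n mu C0 K A eps Hn Hmu HC0 HK HA He) as (K' & C' & HK' & HC' & Habs).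
 exists K', C'. split; [lra|]. split; [lra|]. intros k w x Hw.
 note (xx_ge_1 k) as Hx.
 apply Habs; [lra|]. apply (H (ph k) (lam k)).
 - apply ph_SR.
 - apply ph_PR.
 - rewrite <- (ph_norm k). apply intRn_ext. intros; ring.
 - note (Rpower_ge_1 (xx k) (2 * mu) ltac:(lra) Hx). nra.
 - rewrite Rpow_mult_distr, <- Rpower_pow_l by lra.
  via (C1 ^ 2 * Rpower (xx k ^ m) (2 * mu)).
  + rewrite <- pow2_abs. replace (Rpower (xx k ^ m) (2 * mu)) with (Rpower (xx k) (INR m * mu) ^ 2).
   * rewrite <- Rpow_mult_distr. apply pow_incr. split; [pos|pos].
   * rewrite <- Rpower_pow by apply Rpower_pos. rewrite <- Rpower_pow by lra. rewrite !Rpower_mult. f_equal. simpl. ring.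
  + scale_r. via (C0 ^ 1); [unfold C0; lra|].
   apply Rle_pow; [lra|lia].
 - exact Hw.
Qed.

Lemma intRn_pair_le' f g B : SR n f -> SR n g -> 0 <= B -> intRn n (fun x => f x * f x) <= B ^ 2 ->
 intRn n (fun x => g x * g x) = 1 -> Rabs (intRn n (fun x => f x * g x)) <= B.
Proof.
 intros Hf Hg HB Hff Hgg. apply le_epsilon. intros e He. apply intRn_pair_le; auto; [lra|]. nra.
Qed.

(** The rate [eps] and the constant [K2] are fixed by [C], before [f]: this uniformity lets one rate
    serve all time derivatives of a function at once. *)
Theorem coef_decay C : 1 <= C -> exists eps K2, 0 < eps /\ 0 <= K2 /\ forall k f K, SR n f -> 0 <= K ->
 gs_bound n mu K C f -> Rabs (intRn n (fun x => f x * ph k x)) <= K * K2 * exp (- eps * xx k).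
Proof.
 intros HC. note mu_pos as Hmu0.
 set (cs := lsum Pl (fun mo => Rabs (fst (fst mo)))).
 assert (Hcs : 0 <= cs) by (apply lsum_nonneg; intros; apply Rabs_pos).
 set (cnt := INR (length (wts n))). assert (Hcnt : 0 <= cnt) by apply pos_INR.
 set (R2 := Rpower 2 mu). assert (HR2 : 1 <= R2) by (apply Rpower_ge_1; lra).
 set (R0 := (cs + 1) * (2 * C) ^ m * R2 ^ m).
 assert (HR0 : 0 < R0).
 { repeat apply Rmult_lt_0_compat; [lra|pos|pos]. }
 assert (Hpi : 0 <= PI ^ n) by (apply pow_le; note PI_RGT_0; lra).
 set (Kc := sqrt (PI ^ n) * cnt * (2 * C) ^ (2 * n) * R2 ^ (2 * n) * Rpower (INR (fact (2 * n))) mu).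
 assert (HKc : 0 <= Kc).
 { unfold Kc. pos. }
 assert (Hit : forall k f K N, SR n f -> 0 <= K -> gs_bound n mu K C f ->
   Rabs (lam k) ^ N * Rabs (intRn n (fun x => f x * ph k x)) <= (K * Kc) * (R0 ^ N * Rpower (INR (fact (m * N))) mu)).
 { intros k f K N Hf HK HB. rewrite RPow_abs, <- Rabs_mult, <- PR_iter_coef by exact Hf.
  set (h := Nat.iter N (PR n Pl) f). assert (Hh : SR n h) by (apply SR_PR_iter, Hf).
  set (B1 := cs ^ N * (K * (2 * C) ^ (2 * n + m * N) * Rpower (INR (fact (2 * n + m * N))) mu)).
  assert (HB1 : 0 <= B1).
  { apply Rmult_le_pos; [pos|]. pos. }
  assert (Hb : forall x, Rabs (h x) <= cnt * B1 * iw n x).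
  { apply weighted_word_bound. intros w x Hw Hl.
   eapply Rle_trans; [apply (PR_iter_word_bound n m Pl mu K (2 * C) f); auto; try lra|].
   - apply (proj1 Hop).
   - apply gs_word_bound; auto.
   - scale_l. apply Rmult_le_compat.
    + apply Rmult_le_pos; [lra|pos].
    + left; apply Rpower_pos.
    + scale_l. apply Rle_pow; [lra|lia].
    + apply Rpower_le_l; [lra|pos|]. apply le_INR, fact_le. lia. }
  bound (intRn_pair_le' h (ph k) (sqrt (PI ^ n) * (cnt * B1)) Hh (ph_SR k)).
  - apply Rmult_le_pos; [pos|]. apply Rmult_le_pos; assumption.
  - destruct (En_mult n h h Hh Hh) as [Ke HKe].
   bound Rle_abs. rewrite Rpow_mult_distr, pow2_sqrt by exact Hpi.
   apply (intRn_abs_le n Ke); [pos|]. intros x. rewrite Rabs_mult. specialize (Hb x).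
   note (iw_pos n x). note (iw_le_1 n x).
   via ((cnt * B1 * iw n x) * (cnt * B1 * iw n x)); [mono|].
   replace (cnt * B1 * iw n x * (cnt * B1 * iw n x)) with ((cnt * B1) ^ 2 * iw n x * iw n x) by ring.
   rewrite <- (Rmult_1_r ((cnt * B1) ^ 2 * iw n x)) at 2. apply Rmult_le_compat_l; [|lra].
   apply Rmult_le_pos; [pos|lra].
  - apply ph_norm.
  -
   assert (EF : Rpower (INR (fact (2 * n + m * N))) mu <= R2 ^ (2 * n + m * N) * Rpower (INR (fact (2 * n))) mu * Rpower (INR (fact (m * N))) mu).
   { unfold R2. rewrite <- Rpower_pow_l by lra. note (INR_fact_lt_0 (2 * n)). note (INR_fact_lt_0 (m * N)).
    assert (0 < 2 ^ (2 * n + m * N)) by pos.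
    rewrite !Rpower_mult_distr; try lra; [|pos].
    apply Rpower_le_l; [lra|pos|apply fact_add_le]. }
   via (sqrt (PI ^ n) * (cnt * ((cs + 1) ^ N * (K * (2 * C) ^ (2 * n + m * N) *
     (R2 ^ (2 * n + m * N) * Rpower (INR (fact (2 * n))) mu * Rpower (INR (fact (m * N))) mu))))).
   + scale_l. scale_l.
    apply Rmult_le_compat.
    * apply pow_le, Hcs.
    * apply Rmult_le_pos; [|pos]. apply Rmult_le_pos; [lra|pos].
    * apply pow_incr. lra.
    * apply Rmult_le_compat_l; [|lra]. apply Rmult_le_pos; [lra|pos].
   + right. unfold Kc, R0. rewrite !Rpow_mult_distr, <- !pow_mult, !pow_add, ?Rpow_mult_distr. ring. }
 destruct lam_lower as [c [N0 [Hc Hlow]]].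
 destruct (decay_from_iterates m mu R0 c ltac:(lia) Hmu0 HR0 Hc) as (eps & K2 & He & HK2 & Hdec).
 exists eps, (Kc * (K2 + exp (eps * xx N0))). split; [lra|]. split.
 { pos. }
 intros k f K Hf HK HB. specialize (Hit k f K). note (exp_pos (eps * xx N0)) as Hex.
 assert (HKK : 0 <= K * Kc) by pos.
 (* Below [N0] the eigenvalue has no lower bound; the trivial estimate [N = 0] is used, and the
    factor [exp (eps * xx N0)] in the constant makes up for the decay. *)
 destruct (Nat.lt_ge_cases k N0) as [Hlt|Hge].
 - specialize (Hit O Hf HK HB). rewrite Nat.mul_0_r in Hit. simpl in Hit.
  replace (Rpower 1 mu) with 1 in Hit by (unfold Rpower; rewrite ln_1, Rmult_0_r, exp_0; reflexivity).
  via (K * Kc); [lra|].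
  assert (E : 1 <= exp (eps * xx N0) * exp (- eps * xx k)).
  { rewrite <- exp_plus. replace (eps * xx N0 + - eps * xx k) with (eps * (xx N0 - xx k)) by ring.
   note (xk_mono k N0 ltac:(lia)). note (exp_ineq1_le (eps * (xx N0 - xx k))). nra. }
  replace (K * (Kc * (K2 + exp (eps * xx N0))) * exp (- eps * xx k))
   with (K * Kc * (K2 * exp (- eps * xx k) + exp (eps * xx N0) * exp (- eps * xx k))) by ring.
  rewrite <- (Rmult_1_r (K * Kc)) at 1. scale_l.
  assert (0 <= K2 * exp (- eps * xx k)) by pos. lra.
 - bound (Hdec (K * Kc) (xx k) (Rabs (lam k)) _ HKK).
  + apply xk_ge_1; assumption.
  + apply Hlow, Hge.
  + intros N. apply Hit; assumption.
  + apply Rabs_pos.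
  + scale_r.
   nra.
Qed.

Lemma series_abs_le (u M : nat -> R) : ex_series M -> (forall k, Rabs (u k) <= M k) -> ex_series u /\ Rabs (Series u) <= Series M.
Proof.
 intros HM H. split.
 - apply (ex_series_le (K := R_AbsRing) (V := R_CompleteNormedModule) _ M); [pos|pos].
 - bound Series_Rabs.
  + apply (ex_series_le (K := R_AbsRing) (V := R_CompleteNormedModule) _ M); [|pos].
   intros k. rewrite Rabs_Rabsolu. apply H.
  + apply Series_le; [|pos]. pos.
Qed.

(** A majorant for the second derivatives gives a summable quadratic remainder. *)
Lemma series_derive (g g' g'' : nat -> R -> R) (M : nat -> R) t : ex_series M ->
 (forall k r, is_derive (g k) r (g' k r)) -> (forall k r, is_derive (g' k) r (g'' k r)) ->
 (forall k r, Rabs (g k r) <= M k) -> (forall k r, Rabs (g' k r) <= M k) -> (forall k r, Rabs (g'' k r) <= M k) ->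
 is_derive (fun r => Series (fun k => g k r)) t (Series (fun k => g' k t)).
Proof.
 intros HM D1 D2 B0 B1 B2.
 assert (Ex : forall h : nat -> R -> R, (forall k r, Rabs (h k r) <= M k) -> forall r, ex_series (fun k => h k r)).
 { intros h Hh r. apply (series_abs_le _ M); auto. }
 apply is_derive_quadratic with (C := Series M). intros s.
 rewrite <- Series_scal_l, <- Series_minus, <- Series_minus by (try apply (ex_series_minus (V := R_NormedModule)); try apply ex_series_Rscal; auto).
 rewrite (Rmult_comm (Series M)), <- Series_scal_l. apply series_abs_le.
 - apply ex_series_Rscal. exact HM.
 - intros k. rewrite (Rmult_comm _ (M k)). apply (quadratic_remainder (g k) (g' k) t (M k)); [|pos|].
  + bound Rabs_pos; apply (B0 k t).
  + intros r. apply (lipschitz_of_derivative _ (g'' k)); auto.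
Qed.

Lemma series_single (N : nat) (v : R) : is_series (fun k => if Nat.eqb k N then v else 0) v.
Proof.
 change (is_lim_seq (sum_n (fun k => if Nat.eqb k N then v else 0)) v).
 apply (is_lim_seq_ext_loc (fun _ => v)); [|apply is_lim_seq_const]. exists N.
 assert (H : forall M, sum_n (fun k => if Nat.eqb k N then v else 0) M = if Nat.leb N M then v else 0).
 { induction M as [|M IH].
  - rewrite sum_O. destruct (Nat.eqb_spec 0 N), (Nat.leb_spec N 0); try lia; reflexivity.
  - rewrite sum_Sn, IH. match goal with |- @eq _ (plus ?a ?b) ?c => change (@eq R (a + b) c) end.
   destruct (Nat.leb_spec N M), (Nat.eqb_spec (S M) N), (Nat.leb_spec N (S M)); try lia; ring. }
 intros M HM. rewrite H. destruct (Nat.leb_spec N M); [lra|lia].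
Qed.

(** One more power of the weight is bought by multiplying with the product of the [1 + x_k^2], that
    is by at most [2 n] further letters. *)
Lemma ph_weight eps p : 0 < eps -> forall l, exists K, 0 <= K /\ forall k w x, lt_letters (2 * n) w -> (length w <= l)%nat ->
 Rabs (Yw n w (ph k) x) <= K * exp (eps * xx k) * iw n x ^ p.
Proof.
 intros He. destruct (ph_sup eps He) as (K & C & HK & HC & H). induction p as [|p IH]; intros l.
 - exists (K * C ^ l * Rpower (INR (fact l)) mu). split.
  { pos. }
  intros k w x Hw Hl. rewrite Rmult_1_r. eapply Rle_trans; [apply H, Hw|].
  scale_r. apply Rmult_le_compat.
  + apply Rmult_le_pos; [lra|pos].
  + left; apply Rpower_pos.
  + scale_l. apply Rle_pow; assumption.
  + apply Rpower_le_l; [lra|pos|]. apply le_INR, fact_le, Hl.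
 - destruct (IH (l + 2 * n)%nat) as (K' & HK' & H'). set (cnt := INR (length (wts n))).
  assert (Hc : 0 <= cnt) by apply pos_INR.
  exists (cnt * K'). split; [pos|]. intros k w x Hw Hl.
  rewrite <- (wts_sum n n (Yw n w (ph k)) x (le_n n)), Rabs_mult, (Rabs_pos_eq (iw n x)) by (left; apply iw_pos).
  replace (cnt * K' * exp (eps * xx k) * iw n x ^ S p) with (cnt * (K' * exp (eps * xx k) * iw n x ^ p) * iw n x) by (simpl; ring).
  apply Rmult_le_compat_r; [left; apply iw_pos|]. bound lsum_abs.
  unfold cnt. rewrite <- lsum_const. apply lsum_le. intros v Hv. apply (wts_spec n) in Hv; [|lia]. destruct Hv as [H1 H2].
  rewrite <- Yw_app. apply H'.
  + apply List.Forall_app. split; [apply (lt_letters_le n); [lia|pos]|pos].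
  + rewrite length_app. lia.
Qed.

Lemma ph_weight_D eps ds p : 0 < eps -> lt_letters n ds -> exists K, 0 <= K /\ forall k x,
 Rabs (Dl ds (ph k) x) <= K * exp (eps * xx k) * iw n x ^ p.
Proof.
 intros He Hds. destruct (ph_weight eps p He (length ds)) as (K & HK & H). exists K. split; [lra|].
 intros k x. rewrite <- (Yw_dlist n ds (ph k) Hds). apply H; [|rewrite length_map; lia].
 unfold lt_letters in *. rewrite List.Forall_map. eapply List.Forall_impl; [|exact Hds]. simpl in *. lia.
Qed.

(** * Synthesis of series of eigenfunctions *)

Definition syn (cs : nat -> R) (ds : list nat) : (nat -> R) -> R := fun x => Series (fun k => cs k * Dl ds (ph k) x).
Definition dec (eps K : R) (cs : nat -> R) : Prop := forall k, Rabs (cs k) <= K * exp (- eps * xx k).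

(** Half of the decay of the coefficients pays for the growth [exp (eps / 2 * xx k)] of the
    eigenfunctions, the other half makes the series converge. *)
Lemma syn_majorant eps ds p : 0 < eps -> lt_letters n ds -> exists M, ex_series M /\ (forall k, 0 <= M k) /\
 forall K cs k x, dec eps K cs -> Rabs (cs k * Dl ds (ph k) x) <= K * M k * iw n x ^ p.
Proof.
 intros He Hds. destruct (ph_weight_D (eps / 2) ds p ltac:(lra) Hds) as (D & HD & H).
 exists (fun k => D * exp (- (eps / 2) * xx k)). split; [|split].
 - apply (ex_series_Rscal D). apply exp_xk_summable; [pos|lra|lra].
 - intros k. apply Rmult_le_pos; [lra|pos].
 - intros K cs k x Hc. rewrite Rabs_mult. eapply Rle_trans; [apply Rmult_le_compat; [pos|pos|apply Hc|apply H]|].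
  right. replace (- eps * xx k) with (- (eps / 2) * xx k + - (eps / 2 * xx k)) by field.
  rewrite exp_plus, exp_Ropp. field. note (exp_pos (eps / 2 * xx k)). lra.
Qed.

Lemma dec_pos eps K cs : dec eps K cs -> 0 <= K.
Proof.
 intros H. specialize (H O). note (Rabs_pos (cs O)). note (exp_pos (- eps * xx 0)).
 nra.
Qed.

Lemma syn_bound eps ds p : 0 < eps -> lt_letters n ds -> exists D, 0 <= D /\ forall K cs x, dec eps K cs ->
 ex_series (fun k => cs k * Dl ds (ph k) x) /\ Rabs (syn cs ds x) <= K * D * iw n x ^ p.
Proof.
 intros He Hds. destruct (syn_majorant eps ds p He Hds) as (M & HM & HMp & H). exists (Series M). split.
 { bound (Rabs_pos (Series (fun _ => 0))). apply series_abs_le; [pos|].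
  rewrite Rabs_R0. pos. }
 intros K cs x Hc. replace (K * Series M * iw n x ^ p) with (Series (fun k => K * iw n x ^ p * M k)) by (rewrite Series_scal_l; ring).
 apply series_abs_le.
 - apply ex_series_Rscal. exact HM.
 - intros k. eapply Rle_trans; [apply H, Hc|]. lra.
Qed.

Lemma syn_isD eps K cs ds k : 0 < eps -> dec eps K cs -> lt_letters n ds -> (k < n)%nat -> isD k (syn cs ds) (syn cs (k :: ds)).
Proof.
 intros He Hc Hds Hk x. note (dec_pos _ _ _ Hc) as HK.
 assert (H1 : lt_letters n (k :: ds)) by (apply lt_letters_cons; auto).
 assert (H2 : lt_letters n (k :: k :: ds)) by (apply lt_letters_cons; auto).
 destruct (syn_majorant eps ds 0 He Hds) as (M0 & E0 & P0 & B0).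
 destruct (syn_majorant eps _ 0 He H1) as (M1 & E1 & P1 & B1).
 destruct (syn_majorant eps _ 0 He H2) as (M2 & E2 & P2 & B2).
 unfold syn. replace (fun k0 : nat => cs k0 * Dl (k :: ds) (ph k0) x) with (fun k0 : nat => cs k0 * Dl (k :: ds) (ph k0) (upd x k (x k)))
  by (rewrite upd_id; reflexivity).
 apply (series_derive (fun j s => cs j * Dl ds (ph j) (upd x k s)) (fun j s => cs j * Dl (k :: ds) (ph j) (upd x k s))
  (fun j s => cs j * Dl (k :: k :: ds) (ph j) (upd x k s)) (fun j => K * (M0 j + M1 j + M2 j))).
 - apply ex_series_Rscal.
  apply (ex_series_plus (V := R_NormedModule) (fun j => M0 j + M1 j) M2); [|pos].
  apply (ex_series_plus (V := R_NormedModule) M0 M1); assumption.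
 - intros j r. apply is_derive_scal, isD_upd, (smoothR_isD n); [apply ph_SR|pos|pos].
 - intros j r. apply is_derive_scal. apply isD_upd, (smoothR_isD n _ (k :: ds)); [apply ph_SR|pos|pos].
 - intros j r. eapply Rle_trans; [apply B0, Hc|]. specialize (P1 j). specialize (P2 j). nra.
 - intros j r. eapply Rle_trans; [apply B1, Hc|]. specialize (P0 j). specialize (P2 j). nra.
 - intros j r. eapply Rle_trans; [apply B2, Hc|]. specialize (P1 j). specialize (P0 j). nra.
Qed.

Lemma syn_t (F : nat -> nat -> R -> R) eps (Kg : nat -> R) g ds t x : 0 < eps -> lt_letters n ds ->
 (forall g k t, is_derive (F g k) t (F (S g) k t)) -> (forall g t, dec eps (Kg g) (fun k => F g k t)) ->
 is_derive (fun s => syn (fun k => F g k s) ds x) t (syn (fun k => F (S g) k t) ds x).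
Proof.
 intros He Hds HF HB. destruct (syn_majorant eps ds 0 He Hds) as (M & E & P & B).
 assert (HK : forall j, 0 <= Kg j) by (intros j; eapply dec_pos, (HB j 0)).
 assert (HB2 : forall j k s, Rabs (F j k s * Dl ds (ph k) x) <= Kg j * M k).
 { intros j k s. eapply Rle_trans; [apply (B (Kg j) (fun k => F j k s) k x), HB|]. lra. }
 apply (series_derive (fun j s => F g j s * Dl ds (ph j) x) (fun j s => F (S g) j s * Dl ds (ph j) x)
  (fun j s => F (S (S g)) j s * Dl ds (ph j) x) (fun k => (Kg g + Kg (S g) + Kg (S (S g))) * M k)).
 - apply ex_series_Rscal, E.
 - intros k r. apply (is_derive_scal_l (K := R_AbsRing) (V := R_NormedModule) (F g k)), HF.
 - intros k r. apply (is_derive_scal_l (K := R_AbsRing) (V := R_NormedModule) (F (S g) k)), HF.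
 - intros k r. bound HB2. note (HK (S g)). note (HK (S (S g))). specialize (P k). nra.
 - intros k r. bound HB2. note (HK g). note (HK (S (S g))). specialize (P k). nra.
 - intros k r. bound HB2. note (HK (S g)). note (HK g). mono.
Qed.

Lemma Dl_syn eps K cs ds : 0 < eps -> dec eps K cs -> lt_letters n ds -> Dl ds (syn cs []) = syn cs ds.
Proof.
 intros He Hc. induction ds as [|k ds IH]; intros H; [pos|]. apply lt_letters_cons in H. destruct H as [Hk H].
 simpl. rewrite IH by exact H. apply isD_pdr. apply (syn_isD eps K); assumption.
Qed.

Lemma syn_SR eps K cs : 0 < eps -> dec eps K cs -> SR n (syn cs []).
Proof.
 intros He Hc. split; [split|].
 - intros x. apply Series_ext. intros k. rewrite (proj1 (proj1 (ph_SR k)) x) at 1. reflexivity.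
 - intros ds k x Hds Hk. rewrite (Dl_syn eps K) by assumption. eexists. apply (syn_isD eps K); assumption.
 - intros ds p Hds. rewrite (Dl_syn eps K) by assumption. destruct (syn_bound eps ds p He Hds) as (D & _ & H).
  exists (K * D). intros x. apply H, Hc.
Qed.

Definition cf (f : (nat -> R) -> R) (k : nat) : R := intRn n (fun x => f x * ph k x).

Lemma cf_plus f g k : SR n f -> SR n g -> cf (fun x => f x + g x) k = cf f k + cf g k.
Proof.
 intros Hf Hg. destruct (En_mult n f _ Hf (ph_SR k)) as [K1 H1]. destruct (En_mult n g _ Hg (ph_SR k)) as [K2 H2].
 unfold cf. rewrite <- (intRn_plus n K1 K2) by assumption. apply intRn_ext. triv.
Qed.

Lemma cf_scal c f k : SR n f -> cf (fun x => c * f x) k = c * cf f k.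
Proof.
 intros Hf. destruct (En_mult n f _ Hf (ph_SR k)) as [K1 H1].
 unfold cf. rewrite <- (intRn_scal n K1) by assumption. apply intRn_ext. triv.
Qed.

Lemma cf_PR f k : SR n f -> cf (PR n Pl f) k = lam k * cf f k.
Proof. intros Hf. note (PR_iter_coef f 1 k Hf) as H. simpl in H. unfold cf. lra. Qed.

(** Parseval's identity makes the square integral of the difference vanish, and a continuous
    nonnegative integrand with zero integral is zero. *)
Lemma cf_unique f g : SR n f -> SR n g -> (forall k, cf f k = cf g k) -> f = g.
Proof.
 intros Hf Hg H. set (h := fun x => f x + (-1) * g x).
 assert (Hh : SR n h) by (apply (SR_plus n f); [pos|apply SR_scal, Hg]).
 assert (Hc : forall k, cf h k = 0).
 { intros k. unfold h. rewrite (cf_plus f), cf_scal, H; [ring|pos|pos|apply SR_scal, Hg]. }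
 assert (E : intRn n (fun x => h x ^ 2) = 0).
 { rewrite <- (is_series_unique _ _ (parseval h Hh)).
  rewrite (Series_ext _ (fun k => 0 * 0)); [rewrite Series_scal_l; ring|].
  intros k. note (Hc k) as Hk. unfold cf in Hk. nra. }
 destruct (En_mult n h h Hh Hh) as [K HK].
 fext x. assert (Hz : h x * h x = 0).
 { rewrite (proj1 (proj1 Hh) x). apply (intRn_zero n K (fun y => h y * h y)); [pos|triv| |apply nproj_in_Rn].
  rewrite <- E. apply intRn_ext. triv. }
 unfold h in Hz. nra.
Qed.

(** Finitely many terms are split off, whose coefficients orthonormality gives; the tail is small in
    a weighted sup norm because half of its decay can be kept as the factor
    [exp (- (eps / 2) * xx N)]. *)
Lemma cf_syn eps K cs j : 0 < eps -> dec eps K cs -> cf (syn cs []) j = cs j.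
Proof.
 intros He Hc. note (dec_pos _ _ _ Hc) as HK.
 set (tl := fun (N : nat) k => if Nat.ltb k N then 0 else cs k).
 assert (Htl : forall N, dec eps K (tl N)).
 { intros N k. unfold tl. destruct (Nat.ltb k N); [|pos]. rewrite Rabs_R0. pos. }
 assert (Hstep : forall N, syn (tl N) [] = fun x => cs N * ph N x + syn (tl (S N)) [] x).
 { intros N. fext x. unfold syn.
  destruct (syn_bound eps [] 0 He ltac:(constructor)) as (D & _ & HD).
  rewrite <- (is_series_unique _ _ (series_single N (cs N * ph N x))), <- Series_plus.
  - apply Series_ext. intros k. unfold tl. simpl Dl.
   destruct (Nat.eqb_spec k N), (Nat.ltb_spec k N), (Nat.ltb_spec k (S N)); subst; try lia; ring.
  - eexists; apply series_single.
  - apply (HD K), Htl. }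
 assert (Hsum : forall N, (j < N)%nat -> cf (syn cs []) j = cs j + cf (syn (tl N) []) j).
 { intros N HN. assert (G : cf (syn (tl 0%nat) []) j = (if Nat.ltb j N then cs j else 0) + cf (syn (tl N) []) j).
  { clear HN. induction N as [|N IH]; [simpl; ring|]. rewrite IH, (Hstep N).
   rewrite (cf_plus (fun x => cs N * ph N x)), cf_scal by (first [apply SR_scal, ph_SR|apply ph_SR|apply (syn_SR eps K); auto]).
   unfold cf at 1. rewrite ph_orth.
   destruct (Nat.ltb_spec j N), (Nat.ltb_spec j (S N)), (Nat.eqb_spec N j); subst; try lia; ring. }
  destruct (Nat.ltb_spec j N); [|lia]. exact G. }
 destruct (syn_bound (eps / 2) [] 1 ltac:(lra) ltac:(constructor)) as (D & HD & HB).
 destruct (proj2 (ph_SR j) [] O ltac:(constructor)) as [P HP]. simpl in HP.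
 assert (HP0 : 0 <= P) by (note (Rabs_pos (ph j (fun _ => 0))); specialize (HP (fun _ => 0)); lra).
 apply Rminus_diag_uniq. apply cond_eq. intros e He'. rewrite Rminus_0_r.
 set (Q := PI ^ n * (K * D * P)).
 assert (HQ : 0 <= Q) by (apply Rmult_le_pos; [apply pow_le; note PI_RGT_0; lra|pos]).
 assert (Hex : exists N, (j < N)%nat /\ Q * exp (- (eps / 2) * xx N) < e).
 { note (ex_series_lim_0 _ (exp_xk_summable n mu (eps / 2) Hn mu_pos ltac:(lra))) as L. apply is_lim_seq_spec in L.
  assert (Hd : 0 < e / (Q + 1)) by pos.
  destruct (L (mkposreal _ Hd)) as [N0 HN0]. simpl in HN0. exists (N0 + S j)%nat. split; [lia|].
  specialize (HN0 (N0 + S j)%nat ltac:(lia)). rewrite Rminus_0_r, Rabs_pos_eq in HN0 by pos.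
  note (exp_pos (- (eps / 2) * xx (N0 + S j))) as Hp.
  assert (E : (Q + 1) * exp (- (eps / 2) * xx (N0 + S j)) < (Q + 1) * (e / (Q + 1))) by nra.
  replace ((Q + 1) * (e / (Q + 1))) with e in E by (field; lra). lra. }
 destruct Hex as (N & HN & Hlt). rewrite (Hsum N HN). replace (cs j + cf (syn (tl N) []) j - cs j) with (cf (syn (tl N) []) j) by ring.
 eapply Rle_lt_trans; [|exact Hlt].
 assert (Hd2 : dec (eps / 2) (K * exp (- (eps / 2) * xx N)) (tl N)).
 { intros k. unfold tl. destruct (Nat.ltb_spec k N).
  - rewrite Rabs_R0. repeat apply Rmult_le_pos; try (left; apply exp_pos). exact HK.
  - bound Hc. rewrite Rmult_assoc, <- exp_plus. scale_l.
   note (xk_mono N k ltac:(lia)). destruct (Req_dec (xx N) (xx k)) as [Eq|Neq].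
   + rewrite Eq. right. f_equal. field.
   + left. apply exp_increasing. nra. }
 destruct (En_mult n _ _ (syn_SR eps K (tl N) He (Htl N)) (ph_SR j)) as [KE HE].
 bound (intRn_abs_le n KE (K * exp (- (eps / 2) * xx N) * D * P) _ HE).
 - intros x. rewrite Rabs_mult. destruct (HB _ _ x Hd2) as [_ Hb]. specialize (HP x).
  eapply Rle_trans; [apply Rmult_le_compat; [pos|pos|exact Hb|exact HP]|]. right; ring.
 - right. unfold Q. ring.
Qed.

(** The family [F g] carries the [g]-th time derivatives explicitly, with one order, rate and decay
    for all indices [k]. The pairs in [coef_class] are the real and imaginary parts of the
    coefficients of functions in [F_mu]. *)
Definition coef_family (s eps K C : R) (F : nat -> nat -> R -> R) (c : nat -> R -> R) : Prop :=
 (forall k t, F O k t = c k t) /\ (forall k t, c k (t + 2 * PI) = c k t) /\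
 (forall g k t, is_derive (F g k) t (F (S g) k t)) /\
 forall g t, dec eps (K * C ^ g * Rpower (INR (fact g)) s) (fun k => F g k t).
Definition coef_class (c1 c2 : nat -> R -> R) : Prop :=
 exists s eps K C F1 F2, 1 < s /\ 0 < eps /\ 1 <= C /\ coef_family s eps K C F1 c1 /\ coef_family s eps K C F2 c2.

(** * Passage between functions and their coefficients *)

Fixpoint space_part (L : list (option nat)) : list nat :=
 match L with [] => [] | Some k :: L => k :: space_part L | None :: L => space_part L end.
Fixpoint time_order (L : list (option nat)) : nat :=
 match L with [] => O | Some _ :: L => time_order L | None :: L => S (time_order L) end.

Lemma Cmod_le_sum a b : Cmod (a, b) <= Rabs a + Rabs b.
Proof.
 unfold Cmod. cbn [fst snd]. note (Rabs_pos a). note (Rabs_pos b).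
 rewrite <- (sqrt_pow2 (Rabs a + Rabs b)) by lra. apply sqrt_le_1_alt.
 rewrite <- (pow2_abs a), <- (pow2_abs b). nra.
Qed.

Lemma space_part_lt L : (forall k, In (Some k) L -> (k < n)%nat) -> lt_letters n (space_part L).
Proof.
 induction L as [|[k|] L IH]; intros H; simpl.
 - constructor.
 - apply lt_letters_cons. split; [apply H; simpl; auto|apply IH; intros; apply H; simpl; auto].
 - apply IH; intros; apply H; simpl; auto.
Qed.

Lemma fold_pdir_split (f : R -> (nat -> R) -> C) ds g t :
 fold_right pdir f (map Some ds ++ repeat None g) t = fold_right pdx (Nat.iter g pdt f t) ds.
Proof.
 rewrite fold_right_app. replace (fold_right pdir f (repeat None g)) with (Nat.iter g pdt f) by (induction g as [|g IH]; simpl; [|triv]; reflexivity).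
 induction ds as [|k ds IH]; [pos|]. simpl. triv.
Qed.

Lemma split_parts ds g : space_part (map Some ds ++ repeat None g) = ds /\ time_order (map Some ds ++ repeat None g) = g.
Proof.
 induction ds as [|k ds IH]; simpl.
 - induction g as [|g IH]; simpl; [auto|]. destruct IH as [-> ->]. auto.
 - destruct IH as [-> ->]. auto.
Qed.

Lemma syn_gs eps : 0 < eps -> exists K1 C1, 0 <= K1 /\ 1 <= C1 /\ forall K cs a b x, dec eps K cs ->
 Rabs (xpow n a x) * Rabs (syn cs (dlist n b) x) <= K * K1 * C1 ^ (sumN n a + sumN n b) * Rpower (mfact n a * mfact n b) mu.
Proof.
 intros He. destruct (ph_sup (eps / 2) ltac:(lra)) as (K1 & C1 & HK1 & HC1 & H).
 note (exp_xk_summable n mu (eps / 2) Hn mu_pos ltac:(lra)) as HE.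
 set (E := Series (fun k => exp (- (eps / 2) * xx k))) in *. set (B := 2 * 2 ^ n).
 assert (HB : 1 <= B) by (unfold B; note (pow_R1_Rle 2 n ltac:(lra)); lra).
 assert (HR : 1 <= Rpower B mu) by (apply Rpower_ge_1; lra).
 exists (K1 * Rabs E), (C1 * Rpower B mu). split; [pos|]. split; [nra|].
 intros K cs a b x Hc. note (dec_pos _ _ _ Hc) as HK. set (N := (sumN n a + sumN n b)%nat).
 rewrite <- Rabs_mult. unfold syn. rewrite <- Series_scal_l.
 assert (HF : Rpower (INR (fact N)) mu <= Rpower B mu ^ N * Rpower (mfact n a * mfact n b) mu).
 { note (mfact_pos n a). note (mfact_pos n b).
  rewrite <- Rpower_pow_l, Rpower_mult_distr by (first [lra|apply pow_lt; lra|apply Rmult_lt_0_compat; assumption]).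
  apply Rpower_le_l; [lra|pos|]. unfold N, B.
  bound fact_add_le. rewrite !Rmult_assoc, Rpow_mult_distr, Rmult_assoc.
  scale_l.
  eapply Rle_trans; [apply Rmult_le_compat; [pos|pos|apply fact_sumN_le|apply fact_sumN_le]|].
  rewrite pow_add. lra. }
 set (Z := K * K1 * C1 ^ N * Rpower (INR (fact N)) mu).
 assert (HZ : 0 <= Z) by (repeat apply Rmult_le_pos; try assumption; [pos|pos]).
 via (Series (fun k => Z * exp (- (eps / 2) * xx k))).
 - apply series_abs_le; [apply ex_series_Rscal; exact HE|].
  intros k. rewrite <- Rmult_assoc, (Rmult_comm _ (cs k)), Rmult_assoc, <- (Yw_mono n 0 b a), Rabs_mult.
  destruct (mono_word_spec n (0, b, a)) as [Hl1 Hl2]. change (mono_deg n (0, b, a)) with (sumN n b + sumN n a)%nat in Hl2.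
  specialize (H k _ x Hl1). rewrite Hl2, Nat.add_comm in H. fold N in H.
  eapply Rle_trans; [apply Rmult_le_compat; [pos|pos|apply Hc|exact H]|].
  right. unfold Z. replace (- eps * xx k) with (- (eps / 2) * xx k + - (eps / 2 * xx k)) by field.
  rewrite exp_plus, exp_Ropp. field. note (exp_pos (eps / 2 * xx k)). lra.
 - rewrite Series_scal_l. via (Z * Rabs E); [scale_l; apply Rle_abs|].
  unfold Z. rewrite Rpow_mult_distr.
  via (K * K1 * C1 ^ N * (Rpower B mu ^ N * Rpower (mfact n a * mfact n b) mu) * Rabs E); [|lra].
  mono.
Qed.

Section Synthesis.
Variables (s eps K C : R) (F1 F2 : nat -> nat -> R -> R) (c1 c2 : nat -> R -> R).
Hypothesis (Hs : 1 < s) (He : 0 < eps) (HC : 1 <= C) (HF1 : coef_family s eps K C F1 c1) (HF2 : coef_family s eps K C F2 c2).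

Definition synu : R -> (nat -> R) -> Complex.C := fun t x => (syn (fun k => F1 O k t) [] x, syn (fun k => F2 O k t) [] x).

(** Smoothness concerns mixed derivatives in every order. For the series they reduce to the time
    order and the list of space derivatives, because the two kinds act on different factors of each
    term. *)
Lemma fold_pdir_synu L : lt_letters n (space_part L) ->
 fold_right pdir synu L = fun t x => (syn (fun k => F1 (time_order L) k t) (space_part L) x, syn (fun k => F2 (time_order L) k t) (space_part L) x).
Proof.
 induction L as [|[k|] L IH]; intros HL; [pos| |].
 - apply lt_letters_cons in HL. destruct HL as [Hk HL]. simpl. rewrite IH by exact HL.
  fext t. fext x.
  apply injective_projections; simpl; apply is_derive_unique; eapply syn_isD; eauto; [apply HF1|apply HF2].
 - simpl in *. rewrite IH by exact HL.
  fext t. fext x.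
  apply injective_projections; simpl; apply is_derive_unique;
   [apply (syn_t F1 eps (fun g => K * C ^ g * Rpower (INR (fact g)) s) _ _ t x He HL)|apply (syn_t F2 eps (fun g => K * C ^ g * Rpower (INR (fact g)) s) _ _ t x He HL)]; first [apply HF1|apply HF2].
Qed.

Lemma synu_smooth : smooth_tx n synu.
Proof.
 intros ds d t x Hds Hx. rewrite fold_pdir_synu by (apply space_part_lt, Hds). note (space_part_lt ds Hds) as Hl.
 destruct d as [k|]; [intros Hk|]; split; simpl; eexists.
 - eapply syn_isD; eauto. apply HF1.
 - eapply syn_isD; eauto. apply HF2.
 - apply (syn_t F1 eps (fun g => K * C ^ g * Rpower (INR (fact g)) s) _ _ t x He Hl); apply HF1.
 - apply (syn_t F2 eps (fun g => K * C ^ g * Rpower (INR (fact g)) s) _ _ t x He Hl); apply HF2.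
Qed.

Lemma synu_F_mu : F_mu n mu synu.
Proof.
 exists s. split; [lra|]. split; [|split; [exact synu_smooth|]].
 - intros t x _. unfold synu. f_equal; f_equal; fext k.
  + rewrite !(proj1 HF1). apply HF1.
  + rewrite !(proj1 HF2). apply HF2.
 - destruct (syn_gs eps He) as (K1 & C1 & HK1 & HC1 & H). exists (C * C1), (2 * K * K1). split; [nra|].
  intros a b g t x Hx. rewrite dxa_fold, <- fold_pdir_split.
  destruct (split_parts (dlist n b) g) as [E1 E2]. rewrite fold_pdir_synu by (rewrite E1; apply dlist_lt). rewrite E1, E2.
  note (H _ _ a b x (proj2 (proj2 (proj2 HF1)) g t)) as B1. note (H _ _ a b x (proj2 (proj2 (proj2 HF2)) g t)) as B2.
  eapply Rle_trans; [scale_l; apply Cmod_le_sum|]. rewrite Rmult_plus_distr_l.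
  eapply Rle_trans; [apply Rplus_le_compat; [exact B1|exact B2]|].
  set (N := (sumN n a + sumN n b)%nat). rewrite Rpow_mult_distr, !pow_add.
  set (R1 := Rpower (INR (fact g)) s). set (R2 := Rpower (mfact n a * mfact n b) mu).
  assert (HK : 0 <= K).
  { note (dec_pos _ _ _ (proj2 (proj2 (proj2 HF1)) O 0)) as HK. simpl in HK.
   note (Rpower_pos 1 s). nra. }
  assert (0 < R1) by apply Rpower_pos. assert (0 < R2) by apply Rpower_pos.
  assert (P1 : 1 <= C ^ N) by (apply pow_R1_Rle; lra). assert (P2 : 1 <= C1 ^ g) by (apply pow_R1_Rle; lra).
  assert (P3 : 1 <= C ^ N * C1 ^ g) by nra.
  assert (Q : 0 <= K * K1 * C ^ g * C1 ^ N * R1 * R2).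
  { pos. }
  nra.
Qed.

Lemma fcoef_synu k t : fcoef n phi synu k t = (c1 k t, c2 k t).
Proof.
 unfold fcoef, synu. cbn [fst snd]. f_equal.
 - rewrite <- (proj1 HF1), <- (cf_syn eps _ (fun k => F1 O k t) k He (proj2 (proj2 (proj2 HF1)) O t)).
  apply intRn_ext. intros x Hx. unfold ph. rewrite nproj_id by exact Hx. reflexivity.
 - rewrite <- (proj1 HF2), <- (cf_syn eps _ (fun k => F2 O k t) k He (proj2 (proj2 (proj2 HF2)) O t)).
  apply intRn_ext. intros x Hx. unfold ph. rewrite nproj_id by exact Hx. lra.
Qed.
End Synthesis.

Lemma gs_bound_sup K C f : gs_bound n mu K C f -> forall x, Rabs (f x) <= K.
Proof.
 intros H x. specialize (H (fun _ => O) (fun _ => O) x). unfold mfact, xpow in H.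
 assert (E : forall j, sumN j (fun _ => O) = O /\ prodR j (fun k => x k ^ 0) = 1 /\ prodR j (fun _ => INR (fact 0)) = 1 /\ dlist j (fun _ => O) = []).
 { induction j as [|j (E1 & E2 & E3 & E4)]; simpl in *; [auto|]. triv. }
 destruct (E n) as (E1 & E2 & E3 & E4). rewrite E1, E2, E3, E4 in H. simpl in H. rewrite Rabs_R1, !Rmult_1_r, Rmult_1_l in H.
 unfold Rpower in H. rewrite ln_1, Rmult_0_r, exp_0 in H. lra.
Qed.

Lemma cf_derive (U U1 : R -> (nat -> R) -> R) B k t : 0 <= B -> (forall t, SR n (U t)) -> (forall t, SR n (U1 t)) ->
 (forall t x, is_derive (fun s => U s x) t (U1 t x)) -> (forall s t x, Rabs (U1 s x - U1 t x) <= B * Rabs (s - t)) ->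
 is_derive (fun s => cf (U s) k) t (cf (U1 t) k).
Proof.
 intros HB S0 S1 D L. destruct (proj2 (ph_SR k) [] 1%nat ltac:(constructor)) as [P HP]. simpl in HP.
 apply is_derive_quadratic with (C := PI ^ n * (B * P)). intros s.
 set (h := fun x => U s x + (-1 * U t x + - (s - t) * U1 t x)).
 assert (Hh : SR n h) by (apply (SR_plus n (U s)); [auto|apply (SR_plus n (fun x => -1 * U t x)); apply SR_scal; auto]).
 replace (cf (U s) k - cf (U t) k - (s - t) * cf (U1 t) k) with (cf h k).
 - destruct (En_mult n h _ Hh (ph_SR k)) as [KE HE].
  replace (PI ^ n * (B * P) * (s - t) ^ 2) with (PI ^ n * (B * P * (s - t) ^ 2)) by ring.
  apply (intRn_abs_le n KE); [pos|]. intros x. rewrite Rabs_mult.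
  replace (B * P * (s - t) ^ 2 * iw n x) with ((B * (s - t) ^ 2) * (P * iw n x)) by ring.
  specialize (HP x). apply Rmult_le_compat; [pos|pos| |lra].
  unfold h. replace (U s x + (-1 * U t x + - (s - t) * U1 t x)) with (U s x - U t x - (s - t) * U1 t x) by ring.
  apply (quadratic_remainder (fun r => U r x) (fun r => U1 r x)); auto.
 - unfold h. rewrite (cf_plus (U s)), (cf_plus (fun x => -1 * U t x)), !cf_scal; auto using SR_scal; [ring|].
  apply (SR_plus n (fun x => -1 * U t x)); apply SR_scal; auto.
Qed.

Definition comp (sel : C -> R) (f : R -> (nat -> R) -> C) (g : nat) (t : R) : (nat -> R) -> R :=
 fun x => sel (Nat.iter g pdt f t (nproj n x)).

Lemma GS_comp sigma f : GS n sigma mu f -> exists K C, 0 <= K /\ 1 <= C /\ forall sel, sel = fst \/ sel = snd -> forall g t,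
 SR n (comp sel f g t) /\ (forall x, is_derive (fun s => comp sel f g s x) t (comp sel f (S g) t x)) /\
 gs_bound n mu (K * C ^ g * Rpower (INR (fact g)) sigma) C (comp sel f g t).
Proof.
 intros (_ & Hsm & C0 & K0 & HC0 & HB). exists (Rabs K0), (Rmax 1 C0). split; [pos|]. split; [apply Rmax_l|].
 intros sel Hsel g t.
 assert (Hsch : Schwartz n (Nat.iter g pdt f t)).
 { split.
  - intros ds k x Hds Hk Hx. note (Hsm (map Some ds ++ repeat None g) (Some k) t x) as H.
   rewrite fold_pdir_split in H. apply H; [|pos|pos].
   intros j Hj. apply in_app_or in Hj. destruct Hj as [Hj|Hj].
   + apply in_map_iff in Hj. destruct Hj as (i & E1 & Hi). injection E1 as <-. auto.
   + apply repeat_spec in Hj. discriminate.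
  - triv. }
 destruct (Schwartz_SR n _ Hsch) as [S1 S2]. split; [|split].
 - destruct Hsel as [-> | ->]; assumption.
 - intros x. note (Hsm (map Some [] ++ repeat None g) None t (nproj n x)) as H. simpl in H.
  replace (fold_right pdir f (repeat None g)) with (Nat.iter g pdt f) in H by (clear; induction g as [|g IH]; simpl; [|triv]; reflexivity).
  destruct H as [H1 H2]; [|apply nproj_in_Rn|].
  + intros k Hk. apply repeat_spec in Hk. discriminate.
  + destruct Hsel as [-> | ->]; unfold comp; simpl; unfold pdt; simpl; apply Derive_correct; assumption.
 - intros a b x. note (HB a b g t (nproj n x) (nproj_in_Rn n x)) as H.
  rewrite (xpow_ext n a (nproj n x) x) in H by (intros; apply nproj_at; assumption).
  assert (Hpi : proj_inv n (comp sel f g t)) by (destruct Hsel as [-> | ->]; [apply S1|apply S2]).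
  rewrite (Dl_proj_inv n (comp sel f g t) (dlist n b) Hpi (dlist_lt n b)).
  assert (E : Rabs (Dl (dlist n b) (comp sel f g t) (nproj n x)) <= Cmod (dxa n b (Nat.iter g pdt f t) (nproj n x))).
  { rewrite dxa_fold, (Dl_components n _ _ (dlist_lt n b) _ (nproj_in_Rn n x)).
   destruct Hsel as [-> | ->]; [apply (fst_le_Cmod (_, _))|apply (snd_le_Cmod (_, _))]. }
  eapply Rle_trans; [scale_l; exact E|]. eapply Rle_trans; [exact H|].
  scale_r.
  replace (Rabs K0 * Rmax 1 C0 ^ g * Rpower (INR (fact g)) sigma * Rmax 1 C0 ^ (sumN n a + sumN n b))
   with (Rabs K0 * Rmax 1 C0 ^ (sumN n a + sumN n b + g) * Rpower (INR (fact g)) sigma) by (rewrite !pow_add; ring).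
  scale_r.
  note (pow_le C0 (sumN n a + sumN n b + g) ltac:(lra)). note (Rle_abs K0). note (Rabs_pos K0).
  note (pow_incr C0 (Rmax 1 C0) (sumN n a + sumN n b + g) (conj (Rlt_le _ _ HC0) (Rmax_r 1 C0))). nra.
Qed.

Lemma fcoef_comp f k t : fst (fcoef n phi f k t) = cf (comp fst f O t) k /\ snd (fcoef n phi f k t) = cf (comp snd f O t) k.
Proof.
 split; apply intRn_ext; intros x Hx; unfold comp, ph; simpl; rewrite nproj_id by exact Hx; reflexivity.
Qed.

Lemma comp_derive sigma f : GS n sigma mu f -> forall sel, sel = fst \/ sel = snd -> forall g k t,
 is_derive (fun s => cf (comp sel f g s) k) t (cf (comp sel f (S g) t) k).
Proof.
 intros Hf sel Hsel g k t. destruct (GS_comp sigma f Hf) as (K & C & HK & HC & H). specialize (H sel Hsel).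
 set (B := K * C ^ S (S g) * Rpower (INR (fact (S (S g)))) sigma).
 apply (cf_derive (comp sel f g) (comp sel f (S g)) B).
 - apply Rmult_le_pos; [pos|pos].
 - apply H.
 - apply H.
 - apply H.
 - intros r r' x. apply (lipschitz_of_derivative (fun q => comp sel f (S g) q x) (fun q => comp sel f (S (S g)) q x)).
  + intros q. apply H.
  + intros q. apply (gs_bound_sup _ C). apply H.
Qed.

Lemma fcoef_class f : F_mu n mu f -> coef_class (fun k t => fst (fcoef n phi f k t)) (fun k t => snd (fcoef n phi f k t)).
Proof.
 intros [sigma [Hs Hf]]. destruct (GS_comp sigma f Hf) as (K & C & HK & HC & H).
 destruct (coef_decay C HC) as (eps & K2 & He & HK2 & Hdec).
 assert (HG : forall sel, sel = fst \/ sel = snd ->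
  coef_family sigma eps (K * K2) C (fun g k t => cf (comp sel f g t) k) (fun k t => cf (comp sel f O t) k)).
 { intros sel Hsel. split; [pos|]. split; [|split].
  - intros k t. f_equal. fext x. unfold comp. f_equal. apply (proj1 Hf), nproj_in_Rn.
  - apply (comp_derive sigma); assumption.
  - intros g t k. destruct (H sel Hsel g t) as (H1 & _ & H3). eapply Rle_trans; [apply (Hdec k _ (K * C ^ g * Rpower (INR (fact g)) sigma) H1); [|pos]|].
   + apply Rmult_le_pos; [pos|pos].
   + lra. }
 exists sigma, eps, (K * K2), C, (fun g k t => cf (comp fst f g t) k), (fun g k t => cf (comp snd f g t) k).
 split; [lra|]. split; [lra|]. split; [lra|]. split.
 - destruct (HG fst (or_introl eq_refl)) as (_ & P & D & B). split; [intros; symmetry; apply fcoef_comp|].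
  split; [|pos]. intros k t. rewrite !(proj1 (fcoef_comp f k _)). apply P.
 - destruct (HG snd (or_intror eq_refl)) as (_ & P & D & B). split; [intros; symmetry; apply fcoef_comp|].
  split; [|pos]. intros k t. rewrite !(proj2 (fcoef_comp f k _)). apply P.
Qed.

Lemma Lop_components a b u t x : in_Rn n x ->
 Lop n Pl a b u t x =
  (comp snd u 1 t x + (a t * PR n Pl (comp fst u 0 t) x + - b t * PR n Pl (comp snd u 0 t) x),
   -1 * comp fst u 1 t x + (a t * PR n Pl (comp snd u 0 t) x + b t * PR n Pl (comp fst u 0 t) x)).
Proof.
 intros Hx. unfold Lop. rewrite (applyP_components n Pl (u t) x Hx). unfold comp. rewrite (nproj_id n x Hx).
 apply injective_projections; simpl; ring.
Qed.

(** Equality of functions is tested on coefficients ([cf_unique]), where the symmetry of [P]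
    replaces it by [lam k]. *)
Lemma Lop_iff_ode a b u f : F_mu n mu u -> F_mu n mu f ->
 ((forall t x, in_Rn n x -> Lop n Pl a b u t x = f t x) <->
  forall k, coef_ode a b (lam k) (fun t => fst (fcoef n phi f k t)) (fun t => snd (fcoef n phi f k t))
   (fun t => fst (fcoef n phi u k t)) (fun t => snd (fcoef n phi u k t))).
Proof.
 intros (su & _ & Hu) (sf & _ & Hf).
 destruct (GS_comp su u Hu) as (Ku & Cu & _ & _ & HU). destruct (GS_comp sf f Hf) as (Kf & Cf & _ & _ & HF).
 note (fun g t => proj1 (HU fst (or_introl eq_refl) g t)) as U1.
 note (fun g t => proj1 (HU snd (or_intror eq_refl) g t)) as U2.
 set (L1 := fun t x => comp snd u 1 t x + (a t * PR n Pl (comp fst u 0 t) x + - b t * PR n Pl (comp snd u 0 t) x)).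
 set (L2 := fun t x => -1 * comp fst u 1 t x + (a t * PR n Pl (comp snd u 0 t) x + b t * PR n Pl (comp fst u 0 t) x)).
 assert (SP : forall c d g h, SR n g -> SR n h -> SR n (fun x => c * PR n Pl g x + d * PR n Pl h x)).
 { intros c d g h Hg Hh. apply (SR_plus n (fun x => c * PR n Pl g x)); apply SR_scal, SR_PR; assumption. }
 assert (S1 : forall t, SR n (L1 t)) by (intros t; apply (SR_plus n (comp snd u 1 t)); auto).
 assert (S2 : forall t, SR n (L2 t)) by (intros t; apply (SR_plus n (fun x => -1 * comp fst u 1 t x)); auto using SR_scal).
 assert (CP : forall c d g h k, SR n g -> SR n h -> cf (fun x => c * PR n Pl g x + d * PR n Pl h x) k = lam k * (c * cf g k + d * cf h k)).
 { intros c d g h k Hg Hh. rewrite (cf_plus (fun x => c * PR n Pl g x)), !cf_scal, !cf_PR; auto using SR_scal, SR_PR. ring. }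
 assert (C1 : forall t k, cf (L1 t) k = cf (comp snd u 1 t) k + lam k * (a t * cf (comp fst u 0 t) k + - b t * cf (comp snd u 0 t) k)).
 { intros t k. unfold L1. rewrite (cf_plus (comp snd u 1 t)), CP; auto. }
 assert (C2 : forall t k, cf (L2 t) k = - cf (comp fst u 1 t) k + lam k * (a t * cf (comp snd u 0 t) k + b t * cf (comp fst u 0 t) k)).
 { intros t k. unfold L2. rewrite (cf_plus (fun x => -1 * comp fst u 1 t x)), CP, cf_scal; auto using SR_scal. ring. }
 assert (D : forall k t, is_derive (fun s => fst (fcoef n phi u k s)) t (cf (comp fst u 1 t) k) /\
             is_derive (fun s => snd (fcoef n phi u k s)) t (cf (comp snd u 1 t) k)).
 { split.
  - apply (is_derive_ext (fun s => cf (comp fst u 0 s) k)); [intros; symmetry; apply fcoef_comp|].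
   apply (comp_derive su); auto.
  - apply (is_derive_ext (fun s => cf (comp snd u 0 s) k)); [intros; symmetry; apply fcoef_comp|].
   apply (comp_derive su); auto. }
 split.
 - intros HL k t. rewrite !(proj1 (fcoef_comp u k t)), !(proj2 (fcoef_comp u k t)), (proj1 (fcoef_comp f k t)), (proj2 (fcoef_comp f k t)).
  assert (E1 : comp fst f 0 t = L1 t).
  { fext x. rewrite (proj1 (proj1 (S1 t))). unfold comp at 1. simpl.
   rewrite <- (HL t (nproj n x) (nproj_in_Rn n x)), Lop_components by apply nproj_in_Rn. pos. }
  assert (E2 : comp snd f 0 t = L2 t).
  { fext x. rewrite (proj1 (proj1 (S2 t))). unfold comp at 1. simpl.
   rewrite <- (HL t (nproj n x) (nproj_in_Rn n x)), Lop_components by apply nproj_in_Rn. pos. }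
  rewrite E1, E2, C1, C2. destruct (D k t) as [D1 D2]. split.
  + match goal with |- is_derive _ _ ?r => replace r with (cf (comp fst u 1 t) k) by ring end. exact D1.
  + match goal with |- is_derive _ _ ?r => replace r with (cf (comp snd u 1 t) k) by ring end. exact D2.
 - intros HO t x Hx.
  assert (UD : forall (h : R -> R) s l l', is_derive h s l -> is_derive h s l' -> l = l')
   by (intros h s l l' H H'; rewrite <- (is_derive_unique _ _ _ H); exact (is_derive_unique _ _ _ H')).
  assert (E : L1 t = comp fst f 0 t /\ L2 t = comp snd f 0 t).
  { split; apply cf_unique; try apply HF; auto; intros k; destruct (HO k t) as [O1 O2]; destruct (D k t) as [D1 D2];
    rewrite ?C1, ?C2; rewrite <- ?(proj1 (fcoef_comp u k t)), <- ?(proj2 (fcoef_comp u k t)), <- ?(proj1 (fcoef_comp f k t)), <- ?(proj2 (fcoef_comp f k t)).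
   - rewrite (UD _ _ _ _ D2 O2). ring.
   - rewrite (UD _ _ _ _ D1 O1). ring. }
  rewrite Lop_components by exact Hx. apply injective_projections; simpl.
  + change (L1 t x = fst (f t x)). rewrite (proj1 E). unfold comp. rewrite nproj_id by exact Hx. reflexivity.
  + change (L2 t x = snd (f t x)). rewrite (proj2 E). unfold comp. simpl. rewrite nproj_id by exact Hx. lra.
Qed.

Theorem solvable_iff_coefficients a b : globally_solvable n Pl mu a b lam phi <->
 forall f1 f2, coef_class f1 f2 -> (forall k, Zset a b lam k -> orthogonality a b (lam k) (f1 k) (f2 k)) ->
 exists u1 u2, coef_class u1 u2 /\ forall k, coef_ode a b (lam k) (f1 k) (f2 k) (u1 k) (u2 k).
Proof.
 split.
 - intros H f1 f2 (s & eps & K & C & F1 & F2 & Hs & He & HC & HF1 & HF2) Horth.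
  assert (E : forall k t, fcoef n phi (synu F1 F2) k t = (f1 k t, f2 k t)) by (intros; apply (fcoef_synu s eps K C); assumption).
  assert (Hf : F_mu n mu (synu F1 F2)) by (apply (synu_F_mu s eps K C F1 F2 f1 f2); assumption).
  destruct (H (synu F1 F2)) as (u & Hu & HL).
  { split; [pos|]. intros k Hk. rewrite <- (Horth k Hk). apply RInt_ext. triv. }
  exists (fun k t => fst (fcoef n phi u k t)), (fun k t => snd (fcoef n phi u k t)). split; [apply fcoef_class, Hu|].
  intros k t. note (proj1 (Lop_iff_ode a b u _ Hu Hf) HL k t) as HO. cbv beta in HO. rewrite E in HO. exact HO.
 - intros H f [Hf Hadm].
  destruct (H _ _ (fcoef_class f Hf)) as (u1 & u2 & (s & eps & K & C & F1 & F2 & Hs & He & HC & HF1 & HF2) & HO).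
  { pos. }
  assert (Hu : F_mu n mu (synu F1 F2)) by (apply (synu_F_mu s eps K C F1 F2 u1 u2); assumption).
  exists (synu F1 F2). split; [pos|]. apply (Lop_iff_ode a b _ f Hu Hf). intros k t.
  assert (E : forall t, fcoef n phi (synu F1 F2) k t = (u1 k t, u2 k t)) by (intros; apply (fcoef_synu s eps K C); assumption).
  rewrite !E. destruct (HO k t) as [O1 O2]. split.
  + apply (is_derive_ext (u1 k)); [intros; rewrite E; reflexivity|pos].
  + apply (is_derive_ext (u2 k)); [intros; rewrite E; reflexivity|pos].
Qed.

(** * Gevrey regularity of periodic coefficients *)

Definition taylor (f : R -> R) (j : nat) (t : R) : R := / INR (fact j) * Derive_n f j t.

Lemma gevrey_taylor f : Gevrey_T f -> exists s C K, 0 <= s /\ 1 <= C /\ 0 <= K /\ taylor_family (taylor f) /\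
 forall j t, Rabs (taylor f j t) <= K * C ^ j * gw s j.
Proof.
 intros (_ & Hd & s & Hs & Cc & K & HB). exists (s - 1), (Rmax 1 (Rabs Cc)), K.
 assert (HK : 0 <= K).
 { specialize (HB O 0). simpl in HB. note (Rabs_pos (f 0)). note (Rpower_pos 1 s).
  nra. }
 split; [lra|]. split; [apply Rmax_l|]. split; [lra|]. split.
 - intros j t. unfold taylor. replace (INR (S j) * (/ INR (fact (S j)) * Derive_n f (S j) t)) with (/ INR (fact j) * Derive_n f (S j) t).
  + apply is_derive_scal. apply Derive_correct, Hd.
  + rewrite fact_simpl, mult_INR. field. split; [apply INR_fact_neq_0|apply not_0_INR; lia].
 - intros j t. note (INR_fact_lt_0 j) as Hf. unfold taylor. rewrite Rabs_mult, Rabs_pos_eq by pos.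
  apply Rmult_le_reg_l with (INR (fact j)); [lra|]. rewrite <- Rmult_assoc, Rinv_r, Rmult_1_l by lra.
  bound HB. unfold gw. replace (Rpower (INR (fact j)) s) with (INR (fact j) * Rpower (INR (fact j)) (s - 1)).
  2:{ rewrite <- (Rpower_1 (INR (fact j)) Hf) at 1. rewrite <- Rpower_plus. f_equal. ring. }
  replace (INR (fact j) * (K * Rmax 1 (Rabs Cc) ^ j * Rpower (INR (fact j)) (s - 1)))
   with (K * Rmax 1 (Rabs Cc) ^ j * (INR (fact j) * Rpower (INR (fact j)) (s - 1))) by ring.
  scale_r. scale_l.
  bound Rle_abs. rewrite <- RPow_abs. apply pow_incr. split; [pos|apply Rmax_r].
Qed.

Lemma coef_family_taylor s eps K C F c k : coef_family s eps K C F c ->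
 taylor_family (fun j t => / INR (fact j) * F j k t) /\
 forall j t, Rabs (/ INR (fact j) * F j k t) <= K * exp (- eps * xx k) * C ^ j * gw (s - 1) j.
Proof.
 intros (_ & _ & HD & HB). split.
 - intros j t. replace (INR (S j) * (/ INR (fact (S j)) * F (S j) k t)) with (/ INR (fact j) * F (S j) k t).
  + apply is_derive_scal, HD.
  + rewrite fact_simpl, mult_INR. field. split; [apply INR_fact_neq_0|apply not_0_INR; lia].
 - intros j t. note (INR_fact_lt_0 j) as Hf. rewrite Rabs_mult, Rabs_pos_eq by pos.
  apply Rmult_le_reg_l with (INR (fact j)); [lra|]. rewrite <- Rmult_assoc, Rinv_r, Rmult_1_l by lra.
  bound (HB j t k). right. unfold gw.
  replace (Rpower (INR (fact j)) s) with (INR (fact j) * Rpower (INR (fact j)) (s - 1)).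
  2:{ rewrite <- (Rpower_1 (INR (fact j)) Hf) at 1. rewrite <- Rpower_plus. f_equal. ring. }
  ring.
Qed.

Lemma coef_family_K s eps K C F c : coef_family s eps K C F c -> 0 <= K.
Proof.
 intros (_ & _ & _ & HB). note (dec_pos _ _ _ (HB O 0)) as HK. simpl in HK.
 note (Rpower_pos 1 s). nra.
Qed.

Lemma exp_decay_mono e e' k : e' <= e -> exp (- e * xx k) <= exp (- e' * xx k).
Proof.
 note (xx_ge_1 k). destruct (Req_dec e e') as [->|Hne]; [lra|].
 left. apply exp_increasing. nra.
Qed.

Lemma taylor_bound_mono K K' C C' s s' j x : 0 <= K <= K' -> 1 <= C <= C' -> s <= s' ->
 x <= K * C ^ j * gw s j -> x <= K' * C' ^ j * gw s' j.
Proof.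
 intros [HK HK'] [HC HC'] Hs H. eapply Rle_trans; [exact H|]. apply Rmult_le_compat.
 - apply Rmult_le_pos; [lra|pos].
 - left; apply Rpower_pos.
 - apply Rmult_le_compat; [lra|pos|lra|mono].
 - apply gw_le, Hs.
Qed.

(** A sup bound with decay is enough: each time derivative costs a factor [1 + |lam k|], at most of
    order [xx k] to the power [m mu], and [power_absorb] converts its [j]-th power into [j!^(m mu)]
    and half of the decay. The shift [psi] lets the same statement cover the test waves. *)
Lemma class_of_ode a b psi f1 f2 u1 u2 eps K : Gevrey_T a -> Gevrey_T b -> (forall k, Rabs (psi k) <= 1) -> coef_class f1 f2 ->
 0 < eps -> (forall k t, u1 k (t + 2 * PI) = u1 k t) -> (forall k t, u2 k (t + 2 * PI) = u2 k t) ->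
 (forall t, dec eps K (fun k => u1 k t)) -> (forall t, dec eps K (fun k => u2 k t)) ->
 (forall k t, is_derive (u1 k) t (- f2 k t + lam k * b t * u1 k t + (lam k * a t - psi k) * u2 k t) /\
        is_derive (u2 k) t (f1 k t + lam k * b t * u2 k t - (lam k * a t - psi k) * u1 k t)) ->
 coef_class u1 u2.
Proof.
 intros Ha Hb Hpsi (sf & ef & Kf & Cf & G1 & G2 & Hsf & Hef & HCf & HG1 & HG2) He P1 P2 B1 B2 HD.
 destruct (gevrey_taylor a Ha) as (sa & Ca & Ka & Hsa & HCa & HKa & Ta & HBa).
 destruct (gevrey_taylor b Hb) as (sb & Cb & Kb & Hsb & HCb & HKb & Tb & HBb).
 note (coef_family_K _ _ _ _ _ _ HG1) as HKf. note (dec_pos _ _ _ (B1 0)) as HK.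
 set (s0 := Rmax sa (Rmax sb (sf - 1))). set (C0 := Rmax Ca (Rmax Cb Cf)). set (e0 := Rmin ef eps). set (h := Ka + Kb + 1).
 assert (Hs3 : sa <= s0 /\ sb <= s0 /\ sf - 1 <= s0) by (split; [apply Rmax_l|split; (bound_by Rmax_r); [apply Rmax_l|apply Rmax_r]]).
 assert (HC3 : Ca <= C0 /\ Cb <= C0 /\ Cf <= C0) by (split; [apply Rmax_l|split; (bound_by Rmax_r); [apply Rmax_l|apply Rmax_r]]).
 assert (He0 : 0 < e0) by (apply Rmin_pos; assumption).
 assert (He1 : e0 <= ef) by apply Rmin_l. assert (He2 : e0 <= eps) by apply Rmin_r.
 set (A := 2 * C0 + 4 * h + 1). assert (HA : 1 <= A) by (unfold A, h; lra).
 assert (Hmm : 0 < INR m * mu) by (apply Rmult_lt_0_compat; [apply lt_0_INR; lia|lra]).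
 destruct lam_upper as (C1 & HC1 & HlamC). destruct (power_absorb (INR m * mu) (e0 / 2) Hmm ltac:(lra)) as (C2 & HC2 & Habs).
 assert (key : forall k j t, ex_derive (Derive_n (u1 k) j) t /\ ex_derive (Derive_n (u2 k) j) t /\
  Rabs (Derive_n (u1 k) j t) <= (Kf + K) * exp (- e0 * xx k) * ((1 + Rabs (lam k)) * A) ^ j * gw (s0 + 1) j /\
  Rabs (Derive_n (u2 k) j t) <= (Kf + K) * exp (- e0 * xx k) * ((1 + Rabs (lam k)) * A) ^ j * gw (s0 + 1) j).
 { intros k. note (Rabs_pos (lam k)) as Hl. specialize (Hpsi k).
  destruct (coef_family_taylor _ _ _ _ _ _ k HG1) as [TG1 BG1]. destruct (coef_family_taylor _ _ _ _ _ _ k HG2) as [TG2 BG2].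
  note (exp_pos (- e0 * xx k)) as Hx0. note (exp_decay_mono ef e0 k He1) as Hx1. note (exp_decay_mono eps e0 k He2) as Hx2.
  note (exp_pos (- ef * xx k)) as Hx3.
  assert (HKe : 0 <= Kf * exp (- ef * xx k) <= (Kf + K) * exp (- e0 * xx k)) by nra.
  (* The constant [psi k] affects only the zeroth Taylor coefficient of [lam k * a - psi k];
     [Q = 1 + |lam k|] isolates the eigenvalue. *)
  apply (system_gevrey (fun j t => - 1 * (/ INR (fact j) * G2 j k t)) (fun j t => / INR (fact j) * G1 j k t)
   (fun j t => lam k * taylor b j t) (fun j t => lam k * taylor a j t - (if Nat.eqb j 0 then psi k else 0))
   (u1 k) (u2 k)) with (s := s0) (M := (Kf + K) * exp (- e0 * xx k)) (h := h) (Q := 1 + Rabs (lam k)) (C := C0).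
  - intros j t. replace (INR (S j) * (-1 * (/ INR (fact (S j)) * G2 (S j) k t))) with (-1 * (INR (S j) * (/ INR (fact (S j)) * G2 (S j) k t))) by ring.
   apply is_derive_scal, TG2.
  - exact TG1.
  - intros j t. replace (INR (S j) * (lam k * taylor b (S j) t)) with (lam k * (INR (S j) * taylor b (S j) t)) by ring. apply is_derive_scal, Tb.
  - intros j t. replace (INR (S j) * (lam k * taylor a (S j) t - (if Nat.eqb (S j) 0 then psi k else 0))) with (lam k * (INR (S j) * taylor a (S j) t) - 0) by (simpl; ring).
   apply (is_derive_minus (fun t => lam k * taylor a j t) (fun _ => if Nat.eqb j 0 then psi k else 0)); [apply is_derive_scal, Ta|apply is_derive_cst].
  - intros t. replace (-1 * (/ INR (fact 0) * G2 0%nat k t) + lam k * taylor b 0 t * u1 k t + (lam k * taylor a 0 t - (if Nat.eqb 0 0 then psi k else 0)) * u2 k t)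
    with (- f2 k t + lam k * b t * u1 k t + (lam k * a t - psi k) * u2 k t) by (rewrite <- (proj1 HG2); unfold taylor; simpl; field). apply HD.
  - intros t. replace (/ INR (fact 0) * G1 0%nat k t + lam k * taylor b 0 t * u2 k t - (lam k * taylor a 0 t - (if Nat.eqb 0 0 then psi k else 0)) * u1 k t)
    with (f1 k t + lam k * b t * u2 k t - (lam k * a t - psi k) * u1 k t) by (rewrite <- (proj1 HG1); unfold taylor; simpl; field). apply HD.
  - lra.
  - nra.
  - unfold h; lra.
  - lra.
  - lra.
  - intros j t. rewrite Rabs_mult. assert (HX : Rabs (taylor b j t) <= h * C0 ^ j * gw s0 j).
   { apply (taylor_bound_mono Kb _ Cb _ sb); [unfold h|..]; try lra. pos. }
   via ((1 + Rabs (lam k)) * (h * C0 ^ j * gw s0 j)); [mono|lra].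
  - intros j t. assert (HX : Rabs (taylor a j t) <= Ka * C0 ^ j * gw s0 j) by (apply (taylor_bound_mono Ka _ Ca _ sa); try lra; apply HBa).
   assert (HW : 1 <= C0 ^ j * gw s0 j).
   { note (pow_R1_Rle C0 j ltac:(lra)). note (Rpower_ge_1 (INR (fact j)) s0 ltac:(lra) (fact_ge_1 j)). unfold gw. nra. }
   via (Rabs (lam k) * Rabs (taylor a j t) + 1).
   + bound Rabs_triang. rewrite Rabs_mult, Rabs_Ropp.
    destruct (Nat.eqb j 0); [lra|rewrite Rabs_R0; lra].
   + unfold h. via (Rabs (lam k) * (Ka * C0 ^ j * gw s0 j) + C0 ^ j * gw s0 j).
    * apply Rplus_le_compat; [mono|lra].
    * set (W := C0 ^ j * gw s0 j) in *. replace (Ka * C0 ^ j * gw s0 j) with (Ka * W) by (unfold W; ring).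
     replace ((Ka + Kb + 1) * (1 + Rabs (lam k)) * C0 ^ j * gw s0 j) with ((Ka + Kb + 1) * (1 + Rabs (lam k)) * W) by (unfold W; ring).
     assert (0 <= Kb * (1 + Rabs (lam k)) * W) by pos.
     assert (0 <= Ka * W) by pos. assert (0 <= Rabs (lam k) * W) by pos. nra.
  - intros j t. rewrite Rabs_mult, Rabs_m1, Rmult_1_l. apply (taylor_bound_mono (Kf * exp (- ef * xx k)) _ Cf _ (sf - 1)); try lra. apply BG2.
  - intros j t. apply (taylor_bound_mono (Kf * exp (- ef * xx k)) _ Cf _ (sf - 1)); try lra. apply BG1.
  - intros t. bound (B1 t k). apply Rmult_le_compat; lra || (left; apply exp_pos).
  - intros t. bound (B2 t k). mono. }
 assert (HQ : forall k j, (Kf + K) * exp (- e0 * xx k) * ((1 + Rabs (lam k)) * A) ^ j * gw (s0 + 1) j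
  <= (Kf + K) * ((1 + C1) * C2 * A) ^ j * Rpower (INR (fact j)) (s0 + 1 + INR m * mu) * exp (- (e0 / 2) * xx k)).
 { intros k j. note (xx_ge_1 k) as Hx1. specialize (HlamC k). specialize (Habs (xx k) j ltac:(lra)).
  assert (HR : 1 <= Rpower (xx k) (INR m * mu)) by (apply Rpower_ge_1; lra).
  assert (E : (1 + Rabs (lam k)) ^ j <= (1 + C1) ^ j * (C2 ^ j * gw (INR m * mu) j * exp (e0 / 2 * xx k))).
  { via (((1 + C1) * Rpower (xx k) (INR m * mu)) ^ j); [mono|].
   rewrite Rpow_mult_distr, <- Rpower_pow_l by lra. mono. }
  rewrite Rpower_plus. fold (gw (s0 + 1) j) (gw (INR m * mu) j).
  replace (exp (- (e0 / 2) * xx k)) with (exp (- e0 * xx k) * exp (e0 / 2 * xx k)) by (rewrite <- exp_plus; f_equal; field).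
  rewrite !Rpow_mult_distr.
  via ((Kf + K) * exp (- e0 * xx k) * A ^ j * gw (s0 + 1) j * ((1 + C1) ^ j * (C2 ^ j * gw (INR m * mu) j * exp (e0 / 2 * xx k)))); [|lra].
  replace ((Kf + K) * exp (- e0 * xx k) * ((1 + Rabs (lam k)) ^ j * A ^ j) * gw (s0 + 1) j)
   with ((Kf + K) * exp (- e0 * xx k) * A ^ j * gw (s0 + 1) j * (1 + Rabs (lam k)) ^ j) by ring.
  apply Rmult_le_compat_l; [|lra]. apply Rmult_le_pos; [|left; apply Rpower_pos].
  pos. }
 exists (s0 + 1 + INR m * mu), (e0 / 2), (Kf + K), ((1 + C1) * C2 * A), (fun g k => Derive_n (u1 k) g), (fun g k => Derive_n (u2 k) g).
 split; [lra|]. split; [lra|]. split; [assert (1 <= (1 + C1) * C2) by nra; nra|]. split.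
 - split; [pos|]. split; [pos|]. split.
  + intros g k t. apply Derive_correct. apply (key k g t).
  + intros g t k. bound (key k g t); pos.
 - split; [pos|]. split; [pos|]. split.
  + intros g k t. apply Derive_correct. apply (key k g t).
  + intros g t k. bound (key k g t); pos.
Qed.

(** * Solvability criteria *)

Lemma gevrey_continuous_periodic f : Gevrey_T f -> continuous_periodic f.
Proof. intros [Hp [Hd _]]. split; [intros s; apply derive_continuous, (Hd O s)|pos]. Qed.

Lemma xx_unbounded B : exists N, forall k, (N <= k)%nat -> B <= xx k.
Proof.
 note (ex_series_lim_0 _ (exp_xk_summable n mu 1 Hn mu_pos Rlt_0_1)) as L. apply is_lim_seq_spec in L.
 destruct (L (mkposreal _ (exp_pos (- B)))) as [N HN]. exists N. intros k Hk. specialize (HN k Hk).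
 rewrite Rminus_0_r, Rabs_pos_eq in HN by pos. apply exp_lt_inv in HN. lra.
Qed.

Lemma lam_growth : exists c N, 0 < c /\ forall k, (N <= k)%nat -> c * xx k <= Rabs (lam k).
Proof.
 destruct lam_lower as (c & N & Hc & H). exists c, N. split; [lra|]. intros k Hk.
 eapply Rle_trans; [|apply H, Hk]. scale_l. note (xx_ge_1 k) as Hx.
 rewrite <- (Rpower_1 (xx k)) at 1 by lra. apply Rle_Rpower; [lra|]. assert (2 <= INR m) by (replace 2 with (INR 2) by reflexivity; apply le_INR, Hm). nra.
Qed.

Lemma class_sup c1 c2 : coef_class c1 c2 -> exists eps K, 0 < eps /\ 0 <= K /\ (forall k, continuous_periodic (c1 k) /\ continuous_periodic (c2 k)) /\
 forall k t, Rabs (c1 k t) <= K * exp (- eps * xx k) /\ Rabs (c2 k t) <= K * exp (- eps * xx k).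
Proof.
 intros (s & eps & K & C & F1 & F2 & Hs & He & HC & H1 & H2). exists eps, K. split; [lra|]. split; [apply (coef_family_K _ _ _ _ _ _ H1)|].
 assert (G : forall F c, coef_family s eps K C F c -> (forall k, continuous_periodic (c k)) /\ forall k t, Rabs (c k t) <= K * exp (- eps * xx k)).
 { intros F c (E & P & D & B). split.
  - split; [|pos]. intros t. apply (continuous_ext (F O k)); [pos|]. eapply is_derive_continuous, D.
  - intros k t. rewrite <- E. bound (B O t k). right. simpl. unfold Rpower. rewrite ln_1, Rmult_0_r, exp_0. ring. }
 destruct (G _ _ H1) as [A1 B1]. destruct (G _ _ H2) as [A2 B2]. pos.
Qed.

Lemma coef_family_weaken s eps K C F c s' eps' K' C' : coef_family s eps K C F c -> 1 <= C -> s <= s' -> eps' <= eps -> K <= K' -> C <= C' ->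
 coef_family s' eps' K' C' F c.
Proof.
 intros H HC Hs He HK HC'. note (coef_family_K _ _ _ _ _ _ H) as HK0. destruct H as (E & P & D & B). split; [pos|]. split; [pos|]. split; [pos|].
 intros g t k. bound B. apply Rmult_le_compat; [|pos| |apply exp_le; note (xx_ge_1 k); nra].
 - apply Rmult_le_pos; [pos|pos].
 - apply (taylor_bound_mono K K' C C' s s'); try lra. easy.
Qed.

Lemma class_plus c1 c2 d1 d2 : coef_class c1 c2 -> coef_class d1 d2 -> coef_class (fun k t => c1 k t + d1 k t) (fun k t => c2 k t + d2 k t).
Proof.
 intros (s & eps & K & C & F1 & F2 & Hs & He & HC & H1 & H2) (s' & eps' & K' & C' & F1' & F2' & Hs' & He' & HC' & H1' & H2').
 exists (Rmax s s'), (Rmin eps eps'), (K + K'), (Rmax C C'), (fun g k t => F1 g k t + F1' g k t), (fun g k t => F2 g k t + F2' g k t).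
 note (Rmax_l s s'). note (Rmax_r s s'). note (Rmax_l C C'). note (Rmax_r C C'). note (Rmin_l eps eps'). note (Rmin_r eps eps').
 split; [lra|]. split; [pos|]. split; [lra|].
 assert (G : forall F c F' c', coef_family s eps K C F c -> coef_family s' eps' K' C' F' c' ->
  coef_family (Rmax s s') (Rmin eps eps') (K + K') (Rmax C C') (fun g k t => F g k t + F' g k t) (fun k t => c k t + c' k t)).
 { intros F c F' c' Q Q'. apply (coef_family_weaken _ _ _ _ _ _ (Rmax s s') (Rmin eps eps') K (Rmax C C')) in Q; try lra.
  apply (coef_family_weaken _ _ _ _ _ _ (Rmax s s') (Rmin eps eps') K' (Rmax C C')) in Q'; try lra.
  destruct Q as (E & P & D & B). destruct Q' as (E' & P' & D' & B'). split; [triv|]. split; [triv|]. split.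
  - intros g k t. apply (is_derive_plus (F g k) (F' g k)); auto.
  - intros g t k. bound Rabs_triang. eapply Rle_trans; [apply Rplus_le_compat; [apply B|apply B']|]. lra. }
 pos.
Qed.

Lemma Derive_n_zero k t : Derive_n (fun _ => 0) k t = 0.
Proof. revert t. induction k as [|k IH]; intros t; [pos|]. simpl. rewrite (Derive_ext _ (fun _ => 0)) by exact IH. apply Derive_const. Qed.

Lemma gevrey_zero : Gevrey_T (fun _ => 0).
Proof.
 split; [pos|]. split.
 - intros k t. apply (ex_derive_ext (fun _ => 0)); [intros; rewrite Derive_n_zero; reflexivity|apply (ex_derive_const (V := R_NormedModule))].
 - exists 2. split; [lra|]. exists 0, 0. intros k t. rewrite Derive_n_zero, Rabs_R0. lra.
Qed.

Lemma class_zero : coef_class (fun _ _ => 0) (fun _ _ => 0).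
Proof.
 assert (H : coef_family 2 1 0 1 (fun _ _ _ => 0) (fun _ _ => 0)).
 { split; [pos|]. split; [pos|]. split.
  - intros g k t. apply is_derive_cst.
  - intros g t k. rewrite Rabs_R0. lra. }
 exists 2, 1, 0, 1, (fun _ _ _ => 0), (fun _ _ _ => 0). repeat (split; [lra|]). pos.
Qed.

Section Coefficients.
Variables (a b : R -> R).
Hypothesis (Ga : Gevrey_T a) (Gb : Gevrey_T b).
Let Ha : continuous_periodic a := gevrey_continuous_periodic a Ga.
Let Hb : continuous_periodic b := gevrey_continuous_periodic b Gb.
Notation A2 := (prim a (2 * PI)).
Notation B2 := (prim b (2 * PI)).
Notation solvesk k := (solves a b (lam k)).
Notation waves psi th w g := (fun k => wave a (lam k) (psi k) (th k) (w k) g).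
Notation distk z k := (Cmod (Cminus (RtoC (IZR z)) (Cmult (c0 a b) (RtoC (lam k))))).
Notation solvable := (globally_solvable n Pl mu a b lam phi).

(** A wave of constant amplitude solves the homogeneous equation with [b = 0] and coefficient
    [lam k * a - psi k], so [class_of_ode] gives its regularity. The integrality condition is
    periodicity of the wave. *)
Lemma test_class psi th r eps K : (forall k, Rabs (psi k) <= 1) -> 0 < eps -> (forall k, Rabs (r k) <= K * exp (- eps * xx k)) ->
 (forall k, r k <> 0 -> exists z, lam k * A2 - 2 * PI * psi k = 2 * PI * IZR z) ->
 coef_class (waves psi th (fun k _ => r k) cos) (waves psi th (fun k _ => r k) sin).
Proof.
 intros Hpsi He Hr Hz.
 assert (Ph : forall k t, r k = 0 \/ exists z, phase a (lam k) (psi k) (th k) (t + 2 * PI) = phase a (lam k) (psi k) (th k) t + 2 * PI * IZR z).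
 { intros k t. destruct (Req_dec (r k) 0) as [|Hk]; [lra|right]. destruct (Hz k Hk) as [z Hzk]. exists (- z)%Z. unfold phase.
  rewrite (prim_shift a) by exact Ha. rewrite opp_IZR. lra. }
 assert (Dp : forall k t, is_derive (phase a (lam k) (psi k) (th k)) t (- (lam k * a t - psi k))).
 { intros k t. note (prim_derive a t (proj1 Ha)) as DA. assert (EA : Derive (fun s => prim a s) t = a t) by (apply is_derive_unique; exact DA).
  unfold phase. auto_derive; [repeat split; eexists; exact DA|nra]. }
 assert (Dc : forall k t, Derive (fun s => phase a (lam k) (psi k) (th k) s) t = - (lam k * a t - psi k)) by (intros; apply is_derive_unique, Dp).
 assert (B : forall k y, -1 <= y <= 1 -> Rabs (r k * y) <= K * exp (- eps * xx k)).
 { intros k y Hy. bound_by Hr. rewrite Rabs_mult. assert (Rabs y <= 1) by (apply Rabs_le; lra). note (Rabs_pos (r k)). nra. }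
 apply (class_of_ode a (fun _ => 0) psi (fun _ _ => 0) (fun _ _ => 0) _ _ eps K Ga gevrey_zero Hpsi class_zero He); unfold wave.
 - intros k t. destruct (Ph k t) as [-> | [z ->]]; [ring|rewrite cos_periodic_Z; reflexivity].
 - intros k t. destruct (Ph k t) as [-> | [z ->]]; [ring|rewrite sin_periodic_Z; reflexivity].
 - intros t k. apply B, COS_bound.
 - intros t k. apply B, SIN_bound.
 - split; (auto_derive; [repeat split; eexists; apply Dp|rewrite Dc; ring]).
Qed.

(** Uniform bounds are asked from index [N] on; each of the finitely many earlier solutions is
    continuous and periodic, hence bounded, and only enlarges the constant. *)
Lemma solve_from_pointwise f1 f2 eps K N : coef_class f1 f2 -> 0 < eps ->
 (forall k, exists u1 u2, solvesk k (f1 k) (f2 k) u1 u2 /\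
  ((N <= k)%nat -> forall t, Rabs (u1 t) <= K * exp (- eps * xx k) /\ Rabs (u2 t) <= K * exp (- eps * xx k))) ->
 exists u1 u2, coef_class u1 u2 /\ forall k, coef_ode a b (lam k) (f1 k) (f2 k) (u1 k) (u2 k).
Proof.
 intros Hf He H. destruct (choice _ H) as [u1 H']. destruct (choice _ H') as [u2 Hu].
 destruct (finite_bound N (fun k M => forall t, Rabs (u1 k t) <= M * exp (- eps * xx k) /\ Rabs (u2 k t) <= M * exp (- eps * xx k))) as [M [HM HMk]].
 - intros k M M' HMt HMM t. destruct (HMt t). split; (eapply Rle_trans; [eassumption|mono]).
 - intros k _. destruct (Hu k) as ((HO & P1 & P2) & _).
  destruct (periodic_bounded (u1 k)) as [M1 B1]; [split; [intros s; apply (is_derive_continuous _ _ _ (proj1 (HO s)))|triv]|].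
  destruct (periodic_bounded (u2 k)) as [M2 B2]; [split; [intros s; apply (is_derive_continuous _ _ _ (proj2 (HO s)))|triv]|].
  exists ((M1 + M2) * exp (eps * xx k)). intros t. rewrite Rmult_assoc, <- exp_plus. replace (eps * xx k + - eps * xx k) with 0 by ring. rewrite exp_0.
  specialize (B1 t). specialize (B2 t). note (Rabs_pos (u1 k t)). note (Rabs_pos (u2 k t)). lra.
 - exists u1, u2. split; [|intros k; apply Hu].
  assert (HB : forall k t, Rabs (u1 k t) <= (M + Rabs K) * exp (- eps * xx k) /\ Rabs (u2 k t) <= (M + Rabs K) * exp (- eps * xx k)).
  { intros k t. note (exp_pos (- eps * xx k)). note (Rle_abs K). note (Rabs_pos K). destruct (Nat.lt_ge_cases k N) as [Hk|Hk].
   - destruct (HMk k Hk t). nra.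
   - destruct (proj2 (Hu k) Hk t). nra. }
  apply (class_of_ode a b (fun _ => 0) f1 f2 _ _ eps (M + Rabs K) Ga Gb); auto.
  + intros _. rewrite Rabs_R0. lra.
  + apply Hu.
  + apply Hu.
  + intros t k. apply HB.
  + intros t k. apply HB.
  + intros k t. destruct (proj1 (proj1 (Hu k)) t) as [O1 O2]. split.
   * replace (- f2 k t + lam k * b t * u1 k t + (lam k * a t - 0) * u2 k t) with (lam k * (b t * u1 k t + a t * u2 k t) - f2 k t) by ring. exact O1.
   * replace (f1 k t + lam k * b t * u2 k t - (lam k * a t - 0) * u1 k t) with (lam k * (b t * u2 k t - a t * u1 k t) + f1 k t) by ring. exact O2.
Qed.

Lemma Cmod_resonance z k : (2 * PI) ^ 2 * distk z k ^ 2 = resonance a b (lam k) z.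
Proof.
 note PI_RGT_0 as Hpi. unfold Cmod, resonance, c0, prim. rewrite pow2_sqrt; [|pos].
 unfold Cminus, Cplus, Copp, Cmult, RtoC. cbn [fst snd]. field. lra.
Qed.

Lemma dist_zero z k : Cminus (RtoC (IZR z)) (Cmult (c0 a b) (RtoC (lam k))) = RtoC 0 <-> lam k * A2 = 2 * PI * IZR z /\ lam k * B2 = 0.
Proof.
 note PI_RGT_0 as Hpi. note (Cmod_resonance z k) as E. unfold resonance in E. split.
 - intros H. rewrite H, Cmod_0 in E. destruct (sum_squares_zero (lam k * A2 - 2 * PI * IZR z) (lam k * B2)); lra.
 - intros [H1 H2]. apply Cmod_eq_0. set (M := Cmod _) in *. assert (0 < (2 * PI) ^ 2) by pos. assert (M ^ 2 = 0) by nra. nra.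
Qed.

Lemma Zset_iff k : Zset a b lam k <-> exists z, lam k * A2 = 2 * PI * IZR z /\ lam k * B2 = 0.
Proof.
 split; intros [z Hz]; exists z.
 - apply dist_zero. rewrite Cmult_comm in Hz. rewrite Hz. apply Cplus_opp_r.
 - apply dist_zero in Hz. rewrite Cmult_comm. symmetry. apply Ceq_minus, Hz.
Qed.

Lemma resonant_exact k f1 f2 S : continuous_periodic f1 -> continuous_periodic f2 -> (forall t, Rabs (f1 t) <= S /\ Rabs (f2 t) <= S) ->
 Zset a b lam k -> orthogonality a b (lam k) f1 f2 -> ~ alternating (fun t => lam k * prim b t) ->
 exists u1 u2, solvesk k f1 f2 u1 u2 /\ forall t, u1 t ^ 2 + u2 t ^ 2 <= (16 * PI * S) ^ 2.
Proof.
 intros Hf1 Hf2 HS HZ Hor Hna. apply Zset_iff in HZ. note HZ as [z [HA HB]]. apply (defect_zero a b (lam k)) in HZ.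
 apply (orthogonality_primitive a b (lam k) Ha Hb f1 f2 Hf1 Hf2) in Hor. destruct Hor as [Z1 Z2].
 destruct (arcs_of_not_alternating (fun t => lam k * prim b t)) as [t0 Harc]; [|pos|].
 { split; [|intros s; rewrite (prim_shift b) by exact Hb; rewrite Rmult_plus_distr_l, HB; ring].
  intros s. eapply is_derive_continuous, is_derive_scal, prim_derive, Hb. }
 destruct (resonant_solution a b (lam k) Ha Hb f1 f2 Hf1 Hf2 t0 HZ Z1 Z2) as (u1 & u2 & HO & W1 & W2).
 exists u1, u2. split; [pos|]. apply (resonant_bound a b (lam k) Ha Hb f1 f2 u1 u2 HO S HS t0 W1 W2 HZ Harc).
Qed.

Lemma abs_le_of_squares x y X q : 0 < q -> 0 <= X -> q ^ 2 * (x ^ 2 + y ^ 2) <= X ^ 2 -> Rabs x <= X / q /\ Rabs y <= X / q.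
Proof.
 intros Hq HX H. assert (K : forall v, q ^ 2 * v ^ 2 <= X ^ 2 -> Rabs v <= X / q).
 { intros v Hv. apply Rmult_le_reg_l with q; [lra|]. replace (q * (X / q)) with X by (field; lra).
  apply Rsqr_incr_0_var; [|lra]. unfold Rsqr. replace (q * Rabs v * (q * Rabs v)) with (q ^ 2 * Rabs v ^ 2) by ring. rewrite pow2_abs. lra. }
 split; apply K; nra.
Qed.

Lemma not_changes_sign l : ~ changes_sign b -> (forall s, 0 <= l * b s) \/ (forall s, l * b s <= 0).
Proof.
 intros H. destruct (classic (exists s, b s < 0)) as [[s Hs]|Hp].
 - assert (Hb0 : forall t, b t <= 0) by (intros t; destruct (Rle_lt_dec (b t) 0); [lra|]; exfalso; apply H; exists s, t; auto).
  destruct (Rle_lt_dec 0 l); [right|left]; intros t; specialize (Hb0 t); nra.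
 - assert (Hb0 : forall t, 0 <= b t) by (intros t; destruct (Rle_lt_dec 0 (b t)); [lra|]; exfalso; apply Hp; exists t; assumption).
  destruct (Rle_lt_dec 0 l); [left|right]; intros t; specialize (Hb0 t); nra.
Qed.

(** [l] times the primitive is monotone with the value 0 at both ends of the period. *)
Lemma primitive_one_signed l : ~ changes_sign b -> l * B2 = 0 -> forall t, l * prim b t = 0.
Proof.
 intros Hsg HB.
 assert (D : forall c t, is_derive (fun s => c * prim b s) t (c * b t)) by (intros; apply is_derive_scal, prim_derive, Hb).
 assert (K : forall c, c * B2 = 0 -> (forall s, 0 <= c * b s) -> forall t, 0 <= t <= 0 + 2 * PI -> c * prim b t = 0).
 { intros c Hc Hs t Ht. note (bounded_below_increment _ 0 t 0 t 0 _ (D c) ltac:(lra) ltac:(lra) ltac:(intros; apply Hs) ltac:(intros; apply Hs)) as I1.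
  note (bounded_below_increment _ t (2 * PI) t (2 * PI) 0 _ (D c) ltac:(lra) ltac:(lra) ltac:(intros; apply Hs) ltac:(intros; apply Hs)) as I2. cbv beta in I1, I2. rewrite prim_0 in I1. lra. }
 apply (periodic_extend _ 0); [intros t; rewrite (prim_shift b), Rmult_plus_distr_l, HB, Rplus_0_r by exact Hb; reflexivity|]. intros t Ht.
 destruct (not_changes_sign l Hsg) as [Hs|Hs]; [pos|].
 assert (E : - l * prim b t = 0) by (apply K; [lra|intros s; specialize (Hs s); lra|lra]). lra.
Qed.

Lemma sufficiency_one_signed : ~ changes_sign b -> condA n mu lam (c0 a b) -> solvable.
Proof.
 intros Hsg HA. apply solvable_iff_coefficients. intros f1 f2 Hf Hor. note PI2_3_2 as Hpi.
 (* Condition (A) is used with [eps / 2]: dividing by the small divisor then leaves half of the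
    decay of the data. *)
 destruct (class_sup f1 f2 Hf) as (eps & K & He & HK & Hcp & HB). destruct (HA (eps / 2) ltac:(lra)) as (Ce & HCe & HAe).
 (* The cap makes [q <= 1], so that one bound also covers the resonant indices and the value 1 in
    [Rmin 1 (resonance z)]. *)
 set (c := Rmin 1 Ce). assert (Hc : 0 < c) by (apply Rmin_pos; lra). note (Rmin_l 1 Ce) as Hc1. note (Rmin_r 1 Ce) as Hc2. fold c in Hc1, Hc2.
 apply (solve_from_pointwise f1 f2 (eps / 2) (16 * PI * K / c) 0 Hf ltac:(lra)). intros k.
 set (S := K * exp (- eps * xx k)). assert (HS : 0 <= S) by (apply Rmult_le_pos; [lra|pos]).
 set (q := c * exp (- (eps / 2) * xx k)). note (exp_pos (- (eps / 2) * xx k)) as Hx. assert (Hq : 0 < q) by (apply Rmult_lt_0_compat; assumption).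
 assert (Hx1 : exp (- (eps / 2) * xx k) <= 1) by (apply exp_xx_le_1; lra).
 assert (Hq1 : q <= 1) by (unfold q; nra).
 assert (Efin : 16 * PI * S / q = 16 * PI * K / c * exp (- (eps / 2) * xx k)).
 { unfold S, q. replace (- eps * xx k) with (- (eps / 2) * xx k + - (eps / 2) * xx k) by field. rewrite exp_plus. field. lra. }
 destruct (Hcp k) as [Hf1 Hf2].
 cut (exists u1 u2, solvesk k (f1 k) (f2 k) u1 u2 /\ forall t, q ^ 2 * (u1 t ^ 2 + u2 t ^ 2) <= (16 * PI * S) ^ 2).
 { intros (u1 & u2 & HO & Hsq). exists u1, u2. split; [easy|]. intros _ t. rewrite <- Efin. apply abs_le_of_squares; [lra|pos|pos]. }
 destruct (Req_dec (defect a b (lam k)) 0) as [HD|HD].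
 - assert (HZ : Zset a b lam k) by (apply Zset_iff, defect_zero, HD). note HZ as HZ'. apply Zset_iff in HZ'. destruct HZ' as [z [_ HB0]].
  destruct (resonant_exact k (f1 k) (f2 k) S Hf1 Hf2 (HB k) HZ (Hor k HZ)) as (u1 & u2 & HO & Hb').
  (* At a resonant index [lam k] times the primitive of [b] vanishes identically, so it cannot
     alternate. *)
  + intros (x1 & y1 & x2 & y2 & r & _ & _ & _ & _ & H5 & _ & H7 & _). rewrite (primitive_one_signed _ Hsg HB0) in H5, H7. lra.
  + exists u1, u2. split; [easy|]. intros t. bound_by (Hb' t). assert (q ^ 2 <= 1) by nra. nra.
 - destruct (nonresonant_solution a b (lam k) Ha Hb (f1 k) (f2 k) Hf1 Hf2 HD) as (u1 & u2 & HO). exists u1, u2. split; [easy|]. intros t.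
  destruct (one_signed_bound a b (lam k) Ha Hb (f1 k) (f2 k) u1 u2 HO S (HB k) (not_changes_sign _ Hsg)) as [z Hz].
  bound_by (Hz t). scale_r. apply Rmin_glb; [nra|]. rewrite <- Cmod_resonance. specialize (HAe z k).
  assert (HN : Cminus (RtoC (IZR z)) (Cmult (c0 a b) (RtoC (lam k))) <> RtoC 0) by (intros E; apply dist_zero in E; apply HD, defect_zero; exists z; exact E).
  specialize (HAe HN). set (M := Cmod _) in *. fold (xk n mu k) in HAe. assert (HqM : q <= M) by (unfold q; eapply Rle_trans; [scale_r; exact Hc2|]; lra).
  via (M ^ 2); [mono|]. rewrite <- (Rmult_1_l (M ^ 2)) at 1. scale_r; nra.
Qed.

Lemma sufficiency_changing : finite_set (fun k => ~ Zset a b lam k) -> (forall r, connected_T (Omega b r)) -> solvable.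
Proof.
 intros [N HN] HC. apply solvable_iff_coefficients. intros f1 f2 Hf Hor. note PI2_3_2 as Hpi.
 destruct (class_sup f1 f2 Hf) as (eps & K & He & HK & Hcp & HB).
 apply (solve_from_pointwise f1 f2 eps (16 * PI * K) N Hf He). intros k. destruct (Hcp k) as [Hf1 Hf2].
 destruct (classic (Zset a b lam k)) as [HZ|HZ].
 - destruct (resonant_exact k (f1 k) (f2 k) (K * exp (- eps * xx k)) Hf1 Hf2 (HB k) HZ (Hor k HZ)) as (u1 & u2 & HO & Hb').
  (* A nonzero resonant [lam k] forces [B2 = 0]; then [prim b] is periodic and the connectedness of
     its superlevel sets applies. *)
  + intros Halt. apply Zset_iff in HZ. destruct HZ as [z [_ HB0]]. destruct (Req_dec (lam k) 0) as [E|E].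
   * destruct Halt as (x1 & y1 & x2 & y2 & r & _ & _ & _ & _ & H5 & _ & H7 & _). rewrite E in *. lra.
   * assert (B0 : B2 = 0) by nra. assert (HP : periodic (prim b)) by (intros; rewrite (prim_shift b), B0 by exact Hb; ring).
    apply (proj1 (connected_iff_not_alternating b HP) HC), (alternating_scal _ (lam k) HP Halt).
  + exists u1, u2. split; [pos|]. intros _ t. specialize (Hb' t).
   replace (16 * PI * K * exp (- eps * xx k)) with (16 * PI * (K * exp (- eps * xx k)) / 1) by field. apply abs_le_of_squares; [lra| |lra].
   apply Rmult_le_pos; [lra|pos].
 - destruct (nonresonant_solution a b (lam k) Ha Hb (f1 k) (f2 k) Hf1 Hf2) as (u1 & u2 & HO).
  { intros E. apply HZ, Zset_iff, defect_zero, E. }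
  exists u1, u2. split; [pos|]. specialize (HN k HZ). lia.
Qed.

(** Of solvability the necessity proofs keep the boundedness of the solutions uniformly in [k]; the
    test data are built to violate it or to turn it into condition (A). *)
Lemma solvable_bounded f1 f2 : solvable -> coef_class f1 f2 -> (forall k, Zset a b lam k -> orthogonality a b (lam k) (f1 k) (f2 k)) ->
 exists u1 u2 K, 0 <= K /\ forall k, solvesk k (f1 k) (f2 k) (u1 k) (u2 k) /\ forall t, Rabs (u1 k t) <= K /\ Rabs (u2 k t) <= K.
Proof.
 intros HG Hf Hor. destruct (proj1 (solvable_iff_coefficients a b) HG f1 f2 Hf Hor) as (u1 & u2 & Hu & HO).
 destruct (class_sup u1 u2 Hu) as (eps & K & He & HK & Hcp & HB). exists u1, u2, K. split; [lra|]. intros k.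
 assert (Hx : K * exp (- eps * xx k) <= K) by (rewrite <- (Rmult_1_r K) at 2; scale_l; apply exp_xx_le_1; lra).
 destruct (Hcp k) as [[_ P1] [_ P2]]. split; [easy|]. intros t. destruct (HB k t). lra.
Qed.

Lemma orthogonality_zero l psi th : orthogonality a b l (wave a l psi th (fun _ => 0) cos) (wave a l psi th (fun _ => 0) sin).
Proof.
 unfold orthogonality. rewrite (RInt_ext (V := C_R_CompleteNormedModule) _ (fun _ => RtoC 0)); [rewrite RInt_const; apply (scal_zero_r (V := C_R_CompleteNormedModule))|].
 intros t _. unfold wave. rewrite !Rmult_0_l. apply Cmult_0_r.
Qed.

(** Data are switched off outside [P]; when [P] avoids the resonant indices, the orthogonality
    conditions hold trivially. *)
Definition gate (P : nat -> Prop) eps k : R := if excluded_middle_informative (P k) then exp (- eps * xx k) else 0.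

Lemma gate_bound P eps k : 0 <= gate P eps k <= exp (- eps * xx k).
Proof. unfold gate. note (exp_pos (- eps * xx k)). destruct (excluded_middle_informative _); lra. Qed.

Lemma wave_solution (P : nat -> Prop) psi th eps : solvable -> 0 < eps -> (forall k, Rabs (psi k) <= 1 / 2) ->
 (forall k, exists z, lam k * A2 - 2 * PI * psi k = 2 * PI * IZR z) -> (forall k, P k -> ~ Zset a b lam k) ->
 exists u1 u2 K, 0 <= K /\ forall k, P k -> solvesk k (waves psi th (fun k _ => exp (- eps * xx k)) cos k) (waves psi th (fun k _ => exp (- eps * xx k)) sin k) (u1 k) (u2 k) /\
  forall t, u1 k t ^ 2 + u2 k t ^ 2 <= 2 * K ^ 2.
Proof.
 intros HG He Hpsi Hz HP.
 destruct (solvable_bounded (waves psi th (fun k _ => gate P eps k) cos) (waves psi th (fun k _ => gate P eps k) sin) HG) as (u1 & u2 & K & HK & Hu).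
 - apply (test_class psi th (gate P eps) eps 1); [intros k; specialize (Hpsi k); lra|lra| |auto].
  intros k. destruct (gate_bound P eps k). rewrite Rabs_pos_eq; lra.
 - intros k HZ. unfold gate. destruct (excluded_middle_informative _) as [Pk|]; [destruct (HP k Pk HZ)|apply orthogonality_zero].
 - exists u1, u2, K. split; [nra|]. intros k Pk. destruct (Hu k) as [H1 H2]. split.
  + unfold gate in H1. destruct (excluded_middle_informative (P k)); [easy|triv].
  + intros t. destruct (H2 t) as [Q1 Q2]. apply square_le in Q1. apply square_le in Q2. lra.
Qed.

Lemma integers_apart z z' : z <> z' -> 1 <= Rabs (IZR z - IZR z').
Proof. intros H. rewrite <- minus_IZR, <- abs_IZR. apply IZR_le. lia. Qed.

Lemma resonance_lower z k y : 0 <= y -> (2 * PI * y) ^ 2 <= resonance a b (lam k) z -> y <= distk z k.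
Proof.
 intros Hy H. note PI_RGT_0 as Hpi. rewrite <- Cmod_resonance, Rpow_mult_distr in H. apply Rmult_le_reg_l in H; [|pos].
 apply Rsqr_incr_0_var; [unfold Rsqr; lra|pos].
Qed.

(** Growth controls the large indices, and only finitely many remain. *)
Lemma lam_gap : exists c, 0 < c /\ forall k, lam k <> 0 -> c <= Rabs (lam k).
Proof.
 destruct lam_growth as (c & N & Hc & H).
 assert (HF : forall N, exists c', 0 < c' /\ forall k, (k < N)%nat -> lam k <> 0 -> c' <= Rabs (lam k)).
 { induction N0 as [|N0 [c' [Hc' IH]]]; [exists 1; split; [lra|lia]|]. destruct (Req_dec (lam N0) 0) as [E|E].
  - exists c'. split; [lra|]. intros k Hk Hne. apply IH; [|lra]. destruct (Nat.eq_dec k N0) as [->|]; [lra|lia].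
  - exists (Rmin c' (Rabs (lam N0))). split; [apply Rmin_pos; [lra|apply Rabs_pos_lt, E]|]. intros k Hk Hne. destruct (Nat.eq_dec k N0) as [->|]; [apply Rmin_r|].
   bound Rmin_l; [apply IH; [lia|lra]]. }
 destruct (HF N) as [c' [Hc' Hlow]]. exists (Rmin c' c). split; [pos|]. intros k Hne. destruct (Nat.lt_ge_cases k N) as [Hk|Hk].
 - bound Rmin_l; pos.
 - bound Rmin_r. specialize (H k Hk). note (xx_ge_1 k). nra.
Qed.

(** [psi k] is the signed distance of [lam k * A2 / (2 PI)] to the nearest integer: it is both the
    frequency shift of the test waves and, when [B2 = 0], the small divisor. *)
Lemma fractional_parts : exists z psi, forall k, lam k * A2 = 2 * PI * (IZR (z k) + psi k) /\ Rabs (psi k) <= 1 / 2 /\ (psi k <> 0 -> ~ Zset a b lam k).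
Proof.
 note PI_RGT_0 as Hpi. destruct (choice _ (fun k => nearest_integer (lam k * A2 / (2 * PI)))) as [z Hz].
 exists z, (fun k => lam k * A2 / (2 * PI) - IZR (z k)). intros k. specialize (Hz k). split; [field; lra|]. split; [nra|].
 intros Hne HZ. apply Hne. apply Zset_iff in HZ. destruct HZ as [z' [E _]]. rewrite E in *.
 replace (2 * PI * IZR z' / (2 * PI)) with (IZR z') in * by (field; lra). destruct (Z.eq_dec z' (z k)) as [->|H]; [ring|]. note (integers_apart _ _ H). lra.
Qed.

(** If [B2 = 0], the primitive of [b] vanishes and the divisor is [psi k], which the test waves
    bound from below. If not, the term [lam k * B2] is bounded away from 0 whenever [lam k] is
    nonzero, and condition (A) holds with a constant lower bound. *)
Lemma necessity_one_signed : ~ changes_sign b -> solvable -> condA n mu lam (c0 a b).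
Proof.
 intros Hsg HG. note PI2_3_2 as Hpi. destruct (Req_dec B2 0) as [HB|HB].
 - assert (HPb : forall t, prim b t = 0) by (intros t; rewrite <- (Rmult_1_l (prim b t)); apply (primitive_one_signed 1 Hsg); lra).
  intros eps He. destruct fractional_parts as (z & psi & Hz).
  destruct (wave_solution (fun k => psi k <> 0) psi (fun k => - psi k * (0 + PI)) eps HG He) as (u1 & u2 & K & HK & Hu).
  + apply Hz.
  + intros k. exists (z k). rewrite (proj1 (Hz k)). ring.
  + apply Hz.
  (* The constant comes from [r^2 <= 32 (|psi k| K)^2] and [32 < 36]. *)
  + assert (key : forall k, psi k <> 0 -> exp (- eps * xx k) <= (6 * K + 1) * Rabs (psi k)).
   { intros k Hk. destruct (Hu k Hk) as [HO HU]. specialize (HU 0). destruct (Hz k) as (HA & Hp & _).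
    set (r := exp (- eps * xx k)) in *. assert (Hr : 0 < r) by apply exp_pos.
    (* On the middle half of the period the cosine is at least [cos (PI / 4)], and the weight is 1
       because the primitive of [b] vanishes. *)
    note (wave_increment a b (lam k) Ha Hb _ _ _ _ HO 0 (PI / 2) (3 * PI / 2) (PI / 2) r (psi k) 0 ltac:(lra) ltac:(lra) ltac:(lra)
     ltac:(intros s _; rewrite HPb; lra) (Rlt_le _ _ Hr) Hp eq_refl eq_refl) as HI.
    rewrite HPb, Rmult_0_r, Ropp_0, exp_0, pow1, Rmult_1_r, Rmult_1_l in HI.
    set (c := cos ((PI - PI / 2) / 2)) in *. assert (Hc : 1 / 2 <= c) by (note PI_4; destruct (cos_quadratic ((PI - PI / 2) / 2)) as [_ Hq]; [lra|]; unfold c; nra).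
    assert (HDf : defect a b (lam k) <= (2 * PI * psi k) ^ 2).
    { rewrite (defect_formula a b (lam k) (z k)), HB, Rmult_0_r, Ropp_0, exp_0, HA. replace (2 * PI * (IZR (z k) + psi k) - 2 * PI * IZR (z k)) with (2 * PI * psi k) by ring.
     apply Rcomplements.Rabs_le_between in Hp. destruct (cos_quadratic (2 * PI * psi k)) as [_ Hq]; [nra|]. lra. }
    assert (E1 : (r * (1 / 2) * PI) ^ 2 <= (2 * PI * psi k) ^ 2 * (2 * K ^ 2)).
    { via ((r * (c * (3 * PI / 2 - PI / 2))) ^ 2); [apply pow_incr; split; [pos|]; assert (r * (1 / 2) <= r * c) by mono; nra|].
     nra. }
    assert (E2 : r ^ 2 <= 32 * (Rabs (psi k) * K) ^ 2) by (rewrite Rpow_mult_distr, pow2_abs; apply Rmult_le_reg_l with (PI ^ 2); [pos|]; nra).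
    note (Rabs_pos (psi k)) as Hps. assert (HpK : 0 <= Rabs (psi k) * K) by pos.
    nra. }
   assert (HC : 0 < / (6 * K + 1)) by pos. exists (/ (6 * K + 1)). split; [nra|]. intros tau k Hne. apply Rle_ge. fold (xk n mu k).
   assert (HC1 : / (6 * K + 1) <= 1) by (rewrite <- Rinv_1; apply Rinv_le_contravar; lra). note (exp_xx_le_1 eps k ltac:(lra)) as Hexp.
   destruct (Hz k) as (HA & Hp & _). set (y := Rabs (IZR (z k) + psi k - IZR tau)).
   assert (Hy : y <= distk tau k).
   { apply resonance_lower; [triv|]. right. unfold resonance, y. rewrite HB, HA, Rpow_mult_distr, pow2_abs. ring. }
   via y; [|lra]. assert (Hkey : psi k <> 0 -> / (6 * K + 1) * exp (- eps * xx k) <= Rabs (psi k)).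
   { intros H0. apply Rmult_le_reg_l with (6 * K + 1); [lra|]. rewrite <- Rmult_assoc, Rinv_r, Rmult_1_l by lra. triv. }
   destruct (Z.eq_dec (z k) tau) as [E|E].
   * assert (Ey : y = Rabs (psi k)) by (unfold y; rewrite E; f_equal; ring). rewrite Ey. apply Hkey. intros E0.
    apply Hne, dist_zero. rewrite HA, HB, E, E0. lra.
   * note (integers_apart _ _ E) as Hap. assert (Hy2 : Rabs (IZR (z k) - IZR tau) - Rabs (psi k) <= y).
    { unfold y. replace (IZR (z k) + psi k - IZR tau) with (IZR (z k) - IZR tau - - psi k) by ring. bound_by Rabs_triang_inv. rewrite Rabs_Ropp. lra. }
    destruct (Req_dec (psi k) 0) as [E0|E0]; [rewrite E0, Rabs_R0 in *; nra|]. lra.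
 - destruct lam_gap as [c [Hc Hgap]]. set (c1 := Rmin 1 (c * Rabs B2 / (2 * PI))).
  assert (Hc1 : 0 < c1) by (apply Rmin_pos; [lra|]; apply Rdiv_lt_0_compat; [apply Rmult_lt_0_compat; [lra|apply Rabs_pos_lt, HB]|lra]).
  exists c1. split; [lra|]. intros tau k Hne. apply Rle_ge. fold (xk n mu k). note (exp_xx_le_1 eps k ltac:(lra)).
  via c1; [nra|]. apply resonance_lower; [lra|]. unfold resonance. destruct (Req_dec (lam k) 0) as [E|E].
  + rewrite E, !Rmult_0_l. destruct (Z.eq_dec tau 0) as [->|Ht].
   * exfalso. apply Hne, dist_zero. rewrite E. lra.
   * note (integers_apart tau 0 Ht) as Hap. rewrite Rminus_0_r in Hap. note (Rmin_l 1 (c * Rabs B2 / (2 * PI))) as Hl. fold c1 in Hl.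
    replace ((0 - 2 * PI * IZR tau) ^ 2 + 0 ^ 2) with ((2 * PI * Rabs (IZR tau)) ^ 2) by (rewrite (Rpow_mult_distr (2 * PI)), pow2_abs; ring).
    apply pow_incr. nra.
  + note (Rmin_r 1 (c * Rabs B2 / (2 * PI))) as Hl. specialize (Hgap k E). note (Rabs_pos B2).
   via ((lam k * B2) ^ 2); [|note (pow2_ge_0 (lam k * A2 - 2 * PI * IZR tau)); lra].
   rewrite <- (pow2_abs (lam k * B2)), Rabs_mult. apply pow_incr. split; [nra|]. via (c * Rabs B2); [|nra].
   apply (Rmult_le_compat_l (2 * PI)) in Hl; [|lra]. replace (2 * PI * (c * Rabs B2 / (2 * PI))) with (c * Rabs B2) in Hl by (field; lra). exact Hl.
Qed.

(** The data decay at half the rate, [eps = c delta / 2], while the solution gains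
    [exp (|lam k| delta)], at least [exp (c delta xx k)]; the product is unbounded along the
    selected indices. *)
Lemma no_exponential_growth (P : nat -> Prop) c delta q K s N : 0 < c -> 0 < delta -> 0 < q -> s ^ 2 = 1 -> (forall M, exists k, (M <= k)%nat /\ P k /\ 0 <= s * lam k) ->
 (forall k, (N <= k)%nat -> c * xx k <= Rabs (lam k)) ->
 (forall k, P k -> 0 <= s * lam k -> exp (s * lam k * delta) * exp (- (c * delta / 2) * xx k) * q <= K) -> False.
Proof.
 intros Hc Hd Hq Hs HP Hlam HB. set (eps := c * delta / 2) in *. assert (He : 0 < eps) by (unfold eps; nra).
 destruct (xx_unbounded (K / q / eps)) as [M HM]. destruct (HP (N + M)%nat) as (k & Hk & Pk & Sk).
 specialize (HM k ltac:(lia)). specialize (HB k Pk Sk). specialize (Hlam k ltac:(lia)). note (exp_ineq1_le (eps * xx k)) as He1.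
 assert (Hsl : Rabs (lam k) = s * lam k) by (rewrite <- (Rabs_pos_eq (s * lam k)) by exact Sk; rewrite Rabs_mult; replace (Rabs s) with 1; [ring|]; symmetry; unfold Rabs; destruct (Rcase_abs s); nra).
 assert (Hg : exp (eps * xx k) <= exp (s * lam k * delta) * exp (- eps * xx k)) by (rewrite <- exp_plus, <- Hsl; apply exp_le; unfold eps in *; nra).
 apply (Rmult_le_compat_l (q * eps)) in HM; [|nra]. replace (q * eps * (K / q / eps)) with K in HM by (field; lra). nra.
Qed.

(** The growth estimates are made for a definite sign of [lam k]; one of the two signs occurs
    infinitely often in [P], and [s] records it. *)
Lemma infinite_sign (P : nat -> Prop) : (forall M, exists k, (M <= k)%nat /\ P k) -> exists s, s ^ 2 = 1 /\ forall M, exists k, (M <= k)%nat /\ P k /\ 0 <= s * lam k.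
Proof.
 intros HP. apply NNPP. intros N.
 assert (H : forall s, s ^ 2 = 1 -> exists M, forall k, (M <= k)%nat -> P k -> s * lam k < 0).
 { intros s Hs. apply NNPP. intros N1. apply N. exists s. split; [nra|]. intros M. apply NNPP. intros N2. apply N1. exists M.
  intros k Hk Pk. apply Rnot_le_lt. intros Hl. triv. }
 destruct (H 1 ltac:(lra)) as [M1 H1]. destruct (H (-1) ltac:(lra)) as [M2 H2]. destruct (HP (M1 + M2)%nat) as (k & Hk & Pk).
 specialize (H1 k ltac:(lia) Pk). specialize (H2 k ltac:(lia) Pk). lra.
Qed.

(** Nonresonant indices impose no orthogonality, so waves adapted to the cut [T] of [growth_exists]
    are admissible there; infinitely many such indices would contradict [no_exponential_growth]. *)
Lemma necessity_finite : changes_sign b -> solvable -> finite_set (fun k => ~ Zset a b lam k).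
Proof.
 intros Hcs HG. apply NNPP. intros Hinf. note PI2_3_2 as Hpi.
 destruct (infinite_sign (fun k => ~ Zset a b lam k)) as (s & Hs & HP).
 { intros M. apply NNPP. intros N. apply Hinf. exists M. intros k Hk. apply not_ge. triv. }
 destruct (growth_exists s b Hs Hb Hcs) as (T & ts & s1 & s2 & eta & delta & HD).
 destruct lam_growth as (c & N & Hc & Hlam). destruct fractional_parts as (z & psi & Hz).
 note HD as (He1 & Hd & Hs1 & _). assert (He : 0 < c * delta / 2) by nra.
 destruct (wave_solution (fun k => ~ Zset a b lam k) psi (fun k => - psi k * (T + PI)) (c * delta / 2) HG He) as (u1 & u2 & K & HK & Hu); [intros k; apply Hz| |auto|].
 { intros k. exists (z k). rewrite (proj1 (Hz k)). ring. }
 set (q := cos ((PI - eta) / 2) * (s2 - s1)). assert (Hq : 0 < q) by (apply Rmult_lt_0_compat; [apply cos_gt_0; lra|lra]).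
 apply (no_exponential_growth (fun k => ~ Zset a b lam k) c delta q (3 * K) s N Hc Hd Hq Hs HP Hlam). intros k HnZ Hsl. destruct (Hu k HnZ) as [HO HU].
 note (growth_bound a b (lam k) Ha Hb _ _ _ _ HO s Hs Hsl T ts s1 s2 eta delta _ (psi k) HD (Rlt_le _ _ (exp_pos _)) (proj1 (proj2 (Hz k))) eq_refl eq_refl) as H.
 fold q in H. specialize (HU ts). nra.
Qed.

Lemma necessity_connected : solvable -> finite_set (fun k => ~ Zset a b lam k) -> forall r, connected_T (Omega b r).
Proof.
 intros HG [N0 HN0]. note PI2_3_2 as Hpi. destruct lam_growth as (c & N & Hc & Hlam).
 assert (HZ : forall k, (N0 <= k)%nat -> Zset a b lam k) by (intros k Hk; apply NNPP; intros HnZ; specialize (HN0 k HnZ); lia).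
 (* All but finitely many indices are resonant, and some of these have a nonzero eigenvalue. *)
 assert (HB : B2 = 0).
 { note (HZ (N0 + N)%nat ltac:(lia)) as HZN. apply Zset_iff in HZN. destruct HZN as [z [_ E]]. specialize (Hlam (N0 + N)%nat ltac:(lia)). note (xx_ge_1 (N0 + N)).
  assert (lam (N0 + N)%nat <> 0) by (intros E0; rewrite E0, Rabs_R0 in Hlam; nra). nra. }
 assert (HPb : periodic (prim b)) by (intros; rewrite (prim_shift b), HB by exact Hb; ring).
 apply (connected_iff_not_alternating b HPb). intros Halt.
 destruct (infinite_sign (Zset a b lam)) as (s & Hs & HP); [intros M; exists (M + N0)%nat; split; [lia|apply HZ; lia]|].
 destruct (alternation_exists (fun t => s * prim b t)) as (x1 & y1 & x2 & y2 & ra & d & e & HD).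
 { intros t. eapply is_derive_continuous, is_derive_scal, prim_derive, Hb. }
 { apply (alternating_scal _ s); [triv|]. replace (fun t => s * (s * prim b t)) with (prim b); [triv|].
  fext t. rewrite <- (Rmult_1_l (prim b t)) at 1. rewrite <- Hs. ring. }
 (* Subtracting [kap k] enforces the orthogonality condition at each index; its bound by 2 keeps the
    data in the class. *)
 destruct (choice _ (fun k => compatible_mean a b (lam k) x1 x2 Hb)) as [kap Hkap]. cbv zeta in Hkap.
 note HD as (He & Hd & O1 & O2 & O3 & O4 & _). set (eps := c * d / 2). assert (Heps : 0 < eps) by (unfold eps; nra).
 set (r := gate (Zset a b lam) eps). assert (Hr : forall k, 0 <= r k <= exp (- eps * xx k)) by apply gate_bound.
 set (F := fun (g : R -> R) k => wave a (lam k) 0 0 (fun t => r k * (bump x1 x2 t - kap k)) g).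
 assert (Hcl : coef_class (F cos) (F sin)).
 (* The amplitude [r k * (bump - kap k)] depends on [t]; the product formulas for cosine and sine
    expand the data into three waves of constant amplitude, with frequency shifts 1, -1 and 0. *)
 { assert (TC : forall (s : R) (rho th : nat -> R) M, Rabs s <= 1 -> (s = 1 \/ s = -1 \/ s = 0) -> (forall k, Rabs (rho k) <= M) ->
   coef_class (waves (fun _ => s) th (fun k _ => r k * rho k) cos) (waves (fun _ => s) th (fun k _ => r k * rho k) sin)).
  { intros s0 rho th M Hs1 Hs0 HM. apply (test_class (fun _ => s0) th (fun k => r k * rho k) eps M); [auto|lra| |].
   - intros k. rewrite Rabs_mult, Rmult_comm. specialize (Hr k). rewrite (Rabs_pos_eq (r k)) by lra. apply Rmult_le_compat; [pos|lra|pos|lra].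
   - intros k Hne. assert (Hk : Zset a b lam k) by (unfold r, gate in Hne; destruct (excluded_middle_informative _); [triv|lra]).
    apply Zset_iff in Hk. destruct Hk as [z [-> _]].
    destruct Hs0 as [-> | [-> | ->]]; [exists (z - 1)%Z; rewrite minus_IZR|exists (z + 1)%Z; rewrite plus_IZR|exists z]; ring. }
  set (mid := (x1 + x2) / 2). set (h := cos ((x2 - x1) / 2)).
  note (class_plus _ _ _ _ (class_plus _ _ _ _ (TC 1 (fun _ => 1 / 2) (fun _ => - mid) 1 ltac:(rewrite Rabs_R1; lra) ltac:(auto) ltac:(intros; rewrite Rabs_pos_eq; lra))
   (TC (-1) (fun _ => 1 / 2) (fun _ => mid) 1 ltac:(rewrite Rabs_m1; lra) ltac:(auto) ltac:(intros; rewrite Rabs_pos_eq; lra)))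
   (TC 0 (fun k => - (h + kap k)) (fun _ => 0) 3 ltac:(rewrite Rabs_R0; lra) ltac:(auto)
    ltac:(intros k; cbv beta; rewrite Rabs_Ropp; bound Rabs_triang; destruct (Hkap k) as [Hk2 _]; assert (Rabs h <= 1) by (apply Rabs_le, COS_bound); lra))) as HS.
  assert (Eph : forall k t, phase a (lam k) 1 (- mid) t = phase a (lam k) 0 0 t + (t - mid) /\ phase a (lam k) (-1) mid t = phase a (lam k) 0 0 t - (t - mid)) by (intros; unfold phase; split; ring).
  match type of HS with coef_class ?p ?q => replace (F cos) with p; [replace (F sin) with q; [triv|]|] end; fext k; fext t; unfold F, wave, bump; destruct (Eph k t) as [-> ->].
  - rewrite (sin_plus (phase _ _ _ _ _)), (sin_minus (phase _ _ _ _ _)). unfold h, mid. field.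
  - rewrite (cos_plus (phase _ _ _ _ _)), (cos_minus (phase _ _ _ _ _)). unfold h, mid. field. }
 destruct (class_sup _ _ Hcl) as (_ & _ & _ & _ & Hcp & _).
 destruct (solvable_bounded (F cos) (F sin) HG Hcl) as (u1 & u2 & K & HK & Hu).
 { intros k _. apply (orthogonality_primitive a b (lam k) Ha Hb); [apply Hcp|apply Hcp|]. apply (Hkap k). }
 set (q := Rmin (sag ((x2 - x1) / 2) e) (sag ((x1 + 2 * PI - x2) / 2) e) * (2 * e)).
 assert (Hq : 0 < q) by (apply Rmult_lt_0_compat; [apply Rmin_glb_lt; apply sag_pos|]; lra).
 apply (no_exponential_growth (Zset a b lam) c d q (4 * K) s N Hc Hd Hq Hs HP Hlam). intros k Zk Hsl. destruct (Hu k) as [HO HU]. fold eps.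
 assert (Er : r k = exp (- eps * xx k)) by (unfold r, gate; destruct (excluded_middle_informative _); [nra|triv]). rewrite <- Er.
 note (alternating_bound a b (lam k) Ha Hb _ _ _ _ HO s Hs Hsl x1 y1 x2 y2 ra d e (kap k) (r k) K HPb HD (proj1 (Hr k)) eq_refl eq_refl HU) as H. unfold q. lra.
Qed.

Theorem solvability_criteria : (~ changes_sign b -> (solvable <-> condA n mu lam (c0 a b))) /\
 (changes_sign b -> (solvable <-> (finite_set (fun k => ~ Zset a b lam k) /\ forall r, connected_T (Omega b r)))).
Proof.
 split; intros Hb0; split.
 - apply necessity_one_signed, Hb0.
 - apply sufficiency_one_signed, Hb0.
 - intros HG. note (necessity_finite Hb0 HG) as HF. split; [triv|]. apply necessity_connected; assumption.
 - intros [HF HC]. apply sufficiency_changing; assumption.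
Qed.
End Coefficients.
End EigenSystem.

Theorem theorem1p1 :
  forall (n m : nat) (Pl : list monom) (lam : nat -> R) (phi : nat -> (nat -> R) -> R)
         (a b : R -> R) (mu : R),
    (1 <= n)%nat -> (2 <= m)%nat ->
    good_operator n m Pl ->
    eigen_system n m Pl lam phi ->
    Gevrey_T a -> Gevrey_T b ->
    1 / 2 <= mu ->
    (~ changes_sign b ->
       (globally_solvable n Pl mu a b lam phi <-> condA n mu lam (c0 a b))) /\
    (changes_sign b ->
       (globally_solvable n Pl mu a b lam phi <->
        (finite_set (fun k => ~ Zset a b lam k) /\
         forall r : R, connected_T (Omega b r)))).
Proof.
  intros n m Pl lam phi a b mu Hn Hm Hop Heig Ga Gb Hmu. exact (solvability_criteria n m Pl lam phi mu Hn Hm Hop Heig Hmu a b Ga Gb).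
Qed.
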